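(* Let $n\ge 1$, let $b\in H^\infty(\mathbb{B}^n)$ be non-constant with $\|b\|_\infty\le 1$, and let $\mu$ be the Clark measure of $b$. For $f\in L^2(\mu)$ put $$V_b(f)(z)=(1-b(z))\int_{S^n}\frac{f(\xi)}{(1-\langle z,\xi\rangle)^n}\,d\mu(\xi),\qquad z\in\mathbb{B}^n.$$ Then $V_b$ is a partial isometry from $L^2(\mu)$ onto $H(b)$, and $\mathrm{Ker}\,V_b=(H^2(\mu))^{\perp}$. Moreover, for every $w\in\mathbb{B}^n$, $$V_b\big(K(\cdot,w)\big)=\frac{K^b(\cdot,w)}{1-\overline{b(w)}}.$$
   Context: $\mathbb{B}^n$ is the open unit ball of $\mathbb{C}^n$, $S^n=\partial\mathbb{B}^n$ is the unit sphere, $\sigma$ is the normalized rotation-invariant measure on $S^n$, and $\langle z,w\rangle=\sum_j z_j\overline{w_j}$. $H^\infty(\mathbb{B}^n)$ is the space of bounded holomorphic functions on $\mathbb{B}^n$. $H^2(\mathbb{B}^n)$ is the Hardy–Hilbert space of holomorphic $f$ on $\mathbb{B}^n$ with $\sup_{0<r<1}\int_{S^n}|f(r\xi)|^2d\sigma(\xi)<\infty$, with inner product $\langle f,g\rangle=\int_{S^n}f\overline g\,d\sigma$ (using boundary values). $T_b$ is the operator $f\mapsto bf$ on $H^2(\mathbb{B}^n)$ and $T_{\overline b}=T_b^*$ is the Toeplitz operator with symbol $\overline b$. The de Branges–Rovnyak space $H(b)$ is the range $(I-T_bT_{\overline b})^{1/2}H^2(\mathbb{B}^n)$ with the Hilbert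 space norm determined by $\|(I-T_bT_{\overline b})^{1/2}f\|_b=\|f\|_2$ for $f\in H^2(\mathbb{B}^n)\ominus\mathrm{Ker}(I-T_bT_{\overline b})^{1/2}$. Kernels: $K(z,w)=(1-\langle z,w\rangle)^{-n}$ (for $z\in\mathbb{B}^n\cup S^n$, $w\in\mathbb{B}^n$) and $K^b(z,w)=\dfrac{1-b(z)\overline{b(w)}}{(1-\langle z,w\rangle)^n}$, the reproducing kernel of $H(b)$. Clark measure: the Clark measure of $b$ is the unique positive Borel measure $\mu$ on $S^n$ with $\int_{S^n}P(z,\xi)\,d\mu(\xi)=\mathrm{Re}\,\frac{1+b(z)}{1-b(z)}=\frac{1-|b(z)|^2}{|1-b(z)|^2}$ for all $z\in\mathbb{B}^n$, where $P(z,\xi)=\left(\frac{1-\|z\|^2}{|1-\langle z,\xi\rangle|^2}\right)^n$ is the invariant Poisson kernel. $H^2(\mu)$ is the generalized Hardy space, i.e. the closure in $L^2(\mu)$ of the holomorphic polynomials; equivalently the closed linear span in $L^2(\mu)$ of the functions $K(\cdot,w)$, $w\in\mathbb{B}^n$. The orthogonal complement is taken in $L^2(\mu)$. *)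

(* Defs.v *)
From HB Require Import structures.
From mathcomp Require Import all_boot all_order all_algebra.
From mathcomp Require Import all_classical all_reals all_analysis.
From mathcomp Require Import complex sesquilinear spectral.
From mathcomp Require mpoly.

Set Implicit Arguments.
Unset Strict Implicit.
Unset Printing Implicit Defensive.

Import Order.TTheory GRing.Theory Num.Theory.
Import numFieldNormedType.Exports.

Local Open Scope classical_set_scope.
Local Open Scope ring_scope.

(* [R[i]] seen as a [numClosedFieldType], so that the generic topology and norm
   of a numeric field (and of row vectors over it) are found by unification. *)
Definition Cplx (R : realType) : numClosedFieldType := R[i].

Definition ofReal {R : realType} (x : R) : Cplx R := x%:C%C.

(* The order, the norm [`|z|] and [dotmx] take values in the complex field;
   [cmod] is the modulus as an element of [R]. *)
Definition cmod {R : realType} (z : Cplx R) : R := complex.Re `|z|.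

(* C^n with its Borel sigma-algebra. *)
Definition BCn (R : realType) (n : nat) :=
  g_sigma_algebraType (@open 'rV[Cplx R]_n).

Section Ball.
Context {R : realType} {n : nat}.
Local Notation C := (Cplx R).
Local Notation Cn := 'rV[Cplx R]_n.

Lemma dotmx_sum (z w : Cn) : dotmx z w = \sum_j z 0 j * (w 0 j)^*.
Proof.
by rewrite dotmxE mxE; apply: eq_bigr => j _; rewrite !mxE.
Qed.

Definition sqnorm (z : Cn) : R := complex.Re (dotmx z z).

Definition cball : set Cn := [set z | sqnorm z < 1].

Definition csphere : set Cn := [set z | sqnorm z = 1].

(* Functions on the ball are represented by functions on C^n whose values
   outside the ball are irrelevant; their equality is equality on the ball. *)
Definition ball_eq (f g : Cn -> C) : Prop := forall z, cball z -> f z = g z.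

Definition holomorphic (f : Cn -> C) : Prop :=
  forall z, cball z -> differentiable f z.

Definition Hinfty_norm (f : Cn -> C) : \bar R :=
  ereal_sup [set (cmod (f z))%:E | z in cball].

Definition Hinfty : set (Cn -> C) :=
  [set f | holomorphic f /\ (Hinfty_norm f < +oo)%E].

Definition cauchy_kernel (z w : Cn) : C := (1 - dotmx z w) ^- n.

Definition deBranges_kernel (b : Cn -> C) (z w : Cn) : C :=
  (1 - b z * (b w)^*) / (1 - dotmx z w) ^+ n.

Definition poisson_kernel (z xi : Cn) : R :=
  ((1 - sqnorm z) / cmod (1 - dotmx z xi) ^+ 2) ^+ n.

End Ball.

(* A Borel measure on the sphere is a Borel measure on C^n whose complement of
   the sphere is null. *)
Section L2.
Context {R : realType} {n : nat}.
Local Notation C := (Cplx R).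
Local Notation Cn := 'rV[Cplx R]_n.
Variable mu : {measure set (BCn R n) -> \bar R}.

Definition cintegral (f : Cn -> C) : C :=
  Complex (\int[mu]_(x in csphere) complex.Re (f x))
          (\int[mu]_(x in csphere) complex.Im (f x)).

(* Square-integrable functions, not classes: equality in L^2(mu) is
   [L2norm (f - g) = 0]. *)
Definition L2 : set (Cn -> C) :=
  [set f | [/\ measurable_fun (csphere : set (BCn R n))
                 (fun x : BCn R n => complex.Re (f x)),
               measurable_fun (csphere : set (BCn R n))
                 (fun x : BCn R n => complex.Im (f x))
             & (\int[mu]_(x in csphere) (cmod (f x) ^+ 2)%:E < +oo)%E]].

Definition L2inner (f g : Cn -> C) : C := cintegral (fun x => f x * (g x)^*).

Definition L2norm (f : Cn -> C) : R := Num.sqrt (complex.Re (L2inner f f)).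

Definition L2ortho (A : set (Cn -> C)) : set (Cn -> C) :=
  [set f | L2 f /\ forall g, A g -> L2inner f g = 0].

Definition polyfun (p : mpoly.mpoly n C) : Cn -> C :=
  fun z => mpoly.meval (fun j => z ord0 j) p.

(* The closure in L^2(mu) of the holomorphic polynomials. *)
Definition H2_of_measure : set (Cn -> C) :=
  [set f | L2 f /\ forall e : R, 0 < e ->
             exists p : mpoly.mpoly n C, L2norm (f - polyfun p) < e].

End L2.

Section Hardy.
Context {R : realType} {n : nat}.
Local Notation C := (Cplx R).
Local Notation Cn := 'rV[Cplx R]_n.

(* Invariance under the unitary group, which already determines [sigma]. *)
Definition normalized_rotation_invariant
    (sigma : {measure set (BCn R n) -> \bar R}) : Prop :=
  [/\ sigma (~` csphere) = 0%E, sigma csphere = 1%E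
    & forall (U : 'M[C]_n) (A : set (BCn R n)), U \is unitarymx ->
        measurable A -> sigma ((fun x : Cn => x *m U) @^-1` A) = sigma A].

Variable sigma : {measure set (BCn R n) -> \bar R}.

Definition Hardy2 : set (Cn -> C) :=
  [set f | holomorphic f /\
     (ereal_sup [set \int[sigma]_(x in csphere)
                       (cmod (f (ofReal r *: x)) ^+ 2)%:E
                | r in [set r : R | (0 < r < 1)%R]] < +oo)%E].

(* Boundary values in the mean-square sense: the dilates [x |-> f (r x)]
   converge to [g] in L^2(sigma) as [r] tends to 1 from below. *)
Definition is_boundary_value (f g : Cn -> C) : Prop :=
  L2 sigma g /\
  (\int[sigma]_(x in csphere) (cmod (f (ofReal r *: x) - g x) ^+ 2)%:E)%E
    @[r --> (1 : R)^'-] --> 0%E.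

Definition boundary_value (f : Cn -> C) : Cn -> C :=
  xget (fun=> 0) (is_boundary_value f).

Definition H2inner (f g : Cn -> C) : C :=
  L2inner sigma (boundary_value f) (boundary_value g).

Definition H2norm (f : Cn -> C) : R := Num.sqrt (complex.Re (H2inner f f)).

Definition bounded_operator (A : (Cn -> C) -> (Cn -> C)) : Prop :=
  [/\ forall f, Hardy2 f -> Hardy2 (A f),
      forall f g, Hardy2 f -> Hardy2 g -> ball_eq f g -> ball_eq (A f) (A g),
      forall (a : C) f g, Hardy2 f -> Hardy2 g ->
        ball_eq (A (fun z => a * f z + g z)) (fun z => a * A f z + A g z)
    & exists M : R, forall f, Hardy2 f -> H2norm (A f) <= M * H2norm f].

Definition is_adjoint (A B : (Cn -> C) -> (Cn -> C)) : Prop :=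
  bounded_operator B /\
  forall f g, Hardy2 f -> Hardy2 g -> H2inner (A f) g = H2inner f (B g).

(* [S] is the positive square root of [A]; in the order of the complex field
   [0 <= z] says that [z] is real and nonnegative. *)
Definition is_positive_sqrt (A S : (Cn -> C) -> (Cn -> C)) : Prop :=
  [/\ bounded_operator S,
      forall f, Hardy2 f -> 0 <= H2inner (S f) f
    & forall f, Hardy2 f -> ball_eq (S (S f)) (A f)].

Definition mulop (b f : Cn -> C) : Cn -> C := fun z => b z * f z.

(* The operator I - T_b B, for B the adjoint of T_b. *)
Definition defect (b : Cn -> C) (B : (Cn -> C) -> (Cn -> C)) (f : Cn -> C) :
    Cn -> C :=
  fun z => f z - mulop b (B f) z.

(* The range of [S] with its range norm; for [S] the positive square root of
   [defect b B] with [B] the adjoint of [mulop b] this is H(b). *)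
Definition range_space (S : (Cn -> C) -> (Cn -> C)) : set (Cn -> C) :=
  [set g | exists2 f, Hardy2 f & ball_eq g (S f)].

Definition range_norm (S : (Cn -> C) -> (Cn -> C)) (g : Cn -> C) : R :=
  xget 0 [set N : R | exists f,
    [/\ Hardy2 f,
        forall h, Hardy2 h -> ball_eq (S h) (fun=> 0) -> H2inner f h = 0,
        ball_eq g (S f)
      & N = H2norm f]].

End Hardy.

Section Clark.
Context {R : realType} {n : nat}.
Local Notation C := (Cplx R).
Local Notation Cn := 'rV[Cplx R]_n.

(* The total mass [(1 - |b(0)|^2) / |1 - b(0)|^2] is finite, by [z = 0]. *)
Definition is_Clark_measure (b : Cn -> C)
    (mu : {measure set (BCn R n) -> \bar R}) : Prop :=
  mu (~` csphere) = 0%E /\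
  forall z, cball z ->
    (\int[mu]_(xi in csphere) (poisson_kernel z xi)%:E =
       (complex.Re ((1 + b z) / (1 - b z)))%:E)%E.

Definition Vb (b : Cn -> C) (mu : {measure set (BCn R n) -> \bar R})
    (f : Cn -> C) : Cn -> C :=
  fun z => (1 - b z) * cintegral mu (fun xi => f xi / (1 - dotmx z xi) ^+ n).

Definition L2ker (mu : {measure set (BCn R n) -> \bar R})
    (V : (Cn -> C) -> (Cn -> C)) : set (Cn -> C) :=
  [set f | L2 mu f /\ ball_eq (V f) (fun=> 0)].

(* [V] is a partial isometry from L^2(mu) to the space [H] of functions on the
   ball, normed by [Hnorm]: linear, and isometric on the orthogonal complement
   of its kernel. *)
Definition partial_isometry (mu : {measure set (BCn R n) -> \bar R})
    (H : set (Cn -> C)) (Hnorm : (Cn -> C) -> R)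
    (V : (Cn -> C) -> (Cn -> C)) : Prop :=
  [/\ forall f, L2 mu f -> H (V f),
      forall (a : C) f g, L2 mu f -> L2 mu g ->
        ball_eq (V (fun x => a * f x + g x)) (fun z => a * V f z + V g z)
    & forall f, L2ortho mu (L2ker mu V) f -> Hnorm (V f) = L2norm mu f].

End Clark.

(* Main.v *)
(* Write [K_w = (1 - <., w>)^-n], [k_w] for its class in [L^2(mu)] and [t_w = S K_w / (1 - conj (b w))],
   an element of the Hardy space, where [S] is the positive square root of [I - T_b T_b^*].  By the
   reproducing property
   [V_b f (z) = (1 - b z) <f, k_z>] and, [S] being self-adjoint, [S u (z) = (1 - b z) <u, t_z>].
   Since [T_b^* K_w = conj (b w) K_w], one has
   [<t_v, t_w> = K_v(w) (1 - b w conj (b v)) / ((1 - b w) (1 - conj (b v)))];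
   polarizing the Clark identity shows that [<k_v, k_w>] has the same value.  Hence [k_w |-> t_w] extends
   to an isometry of the closed span of the [k_w] onto that of the [t_w], whose orthogonal complements are
   [Ker V_b] and [Ker S]: this identifies [V_b] with [S] on these spans.  The closed span of the [k_w] is
   [H^2(mu)], because the coefficients of [<z, .>^k] in a Cauchy kernel can be isolated by analyticity.

   The reproducing property comes from the Cauchy formula on the sphere.  By unitary invariance it is enough
   to evaluate at a multiple of the first basis vector; rotating the other coordinates removes them from the
   integrand, and the moments [int |x_1|^(2k) = 1 / C(n-1+k, k)] follow from invariance by comparing
   coefficients in [int <w, x>^k <x, v>^k = c_k <w, v>^k]. *)
From HB Require Import structures.
Require Import Defs.
From mathcomp Require Import all_boot all_order all_algebra.
From mathcomp Require Import all_classical all_reals all_analysis.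
From mathcomp Require Import complex sesquilinear spectral measurable_realfun.
From mathcomp Require Import ring lra zify.
From mathcomp Require mpoly.
Set Implicit Arguments.
Unset Strict Implicit.
Unset Printing Implicit Defensive.
Import Order.TTheory GRing.Theory Num.Theory.
Import numFieldNormedType.Exports.
Local Open Scope classical_set_scope.
Local Open Scope ring_scope.

(** * The modulus on the complex numbers *)

Section ComplexModulus.
Context {R : realType}.
Local Notation C := (Cplx R).
Local Notation Re := (@complex.Re R).
Local Notation Im := (@complex.Im R).
Implicit Types (z w : C) (x y : R).

(** Two features of the definitions shape the argument. Vectors are functions, not classes, so the
    Hilbert spaces below carry only semidefinite forms and identifications hold up to null distance.
    The inner product of the Hardy space is defined through boundary values picked by choice, so
    mean-square boundary values must exist for every Hardy function before any Hilbert space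
    argument can start; they arise as the orthogonal sum of the homogeneous parts of the function on
    the sphere.

    Holomorphy in several variables is exploited along complex lines, as one-variable power series.
    Their geometric remainders depend on the function only through a bound, hence are uniform over
    the sphere, and justify each termwise integration.

    The Gram matrices are compared vector by vector: each [f] is projected on a closed span and its
    approximating finite combinations are copied into the other space, so that no isometry has to be
    built as a map. Division by [1 - b z] is legitimate because the Clark identity itself excludes
    [b z = 1] for non-constant [b]. *)

Lemma cplxP z w : Re z = Re w -> Im z = Im w -> z = w.
Proof. by case: z w => [a b] [c d] /= -> ->. Qed.

Lemma cReD z w : Re (z + w) = Re z + Re w. Proof. by case: z w => [a b] [c d]. Qed.
Lemma cImD z w : Im (z + w) = Im z + Im w. Proof. by case: z w => [a b] [c d]. Qed.
Lemma cReN z : Re (- z) = - Re z. Proof. by case: z. Qed.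
Lemma cImN z : Im (- z) = - Im z. Proof. by case: z. Qed.
Lemma cReB z w : Re (z - w) = Re z - Re w. Proof. by rewrite cReD cReN. Qed.
Lemma cImB z w : Im (z - w) = Im z - Im w. Proof. by rewrite cImD cImN. Qed.
Lemma cReM z w : Re (z * w) = Re z * Re w - Im z * Im w.
Proof. by case: z w => [a b] [c d]. Qed.
Lemma cImM z w : Im (z * w) = Re z * Im w + Im z * Re w.
Proof. by case: z w => [a b] [c d]. Qed.
(** The conjugation of a closed field is accessible through [normCK], the identity
    [|z|^2 = z * conj z]; cancelling [z] reveals its coordinates. *)
Lemma conjE z : (z^*)%R = Complex (Re z) (- Im z) :> C.
Proof.
have := normCK z; rewrite normc_def.
have [->|z0] := eqVneq z 0; first by move=> _; rewrite rmorph0; apply: cplxP => /=; rewrite ?oppr0.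
move=> /(congr1 (fun u => z^-1 * u)); rewrite mulKf // => <-.
apply: (mulfI z0); rewrite mulVKf // -rmorphXn /= sqr_sqrtr ?addr_ge0 ?sqr_ge0 //.
apply: cplxP; rewrite ?cReM ?cImM /=; ring.
Qed.
Lemma cRe_conj z : Re (z^*) = Re z. Proof. by rewrite conjE. Qed.
Lemma cIm_conj z : Im (z^*) = - Im z. Proof. by rewrite conjE. Qed.
Lemma Re_ofReal x : Re (ofReal x) = x. Proof. by []. Qed.
Lemma cRe1 : Re (1 : C) = 1. Proof. by []. Qed.
Lemma cIm1 : Im (1 : C) = 0. Proof. by []. Qed.
Lemma cRe0 : Re (0 : C) = 0. Proof. by []. Qed.

Lemma cconjK z : (z^*)^* = z. Proof. exact: conjCK. Qed.
Lemma cconjD z w : (z + w)^* = z^* + w^*. Proof. exact: rmorphD. Qed.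
Lemma cconjN z : (- z)^* = - z^*. Proof. exact: rmorphN. Qed.
Lemma cconjB z w : (z - w)^* = z^* - w^*. Proof. exact: rmorphB. Qed.
Lemma cconjM z w : (z * w)^* = z^* * w^*. Proof. exact: rmorphM. Qed.
Lemma cconjX z k : (z ^+ k)^* = z^* ^+ k. Proof. exact: rmorphXn. Qed.
Lemma cconjV z : (z^-1)^* = (z^*)^-1. Proof. exact: fmorphV. Qed.
Lemma cconj0 : (0 : C)^* = 0. Proof. exact: rmorph0. Qed.
Lemma cconj1 : (1 : C)^* = 1. Proof. exact: rmorph1. Qed.
Lemma cconj_sum (I : Type) (s : seq I) (P : pred I) (F : I -> C) :
  (\sum_(i <- s | P i) F i)^* = \sum_(i <- s | P i) (F i)^*.
Proof. exact: rmorph_sum. Qed.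
Lemma ofReal_inj : injective (@ofReal R).
Proof. exact: (@complexI R). Qed.
Lemma ofReal0 : ofReal 0 = 0 :> C. Proof. by []. Qed.
Lemma ofReal1 : ofReal 1 = 1 :> C. Proof. by []. Qed.
Lemma ofRealD x y : ofReal (x + y) = ofReal x + ofReal y.
Proof. exact: (rmorphD (real_complex R)). Qed.
Lemma ofRealB x y : ofReal (x - y) = ofReal x - ofReal y.
Proof. exact: (rmorphB (real_complex R)). Qed.
Lemma ofRealM x y : ofReal (x * y) = ofReal x * ofReal y.
Proof. exact: (rmorphM (real_complex R)). Qed.
Lemma ofRealX x k : ofReal (x ^+ k) = ofReal x ^+ k.
Proof. exact: (rmorphXn (real_complex R)). Qed.
Lemma ofRealV x : ofReal x^-1 = (ofReal x)^-1.
Proof. exact: (fmorphV (real_complex R)). Qed.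
Lemma ofReal_nat k : ofReal k%:R = k%:R :> C.
Proof. exact: (rmorph_nat (real_complex R)). Qed.
Lemma ofReal_eq0 x : (ofReal x == 0) = (x == 0).
Proof. exact: (fmorph_eq0 (real_complex R)). Qed.
Lemma conj_ofReal x : (ofReal x)^* = ofReal x.
Proof. by rewrite conjE; apply: cplxP => /=; rewrite ?oppr0. Qed.
Lemma cReZ x z : Re (ofReal x * z) = x * Re z.
Proof. by rewrite cReM /= mul0r subr0. Qed.
Lemma cImZ x z : Im (ofReal x * z) = x * Im z.
Proof. by rewrite cImM /= mul0r addr0. Qed.

Lemma cmodE z : cmod z = Num.sqrt (Re z ^+ 2 + Im z ^+ 2).
Proof. by rewrite /cmod normc_def. Qed.
Lemma cnormE z : `|z| = ofReal (cmod z).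
Proof. by rewrite cmodE normc_def. Qed.
Lemma cmod_ge0 z : 0 <= cmod z. Proof. by rewrite cmodE sqrtr_ge0. Qed.
Lemma sqr_cmod z : cmod z ^+ 2 = Re z ^+ 2 + Im z ^+ 2.
Proof. by rewrite cmodE sqr_sqrtr // addr_ge0 ?sqr_ge0. Qed.
Lemma mul_conj z : z * z^* = ofReal (cmod z ^+ 2).
Proof. by rewrite -normCK cnormE ofRealX. Qed.
Lemma cmodM z w : cmod (z * w) = cmod z * cmod w.
Proof. by apply: ofReal_inj; rewrite -cnormE normrM !cnormE -ofRealM. Qed.
Lemma ler_cmodD z w : cmod (z + w) <= cmod z + cmod w.
Proof. by rewrite -lecR -/(ofReal _) -cnormE rmorphD /= -/(ofReal _) -/(ofReal _) -!cnormE; exact: ler_normD. Qed.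
Lemma cmod0 : cmod (0 : C) = 0. Proof. by rewrite /cmod normr0. Qed.
Lemma cmod1 : cmod (1 : C) = 1. Proof. by rewrite /cmod normr1. Qed.
Lemma cmodN z : cmod (- z) = cmod z. Proof. by rewrite /cmod normrN. Qed.
Lemma cmodBC z w : cmod (z - w) = cmod (w - z). Proof. by rewrite -cmodN opprB. Qed.
Lemma cmod_eq0 z : (cmod z == 0) = (z == 0).
Proof. by rewrite -ofReal_eq0 -cnormE normr_eq0. Qed.
Lemma cmod_gt0 z : (0 < cmod z) = (z != 0).
Proof. by rewrite lt_def cmod_ge0 andbT cmod_eq0. Qed.
Lemma cmodV z : cmod z^-1 = (cmod z)^-1.
Proof. by apply: ofReal_inj; rewrite -cnormE normfV cnormE ofRealV. Qed.
Lemma cmod_conj z : cmod (z^*) = cmod z.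
Proof. by rewrite !cmodE cRe_conj cIm_conj sqrrN. Qed.
Lemma cmod_ofReal x : cmod (ofReal x) = `|x|.
Proof. by rewrite cmodE /= expr0n /= addr0 sqrtr_sqr. Qed.
Lemma cmodX z k : cmod (z ^+ k) = cmod z ^+ k.
Proof. by elim: k => [|k IH]; rewrite ?expr0 ?cmod1 // !exprS cmodM IH. Qed.
Lemma ler_cmodB z w : cmod (z - w) <= cmod z + cmod w.
Proof. by rewrite (le_trans (ler_cmodD _ _)) // cmodN. Qed.
Lemma ler_cmod_dist z w v : cmod (z - v) <= cmod (z - w) + cmod (w - v).
Proof. by rewrite -[z - v](subrKA w) ler_cmodD. Qed.
Lemma lerB_cmod z w : cmod z - cmod w <= cmod (z - w).
Proof. by rewrite lerBlDr -{1}(subrK w z) ler_cmodD. Qed.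
Lemma ler_Re_cmod z : `|Re z| <= cmod z.
Proof. by rewrite cmodE -[`|_|]sqrtr_sqr ler_wsqrtr // lerDl sqr_ge0. Qed.
Lemma ler_Im_cmod z : `|Im z| <= cmod z.
Proof. by rewrite cmodE -[`|_|]sqrtr_sqr ler_wsqrtr // lerDr sqr_ge0. Qed.
Lemma Re_le_cmod z : Re z <= cmod z.
Proof. exact: le_trans (ler_norm _) (ler_Re_cmod _). Qed.
Lemma cmod_le_ReIm z : cmod z <= `|Re z| + `|Im z|.
Proof.
rewrite -(ler_pXn2r (n := 2)) ?nnegrE ?cmod_ge0 ?addr_ge0 //.
rewrite sqr_cmod sqrrD !real_normK ?num_real //.
by rewrite lerD2r lerDl mulrn_wge0 // mulr_ge0.
Qed.
Lemma ler_cmod_sum (I : Type) (s : seq I) (P : pred I) (F : I -> C) :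
  cmod (\sum_(i <- s | P i) F i) <= \sum_(i <- s | P i) cmod (F i).
Proof.
elim/big_ind2: _ => [|x1 x2 y1 y2 h1 h2|i _] //; first by rewrite cmod0.
by rewrite (le_trans (ler_cmodD _ _)) // lerD.
Qed.
Lemma ge0_cplx z : 0 <= z -> z = ofReal (Re z).
Proof. by move=> /ger0_Im h; apply: cplxP. Qed.
Lemma le0Re z : 0 <= z -> 0 <= Re z.
Proof. by rewrite lecE => /andP[]. Qed.
Lemma cmod_natr k : cmod (k%:R : C) = k%:R.
Proof. by rewrite -ofReal_nat cmod_ofReal normr_nat. Qed.
Lemma cmod_small_eq0 z : (forall e, 0 < e -> cmod z <= e) -> z = 0.
Proof.
move=> h; apply/eqP; rewrite -cmod_eq0 eq_le cmod_ge0 andbT leNgt.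
apply/negP => z0; have := h _ (divr_gt0 z0 (ltr0n _ 2)).
by apply/negP; rewrite -ltNge ltr_pdivrMr // ltr_pMr // ltr1n.
Qed.

Lemma cRe_sum (I : Type) (s : seq I) (P : pred I) (F : I -> C) :
  Re (\sum_(i <- s | P i) F i) = \sum_(i <- s | P i) Re (F i).
Proof. by apply: (big_morph Re cReD). Qed.

End ComplexModulus.

(** * Complex-valued integrals *)

Section ComplexIntegral.
Context {R : realType} {d : measure_display} {T : measurableType d}.
Local Notation C := (Cplx R).
Local Notation Re := (@complex.Re R).
Local Notation Im := (@complex.Im R).
Variables (mu : {measure set T -> \bar R}) (D : set T).
Hypothesis mD : measurable D.
Implicit Types (f g : T -> C).

Definition cmeas f : Prop :=
  measurable_fun D (fun x => Re (f x)) /\ measurable_fun D (fun x => Im (f x)).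

Definition cintegrable f : Prop :=
  mu.-integrable D (EFin \o (fun x => Re (f x))) /\
  mu.-integrable D (EFin \o (fun x => Im (f x))).

(** For [D = csphere] this is [cintegral] by conversion, so results about [cint] apply to [L2inner]
    and [Vb] as they stand. *)
Definition cint f : C :=
  Complex (\int[mu]_(x in D) Re (f x)) (\int[mu]_(x in D) Im (f x)).

Lemma cmeas_cst (c : C) : cmeas (fun=> c).
Proof. by split; apply: measurable_cst. Qed.

Lemma cmeasD f g : cmeas f -> cmeas g -> cmeas (fun x => f x + g x).
Proof.
move=> [f1 f2] [g1 g2]; split.
  under eq_fun do rewrite cReD; exact: measurable_funD.
under eq_fun do rewrite cImD; exact: measurable_funD.
Qed.

Lemma cmeasM f g : cmeas f -> cmeas g -> cmeas (fun x => f x * g x).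
Proof.
move=> [f1 f2] [g1 g2]; split.
  under eq_fun do rewrite cReM; apply: measurable_funB; exact: measurable_funM.
under eq_fun do rewrite cImM; apply: measurable_funD; exact: measurable_funM.
Qed.

Lemma cmeas_conj f : cmeas f -> cmeas (fun x => (f x)^*).
Proof.
move=> [f1 f2]; split; first by under eq_fun do rewrite cRe_conj.
under eq_fun do rewrite cIm_conj.
by apply: measurableT_comp f2.
Qed.

Lemma cmeasZ (c : C) f : cmeas f -> cmeas (fun x => c * f x).
Proof. by apply: cmeasM; exact: cmeas_cst. Qed.

Lemma cmeasN f : cmeas f -> cmeas (fun x => - f x).
Proof. by move=> /(cmeasZ (-1)) h; under eq_fun do rewrite -mulN1r. Qed.

Lemma cmeasB f g : cmeas f -> cmeas g -> cmeas (fun x => f x - g x).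
Proof. by move=> hf /cmeasN; exact: cmeasD. Qed.

Lemma cmeasX f k : cmeas f -> cmeas (fun x => f x ^+ k).
Proof.
move=> hf; elim: k => [|k IH]; first by under eq_fun do rewrite expr0; exact: cmeas_cst.
by under eq_fun do rewrite exprS; exact: cmeasM.
Qed.

Lemma cmeas_sum (I : Type) (s : seq I) (F : I -> T -> C) :
  (forall i, cmeas (F i)) -> cmeas (fun x => \sum_(i <- s) F i x).
Proof.
move=> h; elim: s => [|i s IH].
  by under eq_fun do rewrite big_nil; exact: cmeas_cst.
by under eq_fun do rewrite big_cons; exact: cmeasD.
Qed.

Lemma measurable_sqr_cmod f : cmeas f -> measurable_fun D (fun x => cmod (f x) ^+ 2).
Proof.
move=> [f1 f2]; under eq_fun do rewrite sqr_cmod.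
by apply: measurable_funD; exact: measurable_funX.
Qed.

Lemma measurable_cmod f : cmeas f -> measurable_fun D (fun x => cmod (f x)).
Proof.
move=> hf.
have -> : (fun x => cmod (f x)) = Num.sqrt \o (fun x => cmod (f x) ^+ 2).
  by apply/funext => x /=; rewrite sqrtr_sqr ger0_norm ?cmod_ge0.
apply: measurableT_comp (measurable_sqr_cmod hf).
by apply: continuous_measurable_fun; exact: sqrt_continuous.
Qed.

Lemma cmeas_lim (F : nat -> T -> C) g : (forall k, cmeas (F k)) ->
  (forall x, D x -> forall e : R, 0 < e ->
     exists N, forall k, (N <= k)%N -> cmod (F k x - g x) <= e) ->
  cmeas g.
Proof.
move=> hF hg; split.
- apply: (@measurable_fun_cvg _ _ _ _ (fun k x => Re (F k x))) => [k|x Dx].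
    by case: (hF k).
  apply/cvgrPdist_le => e /(hg x Dx)[N hN]; exists N => // k /= /hN.
  by apply: le_trans; rewrite distrC -cReB ler_Re_cmod.
- apply: (@measurable_fun_cvg _ _ _ _ (fun k x => Im (F k x))) => [k|x Dx].
    by case: (hF k).
  apply/cvgrPdist_le => e /(hg x Dx)[N hN]; exists N => // k /= /hN.
  by apply: le_trans; rewrite distrC -cImB ler_Im_cmod.
Qed.

Lemma cintegrable_meas f : cintegrable f -> cmeas f.
Proof.
by move=> [/measurable_int h1 /measurable_int h2]; split; apply/measurable_EFinP.
Qed.

Lemma le_cintegrable f (h : T -> R) : cmeas f -> mu.-integrable D (EFin \o h) ->
  (forall x, D x -> cmod (f x) <= h x) -> cintegrable f.
Proof.
move=> [f1 f2] hh fh; split; apply: le_integrable hh => //;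
  try (by apply/measurable_EFinP); move=> x Dx /=; rewrite lee_fin.
  by rewrite (le_trans (ler_Re_cmod _)) // (le_trans (fh x Dx)) // ler_norm.
by rewrite (le_trans (ler_Im_cmod _)) // (le_trans (fh x Dx)) // ler_norm.
Qed.

Lemma cintegrable_cmod f : cintegrable f ->
  mu.-integrable D (EFin \o (fun x => cmod (f x))).
Proof.
move=> hf; have mf := cintegrable_meas hf; case: hf => f1 f2.
have := integrableD mD (integrable_norm f1) (integrable_norm f2).
apply: le_integrable => //; first by apply/measurable_EFinP; exact: measurable_cmod.
move=> x Dx /=; rewrite lee_fin (ger0_norm (cmod_ge0 _)).
by rewrite (le_trans (cmod_le_ReIm _)) // ler_norm.
Qed.

Lemma cintegrable_bounded f (M : R) : (mu D < +oo)%E -> cmeas f ->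
  (forall x, D x -> cmod (f x) <= M) -> cintegrable f.
Proof.
move=> muD mf fM; apply: (@le_cintegrable f (fun=> M)) => //.
apply/integrableP; split; first exact/measurable_EFinP.
have := @integral_cst _ _ _ mu D mD (`|M|%:E) => /= ->.
by rewrite lte_mul_pinfty // lee_fin.
Qed.

Lemma cintegrableD f g : cintegrable f -> cintegrable g ->
  cintegrable (fun x => f x + g x).
Proof.
move=> [f1 f2] [g1 g2]; split.
  have := integrableD mD f1 g1; apply: eq_integrable => // x _ /=.
  by rewrite cReD EFinD.
have := integrableD mD f2 g2; apply: eq_integrable => // x _ /=.
by rewrite cImD EFinD.
Qed.

Lemma cintegrableZ (c : C) f : cintegrable f -> cintegrable (fun x => c * f x).
Proof.
move=> hf; apply: (@le_cintegrable _ (fun x => cmod c * cmod (f x))).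
- by apply: cmeasZ; exact: cintegrable_meas.
- have := integrableZl mD (cmod c) (cintegrable_cmod hf).
  by apply: eq_integrable.
- by move=> x _; rewrite cmodM.
Qed.

Lemma cintegrableN f : cintegrable f -> cintegrable (fun x => - f x).
Proof. by move=> /(cintegrableZ (-1)) h; under eq_fun do rewrite -mulN1r. Qed.

Lemma cintegrableB f g : cintegrable f -> cintegrable g ->
  cintegrable (fun x => f x - g x).
Proof. by move=> hf /cintegrableN; exact: cintegrableD. Qed.

Lemma eq_cint f g : (forall x, D x -> f x = g x) -> cint f = cint g.
Proof.
by move=> fg; rewrite /cint; congr Complex; apply: eq_Rintegral => x /set_mem Dx; rewrite fg.
Qed.

Lemma cintD f g : cintegrable f -> cintegrable g ->
  cint (fun x => f x + g x) = cint f + cint g.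
Proof.
move=> [f1 f2] [g1 g2]; apply: cplxP; rewrite ?cReD ?cImD /= -RintegralD //.
  by apply: eq_Rintegral => x _; rewrite cReD.
by apply: eq_Rintegral => x _; rewrite cImD.
Qed.

Lemma integrable_realZl (c : R) (h : T -> R) : mu.-integrable D (EFin \o h) ->
  mu.-integrable D (EFin \o (fun x => c * h x)).
Proof. by move=> hh; have := integrableZl mD c hh; apply: eq_integrable. Qed.

Lemma cintZ (c : C) f : cintegrable f -> cint (fun x => c * f x) = c * cint f.
Proof.
move=> [f1 f2]; apply: cplxP; rewrite ?cReM ?cImM /= -!RintegralZl //.
  rewrite -RintegralB //; try exact: integrable_realZl.
  by apply: eq_Rintegral => x _; rewrite cReM.
rewrite -RintegralD //; try exact: integrable_realZl.
by apply: eq_Rintegral => x _; rewrite cImM.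
Qed.

Lemma cintN f : cintegrable f -> cint (fun x => - f x) = - cint f.
Proof.
by move=> hf; rewrite -mulN1r -cintZ //; apply: eq_cint => x _; rewrite mulN1r.
Qed.

Lemma cintB f g : cintegrable f -> cintegrable g ->
  cint (fun x => f x - g x) = cint f - cint g.
Proof. by move=> hf hg; rewrite cintD ?cintN //; exact: cintegrableN. Qed.

Lemma cint0 : cint (fun=> 0) = 0.
Proof. by rewrite /cint /= Rintegral_cst // mul0r. Qed.

Lemma cintegrable0 : cintegrable (fun=> 0).
Proof. by split; exact: integrable0. Qed.

Lemma cintegrable_sum (I : Type) (s : seq I) (F : I -> T -> C) :
  (forall i, cintegrable (F i)) -> cintegrable (fun x => \sum_(i <- s) F i x).
Proof.
move=> h; elim: s => [|i s IH].
  by under eq_fun do rewrite big_nil; exact: cintegrable0.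
by under eq_fun do rewrite big_cons; exact: cintegrableD.
Qed.

Lemma cint_sum (I : Type) (s : seq I) (F : I -> T -> C) :
  (forall i, cintegrable (F i)) ->
  cint (fun x => \sum_(i <- s) F i x) = \sum_(i <- s) cint (F i).
Proof.
move=> h; elim: s => [|i s IH].
  by under eq_fun do rewrite big_nil; rewrite big_nil cint0.
under eq_fun do rewrite big_cons.
by rewrite big_cons cintD ?IH //; exact: cintegrable_sum.
Qed.

Lemma cint_conj f : cintegrable f -> cint (fun x => (f x)^*) = (cint f)^*.
Proof.
move=> [f1 f2]; rewrite conjE /cint /=; congr Complex.
  by apply: eq_Rintegral => x _; rewrite cRe_conj.
rewrite -mulN1r -RintegralZl //; apply: eq_Rintegral => x _.
by rewrite cIm_conj mulN1r.
Qed.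

Lemma cmod_cint_le f : cintegrable f ->
  cmod (cint f) <= \int[mu]_(x in D) cmod (f x).
Proof.
move=> hf; have [->|I0] := eqVneq (cint f) 0.
  by rewrite cmod0; apply: Rintegral_ge0 => x _; exact: cmod_ge0.
have m0 : cmod (cint f) != 0 by rewrite cmod_eq0.
(* A unimodular factor that turns the integral into its modulus; the real part of [a * f] is then
   compared with [cmod f]. *)
pose a := (cint f)^* / ofReal (cmod (cint f)).
have ha : cmod a = 1 by rewrite cmodM cmodV cmod_conj cmod_ofReal ger0_norm ?cmod_ge0 // divff.
have -> : cmod (cint f) = Re (cint (fun x => a * f x)).
  rewrite cintZ // mulrAC mulrC [_^* * _]mulrC mul_conj -ofRealV -ofRealM Re_ofReal.
  by rewrite expr2 mulKf.
rewrite /cint /=; apply: le_Rintegral => //.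
- by case: (cintegrableZ a hf).
- exact: cintegrable_cmod.
- by move=> x _; rewrite (le_trans (Re_le_cmod _)) // cmodM ha mul1r.
Qed.

Lemma cmod_cint_bounded f (M : R) : (mu D < +oo)%E -> cmeas f ->
  (forall x, D x -> cmod (f x) <= M) -> cmod (cint f) <= M * fine (mu D).
Proof.
move=> muD mf fM; have hf := cintegrable_bounded muD mf fM.
apply: (le_trans (cmod_cint_le hf)).
rewrite -(Rintegral_cst mu mD); apply: le_Rintegral => //.
- exact: cintegrable_cmod.
- apply/integrableP; split; first exact/measurable_EFinP.
  have := @integral_cst _ _ _ mu D mD (`|M|%:E) => /= ->.
  by rewrite lte_mul_pinfty // lee_fin.
Qed.

End ComplexIntegral.

(** * Square-integrable functions *)

Section ComplexCauchy.
Context {R : realType}.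
Local Notation C := (Cplx R).

Lemma real_cauchy_cvg (u : nat -> R) :
  (forall e : R, 0 < e -> exists N, forall m n, (N <= m)%N -> (N <= n)%N ->
     `|u m - u n| <= e) ->
  exists l, forall e : R, 0 < e -> exists N, forall n, (N <= n)%N -> `|u n - l| <= e.
Proof.
move=> h; have /cauchy_cvgP/cvgrPdist_le hu : cauchy (u @ \oo).
  apply: cauchy_exP => e e0; have [N hN] := h _ (divr_gt0 e0 (ltr0n _ 2)).
  exists (u N); exists N => // n /= Nn; apply: (le_lt_trans (hN _ _ (leqnn N) Nn)).
  by rewrite ltr_pdivrMr // ltr_pMr // ltr1n.
exists (limn u) => e /hu [N _ hN]; exists N => n /hN; by rewrite distrC.
Qed.

Lemma cplx_cauchy_cvg (u : nat -> C) :
  (forall e : R, 0 < e -> exists N, forall m n, (N <= m)%N -> (N <= n)%N ->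
     cmod (u m - u n) <= e) ->
  exists l, forall e : R, 0 < e -> exists N, forall n, (N <= n)%N -> cmod (u n - l) <= e.
Proof.
move=> h.
have [a ha] : exists l, forall e : R, 0 < e ->
    exists N, forall n, (N <= n)%N -> `|complex.Re (u n) - l| <= e.
  apply: real_cauchy_cvg => e /h [N hN]; exists N => m n Nm Nn.
  by rewrite -cReB (le_trans (ler_Re_cmod _)) ?hN.
have [b hb] : exists l, forall e : R, 0 < e ->
    exists N, forall n, (N <= n)%N -> `|complex.Im (u n) - l| <= e.
  apply: real_cauchy_cvg => e /h [N hN]; exists N => m n Nm Nn.
  by rewrite -cImB (le_trans (ler_Im_cmod _)) ?hN.
exists (Complex a b : C) => e e0.
have e2 := divr_gt0 e0 (ltr0n R 2); have [N hN] := ha _ e2; have [M hM] := hb _ e2.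
exists (maxn N M) => n; rewrite geq_max => /andP[/hN h1 /hM h2].
rewrite (le_trans (cmod_le_ReIm _)) // cReB cImB /= [leRHS]splitr.
exact: lerD.
Qed.

Lemma cplx_geometric_cvg (u : nat -> C) (c : R) :
  (forall k, cmod (u k.+1 - u k) <= c * (2^-1) ^+ k) ->
  exists l, forall e : R, 0 < e -> exists N, forall n, (N <= n)%N -> cmod (u n - l) <= e.
Proof.
move=> hu; have c0 : 0 <= c.
  by have := hu 0%N; rewrite expr0 mulr1; apply: le_trans; exact: cmod_ge0.
have tail k j : cmod (u (k + j)%N - u k) <= c * (2^-1) ^+ k * (2 - 2 * (2^-1) ^+ j).
  elim: j => [|j IH]; first by rewrite addn0 subrr cmod0 expr0 mulr1 subrr mulr0.
  apply: (le_trans (ler_cmod_dist _ (u (k + j)%N) _)).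
  rewrite addnS (le_trans (lerD (hu _) IH)) // exprD exprS.
  set x := _ ^+ k; set y := _ ^+ j.
  by have -> : c * (x * y) + c * x * (2 - 2 * y) = c * x * (2 - 2 * (2^-1 * y)) by field.
apply: cplx_cauchy_cvg => e e0.
have /cvgrPdist_le /(_ e e0)[N _ hN] := @cvg_geometric R (4 * c) 2^-1 ltac:(by rewrite ger0_norm ?invf_lt1 ?ltr1n ?invr_ge0).
have {}tail n : (N <= n)%N -> cmod (u n - u N) <= e / 2.
  move=> Nn; have := tail N (n - N)%N; rewrite subnKC // => /le_trans; apply.
  have := hN N (leqnn N); rewrite sub0r normrN /= => /(le_trans (ler_norm _)) h.
  have q0 : 0 <= (2^-1 : R) ^+ (n - N) by rewrite exprn_ge0 // invr_ge0.
  have p0 : 0 <= c * (2^-1 : R) ^+ N by rewrite mulr_ge0 // exprn_ge0 // invr_ge0.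
  have := mulr_ge0 p0 q0; move: h; lra.
exists N => m n Nm Nn; rewrite (le_trans (ler_cmod_dist _ (u N) _)) //.
by rewrite [leRHS]splitr lerD ?tail // cmodBC tail.
Qed.

End ComplexCauchy.

Section SquareIntegrable.
Context {R : realType} {d : measure_display} {T : measurableType d}.
Local Notation C := (Cplx R).
Local Notation Re := (@complex.Re R).
Local Notation Im := (@complex.Im R).
Variables (mu : {measure set T -> \bar R}) (D : set T).
Hypothesis mD : measurable D.
Implicit Types (f g : T -> C).

(** Over an arbitrary measurable [D]; for [D = csphere], [sqint] and [sqip] are [L2] and [L2inner]
    by conversion. *)
Definition sqint f : Prop :=
  [/\ measurable_fun D (fun x => Re (f x)), measurable_fun D (fun x => Im (f x))
    & (\int[mu]_(x in D) (cmod (f x) ^+ 2)%:E < +oo)%E].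

Definition sqip f g : C := cint mu D (fun x => f x * (g x)^*).

Lemma sqint_cmeas f : sqint f -> cmeas D f. Proof. by case. Qed.

Lemma esqr_meas f : cmeas D f -> measurable_fun D (fun x => (cmod (f x) ^+ 2)%:E).
Proof. by move=> hf; apply/measurable_EFinP; exact: measurable_sqr_cmod. Qed.

Lemma sqint_integrable f : sqint f ->
  mu.-integrable D (EFin \o (fun x => cmod (f x) ^+ 2)).
Proof.
move=> [f1 f2 f3]; apply/integrableP; split; first exact: esqr_meas.
rewrite (eq_integral (fun x => (cmod (f x) ^+ 2)%:E)) // => x _ /=.
by rewrite ger0_norm // sqr_ge0.
Qed.

Lemma integrable_sqint f : cmeas D f ->
  mu.-integrable D (EFin \o (fun x => cmod (f x) ^+ 2)) -> sqint f.
Proof.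
move=> [f1 f2] /integrable_lty h; split => //; exact: h.
Qed.

Lemma le_sqint f (h : T -> R) : cmeas D f -> mu.-integrable D (EFin \o h) ->
  (forall x, D x -> cmod (f x) ^+ 2 <= h x) -> sqint f.
Proof.
move=> mf hh fh; apply: integrable_sqint => //; apply: le_integrable hh => //.
  exact: esqr_meas.
move=> x Dx /=; rewrite lee_fin ger0_norm ?sqr_ge0 //.
by rewrite (le_trans (fh x Dx)) // ler_norm.
Qed.

Lemma sqint_bounded f (M : R) : (mu D < +oo)%E -> cmeas D f ->
  (forall x, D x -> cmod (f x) <= M) -> sqint f.
Proof.
move=> muD mf fM; apply: (@le_sqint f (fun=> M ^+ 2)) => //.
  apply/integrableP; split; first exact/measurable_EFinP.
  have := @integral_cst _ _ _ mu D mD (`|M ^+ 2|%:E) => /= ->.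
  by rewrite lte_mul_pinfty // lee_fin.
by move=> x Dx; rewrite ler_pXn2r ?nnegrE ?cmod_ge0 ?fM // (le_trans _ (fM x Dx)) ?cmod_ge0.
Qed.

Lemma integrableD_real (h1 h2 : T -> R) : mu.-integrable D (EFin \o h1) ->
  mu.-integrable D (EFin \o h2) -> mu.-integrable D (EFin \o (fun x => h1 x + h2 x)).
Proof. by move=> i1 i2; have := integrableD mD i1 i2; apply: eq_integrable. Qed.

Lemma sqint_mul f g : sqint f -> sqint g -> cintegrable mu D (fun x => f x * (g x)^*).
Proof.
move=> hf hg.
have := integrableD_real (sqint_integrable hf) (sqint_integrable hg).
move=> ii; apply: (le_cintegrable mD _ ii).
  by apply: cmeasM; [|apply: cmeas_conj]; exact: sqint_cmeas.
move=> x _ /=; rewrite cmodM cmod_conj.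
by have := sqr_ge0 (cmod (f x) - cmod (g x)); nra.
Qed.

Lemma sqint_lin (a : C) f g : sqint f -> sqint g -> sqint (fun x => a * f x + g x).
Proof.
move=> hf hg.
have := integrableD_real (integrable_realZl mD (2 * cmod a ^+ 2) (sqint_integrable hf))
  (integrable_realZl mD 2 (sqint_integrable hg)).
move=> ii; apply: (le_sqint _ ii); first by apply: cmeasD; [apply: cmeasZ|]; exact: sqint_cmeas.
move=> x _ /=.
have h := ler_cmodD (a * f x) (g x); rewrite cmodM in h.
have h2 : cmod (a * f x + g x) ^+ 2 <= (cmod a * cmod (f x) + cmod (g x)) ^+ 2.
  by rewrite ler_pXn2r // ?nnegrE ?cmod_ge0 ?addr_ge0 ?mulr_ge0 ?cmod_ge0.
apply: (le_trans h2).
by have := sqr_ge0 (cmod a * cmod (f x) - cmod (g x)); nra.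
Qed.

Lemma sqint0 : sqint (fun=> 0).
Proof.
apply: (@le_sqint _ (fun=> 0)); first exact: cmeas_cst.
  exact: integrable0.
by move=> x _; rewrite cmod0 expr0n.
Qed.

Lemma sqintB f g : sqint f -> sqint g -> sqint (fun x => f x - g x).
Proof.
move=> hf hg; have := sqint_lin (-1) hg hf.
by congr sqint; apply/funext => x; rewrite mulN1r addrC.
Qed.

Lemma sqipl (a : C) f g h : sqint f -> sqint g -> sqint h ->
  sqip (fun x => a * f x + g x) h = a * sqip f h + sqip g h.
Proof.
move=> hf hg hh; rewrite /sqip -(cintZ mD a (sqint_mul hf hh)).
rewrite -(cintD mD (cintegrableZ mD a (sqint_mul hf hh)) (sqint_mul hg hh)).
by apply: eq_cint => x _; rewrite mulrDl mulrA.
Qed.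

Lemma sqipC f g : sqint f -> sqint g -> sqip g f = (sqip f g)^*.
Proof.
move=> hf hg; rewrite /sqip -(cint_conj mD (sqint_mul hf hg)).
by apply: eq_cint => x _; rewrite cconjM cconjK mulrC.
Qed.

Lemma Re_sqip f : Re (sqip f f) = \int[mu]_(x in D) (cmod (f x) ^+ 2).
Proof.
rewrite /sqip /cint /=; apply: eq_Rintegral => x _; by rewrite mul_conj.
Qed.

Lemma sqip_ge0 f : 0 <= Re (sqip f f).
Proof. by rewrite Re_sqip; apply: Rintegral_ge0 => x _; exact: sqr_ge0. Qed.

Lemma EFin_sqip f : sqint f ->
  (Re (sqip f f))%:E = (\int[mu]_(x in D) (cmod (f x) ^+ 2)%:E)%E.
Proof.
move=> hf; rewrite Re_sqip /Rintegral fineK //.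
by apply: integrable_fin_num => //; exact: sqint_integrable.
Qed.

Lemma limn_einf_le (u : nat -> \bar R) (e : \bar R) :
  (forall k, (u k <= e)%E) -> (limn_einf u <= e)%E.
Proof.
move=> h; apply: (le_trans (limn_einf_sup _)); rewrite limn_esup_lim.
apply: lime_le; first exact: is_cvg_esups.
by apply: nearW => k; apply: ge_ereal_sup => _ [m _ <-].
Qed.

(** Fatou's lemma for squared moduli. It closes the completeness proofs both of L^2 and of the Hardy
    space, where only pointwise convergence is at hand. *)
Lemma fatou_sqint (F : nat -> T -> C) g (e : \bar R) :
  (forall k, cmeas D (F k)) ->
  (forall x, D x -> forall e : R, 0 < e ->
     exists N, forall k, (N <= k)%N -> cmod (F k x - g x) <= e) ->
  (forall k, (\int[mu]_(x in D) (cmod (F k x) ^+ 2)%:E <= e)%E) ->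
  (\int[mu]_(x in D) (cmod (g x) ^+ 2)%:E <= e)%E.
Proof.
move=> mF hg hF; apply: (le_trans _ (limn_einf_le hF)).
have := @fatou _ _ _ mu D mD (fun k x => (cmod (F k x) ^+ 2)%:E) (fun k => esqr_meas (mF k)).
move=> /(_ ltac:(by move=> k x _; rewrite lee_fin sqr_ge0)).
apply: le_trans; rewrite le_eqVlt; apply/orP; left; apply/eqP.
apply: eq_integral => x /set_mem Dx; apply/esym.
suff /cvg_limn_einf_sup[-> //] :
    (cmod (F k x) ^+ 2)%:E @[k --> \oo] --> (cmod (g x) ^+ 2)%:E.
apply/cvg_EFin; first exact: nearW.
have hc : cmod (F k x) @[k --> \oo] --> cmod (g x).
  apply/cvgrPdist_le => r /(hg x Dx)[N hN]; exists N => // k /= /hN.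
  apply: le_trans; rewrite ler_norml; have := lerB_cmod (F k x) (g x).
  by have := lerB_cmod (g x) (F k x); rewrite cmodBC => ? ?; lra.
exact: (cvgM hc hc).
Qed.

End SquareIntegrable.

(** * Completeness of L^2 *)

Section SquareIntegrableComplete.
Context {R : realType} {d : measure_display} {T : measurableType d}.
Local Notation C := (Cplx R).
Local Notation Re := (@complex.Re R).
Local Notation Im := (@complex.Im R).
Variables (mu : {measure set T -> \bar R}) (D : set T).
Hypothesis mD : measurable D.
Implicit Types (f g : T -> C).

(* Along a subsequence with |F_(k+1) - F_k|^2 of integral at most 8^-k, the sum
   of 4^k |F_(k+1) - F_k|^2 is finite almost everywhere. *)
Lemma sqint_fast_cvg (G : nat -> T -> C) :
  (forall k, sqint mu D (G k)) ->
  (forall k, (\int[mu]_(x in D) (cmod (G k.+1 x - G k x) ^+ 2)%:E <= ((8^-1) ^+ k)%:E)%E) ->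
  exists (G' : nat -> T -> C) g,
  [/\ forall k, cmeas D (G' k),
      forall x, D x -> forall e : R, 0 < e ->
        exists N, forall k, (N <= k)%N -> cmod (G' k x - g x) <= e
    & forall f, cmeas D f -> forall k, (\int[mu]_(x in D) (cmod (f x - G' k x) ^+ 2)%:E =
        \int[mu]_(x in D) (cmod (f x - G k x) ^+ 2)%:E)%E].
Proof.
move=> hG hd; have mdG k : cmeas D (fun x => G k.+1 x - G k x).
  by apply: cmeasB; exact: sqint_cmeas.
pose q k x : \bar R := (4 ^+ k * cmod (G k.+1 x - G k x) ^+ 2)%:E.
have q0 k x : (0 <= q k x)%E by rewrite /q lee_fin mulr_ge0 ?sqr_ge0 ?exprn_ge0.
have mq k : measurable_fun D (q k).
  rewrite /q; apply/measurable_EFinP; apply: measurable_funM => //; exact: measurable_sqr_cmod.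
pose Q x : \bar R := (\sum_(0 <= k <oo) q k x)%E.
have mQ : measurable_fun D Q.
  apply: (@emeasurable_fun_cvg _ _ _ _ (fun n x => (\sum_(0 <= k < n) q k x)%E)) => [n|x Dx].
    exact: emeasurable_sum.
  by apply: is_cvg_nneseries => n _ _.
have iq k : (\int[mu]_(x in D) q k x <= ((2^-1) ^+ k)%:E)%E.
  rewrite /q; under eq_integral do rewrite EFinM.
  rewrite ge0_integralZl_EFin ?exprn_ge0 //; last 2 first.
  - by move=> x _; rewrite lee_fin sqr_ge0.
  - exact: esqr_meas.
  have -> : (2^-1 : R) ^+ k = 4 ^+ k * 8^-1 ^+ k by rewrite -exprMn; congr (_ ^+ k); field.
  by rewrite EFinM lee_pmul2l // lte_fin exprn_gt0.
have iQ : (\int[mu]_(x in D) Q x < +oo)%E.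
  rewrite /Q integral_nneseries //.
  apply: (@le_lt_trans _ _ 2%:E); last by rewrite ltry.
  apply: lime_le; first by apply: is_cvg_nneseries => n _ _; apply: integral_ge0.
  apply: nearW => n; apply: (le_trans (lee_sum _ (fun k _ => iq k))).
  rewrite sumEFin lee_fin.
  have := @geometric_le_lim R n 1 2^-1 ler01 ltac:(by rewrite invr_gt0) ltac:(by rewrite ger0_norm ?invf_lt1 ?ltr1n ?invr_ge0).
  rewrite /series /=; under eq_bigr do rewrite mul1r.
  by move=> /le_trans; apply; rewrite le_eqVlt; apply/orP; left; apply/eqP; field.
pose E := D `&` [set x | (Q x < +oo)%E].
have mE : measurable E by apply: emeasurable_fun_infty_o.
(* Cutting off outside [E] changes each function on a null set only and makes the sequence converge
   at every point of [D], so that the limit is measurable. *)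
pose G' k x := ofReal (\1_E x) * G k x.
have hE x : E x -> G'^~ x = G^~ x.
  by move=> Ex; apply/funext => k; rewrite /G' indicE mem_set // mul1r.
have hNE x : ~ E x -> G'^~ x = (fun=> 0).
  by move=> Ex; apply/funext => k; rewrite /G' indicE memNset // mul0r.
have mG' k : cmeas D (G' k).
  apply: cmeasM; last exact: sqint_cmeas.
  by split => /=; [exact: measurable_indic|exact: measurable_cst].
have cv x : D x -> exists l, forall e : R, 0 < e ->
     exists N, forall k, (N <= k)%N -> cmod (G' k x - l) <= e.
  move=> Dx; have [Ex|Ex] := pselect (E x); last first.
    exists 0 => e e0; exists 0%N => k _; have /(congr1 (@^~ k)) /= -> := hNE x Ex.
    by rewrite subr0 cmod0 ltW.
  case: Ex (Ex) => _ /= Qx Ex.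
  have Q0 : (0 <= Q x)%E by apply: nneseries_ge0.
  have Qf : Q x = (fine (Q x))%:E by rewrite fineK // ge0_fin_numE.
  (* The single term [q k x <= Q x] already bounds the increment number [k] by
     [sqrt (Q x) / 2^k]. *)
  apply: (@cplx_geometric_cvg _ _ (Num.sqrt (fine (Q x)))) => k.
  have /(congr1 (@^~ k)) /= -> := hE x Ex; have /(congr1 (@^~ k.+1)) /= -> := hE x Ex.
  rewrite -(ler_pXn2r (n := 2)) ?nnegrE ?cmod_ge0 ?mulr_ge0 ?sqrtr_ge0 ?exprn_ge0 ?invr_ge0 //.
  rewrite exprMn sqr_sqrtr; last by rewrite -lee_fin -Qf.
  have : (q k x <= Q x)%E.
    apply: le_trans (nneseries_lim_ge k.+1 _) => //.
    by rewrite big_nat_recr //= leeDr // sume_ge0.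
  rewrite Qf lee_fin => h.
  have -> : (2^-1 : R) ^+ k ^+ 2 = (4 ^+ k)^-1.
    by rewrite -exprM mulnC exprM -exprVn; congr (_ ^+ k); field.
  by rewrite ler_pdivlMr ?exprn_gt0 // mulrC.
have [g hg] : exists g : T -> C, forall x, D x -> forall e : R, 0 < e ->
     exists N, forall k, (N <= k)%N -> cmod (G' k x - g x) <= e.
  have /choice[g hg] : forall x, exists l, D x -> forall e : R, 0 < e ->
     exists N, forall k, (N <= k)%N -> cmod (G' k x - l) <= e.
    by move=> x; have [/cv[l hl]|] := pselect (D x); [exists l|exists 0].
  by exists g.
exists G', g; split => // f mf k.
apply: ge0_ae_eq_integral => //.
- by apply: esqr_meas; exact: cmeasB.
- by apply: esqr_meas; apply: cmeasB => //; exact: sqint_cmeas.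
- by move=> x _; rewrite lee_fin sqr_ge0.
- by move=> x _; rewrite lee_fin sqr_ge0.
have : mu.-integrable D Q.
  apply/integrableP; split => //.
  rewrite (eq_integral Q) // => x _; rewrite gee0_abs //; exact: nneseries_ge0.
move=> /(integrable_ae mD); apply: filterS => x hx Dx.
have Ex : E x.
  by split => //=; have := hx Dx; rewrite fin_numE => /andP[_ h]; rewrite ltey.
by have /(congr1 (@^~ k)) /= -> := hE x Ex.
Qed.

(** The Riesz-Fischer theorem. A fast subsequence provides the limit; Fatou's lemma along it shows
    that the whole sequence is close to the limit. *)
Lemma sqint_complete (F : nat -> T -> C) :
  (forall k, sqint mu D (F k)) ->
  (forall e : R, 0 < e -> exists N, forall m n, (N <= m)%N -> (N <= n)%N ->
     (\int[mu]_(x in D) (cmod (F m x - F n x) ^+ 2)%:E <= e%:E)%E) ->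
  exists2 g, sqint mu D g & forall e : R, 0 < e -> exists N, forall n, (N <= n)%N ->
     (\int[mu]_(x in D) (cmod (F n x - g x) ^+ 2)%:E <= e%:E)%E.
Proof.
move=> hF hC.
have /choice[N hN] : forall k, exists N, forall m n, (N <= m)%N -> (N <= n)%N ->
     (\int[mu]_(x in D) (cmod (F m x - F n x) ^+ 2)%:E <= ((8^-1) ^+ k)%:E)%E.
  by move=> k; apply: hC; rewrite exprn_gt0 // invr_gt0.
(* The maximum makes [phi] monotone and at least [N k]; the summand [k] makes it tend to infinity,
   so that [phi (k + M) >= M] below. *)
pose phi k := (k + \max_(i < k.+1) N i)%N.
have phiN k : (N k <= phi k)%N.
  by rewrite (leq_trans _ (leq_addl _ _)) //; exact: (leq_bigmax (ord_max : 'I_k.+1)).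
have phiS k : (phi k <= phi k.+1)%N.
  by apply: leq_add => //; rewrite [leqRHS]big_ord_recr /= leq_maxl.
have [G' [g [mG' cg eG']]] := sqint_fast_cvg (fun k => hF (phi k))
  (fun k => hN k _ _ (leq_trans (phiN k) (phiS k)) (phiN k)).
have mg : cmeas D g by apply: cmeas_lim cg.
have hg : forall e : R, 0 < e -> exists N, forall n, (N <= n)%N ->
     (\int[mu]_(x in D) (cmod (F n x - g x) ^+ 2)%:E <= e%:E)%E.
  move=> e e0; have [M hM] := hC e e0; exists M => n Mn.
  apply: (fatou_sqint mD (F := fun k x => F n x - G' (k + M)%N x)) => [k|x Dx r /(cg x Dx)[K hK]|k].
  - by apply: cmeasB => //; exact: sqint_cmeas.
  - exists K => k Kk.
    have -> : F n x - G' (k + M)%N x - (F n x - g x) = - (G' (k + M)%N x - g x) by ring.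
    by rewrite cmodN; apply: hK; rewrite (leq_trans Kk) ?leq_addr.
  - rewrite eG'; last exact: sqint_cmeas.
    by apply: hM => //; rewrite /phi -addnA (leq_trans _ (leq_addl _ _)) // leq_addr.
exists g => //; have [n hn] := hg 1 ltr01.
have hFg : sqint mu D (fun x => F n x - g x).
  have mFg : cmeas D (fun x => F n x - g x) by apply: cmeasB => //; exact: sqint_cmeas.
  by case: (mFg) => m1 m2; split => //; apply: (le_lt_trans (hn n (leqnn n))); rewrite ltry.
have := sqintB mD (hF n) hFg; congr sqint; apply/funext => x.
by rewrite opprB addrC subrK.
Qed.

End SquareIntegrableComplete.

(** * Families with the same Gram matrix in two Hilbert spaces *)

(** Vectors are functions and no quotient is taken: [hip] is only positive semidefinite and limits
    are determined up to null distance. In this form square-integrable functions and Hardy functions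
    are instances without passing to classes. *)
Record hilbert (R : realType) (X : Type) := Hilbert {
  hcar : (X -> Cplx R) -> Prop;
  hip : (X -> Cplx R) -> (X -> Cplx R) -> Cplx R;
  hcar0 : hcar (fun=> 0);
  hcar_lin : forall a f g, hcar f -> hcar g -> hcar (fun x => a * f x + g x);
  hip_lin : forall a f g h, hcar f -> hcar g -> hcar h ->
    hip (fun x => a * f x + g x) h = a * hip f h + hip g h;
  hip_conj : forall f g, hcar f -> hcar g -> hip g f = (hip f g)^*;
  hip_ge0 : forall f, hcar f -> 0 <= complex.Re (hip f f);
  hcomplete : forall u : nat -> X -> Cplx R, (forall k, hcar (u k)) ->
    (forall e : R, 0 < e -> exists N, forall m n, (N <= m)%N -> (N <= n)%N ->
       complex.Re (hip (fun x => u m x - u n x) (fun x => u m x - u n x)) <= e) ->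
    exists2 l, hcar l & forall e : R, 0 < e -> exists N, forall n, (N <= n)%N ->
       complex.Re (hip (fun x => u n x - l x) (fun x => u n x - l x)) <= e
}.

Section HilbertTheory.
Context {R : realType} {X : Type}.
Variable H : hilbert R X.
Local Notation C := (Cplx R).
Local Notation Re := (@complex.Re R).
Local Notation P := (hcar H).
Local Notation ip := (hip H).
Implicit Types (f g h : X -> C).

Definition hnorm2 f : R := Re (ip f f).
Local Notation q := hnorm2.

Lemma hcarB f g : P f -> P g -> P (fun x => f x - g x).
Proof.
move=> hf hg; have := hcar_lin (-1) hg hf.
by congr hcar; apply/funext => x; rewrite mulN1r addrC.
Qed.

Lemma hipBl f g h : P f -> P g -> P h -> ip (fun x => f x - g x) h = ip f h - ip g h.
Proof.
move=> hf hg hh; have := hip_lin (-1) hg hf hh.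
rewrite mulN1r addrC => <-; congr (ip _ h).
by apply/funext => x; rewrite mulN1r addrC.
Qed.

Lemma hip0l h : P h -> ip (fun=> 0) h = 0.
Proof.
move=> hh; rewrite -[RHS](subrr (ip (fun=> 0) h)) -(hipBl (hcar0 H) (hcar0 H) hh).
by congr (ip _ h); apply/funext => x; rewrite subrr.
Qed.

Lemma hip_linr a f g h : P f -> P g -> P h ->
  ip h (fun x => a * f x + g x) = a^* * ip h f + ip h g.
Proof.
move=> hf hg hh; rewrite (hip_conj (hcar_lin a hf hg) hh) hip_lin // cconjD cconjM.
by rewrite -(hip_conj hf hh) -(hip_conj hg hh).
Qed.

Lemma hnorm2_lin a f g : P f -> P g ->
  q (fun x => a * f x + g x) = cmod a ^+ 2 * q f + q g + 2 * Re (a * ip f g).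
Proof.
move=> hf hg; rewrite /q hip_lin //; last exact: hcar_lin.
rewrite !hip_linr // (hip_conj hf hg) sqr_cmod !(cReD, cReM, cImM, cImD, cRe_conj, cIm_conj).
have : complex.Im (ip f f) = 0.
  have := congr1 (@complex.Im R) (hip_conj hf hf); rewrite cIm_conj; lra.
by move=> ->; ring.
Qed.

Lemma hnorm2B f g : P f -> P g ->
  q (fun x => f x - g x) = q f + q g - 2 * Re (ip f g).
Proof.
move=> hf hg.
have -> : (fun x => f x - g x) = (fun x => -1 * g x + f x).
  by apply/funext => x; rewrite mulN1r addrC.
rewrite hnorm2_lin // cmodN cmod1 expr1n mul1r mulN1r cReN (hip_conj hf hg) cRe_conj; ring.
Qed.

(** Discriminant argument: the value at [t = 1 / Q], or, when [Q = 0], the value -1 at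
    [t = (F + 1) / (2 h)]. With [h] a squared inner product the polynomial is a squared norm for a
    real parameter [t]. It yields Cauchy-Schwarz for [hip] and for [cdot], and the orthogonality in
    [hprojection]. *)
Lemma quadratic_bound (h Q F : R) : 0 <= h -> 0 <= Q -> 0 <= F ->
  (forall t, 0 <= t ^+ 2 * h * Q - 2 * t * h + F) -> h <= Q * F.
Proof.
move=> h0 Q0 F0 ht; have [->|hn] := eqVneq h 0; first exact: mulr_ge0.
have {h0 hn} hp : 0 < h by rewrite lt_def hn h0.
have [QE|Qn] := eqVneq Q 0.
  have := ht ((F + 1) / (2 * h)); rewrite QE.
  have -> : ((F + 1) / (2 * h)) ^+ 2 * h * 0 - 2 * ((F + 1) / (2 * h)) * h + F = -1.
    by field; rewrite gt_eqF.
  by rewrite ler0N1.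
have := ht Q^-1; have Qp : 0 < Q by rewrite lt_def Qn Q0.
have -> : Q^-1 ^+ 2 * h * Q - 2 * Q^-1 * h + F = (Q * F - h) / Q by field; rewrite gt_eqF.
by rewrite pmulr_lge0 ?invr_gt0 // subr_ge0.
Qed.

Lemma hnorm2_shift f g (t : R) : P f -> P g ->
  q (fun x => - (ofReal t * (ip f g)^*) * f x + g x) =
  t ^+ 2 * cmod (ip f g) ^+ 2 * q f - 2 * t * cmod (ip f g) ^+ 2 + q g.
Proof.
move=> hf hg; rewrite hnorm2_lin // cmodN cmodM cmod_conj cmod_ofReal exprMn real_normK ?num_real //.
rewrite mulNr cReN -(mulrA (ofReal t)) (mulrC (ip f g)^*) mul_conj -ofRealM Re_ofReal; ring.
Qed.

Lemma hcauchy_schwarz f g : P f -> P g -> cmod (ip f g) ^+ 2 <= q f * q g.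
Proof.
move=> hf hg; apply: quadratic_bound; rewrite ?sqr_ge0 ?hip_ge0 //.
by move=> t; rewrite -hnorm2_shift // hip_ge0 //; exact: hcar_lin.
Qed.

Definition hcvg (u : nat -> X -> C) l := forall e : R, 0 < e ->
  exists N, forall n, (N <= n)%N -> q (fun x => u n x - l x) <= e.

Lemma hip_lim u l g (z : C) : (forall k, P (u k)) -> P l -> P g -> hcvg u l ->
  (forall e : R, 0 < e -> exists N, forall n, (N <= n)%N -> cmod (ip (u n) g - z) <= e) ->
  ip l g = z.
Proof.
move=> hu hl hg cu cz; apply/eqP; rewrite -subr_eq0; apply/eqP.
apply: cmod_small_eq0 => e e0.
have e2 : 0 < e / 2 by rewrite divr_gt0.
have q1 : 0 < q g + 1 by rewrite ltr_wpDl // hip_ge0.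
have [N hN] := cz _ e2; have [M hM] := cu ((e / 2) ^+ 2 / (q g + 1)) ltac:(by rewrite divr_gt0 // exprn_gt0).
have h1 := hN _ (leq_maxl N M); have h2 := hM _ (leq_maxr N M).
set n := maxn N M in h1 h2 *.
apply: (le_trans (ler_cmod_dist _ (ip (u n) g) _)); rewrite [leRHS]splitr lerD //.
rewrite cmodBC -hipBl // -(ler_pXn2r (n := 2)) ?nnegrE ?cmod_ge0 ?(ltW e2) //.
apply: (le_trans (hcauchy_schwarz (hcarB (hu n) hl) hg)).
apply: (le_trans (ler_wpM2r (hip_ge0 hg) h2)).
by rewrite -mulrA ler_piMr ?exprn_ge0 ?(ltW e2) // mulrC ler_pdivrMr // mul1r lerDl.
Qed.

Lemma hip_lim_cst u l g (z : C) : (forall k, P (u k)) -> P l -> P g -> hcvg u l ->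
  (forall n, ip (u n) g = z) -> ip l g = z.
Proof.
move=> hu hl hg cu cz; apply: (hip_lim hu hl hg cu) => e e0; exists 0%N => n _.
by rewrite cz subrr cmod0 ltW.
Qed.

(** Projection on the closure of the subspace [A]: a minimizing sequence is Cauchy by the
    parallelogram law. The sequence is returned together with its limit because its terms lie in [A]
    itself, and [gram_transfer] copies them into the other space. *)
Lemma hprojection (A : (X -> C) -> Prop) f :
  (forall g, A g -> P g) -> A (fun=> 0) ->
  (forall a g h, A g -> A h -> A (fun x => a * g x + h x)) -> P f ->
  exists u (a : nat -> X -> C), [/\ P u, forall n, A (a n), hcvg a u
    & forall g, A g -> ip (fun x => f x - u x) g = 0].
Proof.
move=> AP A0 Alin hf.
pose D := [set q (fun x => f x - g x) | g in A].
have D0 : has_lbound D.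
  by exists 0 => _ [g Ag <-]; apply: hip_ge0; apply: hcarB => //; exact: AP.
have Dinf : has_inf D by split => //; exists (q (fun x => f x - 0)); exists (fun=> 0).
pose d := inf D.
have dle g : A g -> d <= q (fun x => f x - g x).
  by move=> Ag; apply: ge_inf => //; exists g.
have /choice[a ha] : forall n : nat, exists g, A g /\ q (fun x => f x - g x) <= d + n.+1%:R^-1.
  move=> n; have n0 : 0 < (n.+1%:R^-1 : R) by rewrite invr_gt0.
  have [_ [g Ag <-] hg] := inf_adherent n0 Dinf.
  by exists g; split => //; exact: ltW.
have Aa n : A (a n) by case: (ha n).
have Pa n : P (a n) by exact/AP.
have da n : q (fun x => f x - a n x) <= d + n.+1%:R^-1 by case: (ha n).
have small (e : R) : 0 < e -> exists N, forall n, (N <= n)%N -> (n.+1%:R^-1 : R) <= e.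
  move=> e0; have [N hN] := ltr_add_invr (y := 0) (x := e) e0; rewrite add0r in hN.
  exists N => n Nn; rewrite (le_trans _ (ltW hN)) // lef_pV2 ?posrE // ler_nat.
  by rewrite ltnS.
have [u Pu cu] : exists2 l, P l & hcvg a l.
  apply: hcomplete => // e e0.
  (* The parallelogram law bounds the squared distance by [2 / (m + 1) + 2 / (n + 1)]. *)
  have [N hN] := small (e / 4) ltac:(by rewrite divr_gt0).
  exists N => m n Nm Nn.
  set x := fun x => f x - a m x; set y := fun x => f x - a n x.
  have Px : P x by exact: hcarB.
  have Py : P y by exact: hcarB.
  have -> : (fun t => a m t - a n t) = (fun t => y t - x t).
    by apply/funext => t; rewrite /x /y; ring.
  rewrite -/(q _) hnorm2B // (hip_conj Px Py) cRe_conj.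
  have hm := da m; have hn := da n; rewrite -/x -/y in hm hn.
  (* The midpoint lies in [A], so its squared distance to [f] is at least [d]. *)
  pose mid := fun t => 2^-1 * a m t + (2^-1 * a n t + 0).
  have Amid : A mid by apply: (Alin _ _ _ (Aa m)); apply: (Alin _ _ _ (Aa n)).
  have := dle _ Amid.
  have -> : (fun t => f t - mid t) = (fun t => 2^-1 * x t + (2^-1 * y t + 0)).
    by apply/funext => t; rewrite /x /y /mid; field.
  have Py' : P (fun t => 2^-1 * y t + 0) by apply: hcar_lin => //; exact: hcar0.
  rewrite hnorm2_lin // hnorm2_lin //; last exact: hcar0.
  rewrite hip_linr //; last exact: hcar0.
  have z0 g : P g -> ip g (fun=> 0) = 0.
    by move=> Pg; rewrite (hip_conj (hcar0 H) Pg) hip0l // cconj0.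
  rewrite !z0 // mulr0 !addr0 cRe0 mulr0 addr0 /q hip0l ?addr0; last exact: hcar0.
  have half : (2^-1 : C) = ofReal 2^-1 by rewrite ofRealV ofReal_nat.
  rewrite half conj_ofReal cmod_ofReal !cReZ ger0_norm ?invr_ge0 //.
  have := hN _ Nm; have := hN _ Nn; rewrite /q in hm hn.
  set i := (m.+1%:R^-1 : R) in hm *; set j := (n.+1%:R^-1 : R) in hn *.
  move: (Re (ip x x)) (Re (ip y y)) (Re (ip x y)) hm hn => a1 a2 a3.
  lra.
exists u, a; split => // g Ag.
have Pg := AP _ Ag.
apply/eqP; rewrite hipBl // subr_eq0; apply/eqP/esym.
apply: (hip_lim Pa Pu Pg cu) => e e0.
have q1 : 0 < q g + 1 by rewrite ltr_wpDl // hip_ge0.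
have [N hN] := small (e ^+ 2 / (q g + 1)) ltac:(by rewrite divr_gt0 // exprn_gt0).
exists N => n Nn; rewrite cmodBC -hipBl //.
set y := fun x => f x - a n x; have Py : P y by exact: hcarB.
rewrite -(ler_pXn2r (n := 2)) ?nnegrE ?cmod_ge0 ?(ltW e0) //.
(* Every [y + c g] is [f] minus an element of [A], so its squared norm stays above [d]; the
   discriminant in the real parameter of [c] gives the bound, and [q y - d] tends to 0. *)
have : cmod (ip y g) ^+ 2 <= q g * (q y - d).
  apply: quadratic_bound; rewrite ?sqr_ge0 ?hip_ge0 ?subr_ge0 ?dle //.
  move=> t; rewrite -cmod_conj -(hip_conj Py Pg) addrA -hnorm2_shift // subr_ge0.
  set s := - _; have := Alin (- s) _ _ Ag (Aa n); move/dle.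
  by congr (_ <= q _); apply/funext => x; rewrite /y; ring.
move=> /le_trans; apply; have := da n; rewrite -/y -lerBlDl => h.
apply: (le_trans (ler_wpM2l (hip_ge0 Pg) (le_trans h (hN _ Nn)))).
by rewrite mulrCA ler_piMr ?exprn_ge0 ?(ltW e0) // ler_pdivrMr // mul1r lerDl.
Qed.

End HilbertTheory.

(** * Transfer between closed spans *)

Section Transfer.
Context {R : realType} {X Y : Type} {W : Type}.
Local Notation C := (Cplx R).
Local Notation Re := (@complex.Re R).

Definition lincomb {Z : Type} (k : W -> Z -> C) (s : seq (C * W)) : Z -> C :=
  fun x => \sum_(p <- s) p.1 * k p.2 x.

Section Lincomb.
Context {Z : Type}.
Variables (H : hilbert R Z) (k : W -> Z -> C).
Hypothesis kP : forall w, hcar H (k w).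

Lemma lincomb_nil : lincomb k [::] = (fun=> 0).
Proof. by apply/funext => x; rewrite /lincomb big_nil. Qed.

Lemma lincomb_cons p s : lincomb k (p :: s) = (fun x => p.1 * k p.2 x + lincomb k s x).
Proof. by apply/funext => x; rewrite /lincomb big_cons. Qed.

Lemma lincomb_cat (a : C) s t :
  (fun x => a * lincomb k s x + lincomb k t x) =
  lincomb k ([seq (a * p.1, p.2) | p <- s] ++ t).
Proof.
apply/funext => x; rewrite /lincomb big_cat big_map mulr_sumr /=.
by congr (_ + _); apply: eq_bigr => p _; rewrite mulrA.
Qed.

Lemma hcar_lincomb s : hcar H (lincomb k s).
Proof.
elim: s => [|p s IH]; first by rewrite lincomb_nil; exact: hcar0.
by rewrite lincomb_cons; exact: hcar_lin.
Qed.

Lemma hip_lincombl s g : hcar H g ->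
  hip H (lincomb k s) g = \sum_(p <- s) p.1 * hip H (k p.2) g.
Proof.
move=> hg; elim: s => [|p s IH]; first by rewrite lincomb_nil big_nil hip0l.
by rewrite lincomb_cons big_cons hip_lin ?IH //; exact: hcar_lincomb.
Qed.

End Lincomb.

Variables (H1 : hilbert R X) (H2 : hilbert R Y).
Variables (k1 : W -> X -> C) (k2 : W -> Y -> C).
Hypothesis k1P : forall w, hcar H1 (k1 w).
Hypothesis k2P : forall w, hcar H2 (k2 w).
Hypothesis gram : forall v w, hip H1 (k1 v) (k1 w) = hip H2 (k2 v) (k2 w).

Lemma gram_lincomb s t : hip H1 (lincomb k1 s) (lincomb k1 t) =
  hip H2 (lincomb k2 s) (lincomb k2 t).
Proof.
rewrite !hip_lincombl //; try exact: hcar_lincomb.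
apply: eq_bigr => p _; congr (_ * _).
rewrite (hip_conj (hcar_lincomb k1P t) (k1P p.2)) (hip_conj (hcar_lincomb k2P t) (k2P p.2)).
by rewrite !hip_lincombl //; congr (_^*); apply: eq_bigr => r _; rewrite gram.
Qed.

(* The isometry between the closed spans that matches the two families. *)
Lemma gram_transfer f : hcar H1 f -> exists f1 u,
  [/\ hcar H1 f1 /\ hcar H2 u,
      forall w, hip H1 f1 (k1 w) = hip H1 f (k1 w),
      forall w, hip H2 u (k2 w) = hip H1 f (k1 w),
      hnorm2 H1 f1 = hnorm2 H2 u
    & (forall h, hcar H1 h -> (forall w, hip H1 h (k1 w) = 0) -> hip H1 f1 h = 0) /\
      (forall h, hcar H2 h -> (forall w, hip H2 h (k2 w) = 0) -> hip H2 u h = 0)].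
Proof.
move=> hf; pose A g := exists s, g = lincomb k1 s.
have AP g : A g -> hcar H1 g by move=> [s ->]; exact: hcar_lincomb.
have A0 : A (fun=> 0) by exists [::]; rewrite lincomb_nil.
have Alin a g h : A g -> A h -> A (fun x => a * g x + h x).
  by move=> [s ->] [t ->]; rewrite lincomb_cat; eexists.
have [f1 [a [Pf1 Aa cf1 of1]]] := hprojection AP A0 Alin hf.
have [s hs] := choice Aa; have {hs} {}cf1 : hcvg H1 (fun n => lincomb k1 (s n)) f1.
  by move=> e /cf1[N hN]; exists N => n /hN; rewrite hs.
have P1 n : hcar H1 (lincomb k1 (s n)) by exact: hcar_lincomb.
have P2 n : hcar H2 (lincomb k2 (s n)) by exact: hcar_lincomb.
(* Equal Gram matrices give equal distances, so the copied combinations form a Cauchy sequence in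
   the second space. *)
have dist m n : hnorm2 H2 (fun x => lincomb k2 (s m) x - lincomb k2 (s n) x) =
    hnorm2 H1 (fun x => lincomb k1 (s m) x - lincomb k1 (s n) x).
  by rewrite !hnorm2B // /hnorm2 !gram_lincomb.
have [u Pu cu] : exists2 l, hcar H2 l & hcvg H2 (fun n => lincomb k2 (s n)) l.
  apply: hcomplete => // e e0.
  have [N hN] := cf1 (e / 4) ltac:(by rewrite divr_gt0).
  exists N => m n /hN hm /hN hn; rewrite -/(hnorm2 _ _) dist.
  set x := fun x => _ - _ in hm; set y := fun x => _ - _ in hn.
  have -> : (fun t => lincomb k1 (s m) t - lincomb k1 (s n) t) = (fun t => x t - y t).
    by apply/funext => t; rewrite /x /y; ring.
  have Px : hcar H1 x by exact: hcarB.
  have Py : hcar H1 y by exact: hcarB.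
  have := hip_ge0 (hcar_lin 1 Px Py); rewrite -/(hnorm2 _ _) (hnorm2_lin 1 Px Py) (hnorm2B Px Py).
  by rewrite mul1r cmod1 expr1n mul1r; lra.
have of1' w : hip H1 f1 (k1 w) = hip H1 f (k1 w).
  have := of1 (k1 w) ltac:(by exists [:: (1, w)]; rewrite lincomb_cons lincomb_nil; apply/funext => x; rewrite mul1r addr0).
  by rewrite hipBl // => /eqP; rewrite subr_eq0 => /eqP.
have lim1 g : hcar H1 g -> forall e : R, 0 < e -> exists N, forall n, (N <= n)%N ->
    cmod (hip H1 (lincomb k1 (s n)) g - hip H1 f1 g) <= e.
  move=> Pg e e0; have q1 : 0 < hnorm2 H1 g + 1 by rewrite ltr_wpDl // hip_ge0.
  have [N hN] := cf1 (e ^+ 2 / (hnorm2 H1 g + 1)) ltac:(by rewrite divr_gt0 // exprn_gt0).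
  exists N => n /hN h; rewrite -hipBl // -(ler_pXn2r (n := 2)) ?nnegrE ?cmod_ge0 ?(ltW e0) //.
  apply: (le_trans (hcauchy_schwarz (hcarB (P1 n) Pf1) Pg)).
  apply: (le_trans (ler_wpM2r (hip_ge0 Pg) h)).
  by rewrite -mulrA ler_piMr ?exprn_ge0 ?(ltW e0) // mulrC ler_pdivrMr // mul1r lerDl.
have span1 h : hcar H1 h -> (forall w, hip H1 h (k1 w) = 0) -> hip H1 f1 h = 0.
  move=> hh h0; apply: (hip_lim_cst P1 Pf1 hh cf1) => n.
  by rewrite hip_lincombl // big1 // => p _; rewrite (hip_conj hh) // h0 cconj0 mulr0.
exists f1, u; split => //.
- move=> w; rewrite -of1'.
  apply: (hip_lim P2 Pu (k2P w) cu) => e e0; have [N hN] := lim1 _ (k1P w) e e0.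
  exists N => n /hN; congr (cmod (_ - _) <= _).
  by rewrite !hip_lincombl //; apply: eq_bigr => p _; rewrite gram.
(* The limit of [<sum_m, sum_n>] is taken in one argument at a time; [key] is the limit in [m] for
   fixed [n]. *)
- have key n : hip H1 f1 (lincomb k1 (s n)) = hip H2 u (lincomb k2 (s n)).
    apply/esym; apply: (hip_lim P2 Pu (P2 n) cu) => e e0.
    have [N hN] := lim1 _ (P1 n) e e0; exists N => m /hN.
    by rewrite gram_lincomb.
  rewrite /hnorm2; suff -> : hip H2 u u = hip H1 f1 f1 by [].
  apply: (hip_lim P2 Pu Pu cu) => e e0.
  have [N hN] := lim1 _ Pf1 e e0; exists N => m /hN.
  by rewrite (hip_conj Pf1 (P1 m)) (hip_conj Pu (P2 m)) key.
- split => // h hh h0; apply: (hip_lim_cst P2 Pu hh cu) => n.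
  by rewrite hip_lincombl // big1 // => p _; rewrite (hip_conj hh) // h0 cconj0 mulr0.
Qed.

End Transfer.

(** * Goursat's theorem on rectangles *)

Lemma geometric_small (R : realType) (c q e : R) : `|q| < 1 -> 0 < e ->
  exists N, forall n, (N <= n)%N -> `|c * q ^+ n| < e.
Proof.
move=> q1 e0; have /cvgrPdist_lt/(_ e e0)[N _ hN] := @cvg_geometric R c q q1.
by exists N => n Nn; have := hN n Nn; rewrite /= sub0r normrN.
Qed.

Section LineIntegral.
Context {R : realType}.
Local Notation C := (Cplx R).
Local Notation Re := (@complex.Re R).
Local Notation Im := (@complex.Im R).
Implicit Types (f g : R -> C) (a b : R).

Definition ccont f (x : R) := forall e : R, 0 < e ->
  exists2 dl : R, 0 < dl & forall s, `|s| < dl -> cmod (f (x + s) - f x) <= e.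

Definition lint f a b : C := cint lebesgue_measure `[a, b]%classic (f : measurableTypeR R -> C).

Definition lintegrable f a b :=
  cintegrable lebesgue_measure `[a, b]%classic (f : measurableTypeR R -> C).

Let mI a b : measurable (`[a, b]%classic : set (measurableTypeR R)).
Proof. exact: measurable_itv. Qed.

Lemma lebesgue_segment a b : a <= b ->
  lebesgue_measure (`[a, b]%classic : set (measurableTypeR R)) = (b - a)%:E.
Proof.
move=> ab; rewrite lebesgue_measure_itv /= lte_fin.
have [//|] := ltP a b; move=> ba; have -> : a = b by apply/le_anti/andP.
by rewrite subrr.
Qed.

Lemma near_dist (x dl : R) : 0 < dl -> \forall y \near x, `|y - x| < dl.
Proof. by move=> /(near_ball x); apply: filterS => y; rewrite distrC. Qed.

Lemma ccont_Re f x : ccont f x -> {for x, continuous (fun t => Re (f t))}.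
Proof.
move=> h; apply/cvgrPdist_le => e /h[dl d0 hd].
apply: filterS (near_dist x d0) => t /hd; rewrite [x + _]addrC subrK => ht.
by rewrite distrC -cReB (le_trans (ler_Re_cmod _)).
Qed.

Lemma ccont_Im f x : ccont f x -> {for x, continuous (fun t => Im (f t))}.
Proof.
move=> h; apply/cvgrPdist_le => e /h[dl d0 hd].
apply: filterS (near_dist x d0) => t /hd; rewrite [x + _]addrC subrK => ht.
by rewrite distrC -cImB (le_trans (ler_Im_cmod _)).
Qed.

Lemma ccont_lintegrable f a b : (forall x, a <= x <= b -> ccont f x) -> lintegrable f a b.
Proof.
move=> h; split; apply: continuous_compact_integrable; rewrite ?segment_compact //;
  try exact: segment_compact; apply: continuous_in_subspaceT => x /set_mem /=;
  rewrite in_itv /= => /h; [exact: ccont_Re|exact: ccont_Im].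
Qed.

Lemma lintB f g a b : lintegrable f a b -> lintegrable g a b ->
  lint (fun x => f x - g x) a b = lint f a b - lint g a b.
Proof. exact: cintB. Qed.

Lemma lintZ (c : C) f a b : lintegrable f a b ->
  lint (fun x => c * f x) a b = c * lint f a b.
Proof. exact: cintZ. Qed.

Lemma lint_sum (I : Type) (s : seq I) (F : I -> R -> C) a b :
  (forall i, lintegrable (F i) a b) ->
  lint (fun x => \sum_(i <- s) F i x) a b = \sum_(i <- s) lint (F i) a b.
Proof. exact: cint_sum. Qed.

Lemma lintegrableB f g a b : lintegrable f a b -> lintegrable g a b ->
  lintegrable (fun x => f x - g x) a b.
Proof. exact: cintegrableB. Qed.

Lemma lintegrableZ (c : C) f a b : lintegrable f a b -> lintegrable (fun x => c * f x) a b.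
Proof. exact: cintegrableZ. Qed.

Lemma lintegrable_sum (I : Type) (s : seq I) (F : I -> R -> C) a b :
  (forall i, lintegrable (F i) a b) -> lintegrable (fun x => \sum_(i <- s) F i x) a b.
Proof. exact: cintegrable_sum. Qed.

Lemma lint_cst (c : C) a b : a <= b -> lint (fun=> c) a b = c * ofReal (b - a).
Proof.
move=> ab; apply: cplxP; rewrite ?cReM ?cImM /= ?mulr0 ?subr0 ?add0r.
  by rewrite (Rintegral_cst _ (mI a b)) /= lebesgue_segment.
by rewrite (Rintegral_cst _ (mI a b)) /= lebesgue_segment.
Qed.

Lemma lint_bound f a b (M : R) : a <= b -> lintegrable f a b ->
  (forall x, a <= x <= b -> cmod (f x) <= M) -> cmod (lint f a b) <= M * (b - a).
Proof.
move=> ab hf hM.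
have -> : b - a = fine (lebesgue_measure (`[a, b]%classic : set (measurableTypeR R))).
  by apply/esym; exact: (congr1 fine (lebesgue_segment ab)).
apply: cmod_cint_bounded => //.
- by apply: (@eq_ind _ _ (fun u : \bar R => (u < +oo)%E) (ltry (b - a)) _ (esym (lebesgue_segment ab))).
- exact: cintegrable_meas hf.
Qed.

Lemma eq_lint f g a b : (forall x, a <= x <= b -> f x = g x) -> lint f a b = lint g a b.
Proof. by move=> h; apply: eq_cint => x /=; rewrite in_itv /=; exact: h. Qed.

Lemma lint_split f a m b : a <= m -> m <= b -> lintegrable f a b ->
  lint f a b = lint f a m + lint f m b.
Proof.
move=> am mb [f1 f2].
have E (h : R -> R) :
    lebesgue_measure.-integrable (`[a, b]%classic : set (measurableTypeR R)) (EFin \o h) ->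
    \int[lebesgue_measure]_(x in `[a, b]) h x =
    \int[lebesgue_measure]_(x in `[a, m]) h x + \int[lebesgue_measure]_(x in `[m, b]) h x.
  move=> hi; have := @Rintegral_itvB R h (BLeft a) (BRight b) m hi.
  rewrite !bnd_simp => /(_ am mb) /eqP; rewrite subr_eq addrC => /eqP ->; congr (_ + _).
  apply: Rintegral_itv_obnd_cbnd; apply: integrableS hi => //.
  by move=> x /=; rewrite !in_itv /= => /andP[mx ->]; rewrite (le_trans am) ?ltW.
by apply: cplxP; rewrite ?cReD ?cImD /=; exact: E.
Qed.

End LineIntegral.

Section Goursat.
Context {R : realType}.
Local Notation C := (Cplx R).
Implicit Types (G : R -> R -> C).

(** Complex differentiability in real coordinates: the differential is multiplication by one complex
    number [d]. *)
Definition rdiff G (x y : R) := exists d : C, forall e : R, 0 < e ->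
  exists2 dl : R, 0 < dl & forall s t, `|s| < dl -> `|t| < dl ->
    cmod (G (x + s) (y + t) - G x y - d * Complex s t) <= e * (`|s| + `|t|).

Lemma rdiff_cont G x y : rdiff G x y -> forall e : R, 0 < e ->
  exists2 dl : R, 0 < dl & forall s t, `|s| < dl -> `|t| < dl ->
    cmod (G (x + s) (y + t) - G x y) <= e.
Proof.
move=> [d hd] e e0; have [dl d0 h] := hd 1 ltr01.
have c0 : 0 < 2 * (1 + cmod d) by rewrite mulr_gt0 // ltr_wpDr ?cmod_ge0.
exists (Num.min dl (e / (2 * (1 + cmod d)))) => [|s t].
  by rewrite lt_min d0 divr_gt0.
rewrite !lt_min => /andP[s1 s2] /andP[t1 t2]; have := h s t s1 t1.
set z := G _ _ - _; move=> hz.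
have -> : z = (z - d * Complex s t) + d * Complex s t by ring.
apply: (le_trans (ler_cmodD _ _)); rewrite cmodM.
have hc := cmod_le_ReIm (Complex s t : C); rewrite /= in hc.
have hc2 : cmod d * cmod (Complex s t : C) <= cmod d * (`|s| + `|t|).
  by rewrite ler_wpM2l ?cmod_ge0.
apply: (le_trans (lerD hz hc2)); rewrite -mulrDl.
have : `|s| + `|t| <= 2 * (e / (2 * (1 + cmod d))) by lra.
move=> /(ler_wpM2l (ltW (ltr_wpDr (cmod_ge0 d) ltr01))) /le_trans; apply.
rewrite le_eqVlt; apply/orP; left; apply/eqP; field.
by rewrite gt_eqF // ltr_wpDr ?cmod_ge0.
Qed.

(** The integral of [G dz] along the counterclockwise boundary of [[a, b] x [c, d]], opposite sides
    being taken together. *)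
Definition rect_int G (a b c d : R) : C :=
  lint (fun x => G x c - G x d) a b + Complex 0 1 * lint (fun y => G b y - G a y) c d.

Section Bisection.
Variables (G : R -> R -> C) (a0 c0 w h : R).
Hypothesis w0 : 0 <= w.
Hypothesis h0 : 0 <= h.
Hypothesis dG : forall x y, a0 <= x <= a0 + w -> c0 <= y <= c0 + h -> rdiff G x y.

Let contx x y : a0 <= x <= a0 + w -> c0 <= y <= c0 + h -> ccont (G ^~ y) x.
Proof.
move=> hx hy e e0; have [dl d0 hd] := rdiff_cont (dG hx hy) e0.
by exists dl => // s hs; have := hd s 0 hs; rewrite normr0 addr0; apply.
Qed.

Let conty x y : a0 <= x <= a0 + w -> c0 <= y <= c0 + h -> ccont (G x) y.
Proof.
move=> hx hy e e0; have [dl d0 hd] := rdiff_cont (dG hx hy) e0.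
by exists dl => // s hs; have := hd 0 s; rewrite normr0 addr0; apply.
Qed.

Lemma rect_lintx a b y : a0 <= a -> b <= a0 + w -> c0 <= y <= c0 + h ->
  lintegrable (G ^~ y) a b.
Proof.
move=> ha hb hy; apply: ccont_lintegrable => x /andP[ax xb]; apply: contx => //.
by rewrite (le_trans ha ax) (le_trans xb hb).
Qed.

Lemma rect_linty c d x : c0 <= c -> d <= c0 + h -> a0 <= x <= a0 + w ->
  lintegrable (G x) c d.
Proof.
move=> hc hd hx; apply: ccont_lintegrable => y /andP[cy yd]; apply: conty => //.
by rewrite (le_trans hc cy) (le_trans yd hd).
Qed.

Lemma rect_int_split4 a b c d m k : a0 <= a -> a <= m -> m <= b -> b <= a0 + w ->
  c0 <= c -> c <= k -> k <= d -> d <= c0 + h ->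
  rect_int G a b c d = rect_int G a m c k + rect_int G m b c k +
                       rect_int G a m k d + rect_int G m b k d.
Proof.
move=> a0a am mb bw c0c ck kd dh.
have X u v y : a0 <= u -> v <= a0 + w -> c <= y <= d -> lintegrable (G ^~ y) u v.
  by move=> hu hv /andP[y1 y2]; apply: rect_lintx => //; rewrite (le_trans c0c y1) (le_trans y2 dh).
have Y u v x : c0 <= u -> v <= c0 + h -> a <= x <= b -> lintegrable (G x) u v.
  by move=> hu hv /andP[x1 x2]; apply: rect_linty => //; rewrite (le_trans a0a x1) (le_trans x2 bw).
have a0m := le_trans a0a am; have mw := le_trans mb bw.
have c0k := le_trans c0c ck; have kh := le_trans kd dh.
have ab := le_trans am mb; have cd := le_trans ck kd.
rewrite /rect_int !lintB; try (by apply: X => //; rewrite ?lexx ?ck ?kd ?cd);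
  try (by apply: Y => //; rewrite ?lexx ?am ?mb ?ab).
rewrite (lint_split (f := G ^~ c) am mb) ?(lint_split (f := G ^~ d) am mb);
  try (by apply: X => //; rewrite ?lexx ?ck ?kd ?cd).
rewrite (lint_split (f := G b) ck kd) ?(lint_split (f := G a) ck kd);
  try (by apply: Y => //; rewrite ?lexx ?am ?mb ?ab).
ring.
Qed.

(** The affine approximation of [G] at [(p, q)] has boundary integral 0, so only the remainder
    counts; on the whole rectangle it is at most [e / 2] times half the perimeter. *)
Lemma rect_int_local p q : a0 <= p <= a0 + w -> c0 <= q <= c0 + h ->
  forall e : R, 0 < e -> exists2 dl : R, 0 < dl &
  forall a b c d, a0 <= a -> a <= p -> p <= b -> b <= a0 + w ->
    c0 <= c -> c <= q -> q <= d -> d <= c0 + h ->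
    b - a < dl -> d - c < dl ->
    cmod (rect_int G a b c d) <= e * (b - a + (d - c)) ^+ 2.
Proof.
move=> hp hq e e0; have [D hD] := dG hp hq.
have [dl d0 hd] := hD (e / 2) ltac:(by rewrite divr_gt0).
exists dl => // a b c d a0a ap pb bw c0c cq qd dh bal dcl.
have ab := le_trans ap pb; have cd := le_trans cq qd.
pose A x y : C := G p q + D * Complex (x - p) (y - q).
have est x y : a <= x <= b -> c <= y <= d ->
    cmod (G x y - A x y) <= e / 2 * (b - a + (d - c)).
  move=> /andP[ax xb] /andP[cy yd].
  have hx : `|x - p| <= b - a by rewrite ler_norml; lra.
  have hy : `|y - q| <= d - c by rewrite ler_norml; lra.
  have := hd (x - p) (y - q) (le_lt_trans hx bal) (le_lt_trans hy dcl).
  rewrite !subrKC /A opprD addrA => /le_trans; apply.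
  by rewrite ler_pM2l ?divr_gt0 // lerD.
have X y : c <= y <= d -> lintegrable (G ^~ y) a b.
  by move=> /andP[y1 y2]; apply: rect_lintx => //; rewrite (le_trans c0c y1) (le_trans y2 dh).
have Y x : a <= x <= b -> lintegrable (G x) c d.
  by move=> /andP[x1 x2]; apply: rect_linty => //; rewrite (le_trans a0a x1) (le_trans x2 bw).
have cst (z : C) u v : lintegrable (fun=> z) u v.
  by apply: ccont_lintegrable => x _ r r0; exists 1 => // s _; rewrite subrr cmod0 ltW.
have iX : lintegrable (fun x => G x c - G x d) a b.
  by apply: cintegrableB; [exact: measurable_itv|apply: X|apply: X]; rewrite ?lexx ?cd.
have iY : lintegrable (fun y => G b y - G a y) c d.
  by apply: cintegrableB; [exact: measurable_itv|apply: Y|apply: Y]; rewrite ?lexx ?ab.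
pose zx : C := D * Complex 0 (c - d).
pose zy : C := D * Complex (b - a) 0.
have -> : rect_int G a b c d = lint (fun x => G x c - G x d - zx) a b +
    Complex 0 1 * lint (fun y => G b y - G a y - zy) c d.
  rewrite /rect_int (lintB iX (cst _ _ _)) (lintB iY (cst _ _ _)) !lint_cst // /zx /zy.
  suff E : Complex 0 (c - d) * ofReal (b - a) + Complex 0 1 * (Complex (b - a) 0 * ofReal (d - c)) = 0 :> C.
    rewrite mulrBr; set I1 := lint _ _ _; set I2 := lint _ _ _.
    have -> : I1 - D * Complex 0 (c - d) * ofReal (b - a) +
      (Complex 0 1 * I2 - Complex 0 1 * (D * Complex (b - a) 0 * ofReal (d - c))) =
      I1 + Complex 0 1 * I2 - D * (Complex 0 (c - d) * ofReal (b - a) + Complex 0 1 * (Complex (b - a) 0 * ofReal (d - c))) by ring.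
    by rewrite E mulr0 subr0.
  by apply: cplxP; rewrite !(cReD, cImD, cReM, cImM) /=; ring.
have i1 : cmod (Complex 0 1 : C) = 1 by rewrite cmodE /= expr0n add0r expr1n sqrtr1.
apply: (le_trans (ler_cmodD _ _)); rewrite cmodM i1 mul1r.
set E := e / 2 * (b - a + (d - c)) in est.
have b1 : cmod (lint (fun x => G x c - G x d - zx) a b) <= (E + E) * (b - a).
  apply: lint_bound => //; first by apply: cintegrableB; [exact: measurable_itv|exact: iX|exact: cst].
  move=> x hx; have -> : G x c - G x d - zx = (G x c - A x c) - (G x d - A x d).
    have -> : zx = A x c - A x d.
      rewrite /A /zx opprD addrACA subrr add0r -mulrBr; congr (D * _).
      by apply: cplxP; rewrite ?cReB ?cImB /=; ring.
    ring.
  by apply: (le_trans (ler_cmodB _ _)); apply: lerD; apply: est => //; rewrite ?lexx ?cd.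
have b2 : cmod (lint (fun y => G b y - G a y - zy) c d) <= (E + E) * (d - c).
  apply: lint_bound => //; first by apply: cintegrableB; [exact: measurable_itv|exact: iY|exact: cst].
  move=> y hy; have -> : G b y - G a y - zy = (G b y - A b y) - (G a y - A a y).
    have -> : zy = A b y - A a y.
      rewrite /A /zy opprD addrACA subrr add0r -mulrBr; congr (D * _).
      by apply: cplxP; rewrite ?cReB ?cImB /=; ring.
    ring.
  by apply: (le_trans (ler_cmodB _ _)); apply: lerD; apply: est => //; rewrite ?lexx ?ab.
apply: (le_trans (lerD b1 b2)); rewrite /E le_eqVlt; by apply/orP; left; apply/eqP; field.
Qed.

Let good k (z : R * R) := [/\ a0 <= z.1, z.1 + w / 2 ^+ k <= a0 + w, c0 <= z.2,
  z.2 + h / 2 ^+ k <= c0 + h & cmod (rect_int G a0 (a0 + w) c0 (c0 + h)) / 4 ^+ k <=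
  cmod (rect_int G z.1 (z.1 + w / 2 ^+ k) z.2 (z.2 + h / 2 ^+ k))].

(** The four quarters add up to the rectangle, so at least one of them keeps a quarter of the
    modulus. *)
Let step k z : good k z -> exists z', [/\ good k.+1 z', z.1 <= z'.1,
  z'.1 + w / 2 ^+ k.+1 <= z.1 + w / 2 ^+ k, z.2 <= z'.2 &
  z'.2 + h / 2 ^+ k.+1 <= z.2 + h / 2 ^+ k].
Proof.
case: z => a c [/= a1 a2 c1 c2 hF].
have half (x : R) : x / 2 ^+ k = x / 2 ^+ k.+1 + x / 2 ^+ k.+1.
  by rewrite exprS; field; rewrite expf_neq0.
have wk : 0 <= w / 2 ^+ k.+1 by rewrite divr_ge0 ?exprn_ge0.
have hk : 0 <= h / 2 ^+ k.+1 by rewrite divr_ge0 ?exprn_ge0.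
rewrite !half !addrA in a2 c2 hF.
have := @rect_int_split4 a (a + w / 2 ^+ k.+1 + w / 2 ^+ k.+1) c
  (c + h / 2 ^+ k.+1 + h / 2 ^+ k.+1) (a + w / 2 ^+ k.+1) (c + h / 2 ^+ k.+1) a1.
move=> /(_ ltac:(by rewrite lerDl) ltac:(by rewrite lerDl) a2 c1 ltac:(by rewrite lerDl) ltac:(by rewrite lerDl) c2) E.
rewrite E in hF; move: hF => {E}.
set P1 := rect_int _ _ _ _ _; set p1 := rect_int G a _ c _; set p2 := rect_int G _ _ c _.
set p3 := rect_int G a _ _ _; set p4 := rect_int G _ _ _ _ => hF.
have Pk : cmod P1 / 4 ^+ k = 4 * (cmod P1 / 4 ^+ k.+1).
  by rewrite exprS; field; rewrite expf_neq0.
have := le_trans hF (le_trans (ler_cmodD _ _) (lerD (le_trans (ler_cmodD _ _) (lerD (ler_cmodD _ _) (lexx _))) (lexx _))).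
rewrite Pk; set t := _ / _ => ht.
have [h1|h1] := leP t (cmod p1).
  exists (a, c); split => //=; rewrite ?half ?addrA ?lerDl //.
  by split => //=; rewrite ?(le_trans _ a2) ?(le_trans _ c2) ?lerDl.
have [h2|h2] := leP t (cmod p2).
  exists (a + w / 2 ^+ k.+1, c); split => //=; rewrite ?half ?addrA ?lerDl //.
  by split => //=; rewrite ?(le_trans _ c2) ?lerDl // (le_trans a1) ?lerDl.
have [h3|h3] := leP t (cmod p3).
  exists (a, c + h / 2 ^+ k.+1); split => //=; rewrite ?half ?addrA ?lerDl //.
  by split => //=; rewrite ?(le_trans _ a2) ?lerDl // (le_trans c1) ?lerDl.
have [h4|h4] := leP t (cmod p4).
  exists (a + w / 2 ^+ k.+1, c + h / 2 ^+ k.+1); split => //=; rewrite ?half ?addrA ?lerDl //.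
  by split => //=; [rewrite (le_trans a1) ?lerDl|rewrite (le_trans c1) ?lerDl].
exfalso; move: ht h1 h2 h3 h4; lra.
Qed.

Lemma nested_point (u : nat -> R) (r : R) : 0 <= r ->
  (forall k, u k <= u k.+1) -> (forall k, u k.+1 + r / 2 ^+ k.+1 <= u k + r / 2 ^+ k) ->
  exists p, forall k, u k <= p <= u k + r / 2 ^+ k.
Proof.
move=> r0 u1 u2.
have r2 k : 0 <= r / 2 ^+ k by rewrite divr_ge0 ?exprn_ge0.
have inc k j : u k <= u (k + j)%N.
  by elim: j => [|j IH]; rewrite ?addn0 // addnS (le_trans IH).
have dec k j : u (k + j)%N + r / 2 ^+ (k + j) <= u k + r / 2 ^+ k.
  by elim: j => [|j IH]; rewrite ?addn0 // addnS (le_trans (u2 _)).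
have cross j k : u j <= u k + r / 2 ^+ k.
  have [jk|/ltnW kj] := leqP j k.
    by rewrite -(subnKC jk) (le_trans (inc j (k - j)%N)) // lerDl.
  rewrite -(subnKC kj); apply: le_trans (dec k (j - k)%N).
  by rewrite lerDl.
exists (sup (range u)) => k; apply/andP; split.
  by apply: ub_le_sup; [exists (u 0%N + r / 2 ^+ 0) => _ [j _ <-]|exists k].
by apply: ge_sup; [exists (u 0%N); exists 0%N|move=> _ [j _ <-]].
Qed.

Theorem goursat : rect_int G a0 (a0 + w) c0 (c0 + h) = 0.
Proof.
apply/eqP; rewrite -cmod_eq0 eq_le cmod_ge0 andbT leNgt; apply/negP => Phi0.
set Phi := cmod _ in Phi0.
have /choice[f hf] : forall kz : nat * (R * R), exists z', good kz.1 kz.2 ->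
   [/\ good kz.1.+1 z', kz.2.1 <= z'.1,
  z'.1 + w / 2 ^+ kz.1.+1 <= kz.2.1 + w / 2 ^+ kz.1, kz.2.2 <= z'.2 &
  z'.2 + h / 2 ^+ kz.1.+1 <= kz.2.2 + h / 2 ^+ kz.1].
  move=> [k z] /=; have [/step[z' hz]|] := pselect (good k z); first by exists z'.
  by exists z.
pose s := fix s k := if k is j.+1 then f (j, s j) else (a0, c0).
have gs k : good k (s k).
  elim: k => [|k /(hf (k, _))[]//].
  by split => /=; rewrite ?expr0 ?divr1.
have hs k := hf (k, s k) (gs k); rewrite /= in hs.
have [p hp] : exists p, forall k, (s k).1 <= p <= (s k).1 + w / 2 ^+ k.
  by apply: nested_point => // k; case: (hs k).
have [q hq] : exists q, forall k, (s k).2 <= q <= (s k).2 + h / 2 ^+ k.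
  by apply: nested_point => // k; case: (hs k).
have hp0 : a0 <= p <= a0 + w by have := hp 0%N; rewrite /= expr0 divr1.
have hq0 : c0 <= q <= c0 + h by have := hq 0%N; rewrite /= expr0 divr1.
have S1 : 0 < (w + h) ^+ 2 + 1 by rewrite ltr_wpDl // sqr_ge0.
(* For this [e], the local bound at level [k] is [Phi * (w + h)^2 / ((w + h)^2 + 1)] divided by
   [4^k], strictly below the [Phi / 4^k] that the bisection preserves. *)
have [dl d0 hd] := rect_int_local hp0 hq0 (divr_gt0 Phi0 S1).
have [k hk] : exists k, (w + h) / 2 ^+ k < dl.
  have [|k0 hk0] := @geometric_small R (w + h) 2^-1 dl _ d0.
    by rewrite ger0_norm ?invf_lt1 ?ltr1n ?invr_ge0.
  by exists k0; have := hk0 k0 (leqnn k0); rewrite exprVn; apply: le_lt_trans; exact: ler_norm.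
have p2 : 0 < (2 ^+ k : R) by rewrite exprn_gt0.
have wk : w / 2 ^+ k < dl by apply: le_lt_trans hk; rewrite ler_pM2r ?invr_gt0 // lerDl.
have hk' : h / 2 ^+ k < dl by apply: le_lt_trans hk; rewrite ler_pM2r ?invr_gt0 // lerDr.
have [g1 g2 g3 g4 g5] := gs k; have /andP[k1 k2] := hp k; have /andP[k3 k4] := hq k.
have X (x y : R) : x + y - x = y by rewrite addrC addKr.
have := hd _ _ _ _ g1 k1 k2 g2 g3 k3 k4 g4; rewrite !X => /(_ wk hk') /(le_trans g5).
rewrite -/Phi -mulrDl expr_div_n -exprM mulnC exprM.
have -> : (2 ^+ 2 : R) = 4 by rewrite -natrX.
rewrite mulrA ler_pM2r ?invr_gt0 ?exprn_gt0 // mulrAC ler_pdivlMr // ler_pM2l //.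
by rewrite gerDl ler10.
Qed.

End Bisection.
End Goursat.

(** * Complex differentiability and the exponential *)

Section ComplexDiff.
Context {R : realType}.
Local Notation C := (Cplx R).
Implicit Types (f g : C -> C) (z : C).

Lemma ltc_norm z (r : R) : (`|z| < ofReal r) = (cmod z < r).
Proof. by rewrite cnormE ltcR. Qed.

Lemma lec_norm z (r : R) : (`|z| <= ofReal r) = (cmod z <= r).
Proof. by rewrite cnormE lecR. Qed.

Lemma gt0_cplx z : 0 < z -> z = ofReal (complex.Re z) /\ 0 < complex.Re z.
Proof.
move=> z0; have E := ge0_cplx (ltW z0); split => //.
by move: z0; rewrite {1}E -ofReal0 ltcR.
Qed.

Lemma nbhs_cplxP z (P : C -> Prop) : (\forall w \near z, P w) <->
  exists2 dl : R, 0 < dl & forall w, cmod (w - z) < dl -> P w.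
Proof.
split => [/nbhs_ballP[e /= /gt0_cplx[eE e0] he]|[dl d0 hd]].
  exists (complex.Re e) => // w hw; apply: he.
  by rewrite /ball /= eE ltc_norm cmodBC.
apply/nbhs_ballP; exists (ofReal dl) => /=; first by rewrite -ofReal0 ltcR.
by move=> w; rewrite /ball /= ltc_norm cmodBC; exact: hd.
Qed.

Lemma cvg_cplxP (T : Type) (F : set_system T) (FF : Filter F) (h : T -> C) (l : C) :
  h x @[x --> F] --> l <->
  forall e : R, 0 < e -> \forall x \near F, cmod (h x - l) <= e.
Proof.
split => [/cvgrPdist_le hc e e0|hc].
  have e0' : 0 < ofReal e :> C by rewrite -ofReal0 ltcR.
  by apply: filterS (hc _ e0') => x; rewrite lec_norm cmodBC.
apply/cvgrPdist_le => e /gt0_cplx[-> /hc]; apply: filterS => x.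
by rewrite lec_norm cmodBC.
Qed.

Definition cdiff f z := exists d : C, forall e : R, 0 < e ->
  exists2 dl : R, 0 < dl & forall h, cmod h < dl ->
    cmod (f (z + h) - f z - d * h) <= e * cmod h.

Definition ccontz f z := forall e : R, 0 < e ->
  exists2 dl : R, 0 < dl & forall h, cmod h < dl -> cmod (f (z + h) - f z) <= e.

Lemma cdiffP f z : cdiff f z <-> derivable (f : C -> C^o) z 1.
Proof.
have E (d h : C) : h != 0 ->
    cmod (h^-1 * (f (h + z) - f z) - d) * cmod h = cmod (f (z + h) - f z - d * h).
  by move=> h0; rewrite -cmodM mulrBl mulrAC mulVf // mul1r [h + z]addrC.
split => [[d hd]|/cvg_ex[d]].
  apply/cvg_ex; exists d; apply/cvg_cplxP => e /hd[dl d0 hdl].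
  apply/nbhs_cplxP; exists dl => // h; rewrite subr0 => hh h0.
  have hp : 0 < cmod h by rewrite cmod_gt0.
  by rewrite -(ler_pM2r hp) /= /GRing.scale /= mulr1 E //; exact: hdl.
move=> /cvg_cplxP hd; exists d => e /hd/nbhs_cplxP[dl d0 hdl]; exists dl => // h hh.
have [->|h0] := eqVneq h 0; first by rewrite addr0 subrr mulr0 subr0 cmod0 mulr0.
rewrite -E // ler_pM2r ?cmod_gt0 //.
by have := hdl h; rewrite subr0 /= /GRing.scale /= mulr1; apply.
Qed.

Lemma cdiff_cont f z : cdiff f z -> ccontz f z.
Proof.
move=> [d hd] e e0; have [dl d0 h] := hd 1 ltr01.
have c0 : 0 < 1 + cmod d by rewrite ltr_wpDr ?cmod_ge0.
exists (Num.min dl (e / (1 + cmod d))) => [|s].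
  by rewrite lt_min d0 divr_gt0.
rewrite lt_min => /andP[/h]; rewrite ltr_pdivlMr // mul1r => h1 h2.
rewrite -[_ - _](subrK (d * s)) (le_trans (ler_cmodD _ _)) // cmodM.
by rewrite (le_trans (lerD h1 (lexx _))) // -{1}[cmod s]mul1r -mulrDl mulrC ltW.
Qed.

Lemma cdiff_cst (c : C) z : cdiff (fun=> c) z.
Proof.
by exists 0 => e e0; exists 1 => // h _; rewrite subrr mul0r subr0 cmod0 mulr_ge0 ?cmod_ge0 ?ltW.
Qed.

Lemma cdiff_id z : cdiff id z.
Proof.
exists 1 => e e0; exists 1 => // h _.
by rewrite [z + h]addrC addrK mul1r subrr cmod0 mulr_ge0 ?cmod_ge0 ?ltW.
Qed.

Lemma cdiffD f g z : cdiff f z -> cdiff g z -> cdiff (fun x => f x + g x) z.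
Proof. by move=> /cdiffP hf /cdiffP hg; apply/cdiffP; exact: derivableD. Qed.

Lemma cdiffB f g z : cdiff f z -> cdiff g z -> cdiff (fun x => f x - g x) z.
Proof. by move=> /cdiffP hf /cdiffP hg; apply/cdiffP; exact: derivableB. Qed.

Lemma cdiffM f g z : cdiff f z -> cdiff g z -> cdiff (fun x => f x * g x) z.
Proof. by move=> /cdiffP hf /cdiffP hg; apply/cdiffP; exact (@derivableM C C^o f g z 1 hf hg). Qed.

Lemma cdiffV f z : f z != 0 -> cdiff f z -> cdiff (fun x => (f x)^-1) z.
Proof. by move=> f0 /cdiffP hf; apply/cdiffP; exact (@derivableV C C^o f z 1 f0 hf). Qed.

Lemma cdiffX f k z : cdiff f z -> cdiff (fun x => f x ^+ k) z.
Proof.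
move=> hf; elim: k => [|k IH]; first by under eq_fun do rewrite expr0; exact: cdiff_cst.
by under eq_fun do rewrite exprS; exact: cdiffM.
Qed.

Lemma cdiff_near f g z (r : R) : 0 < r -> (forall h, cmod h < r -> f (z + h) = g (z + h)) ->
  cdiff f z -> cdiff g z.
Proof.
move=> r0 fg [d hd]; exists d => e /hd[dl d0 h].
exists (Num.min dl r); first by rewrite lt_min d0.
move=> s; rewrite lt_min => /andP[/h h1 /fg <-].
by have := fg 0; rewrite cmod0 addr0 => <-.
Qed.

Lemma ccontzM f g z : ccontz f z -> ccontz g z -> ccontz (fun x => f x * g x) z.
Proof.
have P (u : C -> C) : ccontz u z <-> u x @[x --> z] --> u z.
  split => [h|/(@cvg_cplxP _ (nbhs z) _ _ _) h e /h/nbhs_cplxP[dl d0 hd]].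
    apply/(@cvg_cplxP _ (nbhs z) _ _ _) => e /h[dl d0 hd]; apply/nbhs_cplxP; exists dl => // w /hd.
    by rewrite subrKC.
  by exists dl => // s hs; apply: hd; rewrite [z + s]addrC addrK.
by move=> /P hf /P hg; apply/P; exact (cvgM hf hg).
Qed.

End ComplexDiff.

Section ComplexExponential.
Context {R : realType}.
Local Notation C := (Cplx R).

(* In the logarithmic coordinates [z = exp (x + i y)] circles become vertical segments, so that
   Goursat's theorem on rectangles compares integrals over concentric circles. *)
Definition cexp (x y : R) : C := ofReal (expR x) * Complex (cos y) (sin y).

Lemma cmod_cexp x y : cmod (cexp x y) = expR x.
Proof.
rewrite cmodM cmod_ofReal ger0_norm ?expR_ge0 // cmodE /= cos2Dsin2 sqrtr1 mulr1 //.
Qed.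

Lemma cexp_neq0 x y : cexp x y != 0.
Proof. by rewrite -cmod_gt0 cmod_cexp expR_gt0. Qed.

Lemma cexpD x y s t : cexp (x + s) (y + t) = cexp x y * cexp s t.
Proof.
rewrite /cexp expRD ofRealM cosD sinD.
set u := ofReal _; set v := ofReal _.
rewrite -!mulrA; congr (u * _); rewrite mulrCA; congr (v * _).
by apply: cplxP; rewrite ?cReM ?cImM /=; ring.
Qed.

Lemma cexp_2pi x : cexp x (2 * pi) = cexp x 0.
Proof. by rewrite /cexp mulr_natl cos2pi sin2pi cos0 sin0. Qed.

Lemma real_derive_small (f : R -> R) (x a : R) : is_derive x 1 f a ->
  forall e : R, 0 < e -> exists2 dl : R, 0 < dl &
    forall s, `|s| < dl -> `|f (x + s) - f x - a * s| <= e * `|s|.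
Proof.
move=> /is_derive1_caratheodory[g [hg cg <-]] e e0.
have /cvgrPdist_le /(_ e e0) := cg; move=> /nbhs_ballP[dl /= d0 hd].
exists dl => // s hs; rewrite hg addrAC subrr add0r -mulrBl normrM ler_wpM2r //.
rewrite distrC; apply: hd; rewrite /ball /=.
by rewrite opprD addrA subrr sub0r normrN.
Qed.

Lemma cexp_small : forall e : R, 0 < e -> exists2 dl : R, 0 < dl &
  forall s t, `|s| < dl -> `|t| < dl ->
    cmod (cexp s t - 1 - Complex s t) <= e * (`|s| + `|t|).
Proof.
(* The bound [e / 8] leaves room for the cross terms of the products with [expR s]; the bound
   [1 / 8], also imposed on [s], keeps [expR s] below 2. *)
move=> e e0; pose e' := Num.min (e / 8) (1 / 8).
have e'0 : 0 < e' by rewrite lt_min !divr_gt0.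
have e8 : e' <= e / 8 by rewrite ge_min lexx.
have e1 : e' <= 1 / 8 by rewrite ge_min lexx orbT.
clearbody e'.
have [d1 d10 h1] := real_derive_small (is_derive_expR 0) e'0.
have [d2 d20 h2] := real_derive_small (is_derive_cos 0) e'0.
have [d3 d30 h3] := real_derive_small (is_derive_sin 0) e'0.
exists (Num.min (Num.min d1 d2) (Num.min d3 e')).
  by rewrite !lt_min d10 d20 d30.
move=> s t; rewrite !lt_min => /andP[/andP[s1 s2] /andP[s3 s4]] /andP[/andP[t1 t2] /andP[t3 t4]].
have := h1 s s1; rewrite add0r expR0 mul1r.
have := h2 t t2; rewrite add0r sin0 cos0 oppr0 mul0r subr0.
have := h3 t t3; rewrite add0r sin0 cos0 subr0 mul1r.
set S := sin t; set Cs := cos t; set E := expR s => hS hC hE.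
apply: (le_trans (cmod_le_ReIm _)); rewrite !(cReB, cImB, cReM, cImM) /= !mul0r subr0 addr0.
have hE2 : `|E| <= 2.
  have -> : E = (E - 1 - s) + 1 + s by ring.
  rewrite (le_trans (ler_normD _ _)) // (le_trans (lerD (ler_normD _ _) (lexx _))) // normr1.
  have : e' * `|s| <= 1 / 8 * (1 / 8) by apply: ler_pM => //; [exact: ltW|exact: le_trans (ltW s4) e1].
  by have := le_trans (ltW s4) e1; lra.
have hE3 : `|E - 1| <= 2 * `|s|.
  have -> : E - 1 = (E - 1 - s) + s by ring.
  rewrite (le_trans (ler_normD _ _)) //.
  have : e' * `|s| <= 1 / 8 * `|s| by rewrite ler_wpM2r.
  by have := normr_ge0 s; lra.
have -> : E * Cs - 1 - s = E * (Cs - 1) + (E - 1 - s) by ring.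
have -> : E * S - 0 - t = E * (S - t) + (E - 1) * t by ring.
have a1 : `|E * (Cs - 1) + (E - 1 - s)| <= 2 * (e' * `|t|) + e' * `|s|.
  rewrite (le_trans (ler_normD _ _)) // normrM lerD // ler_pM //.
have a2 : `|E * (S - t) + (E - 1) * t| <= 2 * (e' * `|t|) + 2 * `|s| * e'.
  by rewrite (le_trans (ler_normD _ _)) // !normrM lerD // ler_pM // ltW.
apply: (le_trans (lerD a1 a2)).
have := ler_wpM2r (normr_ge0 s) e8; have := ler_wpM2r (normr_ge0 t) e8.
have := mulr_ge0 (ltW e0) (normr_ge0 s); have := mulr_ge0 (ltW e0) (normr_ge0 t).
lra.
Qed.

(** Chain rule: [exp] is its own derivative, so the derivative is [d * cexp x y]. This carries
    functions on a disc to the rectangles of [goursat]. *)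
Lemma rdiff_cexp (g : C -> C) x y : cdiff g (cexp x y) -> rdiff (fun x y => g (cexp x y)) x y.
Proof.
move=> [d hd]; set z := cexp x y in hd *; exists (d * z) => e e0.
have z0 : 0 < cmod z by rewrite cmod_gt0 cexp_neq0.
pose K := 2 * cmod z; have K0 : 0 < K by rewrite mulr_gt0.
have [d1 d10 h1] := hd (e / 2 / K) ltac:(by rewrite !divr_gt0).
pose e2 := Num.min 1 (e / 2 / ((1 + cmod d) * cmod z)).
have cd : 0 < 1 + cmod d by rewrite ltr_wpDr ?cmod_ge0.
have e20 : 0 < e2 by rewrite lt_min ltr01 !divr_gt0 // mulr_gt0.
have e21 : e2 <= 1 by rewrite ge_min lexx.
have e22 : e2 <= e / 2 / ((1 + cmod d) * cmod z) by rewrite ge_min lexx orbT.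
clearbody e2.
have [d2 d20 h2] := cexp_small e20.
exists (Num.min d2 (d1 / (4 * cmod z))).
  by rewrite lt_min d20 divr_gt0 // mulr_gt0.
move=> s t; rewrite !lt_min => /andP[s1 s2] /andP[t1 t2].
have hst := h2 s t s1 t1; rewrite /= cexpD -/z.
pose u := z * (cexp s t - 1).
have -> : z * cexp s t = z + u by rewrite /u; ring.
have hN := cmod_le_ReIm (Complex s t : C); rewrite /= in hN.
have hu1 : cmod (cexp s t - 1) <= 2 * (`|s| + `|t|).
  have -> : cexp s t - 1 = (cexp s t - 1 - Complex s t) + Complex s t by ring.
  rewrite (le_trans (ler_cmodD _ _)) // (le_trans (lerD hst hN)) //.
  by have := e21; move=> /(ler_wpM2r (addr_ge0 (normr_ge0 s) (normr_ge0 t))); lra.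
have hu : cmod u <= K * (`|s| + `|t|).
  by rewrite /u cmodM /K [2 * _]mulrC -mulrA ler_pM2l.
have hud : cmod u < d1.
  apply: (le_lt_trans hu).
  move: s2 t2; rewrite !ltr_pdivlMr ?mulr_gt0 // /K; lra.
have {h1} h1 := h1 u hud.
have -> : g (z + u) - g z - d * z * Complex s t =
  (g (z + u) - g z - d * u) + d * (z * (cexp s t - 1 - Complex s t)) by rewrite /u; ring.
rewrite (le_trans (ler_cmodD _ _)) // (cmodM d) (cmodM z).
have b1 : e / 2 / K * cmod u <= e / 2 * (`|s| + `|t|).
  apply: (le_trans (ler_wpM2l _ hu)); first by rewrite !divr_ge0 // ltW.
  by rewrite mulrA divfK ?gt_eqF.
have b2 : cmod d * (cmod z * cmod (cexp s t - 1 - Complex s t)) <= e / 2 * (`|s| + `|t|).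
  apply: (@le_trans _ _ ((1 + cmod d) * cmod z * (e2 * (`|s| + `|t|)))).
    rewrite mulrA; apply: ler_pM => //; rewrite ?mulr_ge0 ?cmod_ge0 //.
    by rewrite ler_wpM2r ?cmod_ge0 // lerDr.
  rewrite mulrA ler_wpM2r ?addr_ge0 //.
  by move: e22; rewrite ler_pdivlMr ?mulr_gt0 // mulrC.
by apply: (le_trans (lerD (le_trans h1 b1) b2)); rewrite -mulrDl -splitr.
Qed.

End ComplexExponential.

(** * Power series on a disc *)

Local Opaque lint.

Section CircleIntegrals.
Context {R : realType}.
Local Notation C := (Cplx R).
Implicit Types (f g H : C -> C).
Local Notation tpi := (2 * (pi : R)).

(** The integral of [g(z) dz / (i z)] over the circle of radius [expR x]; this is why the Cauchy
    kernel appears below as [z / (z - a)]. *)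
Definition circ_int g (x : R) : C := lint (fun y => g (cexp x y)) 0 tpi.

Lemma tpi_gt0 : 0 < tpi. Proof. by rewrite mulr_gt0 // pi_gt0. Qed.

Lemma cexp_cont (x y e : R) : 0 < e -> exists2 dl : R, 0 < dl & forall s t,
  `|s| < dl -> `|t| < dl -> cmod (cexp (x + s) (y + t) - cexp x y : C) < e.
Proof.
move=> e0; have [dl d0 hd] := rdiff_cont (rdiff_cexp (cdiff_id (cexp x y))) (divr_gt0 e0 (ltr0n R 2)).
exists dl => // s t hs ht; rewrite (le_lt_trans (hd s t hs ht)) //.
by rewrite ltr_pdivrMr // ltr_pMr // ltr1n.
Qed.

Lemma ccontz_cexp g x y : ccontz g (cexp x y) -> forall e : R, 0 < e ->
  exists2 dl : R, 0 < dl & forall s t, `|s| < dl -> `|t| < dl ->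
    cmod (g (cexp (x + s) (y + t)) - g (cexp x y)) <= e.
Proof.
move=> hg e /hg[d1 d10 h1]; have [dl d0 hd] := cexp_cont x y d10.
exists dl => // s t hs ht.
by have := h1 _ (hd s t hs ht); rewrite subrKC.
Qed.

Lemma circ_integrable g x : (forall y, ccontz g (cexp x y)) ->
  lintegrable (fun y => g (cexp x y)) 0 tpi.
Proof.
move=> hg; apply: ccont_lintegrable => y _ e e0.
have [dl d0 hd] := ccontz_cexp (hg y) e0; exists dl => // s hs.
by have := hd 0 s; rewrite normr0 addr0; apply.
Qed.

(** In [goursat] on [[x1, x2] x [0, 2 pi]] the two horizontal sides cancel by periodicity of [cexp],
    and the vertical sides are the two circles. *)
Lemma circ_int_const g x1 x2 : x1 <= x2 ->
  (forall x y, x1 <= x <= x2 -> cdiff g (cexp x y)) ->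
  circ_int g x1 = circ_int g x2.
Proof.
move=> x12 hg; have w0 : 0 <= x2 - x1 by rewrite subr_ge0.
have := @goursat _ (fun x y => g (cexp x y)) x1 0 (x2 - x1) tpi w0 (ltW tpi_gt0).
rewrite subrKC add0r => /(_ (fun x y hx _ => rdiff_cexp (hg x y hx))).
have E1 : lint (fun x => g (cexp x 0) - g (cexp x tpi)) x1 x2 = 0.
  rewrite (@eq_lint _ _ (fun=> 0)) => [|x _]; last by rewrite cexp_2pi subrr.
  by rewrite (lint_cst 0 x12) mul0r.
have i0 : Complex 0 1 != 0 :> C by rewrite -cmod_gt0 cmodE /= expr0n add0r expr1n sqrtr1.
rewrite /rect_int E1 add0r => /eqP; rewrite mulf_eq0 (negbTE i0) /=.
have ig x : x1 <= x <= x2 -> lintegrable (fun y => g (cexp x y)) 0 tpi.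
  by move=> hx; apply: circ_integrable => y; apply: cdiff_cont; exact: hg.
have i1 := ig x1 ltac:(by rewrite lexx x12).
have i2 := ig x2 ltac:(by rewrite lexx x12).
by rewrite (lintB i2 i1) subr_eq0 eq_sym => /eqP.
Qed.

Lemma circ_int_bound g x (M : R) : (forall y, ccontz g (cexp x y)) ->
  (forall y, 0 <= y <= tpi -> cmod (g (cexp x y)) <= M) -> cmod (circ_int g x) <= M * tpi.
Proof.
move=> hg hM; have := lint_bound (ltW tpi_gt0) (circ_integrable hg) hM.
by rewrite subr0.
Qed.

(* Uniform continuity in the angle, from compactness of [0, 2 pi]. *)
Lemma circ_int_cont H x0 (X : R) : x0 < X -> (forall x y, x < X -> ccontz H (cexp x y)) ->
  forall e : R, 0 < e -> exists2 dl : R, 0 < dl &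
    forall s, `|s| < dl -> cmod (circ_int H (x0 + s) - circ_int H x0) <= e.
Proof.
move=> xX hH e e0; have e1 : 0 < e / tpi by rewrite divr_gt0 // tpi_gt0.
have cov : near_covering (`[0, tpi]%classic : set R).
  by apply/compact_near_coveringP; exact: segment_compact.
have key (y : R) : \forall y' \near y & s \near (0 : R),
    cmod (H (cexp (x0 + s) y') - H (cexp x0 y')) <= e / tpi.
  have [dl d0 hd] := ccontz_cexp (hH x0 y xX) (divr_gt0 e1 (ltr0n R 2)).
  exists ([set y' | `|y' - y| < dl], [set s | `|s| < dl]).
    split => /=; first exact: near_dist.
    by apply: filterS (near_dist 0 d0) => s; rewrite subr0.
  move=> [y' s] /= [hy hs].
  have -> : H (cexp (x0 + s) y') - H (cexp x0 y') = (H (cexp (x0 + s) y') - H (cexp x0 y)) -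
     (H (cexp x0 y') - H (cexp x0 y)) by ring.
  rewrite (le_trans (ler_cmodB _ _)) // [leRHS]splitr lerD //.
    by have := hd s (y' - y) hs hy; rewrite subrKC.
  by have := hd 0 (y' - y); rewrite normr0 addr0 subrKC; apply.
have : nbhs (0 : R) (fun s => `[0, tpi]%classic `<=`
    (fun y => cmod (H (cexp (x0 + s) y) - H (cexp x0 y)) <= e / tpi)).
  exact: (cov R (nbhs (0 : R))
    (fun s y => cmod (H (cexp (x0 + s) y) - H (cexp x0 y)) <= e / tpi) _ (fun y _ => key y)).
move=> /nbhs_ballP[dl /= d0 hdl].
exists (Num.min dl (X - x0)); first by rewrite lt_min d0 subr_gt0.
move=> s; rewrite lt_min => /andP[sd sX].
have hs := hdl s ltac:(by rewrite /ball /= sub0r normrN).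
have c1 y : ccontz H (cexp (x0 + s) y).
  by apply: hH; rewrite -ltrBrDl (le_lt_trans (ler_norm _)).
rewrite /circ_int -lintB; [|exact: circ_integrable|by apply: circ_integrable => y; exact: hH].
have -> : e = e / tpi * (tpi - 0) by rewrite subr0 divfK // gt_eqF // tpi_gt0.
apply: lint_bound => [||y hy]; first exact/ltW/tpi_gt0.
  by apply: lintegrableB; [exact: circ_integrable|apply: circ_integrable => y; exact: hH].
by apply: hs; rewrite /= in_itv.
Qed.

(* Constancy survives one exceptional circle on which [H] is merely continuous. *)
Lemma circ_int_const_sing H x0 (X : R) : (forall x y, x < X -> ccontz H (cexp x y)) ->
  (forall x y, x < X -> x != x0 -> cdiff H (cexp x y)) ->
  forall x1 x2, x1 < X -> x2 < X -> circ_int H x1 = circ_int H x2.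
Proof.
move=> hc hd.
have E0 x : x < X -> x0 < X -> circ_int H x = circ_int H x0.
  move=> xX x0X; apply/eqP; rewrite -subr_eq0; apply/eqP.
  apply: cmod_small_eq0 => e /(circ_int_cont x0X hc)[dl d0 hdl].
  have [->|xx0] := eqVneq x x0; first by rewrite -{1}[x0]addr0 hdl // normr0.
  case: (ltgtP x x0) xx0 => // [xl|xg] _.
    pose s := Num.min (dl / 2) (x0 - x).
    have s0 : 0 < s by rewrite lt_min subr_gt0 xl divr_gt0.
    have s1 : s <= x0 - x by rewrite ge_min lexx orbT.
    have s2 : s < dl by rewrite (@le_lt_trans _ _ (dl / 2)) ?ge_min ?lexx // ltr_pdivrMr // ltr_pMr // ltr1n.
    rewrite (@circ_int_const H x (x0 + - s)); first by apply: hdl; rewrite normrN gtr0_norm.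
      by lra.
    move=> t y /andP[t1 t2]; apply: hd; first by lra.
    by rewrite lt_eqF //; lra.
  pose s := Num.min (dl / 2) (x - x0).
  have s0 : 0 < s by rewrite lt_min subr_gt0 xg divr_gt0.
  have s1 : s <= x - x0 by rewrite ge_min lexx orbT.
  have s2 : s < dl by rewrite (@le_lt_trans _ _ (dl / 2)) ?ge_min ?lexx // ltr_pdivrMr // ltr_pMr // ltr1n.
  rewrite -(@circ_int_const H (x0 + s) x); first by apply: hdl; rewrite gtr0_norm.
    by lra.
  move=> t y /andP[t1 t2]; apply: hd; first by lra.
  by rewrite gt_eqF //; lra.
move=> x1 x2 h1 h2; have [h0|h0] : x0 < X \/ X <= x0 by case: (ltP x0 X); [left|right].
  by move: (E0 _ h1 h0) (E0 _ h2 h0) => -> ->.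
wlog x12 : x1 x2 h1 h2 / x1 <= x2.
  move=> W; have [h12|h12] : x1 <= x2 \/ x2 <= x1 by case: (leP x1 x2) => [|/ltW]; [left|right].
    exact: W.
  exact/esym/W.
by apply: circ_int_const => // x y /andP[_ xx2]; apply: hd; rewrite ?lt_eqF //; lra.
Qed.

(** Passing from [x] to [x + 1] multiplies the integral by [(expR 1) ^- k], which is not 1, while
    [circ_int_const] leaves it unchanged. *)
Lemma circ_int_pow k x : (0 < k)%N -> circ_int (fun z => z ^- k) x = 0.
Proof.
move=> k0.
have D z : z != 0 -> cdiff (fun z : C => z ^- k) z.
  move=> z0; apply: (@cdiffV _ (fun z => z ^+ k)); first by rewrite expf_neq0.
  by apply: cdiffX; exact: cdiff_id.
have hI y : ccontz (fun z : C => z ^- k) (cexp x y) by apply: cdiff_cont; apply: D; exact: cexp_neq0.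
have := @circ_int_const (fun z => z ^- k) x (x + 1) ltac:(by rewrite lerDl) (fun _ _ _ => D _ (cexp_neq0 _ _)).
have -> : circ_int (fun z => z ^- k) (x + 1) = ofReal ((expR 1) ^- k) * circ_int (fun z => z ^- k) x.
  rewrite /circ_int -(lintZ _ (@circ_integrable (fun z => z ^- k) x hI)).
  apply: eq_lint => y _; rewrite -{1}[y]addr0 cexpD exprMn invfM mulrC.
  congr (_ * _); rewrite /cexp cos0 sin0.
  have -> : Complex 1 0 = 1 :> C by [].
  by rewrite mulr1 -ofRealX -ofRealV.
move=> /eqP; rewrite -subr_eq0 -{1}[circ_int _ _]mul1r -mulrBl mulf_eq0 => /orP[|/eqP//].
rewrite -ofReal1 -ofRealB ofReal_eq0 subr_eq0 eq_sym invr_eq1 => /eqP h.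
have : 1 < (expR 1 : R) ^+ k by rewrite exprn_egt1 -?lt0n // expR_gt1.
by rewrite h ltxx.
Qed.

End CircleIntegrals.

(** * Cauchy's formula and Taylor expansion *)

Section PowerSeries.
Context {R : realType}.
Local Notation C := (Cplx R).
Local Notation tpi := (2 * (pi : R)).

Lemma cexp_ln (r y : R) : 0 < r -> cmod (cexp (ln r) y : C) = r.
Proof. by move=> r0; rewrite cmod_cexp lnK. Qed.

Lemma geometric_kernel (z a : C) (N : nat) : z != 0 -> z != a ->
  z / (z - a) = \sum_(k < N) a ^+ k * z ^- k + (a / z) ^+ N * (z / (z - a)).
Proof.
move=> z0 za; have za0 : z - a != 0 by rewrite subr_eq0.
elim: N => [|N IH]; first by rewrite big_ord0 add0r expr0 mul1r.
rewrite big_ord_recr /= {1}IH -addrA; congr (_ + _).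
rewrite exprS -expr_div_n; set y := (a / z) ^+ N.
by field; rewrite z0 za0.
Qed.

Variables (f : C -> C) (rho : R).
Hypothesis rho0 : 0 < rho.
Hypothesis df : forall z, cmod z < rho -> cdiff f z.

(** The radius [rho / 2] is an arbitrary choice: by [coefE] any circle inside the disc gives the
    same value. *)
Let coef k : C := (ofReal tpi)^-1 * circ_int (fun z => f z * z ^- k) (ln (rho / 2)).

Let dom x y : x < ln rho -> cmod (cexp x y : C) < rho.
Proof. by move=> h; rewrite cmod_cexp -[rho]lnK ?posrE // ltr_expR. Qed.

Let dfk k x y : x < ln rho -> cdiff (fun z => f z * z ^- k) (cexp x y).
Proof.
move=> h; apply: cdiffM; first exact/df/dom.
apply: (@cdiffV _ (fun z => z ^+ k)); first by rewrite expf_neq0 // cexp_neq0.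
by apply: cdiffX; exact: cdiff_id.
Qed.

Let tpi0 : ofReal tpi != 0 :> C. Proof. by rewrite ofReal_eq0 gt_eqF // tpi_gt0. Qed.

Let coefE k x : x < ln rho -> circ_int (fun z => f z * z ^- k) x = ofReal tpi * coef k.
Proof.
move=> xX; rewrite /coef (mulVKf tpi0).
have h2 : ln (rho / 2) < ln rho.
  by rewrite ltr_ln ?posrE ?divr_gt0 // ltr_pdivrMr // ltr_pMr // ltr1n.
apply: (@circ_int_const_sing _ _ (ln rho) (ln rho) _ _ x (ln (rho / 2)) xX h2) => u y hu.
  by apply: cdiff_cont; exact: dfk.
by move=> _; exact: dfk.
Qed.

(** [geometric_kernel] integrated against a function continuous on the circle. It serves twice: with
    [g = 1] to integrate the kernel itself, and with [g = f] for the Taylor remainder. *)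
Lemma kernel_expansion (g : C -> C) a x (M : R) N : cmod a < expR x -> (forall y, ccontz g (cexp x y)) ->
  (forall y, 0 <= y <= tpi -> cmod (g (cexp x y)) <= M) ->
  cmod (circ_int (fun z => g z * (z / (z - a))) x -
        \sum_(k < N) a ^+ k * circ_int (fun z => g z * z ^- k) x) <=
  M * (cmod a / expR x) ^+ N * (expR x / (expR x - cmod a)) * tpi.
Proof.
move=> ax gc gM.
have ne y : cexp x y != a by apply: contraTneq ax => <-; rewrite cmod_cexp ltxx.
have M0 : 0 <= M by apply: le_trans (gM 0 _); rewrite ?cmod_ge0 // lexx ltW // tpi_gt0.
have c1 y : ccontz (fun z : C => z / (z - a)) (cexp x y).
  apply/cdiff_cont/cdiffM; first exact: cdiff_id.
  apply: (@cdiffV _ (fun z => z - a)); first by rewrite subr_eq0.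
  by apply: cdiffB; [exact: cdiff_id|exact: cdiff_cst].
have c2 k y : ccontz (fun z : C => z ^- k) (cexp x y).
  apply/cdiff_cont/(@cdiffV _ (fun z => z ^+ k)); first by rewrite expf_neq0 // cexp_neq0.
  by apply: cdiffX; exact: cdiff_id.
have c3 y : ccontz (fun z : C => (a / z) ^+ N) (cexp x y).
  apply/cdiff_cont/cdiffX/cdiffM; first exact: cdiff_cst.
  by apply: (@cdiffV _ id); [exact: cexp_neq0|exact: cdiff_id].
have i1 : lintegrable (fun y => g (cexp x y) * (cexp x y / (cexp x y - a))) 0 tpi.
  by apply: (@circ_integrable _ (fun z => g z * (z / (z - a)))) => y; exact: ccontzM.
have i2 k : lintegrable (fun y => a ^+ k * (g (cexp x y) * (cexp x y) ^- k)) 0 tpi.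
  apply: lintegrableZ.
  by apply: (@circ_integrable _ (fun z => g z * z ^- k)) => y; exact: ccontzM.
pose F z := g z * ((a / z) ^+ N * (z / (z - a))).
have -> : circ_int (fun z => g z * (z / (z - a))) x -
    \sum_(k < N) a ^+ k * circ_int (fun z => g z * z ^- k) x = circ_int F x.
  have -> : \sum_(k < N) a ^+ k * circ_int (fun z => g z * z ^- k) x =
      lint (fun y => \sum_(k < N) a ^+ k * (g (cexp x y) * (cexp x y) ^- k)) 0 tpi.
    rewrite (lint_sum _ (fun k : 'I_N => i2 k)); apply: eq_bigr => k _; rewrite lintZ //.
    by apply: (@circ_integrable _ (fun z => g z * z ^- k)) => y; exact: ccontzM.
  rewrite /circ_int -(lintB i1 (lintegrable_sum _ (fun k : 'I_N => i2 k))).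
  apply: eq_lint => y _; rewrite {1}(geometric_kernel N (cexp_neq0 x y) (ne y)) /F.
  rewrite mulrDr mulr_sumr addrAC [X in _ - X](eq_bigr (fun k : 'I_N => g (cexp x y) * (a ^+ k * cexp x y ^- k))).
    by rewrite subrr add0r.
  by move=> k _; rewrite mulrCA.
apply: circ_int_bound => [y|y hy]; first by apply: ccontzM => //; exact: ccontzM.
rewrite /F; move: (cmod_cexp x y) (ne y) (gM y hy); move: (cexp x y) => u hu nu gu.
rewrite !cmodM cmodX cmodM !cmodV hu -mulrA.
apply: ler_pM => //; rewrite ?mulr_ge0 ?exprn_ge0 ?invr_ge0 ?mulr_ge0 ?invr_ge0 ?cmod_ge0 ?expR_ge0 //.
rewrite ler_wpM2l ?exprn_ge0 ?mulr_ge0 ?invr_ge0 ?cmod_ge0 ?expR_ge0 //.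
rewrite ler_wpM2l ?expR_ge0 // lef_pV2 ?posrE ?subr_gt0 //.
  by rewrite -hu lerB_cmod.
by rewrite cmod_gt0 subr_eq0.
Qed.

(** Let [h] be the difference quotient of [f] at [a], completed by the derivative. The circle
    integrals of [h z * z] do not depend on the radius, although [h] is only continuous at [a], and
    they shrink with the circle because of the factor [z]; so they vanish. *)
Lemma cauchy_formula a x : cmod a < expR x -> x < ln rho ->
  circ_int (fun z => f z * (z / (z - a))) x = ofReal tpi * f a.
Proof.
move=> ax xX.
have ne y : cexp x y != a by apply: contraTneq ax => <-; rewrite cmod_cexp ltxx.
have arho : cmod a < rho by rewrite (lt_trans ax) // -[rho]lnK ?posrE // ltr_expR.
have [d hd] := df arho.
pose h z := if z == a then d else (f z - f a) / (z - a).
have dh z : cmod z < rho -> z != a -> cdiff h z.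
  move=> zr za; apply: (@cdiff_near _ (fun z => (f z - f a) / (z - a)) _ _ (cmod (z - a))).
  - by rewrite cmod_gt0 subr_eq0.
  - move=> s hs; rewrite /h ifF //; apply/negbTE; apply: contraTneq hs => E.
    by rewrite -E opprD addrA subrr sub0r cmodN ltxx.
  - apply: cdiffM; first by apply: cdiffB; [exact: df|exact: cdiff_cst].
    apply: (@cdiffV _ (fun z => z - a)); first by rewrite subr_eq0.
    by apply: cdiffB; [exact: cdiff_id|exact: cdiff_cst].
have ch z : cmod z < rho -> ccontz h z.
  move=> zr; have [->|za] := eqVneq z a; last exact/cdiff_cont/dh.
  move=> e e0; have [dl d0 hdl] := hd e e0; exists dl => // s /hdl hs.
  rewrite /h eqxx; case: ifPn => [_|sa]; first by rewrite subrr cmod0 ltW.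
  have s0 : s != 0 by apply: contraNneq sa => ->; rewrite addr0.
  rewrite [a + s]addrC addrK -(ler_pM2r (_ : 0 < cmod s)) ?cmod_gt0 //.
  by rewrite -cmodM mulrBl divfK // [s + a]addrC.
pose H z := h z * z.
have cH z : cmod z < rho -> ccontz H z.
  by move=> zr; apply: ccontzM; [exact: ch|exact/cdiff_cont/cdiff_id].
have dH z : cmod z < rho -> z != a -> cdiff H z.
  by move=> zr za; apply: cdiffM; [exact: dh|exact: cdiff_id].
have constH x1 x2 : x1 < ln rho -> x2 < ln rho -> circ_int H x1 = circ_int H x2.
  (* The exceptional circle is the one through [a]. For [a = 0] the value of [ln 0] is immaterial,
     as no circle [cexp u y] meets 0. *)
  apply: (@circ_int_const_sing _ _ (ln (cmod a))) => u y hu; first exact/cH/dom.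
  move=> ua; apply: dH; first exact: dom.
  by apply: contraNneq ua => E; rewrite -E cmod_cexp expRK.
have H0 : circ_int H x = 0.
  apply: cmod_small_eq0 => e e0.
  have e1 : 0 < e / tpi by rewrite divr_gt0 // tpi_gt0.
  have [dl d0 hdl] := cH 0 ltac:(by rewrite cmod0) _ e1.
  pose u := Num.min (ln dl - 1) (ln rho - 1).
  have u1 : u < ln rho by rewrite gt_min [X in _ || X]ltrBlDr ltrDl ltr01 orbT.
  have u2 : u < ln dl by rewrite gt_min ltrBlDr ltrDl ltr01.
  rewrite (constH x u) //; have -> : e = e / tpi * tpi by rewrite divfK // gt_eqF // tpi_gt0.
  apply: circ_int_bound => [y|y _]; first exact/cH/dom.
  have := hdl (cexp u y); rewrite cmod_cexp -[X in _ < X -> _]lnK ?posrE // ltr_expR => /(_ u2).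
  by rewrite add0r {2}/H mulr0 subr0.
have c1 y : ccontz (fun z : C => z / (z - a)) (cexp x y).
  apply/cdiff_cont/cdiffM; first exact: cdiff_id.
  apply: (@cdiffV _ (fun z => z - a)); first by rewrite subr_eq0.
  by apply: cdiffB; [exact: cdiff_id|exact: cdiff_cst].
have I1 : circ_int (fun z => z / (z - a)) x = ofReal tpi.
  apply/eqP; rewrite -subr_eq0; apply/eqP; apply: cmod_small_eq0 => e e0.
  have q1 : `|cmod a / expR x| < 1.
    by rewrite ger0_norm ?divr_ge0 ?cmod_ge0 ?expR_ge0 // ltr_pdivrMr ?expR_gt0 // mul1r.
  have [N hN] := geometric_small ((expR x / (expR x - cmod a)) * tpi) q1 e0.
  have := @kernel_expansion (fun=> 1) a x 1 N.+1 ax (fun y => cdiff_cont (cdiff_cst _ _)) ltac:(by move=> y _; rewrite cmod1).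
  rewrite big_ord_recl /= expr0 mul1r big1 ?addr0; last first.
    move=> k _; rewrite -[RHS](mulr0 (a ^+ bump 0 k)); congr (_ * _).
    rewrite -(@circ_int_pow _ (bump 0 k) x) //.
    by apply: eq_lint => y _; rewrite mul1r.
  have -> : circ_int (fun z : C => 1 * z ^- 0) x = ofReal tpi.
    rewrite /circ_int (@eq_lint _ _ (fun=> 1)) => [|y _]; last by rewrite mul1r expr0 invr1.
    by rewrite lint_cst ?mul1r ?subr0 // ltW // tpi_gt0.
  have -> : circ_int (fun z : C => 1 * (z / (z - a))) x = circ_int (fun z => z / (z - a)) x.
    by apply: eq_lint => y _; rewrite mul1r.
  move=> /le_trans; apply; rewrite mul1r -mulrA mulrC.
  exact: le_trans (ler_norm _) (ltW (hN _ (leqnSn N))).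
apply/eqP; rewrite -I1 mulrC -subr_eq0 -H0; apply/eqP.
have i1 := @circ_integrable _ (fun z => z / (z - a)) x c1.
have i2 : lintegrable (fun y => f (cexp x y) * (cexp x y / (cexp x y - a))) 0 tpi.
  apply: (@circ_integrable _ (fun z => f z * (z / (z - a)))) => y.
  by apply: ccontzM => //; exact/cdiff_cont/df/dom.
rewrite /circ_int -(lintZ _ i1) -(lintB i2 (lintegrableZ _ i1)).
by apply: eq_lint => y _; rewrite /H /h (negbTE (ne y)) -mulrBl mulrA mulrAC.
Qed.

(** One sequence of coefficients serves every radius [r]. The estimates involve [f] only through its
    bound [M] on the circle, which later makes them uniform in parameters. *)
Theorem power_series : exists c : nat -> C, forall r M : R, 0 < r -> r < rho ->
  (forall y, 0 <= y <= tpi -> cmod (f (cexp (ln r) y)) <= M) ->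
  (forall k, cmod (c k) * r ^+ k <= M) /\
  forall z N, cmod z < r -> cmod (f z - \sum_(k < N) c k * z ^+ k) <=
    M * (cmod z / r) ^+ N * (r / (r - cmod z)).
Proof.
exists coef => r M r0 rr hM; have xX : ln r < ln rho by rewrite ltr_ln ?posrE.
have tp : cmod (ofReal tpi : C) = tpi by rewrite cmod_ofReal gtr0_norm // tpi_gt0.
have cf y : ccontz f (cexp (ln r) y) by apply/cdiff_cont/df/dom.
split => [k|z N zr].
  rewrite -(ler_pM2r tpi_gt0) -{1}tp mulrC mulrA -cmodM -(coefE _ xX).
  rewrite -ler_pdivlMr ?exprn_gt0 // mulrAC.
  apply: circ_int_bound => [y|y hy]; first exact/cdiff_cont/dfk.
  by rewrite cmodM cmodV cmodX cexp_ln // ler_wpM2r ?invr_ge0 ?exprn_ge0 ?(ltW r0) // hM.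
rewrite -(ler_pM2r tpi_gt0) -{1}tp mulrC -cmodM mulrBr mulr_sumr.
have er : expR (ln r) = r by rewrite lnK ?posrE.
have zr' : cmod z < expR (ln r) by rewrite er.
rewrite -(cauchy_formula zr' xX).
have := kernel_expansion N zr' cf hM; rewrite er; congr (cmod (_ - _) <= _).
by apply: eq_bigr => k _; rewrite coefE // mulrCA [_ ^+ _ * _]mulrC.
Qed.

End PowerSeries.

(** * The identity theorem and the Hermitian structure of C^n *)

Lemma ler_of_sqr (R : realType) (a b : R) : 0 <= a -> 0 <= b -> a ^+ 2 <= b ^+ 2 -> a <= b.
Proof. by move=> a0 b0; rewrite ler_pXn2r. Qed.

Section Identity.
Context {R : realType}.
Local Notation C := (Cplx R).

Lemma circle_bounded (f : C -> C) (x : R) : (forall y, ccontz f (cexp x y)) ->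
  exists M, forall y, 0 <= y <= 2 * pi -> cmod (f (cexp x y)) <= M.
Proof.
move=> cf.
have cov : near_covering (`[0, 2 * pi]%classic : set R).
  by apply/compact_near_coveringP; exact: segment_compact.
have key (y : R) : \forall y' \near y & M \near (+oo : set_system R),
    cmod (f (cexp x y')) <= M.
  have [dl d0 hd] := ccontz_cexp (cf y) ltr01.
  exists ([set y' | `|y' - y| < dl], [set M | cmod (f (cexp x y)) + 1 <= M]).
    by split => /=; [exact: near_dist|apply: nbhs_pinfty_ge; exact: num_real].
  move=> [y' M] /= [hy hM]; apply: le_trans hM.
  have := hd 0 (y' - y); rewrite normr0 addr0 subrKC => /(_ d0 hy) h.
  by have := lerB_cmod (f (cexp x y')) (f (cexp x y)); lra.
have /filter_ex[M hM] : (+oo : set_system R) (fun M => `[0, 2 * pi]%classic `<=`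
    (fun y => cmod (f (cexp x y)) <= M)).
  exact: (cov R (+oo : set_system R) (fun M y => cmod (f (cexp x y)) <= M) _ (fun y _ => key y)).
by exists M => y hy; apply: hM; rewrite /= in_itv.
Qed.

(** If the coefficients below [k] vanish, the remainder of order [k + 1] at zeros close to 0 forces
    coefficient [k] to vanish too. *)
Lemma analytic_identity (f : C -> C) (rho : R) :
  (forall z, cmod z < rho -> cdiff f z) ->
  (forall e : R, 0 < e -> exists z, [/\ z != 0, cmod z < e & f z = 0]) ->
  forall z, cmod z < rho -> f z = 0.
Proof.
move=> df fz z zr; have rho0 : 0 < rho by rewrite (le_lt_trans _ zr) // cmod_ge0.
have [c hc] := power_series rho0 df.
pose r := (cmod z + rho) / 2.
have zr2 : cmod z < r by rewrite /r; lra.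
have rr : r < rho by rewrite /r; lra.
have r0 : 0 < r by rewrite (le_lt_trans _ zr2) // cmod_ge0.
clearbody r.
have [M hM] : exists M, forall y, 0 <= y <= 2 * pi -> cmod (f (cexp (ln r) y)) <= M.
  by apply: circle_bounded => y; apply: cdiff_cont; apply: df; rewrite cexp_ln.
have [_ {}hc] := hc r M r0 rr hM.
have M0 : 0 <= M by apply: le_trans (hM 0 _); rewrite ?cmod_ge0 // lexx ltW // tpi_gt0.
have c0 k : c k = 0.
  elim/ltn_ind: k => k IH; apply: cmod_small_eq0 => e e0.
  (* [r / 2] bounds [r / (r - |w|)] by 2; the other bound then makes [2 M |w| / r^(k+1)] at most
     [e]. *)
  have [w [w0 we fw]] := fz (Num.min (r / 2) (e * r ^+ k.+1 / (2 * (M + 1))))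
    ltac:(by rewrite lt_min !divr_gt0 ?mulr_gt0 ?exprn_gt0 // ltr_wpDl).
  move: we; rewrite lt_min => /andP[w1 w2].
  have wp : 0 < cmod w by rewrite cmod_gt0.
  have := hc w k.+1 ltac:(by lra); rewrite fw sub0r cmodN big_ord_recr /= big1; last first.
    by move=> i _; rewrite IH // mul0r.
  rewrite add0r cmodM cmodX => h.
  rewrite -(ler_pM2r (exprn_gt0 k wp)); apply: (le_trans h).
  have h1 : r / (r - cmod w) <= 2 by rewrite ler_pdivrMr; lra.
  rewrite exprMn exprVn [cmod w ^+ _]exprS.
  have rk : 0 < r ^+ k.+1 by rewrite exprn_gt0.
  have wk : 0 < cmod w ^+ k by rewrite exprn_gt0.
  apply: (@le_trans _ _ (M * (cmod w * cmod w ^+ k / r ^+ k.+1) * 2)).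
    by rewrite ler_wpM2l // mulr_ge0 // !mulr_ge0 ?invr_ge0 ?cmod_ge0 // ltW.
  have -> : M * (cmod w * cmod w ^+ k / r ^+ k.+1) * 2 = (2 * M * cmod w / r ^+ k.+1) * cmod w ^+ k by ring.
  rewrite ler_wpM2r ?(ltW wk) // ler_pdivrMr //.
  move: (ltW w2); rewrite ler_pdivlMr ?mulr_gt0 ?ltr_wpDl //.
  by have := cmod_ge0 w; set a := cmod w; set b := e * _ => a0 h2; nra.
apply: cmod_small_eq0 => e e0.
have q1 : `|cmod z / r| < 1.
  by rewrite ger0_norm ?divr_ge0 ?cmod_ge0 ?ltW // ltr_pdivrMr // mul1r.
have [N hN] := geometric_small (M * (r / (r - cmod z))) q1 e0.
have := hc z N zr2; rewrite big1 => [|i _]; last by rewrite c0 mul0r.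
rewrite subr0 => /le_trans; apply; apply: le_trans (ltW (hN N (leqnn N))).
by rewrite mulrAC ler_norm.
Qed.

End Identity.

HB.lock Definition cdot (R : realType) (n : nat) (z w : 'rV[Cplx R]_n) : Cplx R := dotmx z w.
(** The Euclidean norm. The generic norm of row vectors is the maximum norm [mx_norm], which unitary
    matrices do not preserve. *)
HB.lock Definition vnorm (R : realType) (n : nat) (z : 'rV[Cplx R]_n) : R :=
  Num.sqrt (sqnorm z).

Section ComplexSpace.
Context {R : realType} {n : nat}.
Local Notation C := (Cplx R).
Local Notation Cn := 'rV[Cplx R]_n.
Implicit Types (z w v : Cn) (a : C).

Lemma cdotE z w : cdot z w = dotmx z w. Proof. by rewrite unlock. Qed.

Lemma cdot_sum z w : cdot z w = \sum_j z 0 j * (w 0 j)^*.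
Proof. by rewrite cdotE dotmx_sum. Qed.

Lemma cdotDl z w v : cdot (z + w) v = cdot z v + cdot w v.
Proof. by rewrite !cdot_sum -big_split; apply: eq_bigr => j _; rewrite mxE mulrDl. Qed.

Lemma cdotZl a z v : cdot (a *: z) v = a * cdot z v.
Proof. by rewrite !cdot_sum mulr_sumr; apply: eq_bigr => j _; rewrite mxE mulrA. Qed.

Lemma cdot_conj z w : (cdot z w)^* = cdot w z.
Proof.
by rewrite !cdot_sum cconj_sum; apply: eq_bigr => j _; rewrite cconjM cconjK mulrC.
Qed.

Lemma cdotDr z w v : cdot v (z + w) = cdot v z + cdot v w.
Proof. by rewrite -(cdot_conj (z + w)) cdotDl cconjD !cdot_conj. Qed.

Lemma cdotZr a z v : cdot v (a *: z) = a^* * cdot v z.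
Proof. by rewrite -(cdot_conj (a *: z)) cdotZl cconjM !cdot_conj. Qed.

Lemma cdotNl z v : cdot (- z) v = - cdot z v.
Proof. by rewrite -scaleN1r cdotZl mulN1r. Qed.

Lemma cdot0l v : cdot 0 v = 0.
Proof. by rewrite -(scale0r 0) cdotZl mul0r. Qed.

Lemma vnorm_ge0 z : 0 <= vnorm z. Proof. by rewrite unlock; exact: sqrtr_ge0. Qed.

Lemma sqr_vnorm_sum z : vnorm z ^+ 2 = \sum_j cmod (z 0 j) ^+ 2.
Proof.
have E : sqnorm z = \sum_j cmod (z 0 j) ^+ 2.
  by rewrite /sqnorm dotmx_sum cRe_sum; apply: eq_bigr => j _; rewrite mul_conj.
by rewrite unlock sqr_sqrtr E // sumr_ge0 // => j _; exact: sqr_ge0.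
Qed.

Lemma cdot_self z : cdot z z = ofReal (vnorm z ^+ 2).
Proof.
rewrite sqr_vnorm_sum cdot_sum (eq_bigr (fun j => ofReal (cmod (z 0 j) ^+ 2))) => [|j _].
  by rewrite (big_morph ofReal ofRealD ofReal0).
by rewrite mul_conj.
Qed.

Lemma sqr_vnorm z : vnorm z ^+ 2 = complex.Re (cdot z z).
Proof. by rewrite cdot_self. Qed.

Lemma sqnorm_vnorm z : sqnorm z = vnorm z ^+ 2.
Proof. by rewrite sqr_vnorm cdotE. Qed.

Lemma cauchy_schwarz_cdot z w : cmod (cdot z w) <= vnorm z * vnorm w.
Proof.
pose h := \sum_j cmod (z 0 j) * cmod (w 0 j).
have h0 : 0 <= h by rewrite sumr_ge0 // => j _; rewrite mulr_ge0 ?cmod_ge0.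
apply: (@le_trans _ _ h).
  rewrite cdot_sum (le_trans (ler_cmod_sum _ _ _)) //.
  by rewrite le_eqVlt; apply/orP; left; apply/eqP; apply: eq_bigr => j _; rewrite cmodM cmod_conj.
have hE : \sum_j cmod (z 0 j) * cmod (w 0 j) = h by [].
clearbody h; apply: ler_of_sqr => //; first by rewrite mulr_ge0 ?vnorm_ge0.
rewrite exprMn; apply: quadratic_bound; rewrite ?sqr_ge0 // => t.
have -> : t ^+ 2 * h ^+ 2 * vnorm z ^+ 2 - 2 * t * h ^+ 2 + vnorm w ^+ 2 =
    \sum_j (t * h * cmod (z 0 j) - cmod (w 0 j)) ^+ 2.
  have -> : 2 * t * h ^+ 2 = 2 * t * h * \sum_j cmod (z 0 j) * cmod (w 0 j) by rewrite hE; ring.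
  rewrite !sqr_vnorm_sum !mulr_sumr -sumrB -big_split /=.
  by apply: eq_bigr => j _; ring.
by rewrite sumr_ge0 // => j _; exact: sqr_ge0.
Qed.

Lemma sqr_vnormD z w :
  vnorm (z + w) ^+ 2 = vnorm z ^+ 2 + vnorm w ^+ 2 + 2 * complex.Re (cdot z w).
Proof.
rewrite !sqr_vnorm cdotDl !cdotDr !cReD -(cdot_conj z w) cRe_conj; ring.
Qed.

Lemma vnormD z w : vnorm (z + w) <= vnorm z + vnorm w.
Proof.
apply: ler_of_sqr; rewrite ?addr_ge0 ?vnorm_ge0 // sqr_vnormD sqrrD.
have := le_trans (Re_le_cmod _) (cauchy_schwarz_cdot z w).
by rewrite mulr2n; lra.
Qed.

Lemma vnormZ a z : vnorm (a *: z) = cmod a * vnorm z.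
Proof.
apply/eqP; rewrite -(eqrXn2 (n := 2)) ?mulr_ge0 ?vnorm_ge0 ?cmod_ge0 //.
by rewrite exprMn !sqr_vnorm cdotZl cdotZr mulrA mul_conj cReZ.
Qed.

Lemma vnormN z : vnorm (- z) = vnorm z.
Proof. by rewrite -scaleN1r vnormZ cmodN cmod1 mul1r. Qed.

Lemma vnormBC z w : vnorm (z - w) = vnorm (w - z).
Proof. by rewrite -vnormN opprB. Qed.

Lemma vnorm0 : vnorm (0 : Cn) = 0.
Proof. by rewrite -(scale0r 0) vnormZ cmod0 mul0r. Qed.

Lemma cmod_coord z j : cmod (z 0 j) <= vnorm z.
Proof.
apply: ler_of_sqr; rewrite ?cmod_ge0 ?vnorm_ge0 // sqr_vnorm_sum (bigD1 j) //=.
by rewrite lerDl sumr_ge0 // => i _; exact: sqr_ge0.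
Qed.

Lemma vnorm_delta j : vnorm (delta_mx 0 j : Cn) = 1.
Proof.
apply/eqP; rewrite -(eqrXn2 (n := 2)) ?vnorm_ge0 // sqr_vnorm_sum (bigD1 j) //=.
rewrite big1 => [|i ij]; first by rewrite mxE !eqxx cmod1 !expr1n addr0.
by rewrite mxE (negbTE ij) andbF cmod0 expr0n.
Qed.

Lemma vnorm_le_sum z : vnorm z <= \sum_j cmod (z 0 j).
Proof.
rewrite {1}(row_sum_delta z).
apply: (@le_trans _ _ (\sum_j vnorm (z 0 j *: (delta_mx 0 j : Cn)))).
  elim/big_ind2: _ => [|x1 x2 y1 y2 h1 h2|//]; first by rewrite vnorm0.
  by rewrite (le_trans (vnormD _ _)) // lerD.
by apply: ler_sum => j _; rewrite vnormZ vnorm_delta mulr1.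
Qed.

Lemma cball_vnorm z : cball z <-> vnorm z < 1.
Proof.
have -> : cball z = (sqnorm z < 1) :> Prop by [].
rewrite sqnorm_vnorm; split => h.
  by rewrite -(ltr_pXn2r (n := 2)) ?nnegrE ?vnorm_ge0 // expr1n.
by rewrite -(expr1n R 2) ltr_pXn2r ?nnegrE ?vnorm_ge0.
Qed.

Lemma csphere_vnorm z : csphere z <-> vnorm z = 1.
Proof.
have -> : csphere z = (sqnorm z = 1) :> Prop by [].
rewrite sqnorm_vnorm; split => [h|->]; last by rewrite expr1n.
by apply/eqP; rewrite -(eqrXn2 (n := 2)) ?vnorm_ge0 // h expr1n.
Qed.

Lemma nbhs_rowP z (P : Cn -> Prop) : (\forall w \near z, P w) <->
  exists2 dl : R, 0 < dl & forall w, vnorm (w - z) < dl -> P w.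
Proof.
split => [/nbhs_ballP[e /= /gt0_cplx[eE e0] he]|[dl d0 hd]].
  exists (complex.Re e) => // w hw; apply: he.
  rewrite eE; split; first by rewrite -ofReal0 ltcR.
  move=> i j; rewrite /ball /= ltc_norm cmodBC (le_lt_trans _ hw) //.
  by have := cmod_coord (w - z) j; rewrite !mxE ord1.
(* The denominator [n.+1] keeps the sum of [n] coordinates strictly below [dl] and covers
   [n = 0]. *)
apply/nbhs_ballP; exists (ofReal (dl / n.+1%:R)) => /=.
  by rewrite -ofReal0 ltcR divr_gt0.
move=> w [_ hw]; apply: hd; apply: (le_lt_trans (vnorm_le_sum _)).
apply: (@le_lt_trans _ _ (\sum_(j < n) dl / n.+1%:R)).
  apply: ler_sum => j _; have := hw 0 j; rewrite /ball /= ltc_norm cmodBC => /ltW.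
  by rewrite !mxE.
rewrite sumr_const card_ord -[X in X < _]mulr_natr -mulrA gtr_pMr //.
by rewrite mulrC ltr_pdivrMr // mul1r ltr_nat.
Qed.

End ComplexSpace.

(** * Continuity, measurability and differentiability on C^n *)

Section ComplexSpaceTopology.
Context {R : realType} {n : nat}.
Local Notation C := (Cplx R).
Local Notation Cn := 'rV[Cplx R]_n.
Implicit Types (z w v : Cn) (a : C) (f : Cn -> C).

Definition vcont f z := forall e : R, 0 < e -> exists2 dl : R, 0 < dl &
  forall w, vnorm (w - z) < dl -> cmod (f w - f z) <= e.

Lemma vcontP f z : vcont f z <-> {for z, continuous f}.
Proof.
split => [h|/(@cvg_cplxP _ _ (nbhs z) _ _ _) h e /h/nbhs_rowP//].
apply/(@cvg_cplxP _ _ (nbhs z) _ _ _) => e /h hd; exact/nbhs_rowP.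
Qed.

Lemma differentiable_vcont f z : differentiable f z -> vcont f z.
Proof. by move=> /differentiable_continuous/vcontP. Qed.

Lemma vcont_cst a z : vcont (fun=> a) z.
Proof. by move=> e e0; exists 1 => // w _; rewrite subrr cmod0 ltW. Qed.

Lemma vcontD f g z : vcont f z -> vcont g z -> vcont (fun x => f x + g x) z.
Proof. by move=> /vcontP hf /vcontP hg; apply/vcontP; exact: (cvgD hf hg). Qed.

Lemma vcontM f g z : vcont f z -> vcont g z -> vcont (fun x => f x * g x) z.
Proof. by move=> /vcontP hf /vcontP hg; apply/vcontP; exact (cvgM hf hg). Qed.

Lemma vcont_conj f z : vcont f z -> vcont (fun x => (f x)^*) z.
Proof.
move=> hf e /hf[dl d0 hd]; exists dl => // w /hd.
by rewrite -cconjB cmod_conj.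
Qed.

Lemma vcontX f k z : vcont f z -> vcont (fun x => f x ^+ k) z.
Proof.
move=> hf; elim: k => [|k IH]; first by under eq_fun do rewrite expr0; exact: vcont_cst.
by under eq_fun do rewrite exprS; exact: vcontM.
Qed.

Lemma vcontV f z : f z != 0 -> vcont f z -> vcont (fun x => (f x)^-1) z.
Proof. by move=> f0 /vcontP hf; apply/vcontP; exact (cvgV f0 hf). Qed.

Lemma vcont_affine (T : Cn -> Cn) f (K : R) z :
  (forall w, vnorm (T w - T z) <= K * vnorm (w - z)) ->
  vcont f (T z) -> vcont (fun w => f (T w)) z.
Proof.
move=> hT hf e /hf[dl d0 hd].
have K1 : 0 < `|K| + 1 by rewrite ltr_wpDl.
exists (dl / (`|K| + 1)); first by rewrite divr_gt0.
move=> w; rewrite ltr_pdivlMr // => hw; apply: hd; apply: le_lt_trans hw.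
apply: (le_trans (hT w)); rewrite mulrC ler_wpM2l ?vnorm_ge0 //.
by rewrite (le_trans (ler_norm _)) // lerDl.
Qed.

Lemma vcont_cdotl v z : vcont (fun w => cdot w v) z.
Proof.
move=> e e0; have v1 : 0 < vnorm v + 1 by rewrite ltr_wpDl ?vnorm_ge0.
exists (e / (vnorm v + 1)); first by rewrite divr_gt0.
move=> w; rewrite ltr_pdivlMr // => hw.
have -> : cdot w v - cdot z v = cdot (w - z) v by rewrite cdotDl cdotNl.
apply: (le_trans (cauchy_schwarz_cdot _ _)); apply: le_trans (ltW hw).
by rewrite ler_wpM2l ?vnorm_ge0 // lerDl.
Qed.

Lemma vcont_cdotr v z : vcont (fun w => cdot v w) z.
Proof.
have -> : (fun w => cdot v w) = (fun w => (cdot w v)^*) by apply/funext => w; rewrite cdot_conj.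
exact/vcont_conj/vcont_cdotl.
Qed.

Lemma vcont_coord j z : vcont (fun w => w 0 j) z.
Proof.
move=> e e0; exists e => // w /ltW; apply: le_trans.
by have := cmod_coord (w - z) j; rewrite !mxE.
Qed.

Lemma open_vnorm_lt (r : R) : open [set z : Cn | vnorm z < r].
Proof.
rewrite openE => z /= zr; apply/nbhs_rowP; exists (r - vnorm z); first by rewrite subr_gt0.
move=> w hw; have := vnormD (w - z) z; rewrite subrK => h; rewrite /mkset; lra.
Qed.

Lemma open_vnorm_gt (r : R) : open [set z : Cn | r < vnorm z].
Proof.
rewrite openE => z /= zr; apply/nbhs_rowP; exists (vnorm z - r); first by rewrite subr_gt0.
move=> w; rewrite vnormBC => hw; have := vnormD (z - w) w; rewrite subrK => h; rewrite /mkset; lra.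
Qed.

Lemma open_measurable_BCn (A : set Cn) : open A -> measurable (A : set (BCn R n)).
Proof. by move=> oA; apply: sub_gen_smallest. Qed.

Lemma measurable_csphere : measurable (csphere : set (BCn R n)).
Proof.
have -> : (csphere : set (BCn R n)) =
    ~` ([set z : Cn | vnorm z < 1] `|` [set z : Cn | 1 < vnorm z]).
  apply/seteqP; split => z /=; first by move=> /csphere_vnorm ->; rewrite ltxx => -[].
  move=> h; apply/csphere_vnorm/eqP; rewrite eq_le !leNgt; apply/andP; split; apply/negP => ?; apply: h; by [right|left].
apply: measurableC; apply: measurableU; apply: open_measurable_BCn;
  [exact: open_vnorm_lt|exact: open_vnorm_gt].
Qed.

(** Continuity is required only at points of [D], since kernels such as [szego z] are singular
    farther out: within [D], the preimage of an open interval agrees with its interior. *)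
Lemma continuous_measurable_on (D : set (BCn R n)) (h : Cn -> R) : measurable D ->
  (forall x, D x -> forall e : R, 0 < e -> exists2 dl : R, 0 < dl &
    forall w, vnorm (w - x) < dl -> `|h w - h x| <= e) ->
  measurable_fun D (h : BCn R n -> R).
Proof.
move=> mD hc; apply: (measurability _ (RGenOpens.measurableE R)).
move=> _ [_ [a [b ->]] <-].
have -> : D `&` h @^-1` `]a, b[%classic = D `&` (h @^-1` `]a, b[%classic)°.
  apply/seteqP; split => x [Dx hx]; split => //; last exact: interior_subset.
  move: hx; rewrite /= in_itv /= => /andP[ax xb].
  have e0 : 0 < Num.min (h x - a) (b - h x) / 2 by rewrite divr_gt0 // lt_min !subr_gt0 ax.
  apply/nbhs_rowP; have [dl d0 hd] := hc x Dx _ e0; exists dl => // w /hd.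
  rewrite /= in_itv /= ler_norml.
  have : Num.min (h x - a) (b - h x) <= h x - a by rewrite ge_min lexx.
  have : Num.min (h x - a) (b - h x) <= b - h x by rewrite ge_min lexx orbT.
  by move: e0; move: (Num.min _ _) => m; lra.
by apply: measurableI => //; apply: open_measurable_BCn; exact: open_interior.
Qed.

Lemma vcont_cmeas (D : set (BCn R n)) f : measurable D -> (forall x, D x -> vcont f x) ->
  cmeas D (f : BCn R n -> C).
Proof.
move=> mD hf; split; apply: continuous_measurable_on => // x Dx e /(hf x Dx)[dl d0 hd];
  exists dl => // w /hd.
  by rewrite -cReB; apply: le_trans; exact: ler_Re_cmod.
by rewrite -cImB; apply: le_trans; exact: ler_Im_cmod.
Qed.

Lemma compact_cbox (r : R) : compact [set z : C | `|complex.Re z| <= r /\ `|complex.Im z| <= r].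
Proof.
have -> : [set z : C | `|complex.Re z| <= r /\ `|complex.Im z| <= r] =
    (fun p : R * R => Complex p.1 p.2 : C) @` (`[-r, r] `*` `[-r, r]).
  apply/seteqP; split => [z /= [h1 h2]|_ [[x y] [/= hx hy] <-]] /=.
    exists (complex.Re z, complex.Im z); last by case: z h1 h2.
    by split => /=; rewrite in_itv /= -ler_norml.
  by split; [move: hx|move: hy]; rewrite in_itv /= -ler_norml.
apply: continuous_compact; last by apply: compact_setX; exact: segment_compact.
apply: continuous_subspaceT => p; apply/cvg_cplxP => e e0.
have e2 : 0 < e / 2 by rewrite divr_gt0.
exists ([set x | `|x - p.1| < e / 2], [set y | `|y - p.2| < e / 2]).
  by split => /=; exact: near_dist.
move=> [x y] /= [hx hy]; rewrite (le_trans (cmod_le_ReIm _)) // cReB cImB /=.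
by rewrite [leRHS]splitr lerD // ltW.
Qed.

Lemma compact_vball (r : R) : compact [set z : Cn | vnorm z <= r].
Proof.
apply: (subclosed_compact _ (@rV_compact C n (fun=> [set z : C | `|complex.Re z| <= r /\ `|complex.Im z| <= r]) _)).
- have -> : [set z : Cn | vnorm z <= r] = ~` [set z : Cn | r < vnorm z].
    by apply/seteqP; split => z /=; rewrite leNgt => /negP.
  by apply: open_closedC; exact: open_vnorm_gt.
- by move=> _; exact: compact_cbox.
- move=> z /= hz i; have h := le_trans (cmod_coord z i) hz.
  by split; [exact: le_trans (ler_Re_cmod _) h|exact: le_trans (ler_Im_cmod _) h].
Qed.

Lemma vball_bounded f (r : R) : (forall z, vnorm z <= r -> vcont f z) ->
  exists M, forall z, vnorm z <= r -> cmod (f z) <= M.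
Proof.
move=> hf; have cov : near_covering [set z : Cn | vnorm z <= r].
  by apply/compact_near_coveringP; exact: compact_vball.
have key z : [set z : Cn | vnorm z <= r] z -> \forall z' \near z & M \near (+oo : set_system R),
    cmod (f z') <= M.
  move=> /= zr; have [dl d0 hd] := hf z zr 1 ltr01.
  exists ([set w | vnorm (w - z) < dl], [set M | cmod (f z) + 1 <= M]).
    split => /=; first by apply/nbhs_rowP; exists dl.
    by apply: nbhs_pinfty_ge; exact: num_real.
  move=> [w M] /= [/hd h hM]; apply: le_trans hM.
  by have := lerB_cmod (f w) (f z); lra.
have /filter_ex[M hM] : (+oo : set_system R) (fun M => [set z : Cn | vnorm z <= r] `<=`
    (fun z => cmod (f z) <= M)).
  exact: (cov R (+oo : set_system R) (fun M z => cmod (f z) <= M) _ key).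
by exists M.
Qed.

Lemma slice_cdiff f z v t : differentiable f (z + t *: v) ->
  cdiff (fun s => f (z + s *: v)) t.
Proof.
move=> /(@diff_derivable _ _ _ _ _ v) /cvg_ex[d] /cvg_cplxP hd; exists d => e /hd/nbhs_cplxP[dl d0 hdl].
exists dl => // h hh.
have [->|h0] := eqVneq h 0; first by rewrite addr0 subrr mulr0 subr0 cmod0 mulr0.
have hh' : cmod (h - 0) < dl by rewrite subr0.
have H : cmod (h^-1 * (f (h *: v + (z + t *: v)) - f (z + t *: v)) - d) <= e := hdl h hh' h0.
move: H; rewrite -(ler_pM2r (_ : 0 < cmod h)) ?cmod_gt0 // -cmodM.
rewrite mulrBl mulrAC mulVf // mul1r.
suff -> : z + (t + h) *: v = h *: v + (z + t *: v) by [].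
by rewrite scalerDl addrA [RHS]addrC.
Qed.

Lemma vnorm_le_norm z : ofReal (vnorm z) <= n%:R * `|z|.
Proof.
have h j : `|z 0 j| <= `|z|.
  have -> : `|z| = mx_norm z by [].
  rewrite mx_normE; exact: (le_bigmax (0%:nng : {nonneg C}) (fun i : 'I_1 * 'I_n => `|z i.1 i.2|%:nng : {nonneg C}) (0, j)).
apply: (@le_trans _ _ (\sum_j `|z 0 j|)).
  rewrite (eq_bigr (fun j => ofReal (cmod (z 0 j)))) => [|j _]; last by rewrite cnormE.
  by rewrite -(big_morph ofReal ofRealD ofReal0) lecR vnorm_le_sum.
by rewrite (le_trans (ler_sum _ (fun j _ => h j))) // sumr_const card_ord mulr_natl.
Qed.

Lemma differentiable_expansion f z (D : 'I_n -> C) :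
  (forall e : R, 0 < e -> exists2 dl : R, 0 < dl & forall h, vnorm h < dl ->
    cmod (f (z + h) - f z - \sum_j h 0 j * D j) <= e * vnorm h) ->
  differentiable f z.
Proof.
move=> hf; pose L (h : Cn) := \sum_j h 0 j * D j.
have linL : linear (L : Cn -> C^o).
  move=> a u v; rewrite /L scaler_sumr -big_split; apply: eq_bigr => j _ /=.
  by rewrite !mxE mulrDl -mulrA.
pose LM := GRing.isLinear.Build _ _ _ _ _ linL.
pose LL : {linear Cn -> C^o} := HB.pack L LM.
have cL : continuous LL.
  move=> u; apply/vcontP; rewrite /= /L => e e0.
  have S0 : 0 < \sum_j cmod (D j) + 1 by rewrite ltr_wpDl // sumr_ge0 // => j _; exact: cmod_ge0.
  exists (e / (\sum_j cmod (D j) + 1)); first by rewrite divr_gt0.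
  move=> w; rewrite ltr_pdivlMr // => hw; rewrite -sumrB (le_trans (ler_cmod_sum _ _ _)) //.
  apply: le_trans (ltW hw); rewrite mulrDr mulr1 mulr_sumr.
  apply: (@le_trans _ _ (\sum_j vnorm (w - u) * cmod (D j))); last by rewrite lerDl vnorm_ge0.
  apply: ler_sum => j _; rewrite -mulrBl cmodM ler_wpM2r ?cmod_ge0 //.
  by have := cmod_coord (w - u) j; rewrite !mxE.
have E : f \o shift z = cst (f z : C^o) + LL +o_ (0 : Cn) id.
  apply/eqaddoP => e /gt0_cplx[eE e0].
  have n0 : 0 < (n.+1%:R : R) by rewrite ltr0n.
  have [dl d0 hd] := hf (complex.Re e / n.+1%:R) (divr_gt0 e0 n0).
  apply/nbhs_rowP; exists dl => // h; rewrite subr0 => /hd hh.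
  have -> : (f \o shift z - (cst (f z : C^o) + LL)) h = f (z + h) - f z - \sum_j h 0 j * D j.
    by rewrite /= !fctE /= opprD addrA [h + z]addrC.
  rewrite cnormE; apply: (@le_trans _ _ (ofReal (complex.Re e / n.+1%:R * vnorm h))).
    by rewrite lecR.
  rewrite ofRealM ofRealM -eE -mulrA ler_pM2l; last by rewrite eE -ofReal0 ltcR.
  rewrite ofRealV ofReal_nat ler_pdivrMl ?ltr0n //.
  by rewrite (le_trans (vnorm_le_norm h)) // ler_wpM2r // ler_nat.
have dE : 'd (f : Cn -> C^o) z = LL :> (Cn -> C^o) by exact: diff_unique.
by apply/diff_locallyP; rewrite dE.
Qed.

End ComplexSpaceTopology.

(** * The binomial series *)

Section KernelSeries.
Context {R : realType}.
Local Notation C := (Cplx R).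

(** Partial sums of the binomial series of [(1 - s) ^- m.+1]; for [s = <z, w>] they approximate the
    Cauchy kernel of C^(m+1). *)
Definition ksum (m N : nat) (s : C) : C := \sum_(k < N) 'C(m + k, k)%:R * s ^+ k.

Lemma ksum0 N s : (1 - s) * ksum 0 N s = 1 - s ^+ N.
Proof.
rewrite /ksum (eq_bigr (fun k : 'I_N => s ^+ k)); last by move=> k _; rewrite add0n binn mul1r.
by rewrite -[LHS]opprK -mulNr opprB -subrX1 opprB.
Qed.

Lemma ksumS m N s : (1 - s) * ksum m.+1 N.+1 s = ksum m N.+1 s - 'C(m.+1 + N, N)%:R * s ^+ N.+1.
Proof.
elim: N => [|N IH].
  by rewrite /ksum !big_ord1 !bin0 expr0 !mul1r mulr1 expr1.
rewrite /ksum big_ord_recr /= mulrDr -/(ksum _ _ _) IH [in RHS]big_ord_recr /= -/(ksum _ _ _).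
have -> : 'C(m.+1 + N.+1, N.+1) = ('C(m + N.+1, N.+1) + 'C(m.+1 + N, N))%N.
  by rewrite addSn addnS binS addSn.
by rewrite natrD !exprS; ring.
Qed.

Lemma bin_geometric m k (t : R) : 0 < t -> t < 1 -> 'C(m + k, k)%:R * t ^+ k <= (1 - t) ^- m.+1.
Proof.
move=> t0 t1; have u0 : 0 < 1 - t by rewrite subr_gt0.
elim: m k => [|m IH] k.
  rewrite add0n binn mul1r expr1; apply: (@le_trans _ _ 1).
    by rewrite exprn_ile1 // ltW.
  by rewrite invf_ge1 //; lra.
have -> : (1 - t) ^- m.+2 = (1 - t) ^- m.+1 / (1 - t) by rewrite exprSr invfM.
rewrite ler_pdivlMr //.
elim: k => [|k IHk]; first by rewrite expr0 mulr1 bin0 mul1r; have := IH 0%N; rewrite bin0 expr0 mulr1; lra.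
have -> : 'C(m.+1 + k.+1, k.+1) = ('C(m + k.+1, k.+1) + 'C(m.+1 + k, k))%N.
  by rewrite addSn addnS binS addSn.
rewrite natrD mulrDl mulrDl.
have := ler_wpM2r (ltW u0) (IH k.+1); have := ler_wpM2l (ltW t0) IHk.
rewrite [t ^+ k.+1]exprS; set a := _%:R; set b := _%:R; set x := t ^+ k; set y := (1 - t) ^- m.+1.
by move=> h1 h2; lra.
Qed.

(** The coefficients grow with [k]; weakening [cmod s] to [cmod s / t] with [t < 1] absorbs them by
    [bin_geometric] and keeps the remainder geometric. Induction on [m], dividing by [1 - s]. *)
Lemma kernel_series m (r t : R) : 0 <= r -> r < 1 -> 0 < t -> t < 1 ->
  exists2 A : R, 0 <= A & forall N s, cmod s <= r ->
    cmod ((1 - s) ^- m.+1 - ksum m N s) <= A * (cmod s / t) ^+ N.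
Proof.
move=> r0 r1 t0 t1; have u0 : 0 < 1 - r by rewrite subr_gt0.
have ne (s : C) : cmod s <= r -> 1 - s != 0.
  by move=> sr; rewrite subr_eq0; apply: contraTneq sr => <-; rewrite cmod1 -ltNge.
have inv (s : C) : cmod s <= r -> cmod (1 - s)^-1 <= (1 - r)^-1.
  move=> sr; rewrite cmodV lef_pV2 ?posrE // ?cmod_gt0 ?ne //.
  by have := lerB_cmod 1 s; rewrite cmod1; lra.
elim: m => [|m [A A0 IH]].
  exists (1 - r)^-1; first by rewrite invr_ge0 ltW.
  move=> N s sr; rewrite expr1.
  have -> : (1 - s)^-1 - ksum 0 N s = (1 - s)^-1 * s ^+ N.
    apply: (mulfI (ne s sr)); rewrite mulrBr ksum0 mulfV ?ne // mulrA mulfV ?ne //; ring.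
  rewrite cmodM cmodX; apply: ler_pM; rewrite ?cmod_ge0 ?exprn_ge0 ?inv ?cmod_ge0 //.
  rewrite lerXn2r ?nnegrE ?divr_ge0 ?cmod_ge0 ?(ltW t0) // ler_pdivlMr //.
  by rewrite ler_piMr ?cmod_ge0 // ltW.
pose B := (1 - t) ^- m.+2; have B0 : 0 <= B by rewrite invr_ge0 exprn_ge0 // subr_ge0 ltW.
have hB N := bin_geometric m.+1 N t0 t1; rewrite -/B in hB; clearbody B.
have v0 : 0 <= (1 - r)^-1 by rewrite invr_ge0 ltW.
have v1 : 0 <= (1 - r) ^- m.+2 by rewrite invr_ge0 exprn_ge0 // ltW.
have v2 : 0 <= (A + B) / (1 - r) by rewrite mulr_ge0 // addr_ge0.
exists ((A + B) / (1 - r) + (1 - r) ^- m.+2); first exact: addr_ge0.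
case=> [|N] s sr.
  rewrite /ksum big_ord0 subr0 expr0 mulr1 -exprVn cmodX.
  apply: (@le_trans _ _ ((1 - r) ^- m.+2)); last by rewrite lerDr.
  by rewrite -exprVn lerXn2r ?nnegrE ?cmod_ge0 ?invr_ge0 ?(ltW u0) ?inv.
have E : (1 - s) ^- m.+2 - ksum m.+1 N.+1 s =
    (1 - s)^-1 * (((1 - s) ^- m.+1 - ksum m N.+1 s) + 'C(m.+1 + N, N)%:R * s ^+ N.+1).
  apply: (mulfI (ne s sr)); rewrite mulrBr ksumS exprS invfM !mulrA mulfV ?ne // !mul1r; ring.
rewrite E cmodM mulrDl [(A + B) / _]mulrC -mulrA.
apply: (@le_trans _ _ ((1 - r)^-1 * ((A + B) * (cmod s / t) ^+ N.+1))); last first.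
  by rewrite lerDl mulr_ge0 ?invr_ge0 ?exprn_ge0 ?divr_ge0 ?cmod_ge0 // ltW.
apply: ler_pM; rewrite ?cmod_ge0 ?inv // (le_trans (ler_cmodD _ _)) // mulrDl lerD ?IH //.
rewrite cmodM cmod_natr cmodX expr_div_n exprS mulrCA.
have tN : 0 < t ^+ N by rewrite exprn_gt0.
rewrite exprS invfM mulrA mulrACA.
apply: (@le_trans _ _ (cmod s * (B * (cmod s ^+ N / t ^+ N)))).
  rewrite -[X in X <= _]mulrA ler_wpM2l ?cmod_ge0 // mulrA ler_pdivlMr // mulrAC.
  by rewrite ler_wpM2r ?exprn_ge0 ?cmod_ge0.
have st : cmod s <= cmod s / t by rewrite ler_pdivlMr // ler_piMr ?cmod_ge0 // ltW.
rewrite [X in X <= _]mulrCA; apply: ler_wpM2l => //; apply: ler_wpM2r => //.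
by rewrite mulr_ge0 ?invr_ge0 ?exprn_ge0 ?cmod_ge0 // ltW.
Qed.

(** Once the coefficients below [k] vanish, the bound for [N = k + 1] reads
    [|e_k z^k| <= A |z / t|^(k+1)]; divide by [z^k] and let [z] tend to 0. *)
Lemma coef_zero (e : nat -> C) (A t dl : R) : 0 < t -> 0 < dl -> 0 <= A ->
  (forall N z, cmod z < dl -> cmod (\sum_(k < N) e k * z ^+ k) <= A * (cmod z / t) ^+ N) ->
  forall k, e k = 0.
Proof.
move=> t0 d0 A0 h; elim/ltn_ind => k IH; apply: cmod_small_eq0 => x x0.
have tk : 0 < t ^+ k.+1 by rewrite exprn_gt0.
pose y := Num.min (dl / 2) (x * t ^+ k.+1 / (A + 1)).
have y0 : 0 < y by rewrite lt_min !divr_gt0 ?mulr_gt0 ?ltr_wpDl.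
have y1 : y < dl by rewrite (@le_lt_trans _ _ (dl / 2)) ?ge_min ?lexx // ltr_pdivrMr // ltr_pMr // ltr1n.
have y2 : y <= x * t ^+ k.+1 / (A + 1) by rewrite ge_min lexx orbT.
clearbody y; have cy : cmod (ofReal y : C) = y by rewrite cmod_ofReal gtr0_norm.
have := h k.+1 (ofReal y); rewrite cy => /(_ y1).
rewrite big_ord_recr /= big1 => [|i _]; last by rewrite IH // mul0r.
rewrite add0r cmodM cmodX cy expr_div_n exprS => hk.
have yk : 0 < y ^+ k by rewrite exprn_gt0.
rewrite -(ler_pM2r yk) (le_trans hk) // mulrA ler_pdivrMr //.
have -> : A * (y * y ^+ k) = A * y * y ^+ k by ring.
rewrite [X in _ <= X]mulrAC ler_wpM2r ?(ltW yk) //.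
apply: (le_trans (ler_wpM2l A0 y2)); rewrite mulrA ler_pdivrMr ?ltr_wpDl //.
by rewrite mulrC ler_wpM2l ?mulr_ge0 ?(ltW x0) ?(ltW tk) // lerDl.
Qed.

End KernelSeries.

(** * Differentiation under the integral sign *)

Section UniformExpansion.
Context {R : realType} {n m : nat}.
Local Notation C := (Cplx R).
Local Notation Cn := 'rV[Cplx R]_n.
Local Notation Cm := 'rV[Cplx R]_m.
Local Notation S := (csphere : set (BCn R n)).
Implicit Types (p : Cm -> Cn -> C) (q : Cn -> C) (M : 'I_m -> Cn -> C).

(* First-order expansion in the parameter [h], uniform in [xi] in the closed ball. *)
Definition uexp p q M := [/\ cmeas S (q : BCn R n -> C),
  forall j, cmeas S (M j : BCn R n -> C) &
  exists B dl : R, [/\ 0 <= B, 0 < dl,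
    forall h, vnorm h < dl -> cmeas S (p h : BCn R n -> C) &
    forall xi, vnorm xi <= 1 -> [/\ cmod (q xi) <= B, forall j, cmod (M j xi) <= B &
      forall h, vnorm h < dl ->
        cmod (p h xi - q xi - \sum_j h 0 j * M j xi) <= B * vnorm h ^+ 2]]].

Lemma sum_coord_bound (h : Cm) (l : 'I_m -> C) (B : R) : (forall j, cmod (l j) <= B) ->
  cmod (\sum_j h 0 j * l j) <= m%:R * B * vnorm h.
Proof.
move=> hl; apply: (le_trans (ler_cmod_sum _ _ _)).
apply: (@le_trans _ _ (\sum_(j < m) vnorm h * B)).
  by apply: ler_sum => j _; rewrite cmodM ler_pM ?cmod_ge0 ?cmod_coord.
rewrite sumr_const card_ord -[X in X <= _]mulr_natl.
by have -> : m%:R * (vnorm h * B) = m%:R * B * vnorm h by ring.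
Qed.

Lemma uexp_cst q : cmeas S (q : BCn R n -> C) -> (exists B, forall xi, vnorm xi <= 1 -> cmod (q xi) <= B) ->
  uexp (fun _ => q) q (fun _ _ => 0).
Proof.
move=> mq [B hB]; split => //.
exists `|B|, 1; split => // xi hxi; split=> [|j|h _].
- by rewrite (le_trans (hB _ hxi)) // ler_norm.
- by rewrite cmod0.
- by rewrite big1 => [|j _]; rewrite ?mulr0 // subrr subrr cmod0 mulr_ge0 ?sqr_ge0.
Qed.

Lemma uexpM p q M p' q' M' : uexp p q M -> uexp p' q' M' ->
  uexp (fun h xi => p h xi * p' h xi) (fun xi => q xi * q' xi)
       (fun j xi => q xi * M' j xi + M j xi * q' xi).
Proof.
move=> [mq mM [B [dl [B0 d0 mp hp]]]] [mq' mM' [B' [dl' [B0' d0' mp' hp']]]]; split.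
- exact: cmeasM.
- by move=> j; apply: cmeasD; exact: cmeasM.
pose N := (m%:R : R); have N0 : 0 <= N by rewrite ler0n.
pose K := B * B' + B * B' + (B * B' + N * B * (N * B' + B') + B * (B' + N * B' + B')).
pose d := Num.min (Num.min dl dl') 1.
have K0 : 0 <= B * B' by rewrite mulr_ge0.
have hd : 0 < d by rewrite !lt_min d0 d0' ltr01.
exists K, d; split => // [|h|xi hxi].
- by rewrite /K !addr_ge0 // mulr_ge0 ?addr_ge0 ?mulr_ge0.
- by rewrite !lt_min => /andP[/andP[h1 h2] _]; apply: cmeasM; [exact: mp|exact: mp'].
have [b1 b2 b3] := hp xi hxi; have [c1 c2 c3] := hp' xi hxi.
have K1 : B * B' <= K.
  by rewrite /K -addrA lerDl !addr_ge0 // mulr_ge0 ?addr_ge0 ?mulr_ge0.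
have K2 : B * B' + B * B' <= K.
  by rewrite /K lerDl !addr_ge0 // mulr_ge0 ?addr_ge0 ?mulr_ge0.
split=> [|j|h].
- by rewrite cmodM (le_trans _ K1) // ler_pM ?cmod_ge0.
- rewrite (le_trans (ler_cmodD _ _)) // (le_trans _ K2) // !cmodM lerD // ler_pM ?cmod_ge0 //.
rewrite !lt_min => /andP[/andP[h1 h2] h3].
have r1 := b3 h h1; have r2 := c3 h h2.
set l := \sum_j _ in r1; set l' := \sum_j _ in r2.
have El : \sum_j h 0 j * (q xi * M' j xi + M j xi * q' xi) = q xi * l' + l * q' xi.
  rewrite /l /l' mulr_sumr mulr_suml -big_split; apply: eq_bigr => j _ /=; ring.
have hl : cmod l <= N * B * vnorm h by apply: sum_coord_bound.
have hl' : cmod l' <= N * B' * vnorm h by apply: sum_coord_bound.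
rewrite El; clearbody l l'.
set r := p h xi - q xi - l in r1; set r' := p' h xi - q' xi - l' in r2.
have -> : p h xi * p' h xi - q xi * q' xi - (q xi * l' + l * q' xi) =
    q xi * r' + l * (l' + r') + r * (q' xi + l' + r').
  by rewrite /r /r'; ring.
have v0 := vnorm_ge0 h; set v := vnorm h in h1 h2 h3 r1 r2 hl hl' v0 *.
have vv : v ^+ 2 <= v by rewrite expr2 ler_piMl // ltW.
have vr' : cmod r' <= B' * v by rewrite (le_trans r2) // ler_wpM2l.
have v1 : B' * v <= B' by rewrite ler_piMr // ltW.
have v2 : N * B' * v <= N * B' by rewrite ler_piMr ?mulr_ge0 // ltW.
have t1 : cmod (q xi * r') <= B * (B' * v ^+ 2) by rewrite cmodM ler_pM ?cmod_ge0.
have t2 : cmod (l * (l' + r')) <= (N * B * v) * (N * B' * v + B' * v).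
  by rewrite cmodM ler_pM ?cmod_ge0 // (le_trans (ler_cmodD _ _)) // lerD.
have t3 : cmod (r * (q' xi + l' + r')) <= B * v ^+ 2 * (B' + N * B' + B').
  rewrite cmodM ler_pM ?cmod_ge0 // (le_trans (ler_cmodD _ _)) // lerD //.
    by rewrite (le_trans (ler_cmodD _ _)) // lerD // (le_trans hl').
  exact: le_trans vr' v1.
apply: (le_trans (ler_cmodD _ _)); apply: (le_trans (lerD (le_trans (ler_cmodD _ _) (lerD t1 t2)) t3)).
have -> : B * (B' * v ^+ 2) + N * B * v * (N * B' * v + B' * v) + B * v ^+ 2 * (B' + N * B' + B') =
  (K - (B * B' + B * B')) * v ^+ 2 by rewrite /K; ring.
by rewrite ler_wpM2r ?sqr_ge0 // lerBlDr lerDl addr_ge0.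
Qed.

Lemma uexpX p q M k : uexp p q M ->
  exists M', uexp (fun h xi => p h xi ^+ k) (fun xi => q xi ^+ k) M'.
Proof.
move=> hp; elim: k => [|k [M' IH]].
  exists (fun _ _ => 0); apply: (@uexp_cst (fun=> 1)); first exact: cmeas_cst.
  by exists 1 => xi _; rewrite cmod1.
exists (fun j xi => q xi * M' j xi + M j xi * q xi ^+ k).
have -> : (fun h xi => p h xi ^+ k.+1) = (fun h xi => p h xi * p h xi ^+ k).
  by apply/funext => h; apply/funext => xi; rewrite exprS.
have -> : (fun xi => q xi ^+ k.+1) = (fun xi => q xi * q xi ^+ k).
  by apply/funext => xi; rewrite exprS.
exact: uexpM.
Qed.

Lemma uexp_inv (a : Cn -> C) (l : 'I_m -> Cn -> C) (c B : R) : 0 < c ->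
  (forall xi, vcont a xi) -> (forall j xi, vcont (l j) xi) ->
  (forall xi, vnorm xi <= 1 -> c <= cmod (a xi) /\ forall j, cmod (l j xi) <= B) ->
  uexp (fun h xi => (a xi - \sum_j h 0 j * l j xi)^-1) (fun xi => (a xi)^-1)
       (fun j xi => (a xi)^-1 ^+ 2 * l j xi).
Proof.
move=> c0 ca cl hal; pose b : R := `|B|.
have b0 : 0 <= b by exact: normr_ge0.
have hl xi j : vnorm xi <= 1 -> cmod (l j xi) <= b.
  by move=> /hal[_ /(_ j) h]; rewrite (le_trans h) // ler_norm.
have ha xi : vnorm xi <= 1 -> c <= cmod (a xi) by move=> /hal[].
have a0 xi : vnorm xi <= 1 -> a xi != 0.
  by move=> /ha h; rewrite -cmod_gt0 (lt_le_trans c0).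
have S1 xi : S xi -> vnorm xi <= 1 by move=> /csphere_vnorm ->.
pose N := (m%:R * b : R); have N0 : 0 <= N by rewrite mulr_ge0.
have sumb (h : Cm) xi : vnorm xi <= 1 -> cmod (\sum_j h 0 j * l j xi) <= N * vnorm h.
  by move=> hx; apply: sum_coord_bound => j; exact: hl.
(* For [vnorm h < d] the perturbation is at most [c / 2], so the perturbed denominator stays above
   [c / 2]. *)
pose d := c / 2 / (N + 1); have N1 : 0 < N + 1 by rewrite ltr_wpDl.
have d0 : 0 < d by rewrite !divr_gt0.
have den (h : Cm) xi : vnorm xi <= 1 -> vnorm h < d -> c / 2 <= cmod (a xi - \sum_j h 0 j * l j xi).
  move=> hx; rewrite /d ltr_pdivlMr // => hh.
  have := lerB_cmod (a xi) (\sum_j h 0 j * l j xi); have := sumb h xi hx; have := ha xi hx.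
  have := vnorm_ge0 h; nra.
have vsum (h : Cm) xi : vcont (fun xi => \sum_j h 0 j * l j xi) xi.
  elim: (index_enum 'I_m) => [|j s IH].
    by under eq_fun do rewrite big_nil; exact: vcont_cst.
  under eq_fun do rewrite big_cons.
  by apply: vcontD => //; apply: vcontM; [exact: vcont_cst|exact: cl].
have mS : measurable S by exact: measurable_csphere.
have mia : cmeas S (fun xi : BCn R n => (a xi)^-1).
  by apply: vcont_cmeas => // x Sx; apply: vcontV; [exact/a0/S1|exact: ca].
have mlj j : cmeas S (l j : BCn R n -> C) by apply: vcont_cmeas.
split => //.
  by move=> j; apply: cmeasM => //; exact: cmeasX.
have ic : 0 <= c^-1 by rewrite invr_ge0 ltW.
exists (c^-1 + c^-1 ^+ 2 * b + N ^+ 2 * (c^-1 ^+ 2 * (c / 2)^-1)), d; split => //.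
- rewrite !addr_ge0 ?mulr_ge0 ?sqr_ge0 ?exprn_ge0 ?invr_ge0 ?divr_ge0 // ltW //.
- move=> h hh; apply: vcont_cmeas => // x Sx.
  apply: (@vcontV _ _ (fun xi => a xi - \sum_j h 0 j * l j xi)).
    by rewrite -cmod_gt0 (lt_le_trans _ (den h x (S1 _ Sx) hh)) // divr_gt0.
  apply: vcontD => //.
  have -> : (fun x => - (\sum_j h 0 j * l j x)) = (fun x => (-1) * \sum_j h 0 j * l j x).
    by apply/funext => y; rewrite mulN1r.
  by apply: vcontM; [exact: vcont_cst|].
move=> xi hx; have ia : cmod (a xi)^-1 <= c^-1.
  by rewrite cmodV lef_pV2 ?posrE ?ha ?cmod_gt0 ?a0.
have e1 : 0 <= c^-1 ^+ 2 * b by rewrite mulr_ge0 ?sqr_ge0.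
have e2 : 0 <= N ^+ 2 * (c^-1 ^+ 2 * (c / 2)^-1).
  by rewrite mulr_ge0 ?sqr_ge0 // mulr_ge0 ?sqr_ge0 // invr_ge0 divr_ge0 // ltW.
split => [|j|h hh].
- by rewrite (le_trans ia) // -addrA lerDl addr_ge0.
- rewrite cmodM cmodX (@le_trans _ _ (c^-1 ^+ 2 * b)) //.
    by apply: ler_pM; rewrite ?exprn_ge0 ?cmod_ge0 ?hl // lerXn2r ?nnegrE ?cmod_ge0.
  by rewrite addrAC lerDr addr_ge0.
have hden := den h xi hx hh; set L := \sum_j _ in hden *.
have hL : cmod L <= N * vnorm h by exact: sumb.
have -> : \sum_j h 0 j * ((a xi)^-1 ^+ 2 * l j xi) = (a xi)^-1 ^+ 2 * L.
  by rewrite /L mulr_sumr; apply: eq_bigr => j _; rewrite mulrCA.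
clearbody L; have dn0 : a xi - L != 0 by rewrite -cmod_gt0 (lt_le_trans _ hden) // divr_gt0.
have an0 := a0 xi hx.
have -> : (a xi - L)^-1 - (a xi)^-1 - (a xi)^-1 ^+ 2 * L = L ^+ 2 * ((a xi)^-1 ^+ 2 * (a xi - L)^-1).
  by field; rewrite an0 dn0.
rewrite cmodM cmodX cmodM cmodX [X in _ <= X]mulrDl.
apply: (@le_trans _ _ (N ^+ 2 * (c^-1 ^+ 2 * (c / 2)^-1) * vnorm h ^+ 2)); last first.
  by rewrite lerDr mulr_ge0 ?sqr_ge0 // addr_ge0.
rewrite [X in _ <= X]mulrAC -exprMn; apply: ler_pM; rewrite ?mulr_ge0 ?exprn_ge0 ?cmod_ge0 //.
  by rewrite lerXn2r ?nnegrE ?mulr_ge0 ?vnorm_ge0 ?cmod_ge0.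
apply: ler_pM; rewrite ?exprn_ge0 ?cmod_ge0 //.
  by rewrite lerXn2r ?nnegrE ?cmod_ge0.
by rewrite cmodV lef_pV2 ?posrE ?divr_gt0 ?cmod_gt0.
Qed.

(** The remainder is uniform on the sphere, so integrating it against [g] keeps its quadratic order:
    differentiation under the integral sign for every [g] integrable on the sphere. *)
Lemma uexp_integral (mu : {measure set (BCn R n) -> \bar R}) (g : Cn -> C) p q M :
  cintegrable mu S (g : BCn R n -> C) -> uexp p q M ->
  exists B dl : R, [/\ 0 <= B, 0 < dl & forall h, vnorm h < dl ->
    cmod (cint mu S (fun xi => g xi * p h xi) - cint mu S (fun xi => g xi * q xi) -
          \sum_j h 0 j * cint mu S (fun xi => g xi * M j xi)) <= B * vnorm h ^+ 2].
Proof.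
move=> ig [mq mM [B [dl [B0 d0 mp hp]]]].
have mS : measurable S by exact: measurable_csphere.
have S1 xi : S xi -> vnorm xi <= 1 by move=> /csphere_vnorm ->.
have mg := cintegrable_meas ig.
have dom (u : Cn -> C) (K : R) : cmeas S (u : BCn R n -> C) -> (forall xi, S xi -> cmod (u xi) <= K) ->
    cintegrable mu S (fun xi : BCn R n => g xi * u xi).
  move=> mu' hu; apply: (@le_cintegrable _ _ _ mu S mS _ (fun xi => K * cmod (g xi))).
  - exact: cmeasM.
  - by apply: integrable_realZl => //; exact: cintegrable_cmod.
  - by move=> x Sx; rewrite cmodM mulrC ler_wpM2r ?cmod_ge0 ?hu.
exists (B * \int[mu]_(x in S) cmod (g x)), dl; split => //.
  by rewrite mulr_ge0 // Rintegral_ge0 // => x _; exact: cmod_ge0.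
move=> h hh.
have iq : cintegrable mu S (fun xi : BCn R n => g xi * q xi).
  by apply: (@dom q B) => // xi /S1/hp[].
have iM j : cintegrable mu S (fun xi : BCn R n => g xi * M j xi).
  by apply: (@dom (M j) B) => // xi /S1/hp[].
pose r xi := p h xi - q xi - \sum_j h 0 j * M j xi.
have mr : cmeas S (r : BCn R n -> C).
  apply: cmeasB; first by apply: cmeasB => //; exact: mp.
  by apply: cmeas_sum => j; exact: cmeasZ.
have hr xi : S xi -> cmod (r xi) <= B * vnorm h ^+ 2 by move=> /S1/hp[_ _ /(_ h hh)].
have ir := dom r _ mr hr.
have is_ : cintegrable mu S (fun xi : BCn R n => \sum_j h 0 j * (g xi * M j xi)).
  by apply: cintegrable_sum => // j; exact: cintegrableZ.
have -> : cint mu S (fun xi => g xi * p h xi) =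
    cint mu S (fun xi : BCn R n => g xi * r xi) + cint mu S (fun xi : BCn R n => g xi * q xi) +
    cint mu S (fun xi : BCn R n => \sum_j h 0 j * (g xi * M j xi)).
  rewrite -!cintD //; last exact: cintegrableD.
  apply: eq_cint => x _; rewrite /r.
  have -> : \sum_j h 0 j * (g x * M j x) = g x * \sum_j h 0 j * M j x.
    by rewrite mulr_sumr; apply: eq_bigr => j _; rewrite mulrCA.
  ring.
rewrite cint_sum //; last by move=> j; exact: cintegrableZ.
rewrite (eq_bigr (fun j => h 0 j * cint mu S (fun xi : BCn R n => g xi * M j xi))); last first.
  by move=> j _; rewrite cintZ.
rewrite [X in cmod X](_ : _ = cint mu S (fun xi : BCn R n => g xi * r xi)); last by ring.
apply: (le_trans (cmod_cint_le mS ir)).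
rewrite [X in _ <= X]mulrAC -RintegralZl //; last exact: cintegrable_cmod.
  apply: le_Rintegral => //; first exact: cintegrable_cmod.
    by apply: integrable_realZl => //; exact: cintegrable_cmod.
  by move=> x Sx; rewrite cmodM mulrC ler_wpM2r ?cmod_ge0 ?hr.
Qed.

End UniformExpansion.

(** * The Szego kernel and polarization *)

Section SzegoKernel.
Context {R : realType} {m : nat}.
Local Notation n := m.+1.
Local Notation C := (Cplx R).
Local Notation Cn := 'rV[Cplx R]_n.
Local Notation S := (csphere : set (BCn R n)).
Implicit Types (z w xi : Cn).

(** [cauchy_kernel] in terms of [cdot], with the positivity of the dimension built into the type;
    holomorphic in [z], antiholomorphic in [xi]. *)
Definition szego z xi : C := (1 - cdot z xi) ^- n.

Lemma kden_ge z xi : vnorm xi <= 1 -> 1 - vnorm z <= cmod (1 - cdot z xi).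
Proof.
move=> hx; have := lerB_cmod 1 (cdot z xi); rewrite cmod1.
have := cauchy_schwarz_cdot z xi; have : vnorm z * vnorm xi <= vnorm z.
  by rewrite ler_piMr ?vnorm_ge0.
lra.
Qed.

Lemma kden_neq0 z xi : vnorm z < 1 -> vnorm xi <= 1 -> 1 - cdot z xi != 0.
Proof.
by move=> hz hx; rewrite -cmod_gt0 (lt_le_trans _ (kden_ge z hx)) // subr_gt0.
Qed.

Lemma szego_bound z xi : vnorm z < 1 -> vnorm xi <= 1 ->
  cmod (szego z xi) <= (1 - vnorm z) ^- n.
Proof.
move=> hz hx; have z0 : 0 < 1 - vnorm z by rewrite subr_gt0.
rewrite /szego cmodV cmodX lef_pV2 ?posrE ?exprn_gt0 ?cmod_gt0 ?kden_neq0 //.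
by rewrite lerXn2r ?nnegrE ?cmod_ge0 ?(ltW z0) // kden_ge.
Qed.

Lemma szego_conj z w : (szego z w)^* = szego w z.
Proof. by rewrite /szego cconjV cconjX cconjB cconj1 cdot_conj. Qed.

Lemma vcont_kden z xi : vcont (fun xi => 1 - cdot z xi) xi.
Proof.
have -> : (fun xi => 1 - cdot z xi) = (fun xi => 1 + -1 * cdot z xi).
  by apply/funext => y; rewrite mulN1r.
by apply: vcontD; [exact: vcont_cst|apply: vcontM; [exact: vcont_cst|exact: vcont_cdotr]].
Qed.

Lemma vcont_szego z xi : vnorm z < 1 -> vnorm xi <= 1 -> vcont (szego z) xi.
Proof.
move=> hz hx; apply: (@vcontV _ _ (fun xi => (1 - cdot z xi) ^+ n)).
  by rewrite expf_neq0 // kden_neq0.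
by apply: vcontX; exact: vcont_kden.
Qed.

Lemma csphere_le1 xi : S xi -> vnorm xi <= 1.
Proof. by move=> /csphere_vnorm ->. Qed.

Lemma cmeas_szego z : vnorm z < 1 -> cmeas S (szego z : BCn R n -> C).
Proof.
move=> hz; apply: vcont_cmeas; first exact: measurable_csphere.
by move=> x Sx; apply: vcont_szego => //; exact: csphere_le1.
Qed.

Lemma szego_uexp z : vnorm z < 1 ->
  exists M : 'I_n -> Cn -> C, uexp (fun h xi => szego (z + h) xi) (szego z) M.
Proof.
move=> hz.
have c0 : 0 < 1 - vnorm z by rewrite subr_gt0.
have hl xi : vnorm xi <= 1 ->
    1 - vnorm z <= cmod (1 - cdot z xi) /\ forall j, cmod ((xi 0 j)^*) <= 1.
  move=> hx; split => [|j]; first exact: kden_ge.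
  by rewrite cmod_conj (le_trans (cmod_coord _ _)).
have [M hM] := uexpX n (uexp_inv c0 (vcont_kden z) (fun j xi => vcont_conj (vcont_coord j xi)) hl).
exists M; move: hM; congr (uexp _ _ M).
  apply/funext => h; apply/funext => xi; rewrite /= /szego -exprVn -cdot_sum cdotDl.
  by congr (_ ^-1 ^+ _); rewrite opprD addrA.
by apply/funext => xi; rewrite /szego -exprVn.
Qed.

Lemma cauchy_integral_differentiable (mu : {measure set (BCn R n) -> \bar R}) (g : Cn -> C) z :
  cintegrable mu S (g : BCn R n -> C) -> vnorm z < 1 ->
  differentiable (fun z : Cn => cint mu S (fun xi : BCn R n => g xi * szego z xi)) z.
Proof.
move=> ig hz; have [M hM] := szego_uexp hz.
have [B [dl [B0 d0 hB]]] := uexp_integral ig hM.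
apply: (differentiable_expansion (D := fun j => cint mu S (fun xi : BCn R n => g xi * M j xi))) => e e0.
have B1 : 0 < B + 1 by rewrite ltr_wpDl.
exists (Num.min dl (e / (B + 1))); first by rewrite lt_min d0 divr_gt0.
move=> h; rewrite lt_min ltr_pdivlMr // => /andP[/hB h1 h2]; apply: (le_trans h1).
rewrite expr2 mulrA ler_wpM2r ?vnorm_ge0 //.
by have := vnorm_ge0 h; nra.
Qed.

Lemma szego_differentiable z w : vnorm z < 1 -> vnorm w <= 1 ->
  differentiable (fun z : Cn => szego z w) z.
Proof.
move=> hz hw; have [M [_ _ [B [dl [B0 d0 _ hB]]]]] := szego_uexp hz.
apply: (differentiable_expansion (D := M^~ w)) => e e0.
have B1 : 0 < B + 1 by rewrite ltr_wpDl.
exists (Num.min dl (e / (B + 1))); first by rewrite lt_min d0 divr_gt0.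
move=> h; rewrite lt_min ltr_pdivlMr // => /andP[h0 h2].
have [_ _ /(_ h h0) h1] := hB w hw; apply: (le_trans h1).
rewrite expr2 mulrA ler_wpM2r ?vnorm_ge0 //.
by have := vnorm_ge0 h; nra.
Qed.

Definition szego_gram (mu : {measure set (BCn R n) -> \bar R}) z w : C :=
  cint mu S (fun xi : BCn R n => szego z xi * (szego w xi)^*).

(** With the parameter conjugated in the second slot, the denominators [1 - <a + s c, xi>] and
    [1 - <xi, a' + conj s c'>] are both affine in [s], so [uexp_inv] applies to each with a
    one-dimensional parameter. *)
Lemma szego_gram_cdiff (mu : {measure set (BCn R n) -> \bar R}) (a c a' c' : Cn) (t : C) :
  (mu S < +oo)%E -> vnorm (a + t *: c) < 1 -> vnorm (a' + t^* *: c') < 1 ->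
  cdiff (fun s => szego_gram mu (a + s *: c) (a' + s^* *: c')) t.
Proof.
move=> muS h1 h2.
set z := a + t *: c in h1; set w := a' + t^* *: c' in h2.
have c1 : 0 < 1 - vnorm z by rewrite subr_gt0.
have c2 : 0 < 1 - vnorm w by rewrite subr_gt0.
have hl1 xi : vnorm xi <= 1 ->
    1 - vnorm z <= cmod (1 - cdot z xi) /\ forall j : 'I_1, cmod (cdot c xi) <= vnorm c.
  move=> hx; split => [|j]; first exact: kden_ge.
  by rewrite (le_trans (cauchy_schwarz_cdot _ _)) // ler_piMr ?vnorm_ge0.
have [M1 U1] := uexpX n (@uexp_inv _ n 1 _ (fun _ => cdot c) _ _ c1 (vcont_kden z)
  (fun _ xi => vcont_cdotr c xi) hl1).
have cl xi : vcont (fun xi => 1 - cdot xi w) xi.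
  have -> : (fun xi => 1 - cdot xi w) = (fun xi => (1 - cdot w xi)^*).
    by apply/funext => y; rewrite cconjB cconj1 cdot_conj.
  exact/vcont_conj/vcont_kden.
have gl xi : vnorm xi <= 1 -> 1 - vnorm w <= cmod (1 - cdot xi w).
  move=> hx; have -> : 1 - cdot xi w = (1 - cdot w xi)^* by rewrite cconjB cconj1 cdot_conj.
  by rewrite cmod_conj kden_ge.
have hl2 xi : vnorm xi <= 1 ->
    1 - vnorm w <= cmod (1 - cdot xi w) /\ forall j : 'I_1, cmod (cdot xi c') <= vnorm c'.
  move=> hx; split => [|j]; first exact: gl.
  by rewrite (le_trans (cauchy_schwarz_cdot _ _)) // ler_piMl ?vnorm_ge0.
have [M2 U2] := uexpX n (@uexp_inv _ n 1 _ (fun _ xi => cdot xi c') _ _ c2 cl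
  (fun _ xi => vcont_cdotl c' xi) hl2).
have i1 : cintegrable mu S (fun=> 1 : C).
  apply: (@cintegrable_bounded _ _ _ mu S measurable_csphere _ 1 muS); first exact: cmeas_cst.
  by move=> x _; rewrite cmod1.
have [B [dl [B0 d0 hB]]] := uexp_integral i1 (uexpM U1 U2).
exists (cint mu S (fun xi : BCn R n => 1 * ((1 - cdot z xi)^-1 ^+ n * M2 0 xi +
  M1 0 xi * (1 - cdot xi w)^-1 ^+ n))) => e e0.
have B1 : 0 < B + 1 by rewrite ltr_wpDl.
exists (Num.min dl (e / (B + 1))); first by rewrite lt_min d0 divr_gt0.
move=> h; rewrite lt_min ltr_pdivlMr // => /andP[hd he].
pose hr : 'rV[C]_1 := const_mx h.
have vr : vnorm hr = cmod h.
  apply/eqP; rewrite -(eqrXn2 (n := 2)) ?vnorm_ge0 ?cmod_ge0 // sqr_vnorm_sum big_ord1.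
  by rewrite mxE.
have := hB hr; rewrite vr => /(_ hd).
set T := (X in cmod (_ - _ - X)); set D := (X in _ -> cmod (_ - _ - X * h) <= _).
have -> : T = D * h by rewrite /T big_ord1 [hr 0 0]mxE mulrC.
clear T; set I1 := (X in cmod (X - _ - _)); set I0 := (X in cmod (_ - X - _)).
have -> : szego_gram mu (a + (t + h) *: c) (a' + (t + h)^* *: c') = I1.
  apply: eq_cint => xi _; rewrite szego_conj /szego mul1r -!exprVn !big_ord1 [hr 0 0]mxE.
  congr (_^-1 ^+ _ * _^-1 ^+ _); first by rewrite /z !cdotDl !cdotZl; ring.
  by rewrite /w !cdotDr !cdotZr !cconjK; ring.
have -> : szego_gram mu (a + t *: c) (a' + t^* *: c') = I0.
  by apply: eq_cint => xi _; rewrite szego_conj /szego mul1r -!exprVn.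
move=> /le_trans; apply.
rewrite expr2 mulrA ler_wpM2r ?cmod_ge0 //.
by have := cmod_ge0 h; nra.
Qed.

End SzegoKernel.

(** * Polarization of sesqui-holomorphic functions *)

Section Polarization.
Context {R : realType} {n : nat}.
Local Notation C := (Cplx R).
Local Notation Cn := 'rV[Cplx R]_n.

Lemma cdiff_conj (f : C -> C) (t : C) : cdiff f (t^*) -> cdiff (fun s => (f (s^*))^*) t.
Proof.
move=> [d hd]; exists d^* => e /hd[dl d0 h]; exists dl => // s hs.
have := h s^*; rewrite cmod_conj => /(_ hs).
by rewrite -[X in X <= _ -> _]cmod_conj !cconjB cconjM cconjK cconjD.
Qed.

(* Holomorphy in the first and antiholomorphy in the second argument, tested on pairs of
   complex lines with conjugate parameters. *)
Definition sesqui_holo (F : Cn -> Cn -> C) := forall (a c a' c' : Cn) (t : C),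
  vnorm (a + t *: c) < 1 -> vnorm (a' + t^* *: c') < 1 ->
  cdiff (fun s => F (a + s *: c) (a' + s^* *: c')) t.

(** With [p = (z + w) / 2] and [d = (z - w) / 2], the function [s |-> F (p + s d) (p - conj s d)] is
    holomorphic; it equals [F z w] at [s = 1], and at [s = i y] both arguments coincide, so its
    zeros accumulate at 0. *)
Lemma polarization F : sesqui_holo F -> (forall z, vnorm z < 1 -> F z z = 0) ->
  forall z w, vnorm z < 1 -> vnorm w < 1 -> F z w = 0.
Proof.
move=> hF F0.
(* The bound 1/4 keeps both lines inside the ball for [|s| < 2], a disc that contains [s = 1]. *)
have small z w : vnorm z < 1 / 4 -> vnorm w < 1 / 4 -> F z w = 0.
  move=> hz hw; pose p := (2^-1 : C) *: (z + w); pose d := (2^-1 : C) *: (z - w).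
  have c2 : cmod (2^-1 : C) = 2^-1 by rewrite cmodV cmod_natr.
  have hp : vnorm p < 1 / 4 by rewrite vnormZ c2; have := vnormD z w; lra.
  have hd : vnorm d < 1 / 4 by rewrite vnormZ c2; have := vnormD z (- w); rewrite vnormN; lra.
  have bnd (x : Cn) (s : C) : vnorm x < 1 / 4 -> cmod s < 2 -> vnorm (p + s *: x) < 1.
    move=> hx hs; apply: (le_lt_trans (vnormD _ _)); rewrite vnormZ.
    have := vnorm_ge0 x; have := cmod_ge0 s; nra.
  have := @analytic_identity _ (fun s => F (p + s *: d) (p + s^* *: (- d))) 2 _ _ 1.
  rewrite cmod1 cconj1 !scale1r => h.
  have E1 : p + d = z.
    by apply/rowP => j; rewrite /p /d !mxE; field.
  have E2 : p - d = w.
    by apply/rowP => j; rewrite /p /d !mxE; field.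
  rewrite E1 E2 in h; apply: h => [s hs|e e0|]; last by rewrite ltr1n.
    by apply: hF; apply: bnd; rewrite ?vnormN ?cmod_conj.
  pose y := Num.min (e / 2) 1; have y0 : 0 < y by rewrite lt_min divr_gt0 ?ltr01.
  have y1 : y < e by rewrite (@le_lt_trans _ _ (e / 2)) ?ge_min ?lexx // ltr_pdivrMr // ltr_pMr // ltr1n.
  have y2 : y <= 1 by rewrite ge_min lexx orbT.
  clearbody y; have cy : cmod (Complex 0 y : C) = y.
    by rewrite cmodE /= expr0n add0r sqrtr_sqr gtr0_norm.
  exists (Complex 0 y); split; rewrite ?cy // -?cmod_gt0 ?cy //.
  have -> : (Complex 0 y : C)^* = - Complex 0 y.
    by rewrite conjE; apply: cplxP; rewrite /= ?oppr0.
  rewrite scaleNr scalerN opprK F0 //; apply: bnd => //.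
  by rewrite cy (le_lt_trans y2) // ltr1n.
have radius (x : Cn) : vnorm x < 1 -> exists rho : R, [/\ 1 < rho & forall s : C, cmod s < rho -> vnorm (s *: x) < 1].
  move=> hx; have x0 := vnorm_ge0 x; have x1 : 0 < 1 + vnorm x by rewrite ltr_wpDr.
  exists (2 / (1 + vnorm x)); split; first by rewrite ltr_pdivlMr //; lra.
  by move=> s; rewrite ltr_pdivlMr // vnormZ => h; have := cmod_ge0 s; nra.
have real_zero (e : R) : 0 < e -> exists y : R, [/\ 0 < y, y < e & y < 1 / 4].
  move=> e0; exists (Num.min (e / 2) (1 / 8)); split.
  - by rewrite lt_min !divr_gt0.
  - by rewrite (@le_lt_trans _ _ (e / 2)) ?ge_min ?lexx // ltr_pdivrMr // ltr_pMr // ltr1n.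
  - by rewrite (@le_lt_trans _ _ (1 / 8)) ?ge_min ?lexx ?orbT //; lra.
(* The vanishing is extended one argument at a time along the complex line through 0, where small
   parameters fall under the case already known. *)
have half z w : vnorm z < 1 / 4 -> vnorm w < 1 -> F z w = 0.
  move=> hz hw; have [rho [rho1 hrho]] := radius w hw.
  have := @analytic_identity _ (fun s => F (z + s *: 0) (0 + s^* *: w)) rho _ _ 1.
  rewrite cmod1 cconj1 scaler0 addr0 add0r scale1r; apply => // [s hs|e e0].
    apply: hF; first by rewrite scaler0 addr0; lra.
    by rewrite add0r; apply: hrho; rewrite cmod_conj.
  have [y [y0 ye y4]] := real_zero e e0.
  have cy : cmod (ofReal y : C) = y by rewrite cmod_ofReal gtr0_norm.
  exists (ofReal y); split; rewrite ?cy // -?cmod_gt0 ?cy //.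
  rewrite scaler0 addr0 add0r; apply: small => //.
  rewrite vnormZ cmod_conj cy; have := vnorm_ge0 w; nra.
move=> z w hz hw; have [rho [rho1 hrho]] := radius z hz.
have := @analytic_identity _ (fun s => F (0 + s *: z) (w + s^* *: 0)) rho _ _ 1.
rewrite cmod1 scaler0 addr0 add0r scale1r; apply => // [s hs|e e0].
  apply: hF; last by rewrite scaler0 addr0.
  by rewrite add0r; exact: hrho.
have [y [y0 ye y4]] := real_zero e e0.
have cy : cmod (ofReal y : C) = y by rewrite cmod_ofReal gtr0_norm.
exists (ofReal y); split; rewrite ?cy // -?cmod_gt0 ?cy //.
rewrite scaler0 addr0 add0r; apply: half => //.
rewrite vnormZ cy; have := vnorm_ge0 z; nra.
Qed.

End Polarization.

(** * The Gram matrix of the Clark measure *)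

Section SesquiHolo.
Context {R : realType} {n : nat}.
Local Notation C := (Cplx R).
Local Notation Cn := 'rV[Cplx R]_n.
Implicit Types (F G : Cn -> Cn -> C).

Lemma sesqui_holoB F G : sesqui_holo F -> sesqui_holo G ->
  sesqui_holo (fun z w => F z w - G z w).
Proof. by move=> hF hG a c a' c' t h1 h2; apply: cdiffB; [exact: hF|exact: hG]. Qed.

Lemma sesqui_holoM F G : sesqui_holo F -> sesqui_holo G ->
  sesqui_holo (fun z w => F z w * G z w).
Proof. by move=> hF hG a c a' c' t h1 h2; apply: cdiffM; [exact: hF|exact: hG]. Qed.

Lemma sesqui_holo_cst (k : C) : sesqui_holo (fun _ _ : Cn => k).
Proof. by move=> a c a' c' t _ _; exact: cdiff_cst. Qed.

Lemma sesqui_hololl (f : Cn -> C) : (forall z, vnorm z < 1 -> differentiable f z) ->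
  sesqui_holo (fun z _ => f z).
Proof. by move=> hf a c a' c' t h1 _; apply: slice_cdiff; exact: hf. Qed.

Lemma sesqui_holor (f : Cn -> C) : (forall z, vnorm z < 1 -> differentiable f z) ->
  sesqui_holo (fun _ w => (f w)^*).
Proof.
move=> hf a c a' c' t _ h2.
by apply: (@cdiff_conj _ (fun s => f (a' + s *: c'))); apply: slice_cdiff; exact: hf.
Qed.

End SesquiHolo.

Lemma sesqui_holo_szego (R : realType) (m : nat) : sesqui_holo (@szego R m).
Proof.
move=> a c a' c' t h1 h2; apply: (@cdiffV _ (fun s =>
  (1 - cdot (a + s *: c) (a' + s^* *: c')) ^+ m.+1)).
  by rewrite expf_neq0 // kden_neq0 // ltW.
apply: cdiffX; apply: cdiffB; first exact: cdiff_cst.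
have -> : (fun s => cdot (a + s *: c) (a' + s^* *: c')) = (fun s =>
    cdot a a' + s * (cdot a c' + cdot c a' + s * cdot c c')).
  by apply/funext => s; rewrite !cdotDl !cdotDr !cdotZl !cdotZr cconjK; ring.
apply: cdiffD; first exact: cdiff_cst.
apply: cdiffM; first exact: cdiff_id.
apply: cdiffD; first exact: cdiff_cst.
by apply: cdiffM; [exact: cdiff_id|exact: cdiff_cst].
Qed.

Section ClarkMeasure.
Context {R : realType} {m : nat}.
Local Notation n := m.+1.
Local Notation C := (Cplx R).
Local Notation Cn := 'rV[Cplx R]_n.
Local Notation S := (csphere : set (BCn R n)).
Variables (mu : {measure set (BCn R n) -> \bar R}) (b : Cn -> C).
Implicit Types (z w xi : Cn).
Hypothesis hb : forall z, vnorm z < 1 -> differentiable b z.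
Hypothesis bnc : exists z w, [/\ vnorm z < 1, vnorm w < 1 & b z != b w].
Hypothesis clark : is_Clark_measure b mu.

Lemma sqr_vnorm_lt1 (z : Cn) : vnorm z < 1 -> 0 < 1 - vnorm z ^+ 2.
Proof. by move=> hz; rewrite subr_gt0 expr_lt1 ?vnorm_ge0. Qed.

(** Up to a factor depending on [z] alone, the Poisson kernel is the squared modulus of the Cauchy
    kernel; thus the Clark identity prescribes the diagonal of [szego_gram]. *)
Lemma poisson_szego (z xi : Cn) :
  ofReal (poisson_kernel z xi) =
  ofReal ((1 - vnorm z ^+ 2) ^+ n) * (szego z xi * (szego z xi)^*).
Proof.
rewrite mul_conj -ofRealM /poisson_kernel sqnorm_vnorm -cdotE; congr ofReal.
by rewrite expr_div_n /szego cmodV cmodX exprVn -!exprM mulnC.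
Qed.

Lemma clark_total : mu S = (complex.Re ((1 + b 0) / (1 - b 0)))%:E.
Proof.
have h0 : cball (0 : Cn) by apply/cball_vnorm; rewrite vnorm0.
case: clark => _ /(_ _ h0) <-.
rewrite (_ : (fun xi => _) = cst 1%E) ?integral_cst ?mul1e //; first exact: measurable_csphere.
apply/funext => xi; have /ofReal_inj -> : ofReal (poisson_kernel 0 xi) = ofReal 1 => //.
by rewrite poisson_szego /szego cdot0l vnorm0 expr0n !subr0 !expr1n invr1 cconj1 !mul1r.
Qed.

Lemma clark_finite : (mu S < +oo)%E.
Proof. by rewrite clark_total ltry. Qed.

Lemma sqint_szego z : vnorm z < 1 -> sqint mu S (szego z : BCn R n -> C).
Proof.
move=> hz; apply: (sqint_bounded measurable_csphere (M := (1 - vnorm z) ^- n)).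
- exact: clark_finite.
- exact: cmeas_szego.
- by move=> x Sx; exact/szego_bound/csphere_le1.
Qed.

Lemma clark_diag z : vnorm z < 1 ->
  ofReal ((1 - vnorm z ^+ 2) ^+ n) * szego_gram mu z z =
  ofReal (complex.Re ((1 + b z) / (1 - b z))).
Proof.
move=> hz; have iz := sqint_szego hz.
rewrite -(cintZ measurable_csphere) ; last exact: (sqint_mul measurable_csphere iz iz).
have /cball_vnorm/(proj2 clark) := hz; move=> h.
rewrite (@eq_cint _ _ _ mu S _ (fun xi : BCn R n => ofReal (poisson_kernel z xi))); last first.
  by move=> x _; rewrite poisson_szego.
apply: cplxP => /=; first by rewrite /Rintegral h.
by rewrite /Rintegral integral0.
Qed.

Lemma Re_cayley (x : C) : x != 1 ->
  complex.Re ((1 + x) / (1 - x)) * cmod (1 - x) ^+ 2 = 1 - cmod x ^+ 2.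
Proof.
move=> x1; have d0 : 1 - x != 0 by rewrite subr_eq0 eq_sym.
have -> : (1 + x) / (1 - x) = ofReal (cmod (1 - x) ^- 2) * ((1 + x) * (1 - x)^*).
  have : (1 - x)^* != 0 by rewrite conjC_eq0.
  rewrite ofRealV -mul_conj; set y := (1 - x)^*; clearbody y => y0.
  by field; rewrite y0 d0.
rewrite cReZ mulrC mulrA divff ?mul1r; last by rewrite expf_neq0 // cmod_eq0.
by rewrite cReM !sqr_cmod cRe_conj cIm_conj cReD cReB cImD cImB cRe1 cIm1; ring.
Qed.

(* If [b z = 1], division by zero makes the right-hand side of the Clark identity 0 at [z]; then
   [mu = 0], so that [|b| = 1] on the whole ball. *)
Lemma clark_neq1 z : vnorm z < 1 -> b z != 1.
Proof.
move=> hz; apply/eqP => bz1.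
have muS0 : mu S = 0%E.
  have := proj2 clark z; rewrite bz1 subrr invr0 mulr0 => /(_ (proj2 (cball_vnorm z) hz)) h.
  (* A lower bound of the Poisson kernel on the sphere, where [|1 - <z, xi>| <= 2]; a vanishing
     Poisson integral therefore forces total mass 0. *)
  have c0 : 0 < ((1 - vnorm z ^+ 2) / 4) ^+ n.
    by rewrite exprn_gt0 // divr_gt0 // sqr_vnorm_lt1.
  have : (\int[mu]_(xi in S) (((1 - vnorm z ^+ 2) / 4) ^+ n)%:E <= 0)%E.
    rewrite -[leRHS]h; apply: ge0_le_integral => //.
    - exact: measurable_csphere.
    - by move=> x _; rewrite lee_fin ltW.
    - apply/measurable_EFinP.
      rewrite (_ : poisson_kernel z = (fun xi : Cn => complex.Re (ofReal ((1 - vnorm z ^+ 2) ^+ n) * (szego z xi * (szego z xi)^*)))).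
        have /(cmeasZ (ofReal ((1 - vnorm z ^+ 2) ^+ n)))[] // : cmeas S (fun xi : BCn R n => szego z xi * (szego z xi)^*).
        apply: cmeasM; first exact: cmeas_szego.
        by apply: cmeas_conj; exact: cmeas_szego.
      by apply/funext => xi; rewrite -poisson_szego.
    - move=> x Sx; rewrite lee_fin /poisson_kernel sqnorm_vnorm -cdotE.
      have v0 := ltW (sqr_vnorm_lt1 hz).
      have d0 := kden_neq0 hz (csphere_le1 Sx).
      rewrite lerXn2r ?nnegrE //.
      + by rewrite divr_ge0.
      + by rewrite divr_ge0 ?sqr_ge0.
      + rewrite ler_wpM2l //.
        rewrite lef_pV2 ?posrE ?exprn_gt0 ?cmod_gt0 //.
        have := ler_cmodB 1 (cdot z x); have := cauchy_schwarz_cdot z x.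
        rewrite cmod1 (proj1 (csphere_vnorm x) Sx) mulr1; have := cmod_ge0 (1 - cdot z x).
        move: hz; nra.
  rewrite integral_cst; last exact: measurable_csphere.
  move=> h0; have := measure_ge0 mu S; rewrite le_eqVlt => /orP[/eqP //|mu0].
  have c1 : (0 < (((1 - vnorm z ^+ 2) / 4) ^+ n)%:E)%E by rewrite lte_fin.
  by have := lt_le_trans (mule_gt0 c1 mu0) h0; rewrite ltxx.
have mod1 w : vnorm w < 1 -> b w * (b w)^* = 1.
  move=> hw; rewrite mul_conj; case: (eqVneq (b w) 1) => [->|bw]; first by rewrite cmod1 expr1n.
  have := clark_diag hw; have -> : szego_gram mu w w = 0.
    apply: cmod_small_eq0 => e e0; rewrite (le_trans _ (ltW e0)) //.
    have := @cmod_cint_bounded _ _ _ mu S measurable_csphere (fun xi : BCn R n => szego w xi * (szego w xi)^*) ((1 - vnorm w) ^- n * (1 - vnorm w) ^- n).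
    rewrite muS0 mulr0; apply => //.
      apply: cmeasM; first exact: cmeas_szego.
      by apply: cmeas_conj; exact: cmeas_szego.
    move=> x Sx; rewrite cmodM cmod_conj ler_pM ?cmod_ge0 //; exact/szego_bound/csphere_le1.
  rewrite mulr0 => /esym/eqP; rewrite ofReal_eq0 => /eqP h.
  by have := Re_cayley bw; rewrite h mul0r => /esym/eqP; rewrite subr_eq0 => /eqP <-.
(* Polarizing [|b|^2 = 1] gives [b x * conj (b y) = 1] for all [x] and [y]; taking [y = z], where
   [b z = 1], makes [b] constant. *)
have F0 : sesqui_holo (fun x y => 1 - b x * (b y)^*).
  apply: sesqui_holoB; first exact: sesqui_holo_cst.
  by apply: sesqui_holoM; [exact: sesqui_hololl|exact: sesqui_holor].
have := polarization F0 => h.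
have {}h x : vnorm x < 1 -> b x = 1.
  have k (y : Cn) : vnorm y < 1 -> 1 - b y * (b y)^* = 0 by move=> /mod1->; rewrite subrr.
  move=> hx; have := h k x z hx hz.
  by rewrite bz1 cconj1 mulr1 => /eqP; rewrite subr_eq0 => /eqP.
by have [x [y [hx hy]]] := bnc; rewrite !h ?eqxx.
Qed.

(** Denominators are cleared so that both sides are sesqui-holomorphic on the whole ball; the
    nonvanishing of [1 - b] enters on the diagonal, through [Re_cayley]. *)
Lemma clark_gram z w : vnorm z < 1 -> vnorm w < 1 ->
  szego_gram mu z w * ((1 - b z) * (1 - (b w)^*)) = szego z w * (1 - b z * (b w)^*).
Proof.
move=> hz hw; apply/eqP; rewrite -subr_eq0; apply/eqP; move: z w hz hw.
apply: (@polarization _ _ (fun z w => szego_gram mu z w * ((1 - b z) * (1 - (b w)^*)) -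
  szego z w * (1 - b z * (b w)^*))).
  have h1 := @sesqui_hololl _ _ b hb; have h2 := @sesqui_holor _ _ b hb.
  have h3 := sesqui_holo_cst (1 : C).
  apply: sesqui_holoB; apply: sesqui_holoM.
  - by move=> a c a' c' t ? ?; apply: szego_gram_cdiff => //; exact: clark_finite.
  - by apply: sesqui_holoM; apply: sesqui_holoB.
  - exact: sesqui_holo_szego.
  - by apply: sesqui_holoB => //; apply: sesqui_holoM.
move=> z hz; have h := clark_diag hz; have bz := clark_neq1 hz.
have v0 : 1 - vnorm z ^+ 2 != 0.
  by rewrite gt_eqF // sqr_vnorm_lt1.
have -> : 1 - (b z)^* = (1 - b z)^* by rewrite cconjB cconj1.
have -> : 1 - b z * (b z)^* = ofReal ((1 - vnorm z ^+ 2) ^+ n) * szego_gram mu z z * ((1 - b z) * (1 - b z)^*).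
  by rewrite h !mul_conj -ofRealM (Re_cayley bz) ofRealB.
have -> : szego z z = (ofReal ((1 - vnorm z ^+ 2) ^+ n))^-1.
  by rewrite /szego cdot_self [ofReal (_ ^+ n)]ofRealX ofRealB.
by rewrite -!mulrA mulKf ?subrr // ofReal_eq0 expf_neq0.
Qed.

End ClarkMeasure.

(** * Unitary invariance *)

Section Unitary.
Context {R : realType} {m : nat}.
Local Notation n := m.+1.
Local Notation C := (Cplx R).
Local Notation Cn := 'rV[Cplx R]_n.
Implicit Types (U : 'M[C]_n) (x y u : Cn).

Lemma cdot_unitary U x y : U \is unitarymx -> cdot (x *m U) (y *m U) = cdot x y.
Proof.
move=> hU; rewrite !cdotE !dotmxE trmx_mul map_mxM -mulmxA (mulmxA U).
by move/unitarymxP: hU => ->; rewrite mul1mx.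
Qed.

Lemma vnorm_unitary U x : U \is unitarymx -> vnorm (x *m U) = vnorm x.
Proof.
move=> hU; apply/eqP; rewrite -(eqrXn2 (n := 2)) ?vnorm_ge0 //.
by rewrite !sqr_vnorm cdot_unitary.
Qed.

(** Gram-Schmidt applied to the matrix with first row [u] and zeros below: [schmidt] completes the
    family, and its first row is a multiple of [u]. *)
Lemma exists_unitary u : vnorm u = 1 -> exists2 U : 'M[C]_n,
  U \is unitarymx & (delta_mx 0 0 : Cn) *m U = u.
Proof.
move=> hu; pose A : 'M[C]_n := \matrix_i (if i == 0 then u else 0).
have rA : row 0 A = u by rewrite rowK.
exists (schmidt A); first exact: schmidt_unitarymx.
have := row_schmidt_sub A 0; have := form1_row_schmidt A 0; rewrite rA.
rewrite (bigD1 0) //= big1 ?addsmx0; last first.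
  by move=> k /andP[]; rewrite leqn0 => /eqP k0 /eqP[]; exact: val_inj.
rewrite genmxE -rowE; set v := row 0 _ => h1 /sub_rVP[a ua].
have v1 : cdot v v = 1.
  rewrite cdotE; have /row_unitarymxP -> := schmidt_unitarymx A (leqnn n).
  by rewrite eqxx.
(* The multiple is nonnegative by [form1_row_schmidt] and of modulus 1 by normalization, hence equal
   to 1. *)
have a0 : 0 <= a by move: h1; rewrite -cdotE ua cdotZl v1 mulr1.
have : cdot u u = 1 by rewrite cdot_self hu expr1n.
rewrite ua cdotZl cdotZr v1 mulr1 (ge0_cplx a0) conj_ofReal -ofRealM => /ofReal_inj h.
have /eqP : complex.Re a ^+ 2 = 1 ^+ 2 by rewrite expr1n expr2.
rewrite eqrXn2 ?le0Re // => /eqP->.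
by rewrite scale1r.
Qed.

End Unitary.

(** * Rotation invariance of integrals over the sphere *)

Section Invariance.
Context {R : realType} {m : nat}.
Local Notation n := m.+1.
Local Notation C := (Cplx R).
Local Notation Cn := 'rV[Cplx R]_n.
Local Notation S := (csphere : set (BCn R n)).
Variable sigma : {measure set (BCn R n) -> \bar R}.
Hypothesis hs : normalized_rotation_invariant sigma.
Implicit Types (U : 'M[C]_n).

Definition rot U : BCn R n -> BCn R n := fun x : Cn => x *m U.

Lemma preimage_rot_sphere U : U \is unitarymx -> rot U @^-1` S = S.
Proof.
move=> hU; apply/seteqP; split => x; rewrite /preimage /mkset /rot.
  by move=> /csphere_vnorm; rewrite vnorm_unitary // => /csphere_vnorm.
by move=> /csphere_vnorm h; apply/csphere_vnorm; rewrite vnorm_unitary.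
Qed.

Lemma measurable_rot U : U \is unitarymx -> measurable_fun setT (rot U).
Proof.
move=> hU; apply: (@measurability _ _ (BCn R n) (BCn R n) setT (rot U) (@open Cn) erefl).
move=> _ [B oB <-]; rewrite setTI; apply: open_measurable_BCn.
rewrite openE => x Bx; apply/nbhs_rowP.
have /nbhs_rowP[dl d0 h] : nbhs (x *m U) B by move: oB; rewrite openE; apply.
exists dl => // w hw; apply: h.
by rewrite -mulmxBl vnorm_unitary.
Qed.

Lemma ge0_integral_rot U (h : Cn -> \bar R) : U \is unitarymx ->
  measurable_fun S (h : BCn R n -> \bar R) -> (forall x, S x -> (0 <= h x)%E) ->
  (\int[sigma]_(x in S) h (x *m U) = \int[sigma]_(x in S) h x)%E.
Proof.
move=> hU mh h0; have mU := measurable_rot hU.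
rewrite -{1}(preimage_rot_sphere hU) -(ge0_integral_pushforward mU sigma measurable_csphere mh).
  apply: (@eq_measure_integral _ _ _ _ sigma
    (measure_function_pushforward__canonical__measure_function_Measure sigma mU) h) => A mA _.
  by case: hs => _ _; apply.
by move=> x; rewrite inE; exact: h0.
Qed.

Lemma integral_rot U (h : Cn -> R) : U \is unitarymx ->
  measurable_fun S (h : BCn R n -> R) ->
  \int[sigma]_(x in S) h (x *m U) = \int[sigma]_(x in S) h x.
Proof.
move=> hU mh; have {}mh : measurable_fun S (EFin \o h : BCn R n -> \bar R) by exact/measurable_EFinP.
rewrite /Rintegral; congr fine; rewrite integralE [RHS]integralE; congr (_ - _)%E.
  have <- := @ge0_integral_rot U ((EFin \o h)^\+)%E hU (measurable_funepos mh).
    by apply: eq_integral => x _; rewrite !funeposE.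
  by move=> x _; exact: funepos_ge0.
have <- := @ge0_integral_rot U ((EFin \o h)^\-)%E hU (measurable_funeneg mh).
  by apply: eq_integral => x _; rewrite !funenegE.
by move=> x _; exact: funeneg_ge0.
Qed.

Lemma cint_rot U (f : Cn -> C) : U \is unitarymx -> cmeas S (f : BCn R n -> C) ->
  cint sigma S (fun x : BCn R n => f (x *m U)) = cint sigma S (f : BCn R n -> C).
Proof.
move=> hU [m1 m2]; apply: cplxP => /=.
  exact: (integral_rot hU m1).
exact: (integral_rot hU m2).
Qed.

Lemma sigma_finite_total : (sigma S < +oo)%E.
Proof. by case: hs => _ -> _; rewrite ltry. Qed.

End Invariance.

(** * Averages over rotations *)

Section Expansions.
Context {R : realType}.
Local Notation C := (Cplx R).
Implicit Types (g : C -> C) (c : nat -> C) (rho r M : R).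

(** Taylor expansion together with the Cauchy estimates and a geometric remainder. The constants
    depend on [g] only through a bound on a closed disc, so they are common to a uniformly bounded
    family. *)
Definition expands g c rho := forall r M, 0 < r -> r < rho ->
  (forall z, cmod z <= r -> cmod (g z) <= M) ->
  (forall k, cmod (c k) * r ^+ k <= M) /\
  forall z N, cmod z < r -> cmod (g z - \sum_(k < N) c k * z ^+ k) <=
    M * (cmod z / r) ^+ N * (r / (r - cmod z)).

Lemma expands_exists g rho : 0 < rho -> (forall z, cmod z < rho -> cdiff g z) ->
  exists c, expands g c rho.
Proof.
move=> r0 hg; have [c hc] := power_series r0 hg; exists c => r M rp rr hM.
by apply: hc => // y _; apply: hM; rewrite cexp_ln.
Qed.

Lemma expands_half g c rho r M : expands g c rho -> 0 < r -> r < rho ->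
  (forall z, cmod z <= r -> cmod (g z) <= M) ->
  forall z N, cmod z <= r / 2 ->
  cmod (g z - \sum_(k < N) c k * z ^+ k) <= 2 * M * (cmod z / r) ^+ N.
Proof.
move=> hc r0 rr hM z N hz; have zr : cmod z < r by rewrite (le_lt_trans hz) // ltr_pdivrMr // ltr_pMr // ltr1n.
have [_ h] := hc r M r0 rr hM; apply: (le_trans (h z N zr)).
have M0 : 0 <= M by apply: le_trans (hM 0 _); rewrite ?cmod_ge0 // cmod0 ltW.
rewrite mulrC mulrA ler_wpM2r ?exprn_ge0 ?divr_ge0 ?cmod_ge0 ?(ltW r0) //.
rewrite ler_wpM2r // ler_pdivrMr ?subr_gt0 //; move: hz; rewrite ler_pdivlMr //; lra.
Qed.

Lemma expands_uniq g c c' rho r M : 0 < r -> r < rho ->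
  (forall z, cmod z <= r -> cmod (g z) <= M) ->
  expands g c rho -> expands g c' rho -> forall k, c k = c' k.
Proof.
move=> r0 rr hM h h' k; apply/eqP; rewrite -subr_eq0; apply/eqP.
have M0 : 0 <= M by apply: le_trans (hM 0 _); rewrite ?cmod_ge0 // cmod0 ltW.
have r2 : 0 < r / 2 by rewrite divr_gt0.
apply: (@coef_zero _ (fun k => c k - c' k) (4 * M) r (r / 2)) => // [|N z /ltW hz].
  by rewrite mulr_ge0.
have -> : \sum_(j < N) (c j - c' j) * z ^+ j =
    (g z - \sum_(j < N) c' j * z ^+ j) - (g z - \sum_(j < N) c j * z ^+ j).
  rewrite opprB addrC addrA subrK -sumrB.
  by apply: eq_bigr => j _; rewrite mulrBl.
apply: (le_trans (ler_cmodB _ _)).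
have := expands_half h r0 rr hM N hz; have := expands_half h' r0 rr hM N hz; lra.
Qed.

(** Measurability in the parameter: by strong induction, coefficient [k] is the pointwise limit of
    [a_j^-k] times the difference of [G (a_j)] and the lower terms, for reals [a_j] tending to 0. *)
Lemma slice_coef {d} {T : measurableType d} (D : set T) (G : C -> T -> C) rho : 0 < rho ->
  (forall x, D x -> forall z, cmod z < rho -> cdiff (G^~ x) z) ->
  (forall z, cmod z < rho -> cmeas D (G z)) ->
  (forall r, r < rho -> exists M, forall x z, D x -> cmod z <= r -> cmod (G z x) <= M) ->
  exists F : nat -> T -> C, (forall k, cmeas D (F k)) /\
    forall x, D x -> expands (G^~ x) (F^~ x) rho.
Proof.
move=> rho0 hG mG bG.
have /choice[c hc] : forall x, exists c, D x -> expands (G^~ x) c rho.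
  move=> x; case: (pselect (D x)) => Dx; last by exists (fun=> 0).
  by have [c hc] := expands_exists rho0 (hG x Dx); exists c.
exists (fun k x => c x k); split => //; elim/ltn_ind => k IH.
pose r := rho / 2; have r0 : 0 < r by rewrite divr_gt0.
have rr : r < rho by rewrite ltr_pdivrMr // ltr_pMr // ltr1n.
have [M hM] := bG r rr.
(* Starting at [r / 2] keeps these points in the range of [expands_half]. *)
pose a (j : nat) : R := r / j.+2%:R.
have a0 j : 0 < a j by rewrite divr_gt0.
have a2 j : a j <= r / 2 by rewrite ler_wpM2l ?(ltW r0) // lef_pV2 ?posrE // ler_nat.
have aE j : a j / r = j.+2%:R^-1 by rewrite /a mulrAC divff ?mul1r // gt_eqF.
clearbody a; have ca j : cmod (ofReal (a j) : C) = a j by rewrite cmod_ofReal gtr0_norm.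
apply: (@cmeas_lim _ _ _ D (fun j x => (ofReal (a j) ^+ k)^-1 *
  (G (ofReal (a j)) x - \sum_(i < k) c x i * ofReal (a j) ^+ i))) => [j|x Dx e e0].
  apply: cmeasZ; apply: cmeasB.
    by apply: mG; rewrite ca (le_lt_trans (a2 j)) // (lt_trans _ rr) // ltr_pdivrMr // ltr_pMr // ltr1n.
  apply: (@cmeas_sum _ _ _ D 'I_k (index_enum 'I_k) (fun i x => c x i * ofReal (a j) ^+ i)) => i.
  apply: cmeasM; last exact: cmeas_cst.
  exact: (IH i (ltn_ord i)).
have hMx z : cmod z <= r -> cmod (G z x) <= M by exact: hM.
have M0 : 0 <= M by apply: le_trans (hMx 0 _); rewrite ?cmod_ge0 // cmod0 ltW.
pose K := 2 * M / r ^+ k.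
have K0 : 0 <= K by rewrite divr_ge0 ?exprn_ge0 ?(ltW r0) // mulr_ge0.
pose N := Num.bound (K / e).
exists N => j Nj.
have aj0 : ofReal (a j) ^+ k != 0 :> C by rewrite expf_neq0 // ofReal_eq0 gt_eqF.
have -> : (ofReal (a j) ^+ k)^-1 * (G (ofReal (a j)) x - \sum_(i < k) c x i * ofReal (a j) ^+ i) -
    c x k = (ofReal (a j) ^+ k)^-1 * (G (ofReal (a j)) x - \sum_(i < k.+1) c x i * ofReal (a j) ^+ i).
  by rewrite big_ord_recr /=; field.
have aj2 : cmod (ofReal (a j) : C) <= r / 2 by rewrite ca.
have := expands_half (hc x Dx) r0 rr hMx k.+1 aj2; rewrite ca => h.
rewrite cmodM cmodV cmodX ca; apply: (@le_trans _ _ ((a j ^+ k)^-1 * (2 * M * (a j / r) ^+ k.+1))).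
  by rewrite ler_wpM2l // invr_ge0 exprn_ge0 // ltW.
have -> : (a j ^+ k)^-1 * (2 * M * (a j / r) ^+ k.+1) = K / j.+2%:R.
  rewrite /K exprS expr_div_n aE.
  have : a j ^+ k != 0 by rewrite expf_neq0 // gt_eqF.
  have : r ^+ k != 0 by rewrite expf_neq0 // gt_eqF.
  have : j.+2%:R != 0 :> R by rewrite pnatr_eq0.
  move: (a j ^+ k) (r ^+ k) (j.+2%:R : R) => A B D' D0 B0 A0.
  by field; rewrite A0 B0 D0.
rewrite ler_pdivrMr // mulrC -ler_pdivrMr //.
apply: ltW; apply: (@lt_le_trans _ _ N%:R); first by rewrite archi_boundP // divr_ge0 // ltW.
by rewrite ler_nat; lia.
Qed.

End Expansions.

Section UnimodularScalars.
Context {R : realType}.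
Local Notation C := (Cplx R).

(** A rotation acting on degree [k] by the scalar -1, which differs from 1; invariance then
    annihilates the corresponding integrals. *)
Lemma exists_unimodular k : (0 < k)%N -> exists2 x : C, cmod x = 1 & x ^+ k = -1.
Proof.
move=> k0; exists (k.-root (-1 : C)); last exact: rootCK.
have /(congr1 cmod) := rootCK k0 (-1 : C); rewrite cmodX cmodN cmod1 => h.
by apply/eqP; rewrite -(eqrXn2 (n := k)) ?cmod_ge0 // expr1n h.
Qed.

Lemma exists_unimodular_diff k l : k <> l ->
  exists2 x : C, cmod x = 1 & x ^+ k * (x ^+ l)^* = -1.
Proof.
have main p q : (p < q)%N -> exists2 x : C, cmod x = 1 & x ^+ q * (x ^+ p)^* = -1.
  move=> pq; have qp : (0 < q - p)%N by rewrite subn_gt0.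
  have [x x1 hx] := exists_unimodular qp.
  exists x => //; rewrite -(subnK (ltnW pq)) exprD -mulrA mul_conj cmodX x1.
  by rewrite !expr1n hx mulr1.
case: (ltngtP k l) => // [kl|lk] _; last exact: main.
have [x x1 hx] := main _ _ kl; exists x => //.
by rewrite -[LHS]cconjK cconjM cconjK mulrC hx cconjN cconj1.
Qed.

End UnimodularScalars.

Section PolynomialIdentity.
Context {R : realType}.
Local Notation C := (Cplx R).

Lemma poly_ext (p q : {poly C}) : (forall t : C, p.[t] = q.[t]) -> p = q.
Proof.
move=> h; apply/eqP; rewrite -subr_eq0; apply/negPn/negP => d0.
have := max_poly_roots (rs := [seq i%:R | i <- iota 0 (size (p - q))]) d0.
rewrite size_map size_iota ltnn map_inj_uniq ?iota_uniq; last first.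
  by move=> i j /eqP; rewrite eqr_nat => /eqP.
have -> : all (root (p - q)) [seq i%:R | i <- iota 0 (size (p - q))].
  by apply/allP => _ /mapP[i _ ->]; rewrite /root hornerD hornerN h subrr.
by move=> /(_ isT isT).
Qed.

End PolynomialIdentity.

(** * Holomorphy along complex lines *)

Section SliceHolomorphic.
Context {R : realType} {n : nat}.
Local Notation C := (Cplx R).
Local Notation Cn := 'rV[Cplx R]_n.
Implicit Types (f : Cn -> C) (rho : R).

(** What the averaging arguments need of holomorphy, on a ball of arbitrary radius: it passes to
    dilates, whose radius exceeds 1, and to rotations. *)
Definition sliceholo rho f := (forall z, vnorm z < rho -> vcont f z) /\
  forall (z v : Cn) t, vnorm (z + t *: v) < rho -> cdiff (fun s => f (z + s *: v)) t.

Lemma holomorphic_sliceholo f : holomorphic f -> sliceholo 1 f.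
Proof.
move=> hf; split => [z hz|z v t hz].
  by apply: differentiable_vcont; apply: hf; exact/cball_vnorm.
by apply: slice_cdiff; apply: hf; exact/cball_vnorm.
Qed.

Lemma sliceholoX rho f k : sliceholo rho f -> sliceholo rho (fun x => f x ^+ k).
Proof.
move=> [f1 f2]; split => [z hz|z v t hz]; first by apply: vcontX; exact: f1.
by apply: (@cdiffX _ (fun s => f (z + s *: v))); exact: f2.
Qed.

Lemma sliceholo_cdot rho (v : Cn) : sliceholo rho (fun x => cdot x v).
Proof.
split => [z _|z u t _]; first exact: vcont_cdotl.
have -> : (fun s => cdot (z + s *: u) v) = (fun s => cdot z v + s * cdot u v).
  by apply/funext => s; rewrite cdotDl cdotZl.
apply: cdiffD; first exact: cdiff_cst.
by apply: cdiffM; [exact: cdiff_id|exact: cdiff_cst].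
Qed.

Lemma sliceholo_scale rho f (r : R) : 0 < r -> sliceholo rho f ->
  sliceholo (rho / r) (fun x => f (ofReal r *: x)).
Proof.
move=> r0 [f1 f2]; have cr : cmod (ofReal r : C) = r by rewrite cmod_ofReal gtr0_norm.
split => [z hz|z v t].
  apply: (@vcont_affine _ _ (fun x => ofReal r *: x) f r) => [w|].
    by rewrite -scalerBr vnormZ cr.
  by apply: f1; rewrite vnormZ cr mulrC -ltr_pdivlMr.
rewrite ltr_pdivlMr // mulrC -[X in X * _]cr -vnormZ scalerDr scalerA mulrC -scalerA => h.
have -> : (fun s => f (ofReal r *: (z + s *: v))) = (fun s => f (ofReal r *: z + s *: (ofReal r *: v))).
  by apply/funext => s; rewrite scalerDr !scalerA mulrC.
exact: f2.
Qed.

End SliceHolomorphic.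

Lemma sliceholo_rot (R : realType) (m : nat) (rho : R) (f : 'rV[Cplx R]_m.+1 -> Cplx R)
    (U : 'M[Cplx R]_m.+1) : U \is unitarymx ->
  sliceholo rho f -> sliceholo rho (fun x => f (x *m U)).
Proof.
move=> hU [f1 f2]; split => [z hz|z v t].
  apply: (@vcont_affine _ _ (fun x => x *m U) f 1) => [w|].
    by rewrite -mulmxBl vnorm_unitary // mul1r.
  by apply: f1; rewrite vnorm_unitary.
rewrite -(vnorm_unitary _ hU) mulmxDl -scalemxAl => h.
have -> : (fun s => f ((z + s *: v) *m U)) = (fun s => f (z *m U + s *: (v *m U))).
  by apply/funext => s; rewrite mulmxDl -scalemxAl.
exact: f2.
Qed.

HB.lock Definition axis (R : realType) (m : nat) (x : 'rV[Cplx R]_m.+1) : 'rV[Cplx R]_m.+1 :=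
  x 0 0 *: delta_mx 0 0.

(** It interpolates holomorphically in [z] between the projection on the first axis at [z = 0] and
    the identity at [z = 1]; for [|z| = 1] it is the unitary map [axis_rot z]. *)
HB.lock Definition offaxis (R : realType) (m : nat) (z : Cplx R) (x : 'rV[Cplx R]_m.+1) :
  'rV[Cplx R]_m.+1 := axis x + z *: (x - axis x).

Section AxisRotation.
Context {R : realType} {m : nat}.
Local Notation n := m.+1.
Local Notation C := (Cplx R).
Local Notation Cn := 'rV[Cplx R]_n.
Implicit Types (z w : C) (x y : Cn).

Lemma axisE x : axis x = x 0 0 *: delta_mx 0 0.
Proof. by rewrite unlock. Qed.

Lemma offaxis_def z x : offaxis z x = axis x + z *: (x - axis x).
Proof. by rewrite [in LHS]unlock. Qed.

Lemma offaxisE z x j : offaxis z x 0 j = (if j == 0 then 1 else z) * x 0 j.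
Proof.
rewrite offaxis_def axisE !mxE eqxx /=; case: eqP => [->|_].
  by rewrite mulr1 subrr mulr0 addr0 mul1r.
by rewrite mulr0 subr0 add0r.
Qed.

Lemma offaxis1 x : offaxis 1 x = x.
Proof. by apply/rowP => j; rewrite offaxisE; case: ifP; rewrite mul1r. Qed.

Lemma offaxis0 x : offaxis 0 x = axis x.
Proof. by rewrite offaxis_def scale0r addr0. Qed.

Lemma coordB (x y : Cn) j : (x - y) 0 j = x 0 j - y 0 j.
Proof. by rewrite !mxE. Qed.

Lemma offaxisB z x y : offaxis z x - offaxis z y = offaxis z (x - y).
Proof. by apply/rowP => j; rewrite offaxisE !coordB !offaxisE mulrBr. Qed.

Lemma vnorm_offaxis z x : vnorm (offaxis z x) <= Num.max 1 (cmod z) * vnorm x.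
Proof.
have M1 : 1 <= Num.max 1 (cmod z) by rewrite le_max lexx.
have M2 : cmod z <= Num.max 1 (cmod z) by rewrite le_max lexx orbT.
move: M1 M2; move: (Num.max 1 (cmod z)) => M M1 M2; have M0 : 0 <= M by apply: le_trans M1.
apply: ler_of_sqr; rewrite ?mulr_ge0 ?vnorm_ge0 // exprMn !sqr_vnorm_sum mulr_sumr.
apply: ler_sum => j _; rewrite offaxisE cmodM exprMn ler_wpM2r ?sqr_ge0 //.
by rewrite lerXn2r ?nnegrE ?cmod_ge0 //; case: ifP; rewrite ?cmod1.
Qed.

Definition axis_rot (z : C) : 'M[C]_n := diag_mx (\row_j (if j == 0 then 1 else z)).

Lemma mul_axis_rot z (x : Cn) : x *m axis_rot z = offaxis z x.
Proof. by apply/rowP => j; rewrite offaxisE /axis_rot mul_mx_diag !mxE mulrC. Qed.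

Lemma unitary_axis_rot z : cmod z = 1 -> axis_rot z \is unitarymx.
Proof.
move=> z1; apply/unitarymxP; rewrite /axis_rot tr_diag_mx map_diag_mx mulmx_diag -diag_const_mx.
congr diag_mx; apply/rowP => j; rewrite !mxE.
by case: ifP => _; rewrite ?rmorph1 ?mulr1 // mul_conj z1 expr1n.
Qed.

Lemma offaxis_offaxis z w x : offaxis z (offaxis w x) = offaxis (z * w) x.
Proof. by apply/rowP => j; rewrite [LHS]offaxisE offaxisE [RHS]offaxisE mulrA; case: ifP; rewrite ?mulr1. Qed.

Lemma unitary_scalar z : cmod z = 1 -> (z%:M : 'M[C]_n) \is unitarymx.
Proof.
move=> z1; apply/unitarymxP; rewrite tr_scalar_mx map_scalar_mx -scalar_mxM.
by rewrite mul_conj z1 expr1n.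
Qed.

End AxisRotation.

Section RotationAverage.
Context {R : realType} {m : nat}.
Local Notation n := m.+1.
Local Notation C := (Cplx R).
Local Notation Cn := 'rV[Cplx R]_n.
Local Notation S := (csphere : set (BCn R n)).
Variable sigma : {measure set (BCn R n) -> \bar R}.
Hypothesis hs : normalized_rotation_invariant sigma.

Lemma cint_eigen (U : 'M[C]_n) (f : Cn -> C) (c : C) : U \is unitarymx ->
  cintegrable sigma S (f : BCn R n -> C) ->
  (forall x, S x -> f (x *m U) = c * f x) -> c != 1 -> cint sigma S (f : BCn R n -> C) = 0.
Proof.
move=> hU fi hf c1; have := cint_rot hs hU (cintegrable_meas fi).
rewrite (@eq_cint _ _ _ sigma S _ (fun x : BCn R n => c * f x)) // (cintZ measurable_csphere) //.
move/eqP; rewrite -subr_eq0 -{2}[cint _ _ _]mul1r -mulrBl mulf_eq0 subr_eq0 (negbTE c1).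
by move=> /eqP.
Qed.

(* The coefficients of positive degree of [f] in the coordinates off the first axis average to 0,
   since rotating those coordinates multiplies them by a power of the rotation. *)
Lemma cint_axis (rho : R) (f psi : Cn -> C) (B : R) : 1 < rho -> sliceholo rho f ->
  cmeas S (psi : BCn R n -> C) -> (forall x, S x -> cmod (psi x) <= B) ->
  (forall z x, cmod z = 1 -> psi (offaxis z x) = psi x) ->
  cint sigma S (fun x : BCn R n => f x * psi x) =
  cint sigma S (fun x : BCn R n => f (axis x) * psi x).
Proof.
move=> rho1 [f1 f2] mpsi hB hpsi.
have rho0 : 0 < rho by rewrite (lt_trans _ rho1).
have fin := sigma_finite_total hs.
have bnd z x r : S x -> cmod z <= r -> vnorm (offaxis z x) <= Num.max 1 r.
  move=> /csphere_vnorm x1 zr; rewrite (le_trans (vnorm_offaxis _ _)) // x1 mulr1.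
  by rewrite ge_max !le_max lexx zr orbT.
have bnd' z x : S x -> cmod z < rho -> vnorm (offaxis z x) < rho.
  by move=> Sx zr; rewrite (le_lt_trans (bnd z x _ Sx (lexx _))) // gt_max rho1.
have [F [mF hF]] : exists F : nat -> BCn R n -> C, (forall k, cmeas S (F k)) /\
    forall x, S x -> expands (fun z => f (offaxis z x)) (F^~ x) rho.
  apply: (@slice_coef _ _ (BCn R n) S (fun z (x : BCn R n) => f (offaxis z x))) => //.
  - move=> x Sx z zr.
    have -> : (fun s => f (offaxis s x)) = (fun s => f (axis x + s *: (x - axis x))).
      by apply/funext => s; rewrite offaxis_def.
    by apply: f2; rewrite -offaxis_def; exact: bnd'.
  - move=> z zr; apply: vcont_cmeas => [|x Sx]; first exact: measurable_csphere.
    apply: (@vcont_affine _ _ (offaxis z) f (Num.max 1 (cmod z))) => [w|].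
      by rewrite offaxisB vnorm_offaxis.
    by apply: f1; exact: bnd'.
  - move=> r rr; have [M hM] : exists M, forall z, vnorm z <= Num.max 1 r -> cmod (f z) <= M.
      apply: vball_bounded => z hz; apply: f1; rewrite (le_lt_trans hz) //.
      by rewrite gt_max rho1.
    by exists M => x z Sx zr; apply: hM; exact: bnd.
(* A radius strictly between 1 and [rho]: the point [z = 1], where [offaxis] is the identity, is
   interior and the remainder there decays like [r^-N]. *)
pose r := (1 + rho) / 2.
have r1 : 1 < r by rewrite ltr_pdivlMr //; lra.
have rr : r < rho by rewrite ltr_pdivrMr //; lra.
have r0 : 0 < r by rewrite (lt_trans _ r1).
have [M hM] : exists M, forall z, vnorm z <= Num.max 1 r -> cmod (f z) <= M.
  apply: vball_bounded => z hz; apply: f1; rewrite (le_lt_trans hz) //.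
  by rewrite gt_max rho1.
have hMx x : S x -> forall z, cmod z <= r -> cmod (f (offaxis z x)) <= M.
  by move=> Sx z zr; apply: hM; exact: bnd.
have iF k : cintegrable sigma S (fun x : BCn R n => F k x * psi x).
  apply: (cintegrable_bounded measurable_csphere (M := M / r ^+ k * B)) => //.
    by apply: cmeasM.
  move=> x Sx; rewrite cmodM ler_pM ?cmod_ge0 ?hB //.
  have [h _] := hF x Sx r M r0 rr (hMx x Sx).
  by rewrite ler_pdivlMr ?exprn_gt0.
have F0 x : S x -> F 0 x = f (axis x).
  move=> Sx; have [_ h] := hF x Sx r M r0 rr (hMx x Sx).
  have := h 0 1%N; rewrite cmod0 mul0r expr1 mulr0 mul0r big_ord1 expr0 mulr1 offaxis0 => /(_ r0) h0.
  apply/esym/eqP; rewrite -subr_eq0 -cmod_eq0 eq_le cmod_ge0 andbT; exact: h0.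
have rotF k z x : S x -> cmod z = 1 -> F k (offaxis z x) = z ^+ k * F k x.
  move=> Sx z1; have Sx' : S (offaxis z x).
    by rewrite -mul_axis_rot; apply/csphere_vnorm; rewrite vnorm_unitary ?unitary_axis_rot //; exact/csphere_vnorm.
  (* Both sides are the Taylor coefficients of [w |-> f (offaxis (w * z) x)]. *)
  apply: (@expands_uniq _ (fun w => f (offaxis w (offaxis z x))) (fun k => F k (offaxis z x)) (fun k => z ^+ k * F k x) rho r M) => //.
  + by move=> w wr; exact: hMx.
  + exact: hF.
  + move=> r' M' r0' rr' hM'.
    have hx w : cmod w <= r' -> cmod (f (offaxis w x)) <= M'.
      move=> wr; have := hM' (w * z^-1); rewrite offaxis_offaxis cmodM cmodV z1 invr1 mulr1 mulfVK.
        exact.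
      by rewrite -cmod_gt0 z1.
    have [h1 h2] := hF x Sx r' M' r0' rr' hx; split => [j|w N wr].
      by rewrite cmodM cmodX z1 expr1n mul1r.
    have zw : cmod (w * z) = cmod w by rewrite cmodM z1 mulr1.
    have := h2 (w * z) N; rewrite zw offaxis_offaxis => /(_ wr).
    by under eq_bigr => j _ do rewrite exprMn mulrA mulrAC [F j x * _]mulrC.
have zero k : cint sigma S (fun x : BCn R n => F k.+1 x * psi x) = 0.
  have [z z1 zk] := @exists_unimodular R k.+1 isT.
  apply: (@cint_eigen (axis_rot z) (fun x => F k.+1 x * psi x) (z ^+ k.+1)) => //.
  - exact: unitary_axis_rot.
  - by move=> x Sx; rewrite mul_axis_rot rotF // hpsi // mulrA.
  - by rewrite zk -subr_eq0 -opprD oppr_eq0 -[1 + 1]/(2%:R) pnatr_eq0.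
have mf : cmeas S (f : BCn R n -> C).
  apply: vcont_cmeas => [|x Sx]; first exact: measurable_csphere.
  by apply: f1; move/csphere_vnorm: Sx => ->.
have if_ : cintegrable sigma S (fun x : BCn R n => f x * psi x).
  apply: (cintegrable_bounded measurable_csphere (M := M * B)) => //; first exact: cmeasM.
  move=> x Sx; rewrite cmodM ler_pM ?cmod_ge0 ?hB //.
  by rewrite -[x in f x](offaxis1 (x : Cn)); apply: hMx; rewrite // cmod1 ltW.
pose K := M * (r / (r - 1)).
have tail x N : S x -> cmod (f x - \sum_(k < N) F k x) <= K * r^-1 ^+ N.
  move=> Sx; have [_ h] := hF x Sx r M r0 rr (hMx x Sx).
  have := h 1 N; rewrite cmod1 offaxis1 mul1r => /(_ r1).
  under eq_bigr do rewrite expr1n mulr1.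
  by rewrite mulrAC -/K.
have q1 : `|r^-1| < 1 by rewrite ger0_norm ?invr_ge0 ?(ltW r0) // invf_lt1.
apply/eqP; rewrite -subr_eq0; apply/eqP; apply: cmod_small_eq0 => e e0.
have [N hN] := geometric_small (K * B) q1 e0.
have E : cint sigma S (fun x : BCn R n => \sum_(k < N.+1) F k x * psi x) =
    cint sigma S (fun x : BCn R n => f (axis x) * psi x).
  rewrite (cint_sum measurable_csphere _ (fun k : 'I_N.+1 => iF k)) big_ord_recl big1 ?addr0; last first.
    by move=> k _; exact: zero.
  by apply: eq_cint => x Sx; rewrite F0.
rewrite -E -(cintB measurable_csphere) //; last first.
  exact: (cintegrable_sum measurable_csphere _ (fun k : 'I_N.+1 => iF k)).
have h := @cmod_cint_bounded _ _ _ sigma S measurable_csphere (fun x : BCn R n =>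
  f x * psi x - \sum_(k < N.+1) F k x * psi x) (K * r^-1 ^+ N.+1 * B) fin.
have s1 : sigma S = 1%E by case: hs.
rewrite s1 mulr1 in h.
apply: (le_trans (h _ _)).
- apply: cmeasB; first exact: cmeasM.
  by apply: cintegrable_meas; exact: (cintegrable_sum measurable_csphere _ (fun k : 'I_N.+1 => iF k)).
- move=> x Sx; rewrite -mulr_suml -mulrBl cmodM ler_pM ?cmod_ge0 ?hB //.
  exact: tail.
- rewrite mulrAC; apply: le_trans (ler_norm _) _; apply: ltW; apply: hN; exact: leqnSn.
Qed.

End RotationAverage.

(** * The Cauchy formula on the sphere *)

Lemma eq_of_geometric (R : realType) (a b : Cplx R) (K q : R) (k : nat) : 0 <= q -> q < 1 ->
  (forall N, (k <= N)%N -> cmod (a - b) <= K * q ^+ N) -> a = b.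
Proof.
move=> q0 q1 h; apply/eqP; rewrite -subr_eq0; apply/eqP; apply: cmod_small_eq0 => e e0.
have qn : `|q| < 1 by rewrite ger0_norm.
have [N hN] := geometric_small K qn e0.
apply: (le_trans (h (maxn k N) (leq_maxl _ _))); apply: ltW.
by apply: le_lt_trans (ler_norm _) _; apply: hN; exact: leq_maxr.
Qed.

Lemma coef1_linear_pow (R : realType) (a b : Cplx R) k :
  ((a%:P + b *: 'X) ^+ k.+1)`_1 = k.+1%:R * (a ^+ k * b).
Proof.
have -> : ((a%:P + b *: 'X) ^+ k.+1)`_1 = ((a%:P + b *: 'X) ^+ k.+1)^`().[0].
  by rewrite horner_coef0 coef_deriv mulr1n.
rewrite deriv_exp derivD derivC derivZ derivX add0r /= alg_polyC hornerMn hornerM horner_exp.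
by rewrite hornerD !hornerC hornerZ hornerX mulr0 addr0 -mulr_natl [b * _]mulrC.
Qed.

Section Moments.
Context {R : realType} {m : nat}.
Local Notation n := m.+1.
Local Notation C := (Cplx R).
Local Notation Cn := 'rV[Cplx R]_n.
Local Notation S := (csphere : set (BCn R n)).

Lemma vcont_cintegrable (mu : {measure set (BCn R n) -> \bar R}) (f : Cn -> C) :
  (mu S < +oo)%E -> (forall x, vcont f x) -> cintegrable mu S (f : BCn R n -> C).
Proof.
move=> muS hf; have [M hM] := @vball_bounded _ _ f 1 (fun z _ => hf z).
apply: (cintegrable_bounded measurable_csphere (M := M)) => //.
  by apply: vcont_cmeas; first exact: measurable_csphere.
by move=> x /csphere_le1; exact: hM.
Qed.

(** The integral of [(A + t B)^(k+1) H] is a polynomial in [t]; knowing it for all [t] determines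
    its linear coefficient. This differentiates moment identities algebraically. *)
Lemma cint_pow_coef1 (mu : {measure set (BCn R n) -> \bar R}) (A B H : Cn -> C) k (q : {poly C}) :
  (forall x, vcont A x) -> (forall x, vcont B x) ->
  (forall g, (forall x, vcont g x) -> cintegrable mu S (fun x : BCn R n => g x * H x)) ->
  (forall t : C, cint mu S (fun x : BCn R n => (A x + t * B x) ^+ k.+1 * H x) = q.[t]) ->
  k.+1%:R * cint mu S (fun x : BCn R n => A x ^+ k * B x * H x) = q`_1.
Proof.
move=> cA cB cH hq.
pose F (i : nat) (x : Cn) : C := 'C(k.+1, i)%:R * (A x ^+ (k.+1 - i) * B x ^+ i) * H x.
have iF i : cintegrable mu S (F i : BCn R n -> C).
  apply: cH => x; apply: vcontM; first exact: vcont_cst.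
  by apply: vcontM; apply: vcontX.
have -> : q = \poly_(i < k.+2) cint mu S (F i : BCn R n -> C).
  apply: poly_ext => t; rewrite -hq horner_poly.
  rewrite (@eq_cint _ _ _ mu S _ (fun x : BCn R n => \sum_(i < k.+2) t ^+ i * F i x)); last first.
    move=> x _; rewrite exprDn mulr_suml; apply: eq_bigr => i _.
    by rewrite /F exprMn -mulr_natl; ring.
  rewrite (cint_sum measurable_csphere _ (fun i : 'I_k.+2 => cintegrableZ measurable_csphere (t ^+ i) (iF i))).
  by apply: eq_bigr => i _; rewrite (cintZ measurable_csphere) // mulrC.
rewrite coef_poly /= -(cintZ measurable_csphere); last first.
  by apply: cH => x; apply: vcontM (cB x); apply: vcontX.
by apply: eq_cint => x _; rewrite /F bin1 subn1 expr1 -!mulrA.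
Qed.

Lemma cdot_delta j (v : Cn) : cdot (delta_mx 0 j) v = (v 0 j)^*.
Proof.
rewrite cdot_sum (bigD1 j) //= big1 ?addr0 ?mxE ?eqxx ?mul1r // => i ij.
by rewrite mxE (negbTE ij) andbF mul0r.
Qed.

Lemma cdot_delta_r j (v : Cn) : cdot v (delta_mx 0 j) = v 0 j.
Proof. by rewrite -cdot_conj cdot_delta cconjK. Qed.

Variable sigma : {measure set (BCn R n) -> \bar R}.
Hypothesis hs : normalized_rotation_invariant sigma.

Definition gam k : C := cint sigma S (fun x : BCn R n => (x : Cn) 0 0 ^+ k * ((x : Cn) 0 0)^* ^+ k).

Let fin : (sigma S < +oo)%E. Proof. exact: sigma_finite_total hs. Qed.

Lemma sigma_cint1 (c : C) : cint sigma S (fun=> c) = c.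
Proof.
have s1 : sigma S = 1%E by case: hs.
apply: cplxP; rewrite /= Rintegral_cst ?s1 ?mulr1 //; exact: measurable_csphere.
Qed.

Lemma cint_first_coord k (v : Cn) :
  cint sigma S (fun x : BCn R n => cdot x v ^+ k * ((x : Cn) 0 0)^* ^+ k) = (v 0 0)^* ^+ k * gam k.
Proof.
have h := @cint_axis _ _ _ hs 2 (fun x => cdot x v ^+ k) (fun x => (x 0 0)^* ^+ k) 1.
rewrite h {h}.
- rewrite /gam -(cintZ measurable_csphere).
    by apply: eq_cint => x _; rewrite axisE cdotZl cdot_delta exprMn mulrAC mulrC.
  apply: vcont_cintegrable => // x; apply: vcontM; apply: vcontX; first exact: vcont_coord.
  exact/vcont_conj/vcont_coord.
- by rewrite ltr1n.
- exact/sliceholoX/sliceholo_cdot.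
- apply: vcont_cmeas => [|x _]; first exact: measurable_csphere.
  exact/vcontX/vcont_conj/vcont_coord.
- move=> x Sx; rewrite cmodX cmod_conj exprn_ile1 ?cmod_ge0 //.
  by rewrite (le_trans (cmod_coord _ _)) // csphere_le1.
- by move=> z x _; rewrite offaxisE mul1r.
Qed.

Lemma polar_decomposition (w : Cn) : exists2 U : 'M[C]_n,
  U \is unitarymx & w = ofReal (vnorm w) *: ((delta_mx 0 0 : Cn) *m U).
Proof.
case: (eqVneq (vnorm w) 0) => [w0|w0].
  exists 1%:M; first by apply/unitarymxP; rewrite trmx1 map_mx1 mulmx1.
  rewrite w0 scale0r; apply/rowP => j; rewrite mxE; apply/eqP; rewrite -cmod_eq0 eq_le cmod_ge0 andbT.
  by rewrite -w0 cmod_coord.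
pose u : Cn := ofReal (vnorm w)^-1 *: w.
have u1 : vnorm u = 1 by rewrite vnormZ cmod_ofReal ger0_norm ?invr_ge0 ?vnorm_ge0 // mulVf.
have [U hU hu] := exists_unitary u1; exists U => //.
by rewrite hu /u scalerA -ofRealM divff // scale1r.
Qed.

Lemma cint_moment k (w v : Cn) :
  cint sigma S (fun x : BCn R n => cdot w x ^+ k * cdot x v ^+ k) = gam k * cdot w v ^+ k.
Proof.
have [U hU hw] := polar_decomposition w; set s := ofReal (vnorm w) in hw.
pose v' : Cn := v *m map_mx (Num.conj : C -> C) (trmx U).
have vU : v = v' *m U by rewrite /v' mulmxKtV.
have E (x : Cn) : cdot w (x *m U) = s * (x 0 0)^*.
  by rewrite {1}hw cdotZl cdot_unitary // cdot_delta.
have E' (x : Cn) : cdot (x *m U) v = cdot x v' by rewrite {1}vU cdot_unitary.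
rewrite -(cint_rot hs hU (f := fun x : Cn => cdot w x ^+ k * cdot x v ^+ k)); last first.
  apply: vcont_cmeas => [|x _]; first exact: measurable_csphere.
  by apply: vcontM; apply: vcontX; [exact: vcont_cdotr|exact: vcont_cdotl].
rewrite (@eq_cint _ _ _ sigma S _ (fun x : BCn R n => s ^+ k * (cdot x v' ^+ k * ((x : Cn) 0 0)^* ^+ k))); last first.
  by move=> x _; rewrite E E' exprMn mulrAC mulrA.
rewrite (cintZ measurable_csphere); last first.
  apply: vcont_cintegrable => // x; apply: vcontM; apply: vcontX; first exact: vcont_cdotl.
  exact/vcont_conj/vcont_coord.
rewrite cint_first_coord hw {1}vU cdotZl cdot_unitary // cdot_delta exprMn.
by rewrite mulrA mulrC.
Qed.

(** The linear coefficient in [t] of [cint_moment] at [w = e_0 + t e_j]. *)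
Lemma cint_mixed1 k j (v : Cn) :
  cint sigma S (fun x : BCn R n =>
    ((x : Cn) 0 0)^* ^+ k * ((x : Cn) 0 j)^* * cdot x v ^+ k.+1) =
  gam k.+1 * ((v 0 0)^* ^+ k * (v 0 j)^*).
Proof.
have cc i x : vcont (fun x : Cn => (x 0 i)^*) x by exact/vcont_conj/vcont_coord.
have cH g : (forall x, vcont g x) ->
    cintegrable sigma S (fun x : BCn R n => g x * cdot x v ^+ k.+1).
  by move=> cg; apply: (@vcont_cintegrable sigma (fun x => g x * cdot x v ^+ k.+1) fin) => x; apply: vcontM (cg x) _; exact/vcontX/vcont_cdotl.
have k1 : k.+1%:R != 0 :> C by rewrite pnatr_eq0.
apply: (mulfI k1).
rewrite (@cint_pow_coef1 sigma _ _ _ k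
  (gam k.+1 *: (((v 0 0)^*)%:P + (v 0 j)^* *: 'X) ^+ k.+1) (cc 0) (cc j) cH).
  by rewrite coefZ coef1_linear_pow mulrCA.
move=> t; pose w : Cn := delta_mx 0 0 + t *: delta_mx 0 j.
have E (x : Cn) : cdot w x = (x 0 0)^* + t * (x 0 j)^* by rewrite /w cdotDl cdotZl !cdot_delta.
rewrite (@eq_cint _ _ _ sigma S _ (fun x : BCn R n => cdot w x ^+ k.+1 * cdot x v ^+ k.+1)); last first.
  by move=> x _; rewrite E.
rewrite cint_moment E hornerZ horner_exp hornerD hornerC hornerZ hornerX.
by rewrite [t * _]mulrC.
Qed.

(** The linear coefficient in [t] of [cint_mixed1] at [v = e_0 + conj t e_j]. *)
Lemma cint_mixed2 k j : j != 0 ->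
  k.+1%:R * cint sigma S (fun x : BCn R n =>
    (x : Cn) 0 0 ^+ k * (x : Cn) 0 j * (((x : Cn) 0 0)^* ^+ k * ((x : Cn) 0 j)^*)) = gam k.+1.
Proof.
move=> j0; have cc i x : vcont (fun x : Cn => x 0 i) x by exact: vcont_coord.
have cH g : (forall x, vcont g x) -> cintegrable sigma S (fun x : BCn R n =>
    g x * (((x : Cn) 0 0)^* ^+ k * ((x : Cn) 0 j)^*)).
  move=> cg; apply: (@vcont_cintegrable sigma (fun x : Cn => g x * ((x 0 0)^* ^+ k * (x 0 j)^*)) fin) => x.
  apply: vcontM (cg x) _.
  by apply: vcontM; first apply: vcontX; exact/vcont_conj/vcont_coord.
rewrite (@cint_pow_coef1 sigma _ _ _ k (gam k.+1 *: 'X) (cc 0) (cc j) cH).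
  by rewrite coefZ coefX mulr1.
move=> t; pose v : Cn := delta_mx 0 0 + t^* *: delta_mx 0 j.
have E (x : Cn) : cdot x v = x 0 0 + t * x 0 j.
  by rewrite /v cdotDr cdotZr !cdot_delta_r cconjK.
rewrite (@eq_cint _ _ _ sigma S _ (fun x : BCn R n =>
    ((x : Cn) 0 0)^* ^+ k * ((x : Cn) 0 j)^* * cdot x v ^+ k.+1)); last first.
  by move=> x _; rewrite E mulrC.
rewrite cint_mixed1 hornerZ hornerX /v !mxE !eqxx /= (negbTE j0) /= eq_sym (negbTE j0) /=.
by rewrite mulr0 addr0 cconj1 expr1n mul1r add0r mulr1 cconjK.
Qed.

(** Insert [1 = sum_j |x_j|^2] into [gam k]: the first coordinate contributes [gam k.+1], and each
    of the [m] others contributes [gam k.+1 / k.+1]. *)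
Lemma gamS k : gam k * k.+1%:R = gam k.+1 * (k.+1 + m)%:R.
Proof.
have iF j : cintegrable sigma S (fun x : BCn R n =>
    (x : Cn) 0 0 ^+ k * (x : Cn) 0 j * (((x : Cn) 0 0)^* ^+ k * ((x : Cn) 0 j)^*)).
  apply: (@vcont_cintegrable sigma (fun x : Cn => x 0 0 ^+ k * x 0 j * ((x 0 0)^* ^+ k * (x 0 j)^*)) fin) => x.
  by do ?[apply: vcontM|apply: vcontX|apply: vcont_conj|apply: vcont_coord].
have -> : gam k = \sum_j cint sigma S (fun x : BCn R n =>
    (x : Cn) 0 0 ^+ k * (x : Cn) 0 j * (((x : Cn) 0 0)^* ^+ k * ((x : Cn) 0 j)^*)).
  rewrite -(cint_sum measurable_csphere _ iF); apply: eq_cint => x Sx.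
  transitivity ((x : Cn) 0 0 ^+ k * ((x : Cn) 0 0)^* ^+ k * \sum_j (x : Cn) 0 j * ((x : Cn) 0 j)^*).
    by rewrite -cdot_sum cdot_self (proj1 (csphere_vnorm x) Sx) expr1n mulr1.
  by rewrite mulr_sumr; apply: eq_bigr => j _; ring.
rewrite big_ord_recl mulrDl natrD mulrDr; congr (_ + _).
  congr (_ * _); apply: eq_cint => x _; rewrite -exprSr.
  by rewrite [in X in _ * X]mulrC -exprS.
rewrite mulr_suml (eq_bigr (fun=> gam k.+1)); last first.
  by move=> j _; rewrite mulrC cint_mixed2.
by rewrite sumr_const card_ord mulr_natr.
Qed.

Lemma gamE k : gam k * 'C(m + k, k)%:R = 1.
Proof.
elim: k => [|k IH].
  rewrite addn0 bin0 mulr1 /gam -[RHS]sigma_cint1; apply: eq_cint => x _.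
  by rewrite !expr0 mulr1.
have k1 : k.+1%:R != 0 :> C by rewrite pnatr_eq0.
apply: (mulIf k1); rewrite mul1r -mulrA -natrM mulnC -(mul_bin_diag (m + k.+1) k).
have -> : (m + k.+1 = k.+1 + m)%N by rewrite addnC.
by rewrite natrM mulrA -gamS addSn /= addnC mulrAC IH mul1r.
Qed.

(** Expand the kernel in its binomial series: scalar rotations kill every degree but [k], and there
    ['C(m + k, k)] cancels [gam k]. *)
Lemma cint_szego_pow k (s : C) : cmod s < 1 ->
  cint sigma S (fun x : BCn R n => (x : Cn) 0 0 ^+ k * szego (s *: delta_mx 0 0) x) = s ^+ k.
Proof.
move=> s1; have s0 := cmod_ge0 s; pose t := (1 + cmod s) / 2.
have t0 : 0 < t by rewrite divr_gt0 // ltr_wpDr.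
have t1 : t < 1 by rewrite ltr_pdivrMr //; lra.
have st : cmod s / t < 1 by rewrite ltr_pdivrMr // mul1r ltr_pdivlMr //; lra.
clearbody t; have [A A0 hA] := kernel_series m s0 s1 t0 t1.
have E (x : Cn) : szego (s *: delta_mx 0 0) x = (1 - s * (x 0 0)^*) ^- n.
  by rewrite /szego cdotZl cdot_delta.
have ve : vnorm (s *: (delta_mx 0 0 : Cn)) < 1 by rewrite vnormZ vnorm_delta mulr1.
have x1 (x : Cn) : S x -> cmod (x 0 0) <= 1 by move=> /csphere_le1; apply: le_trans; exact: cmod_coord.
have iP l : cintegrable sigma S (fun x : BCn R n =>
    'C(m + l, l)%:R * s ^+ l * ((x : Cn) 0 0 ^+ k * ((x : Cn) 0 0)^* ^+ l)).
  apply: (@vcont_cintegrable sigma (fun x : Cn => 'C(m + l, l)%:R * s ^+ l * (x 0 0 ^+ k * (x 0 0)^* ^+ l)) fin) => x.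
  by do ?[apply: vcontM|apply: vcontX|apply: vcont_conj|apply: vcont_coord|apply: vcont_cst].
have zero l : k <> l -> cint sigma S (fun x : BCn R n => (x : Cn) 0 0 ^+ k * ((x : Cn) 0 0)^* ^+ l) = 0.
  move=> kl; have [z z1 hz] := @exists_unimodular_diff R _ _ kl.
  apply: (@cint_eigen _ _ _ hs z%:M (fun x : Cn => x 0 0 ^+ k * (x 0 0)^* ^+ l) (z ^+ k * (z ^+ l)^*)).
  - exact: unitary_scalar.
  - apply: (@vcont_cintegrable sigma (fun x : Cn => x 0 0 ^+ k * (x 0 0)^* ^+ l) fin) => x.
    by do ?[apply: vcontM|apply: vcontX|apply: vcont_conj|apply: vcont_coord].
  - by move=> x _; rewrite mul_mx_scalar mxE !(exprMn, cconjM, cconjX); ring.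
  - by rewrite hz -subr_eq0 -opprD oppr_eq0 -[1 + 1]/(2%:R) pnatr_eq0.
pose Q N (x : Cn) : C := \sum_(l < N) 'C(m + l, l)%:R * s ^+ l * (x 0 0 ^+ k * (x 0 0)^* ^+ l).
have iQ N : cintegrable sigma S (Q N : BCn R n -> C).
  exact: (cintegrable_sum measurable_csphere _ (fun l : 'I_N => iP l)).
have cQ N : (k < N)%N -> cint sigma S (Q N : BCn R n -> C) = s ^+ k.
  move=> kN; rewrite (cint_sum measurable_csphere _ (fun l : 'I_N => iP l)).
  rewrite (bigD1 (Ordinal kN)) //= big1 ?addr0; last first.
    move=> l lk; rewrite (cintZ measurable_csphere).
      by rewrite zero ?mulr0 // => kl; move/eqP: lk; apply; exact: val_inj.
    apply: (@vcont_cintegrable sigma (fun x : Cn => x 0 0 ^+ k * (x 0 0)^* ^+ l) fin) => x.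
    by do ?[apply: vcontM|apply: vcontX|apply: vcont_conj|apply: vcont_coord].
  rewrite (cintZ measurable_csphere); last first.
    apply: (@vcont_cintegrable sigma (fun x : Cn => x 0 0 ^+ k * (x 0 0)^* ^+ k) fin) => x.
    by do ?[apply: vcontM|apply: vcontX|apply: vcont_conj|apply: vcont_coord].
  by rewrite -/(gam k) mulrAC [_ * gam k]mulrC gamE mul1r.
have mK : cmeas S (szego (s *: delta_mx 0 0) : BCn R n -> C) by exact: cmeas_szego.
have mX : cmeas S ((fun x : Cn => x 0 0 ^+ k) : BCn R n -> C).
  apply: vcont_cmeas => [|x _]; first exact: measurable_csphere.
  exact/vcontX/vcont_coord.
have iK : cintegrable sigma S (fun x : BCn R n => (x : Cn) 0 0 ^+ k * szego (s *: delta_mx 0 0) x).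
  apply: (cintegrable_bounded measurable_csphere (M := 1 * (1 - vnorm (s *: (delta_mx 0 0 : Cn))) ^- n)) => //.
    exact: cmeasM.
  move=> x Sx; rewrite cmodM ler_pM ?cmod_ge0 // ?szego_bound ?csphere_le1 //.
  by rewrite cmodX exprn_ile1 ?cmod_ge0 ?x1.
apply: (@eq_of_geometric _ _ _ A (cmod s / t) k.+1) => // [|N kN]; first by rewrite divr_ge0 // ltW.
rewrite -(cQ N kN) -(cintB measurable_csphere) //.
have s1' : sigma S = 1%E by case: hs.
have := @cmod_cint_bounded _ _ _ sigma S measurable_csphere (fun x : BCn R n =>
  (x : Cn) 0 0 ^+ k * szego (s *: delta_mx 0 0) x - Q N x) (A * (cmod s / t) ^+ N) fin.
rewrite s1' mulr1; apply; first by apply: cmeasB; [exact: cmeasM|exact: cintegrable_meas].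
move=> x Sx; have -> : Q N x = (x : Cn) 0 0 ^+ k * ksum m N (s * ((x : Cn) 0 0)^*).
  by rewrite /Q /ksum mulr_sumr; apply: eq_bigr => l _; rewrite exprMn; ring.
rewrite -mulrBr cmodM E; have sx : cmod (s * ((x : Cn) 0 0)^*) <= cmod s.
  by rewrite cmodM cmod_conj ler_piMr // x1.
apply: (le_trans (y := 1 * (A * (cmod (s * ((x : Cn) 0 0)^*) / t) ^+ N))).
  by rewrite ler_pM ?cmod_ge0 ?hA // cmodX exprn_ile1 ?cmod_ge0 ?x1.
rewrite mul1r ler_wpM2l // lerXn2r ?nnegrE ?divr_ge0 ?cmod_ge0 ?(ltW t0) //.
by rewrite ler_wpM2r // invr_ge0 ltW.
Qed.

(** The kernel at [s e_0] involves only the first coordinate, so [cint_axis] replaces [f] by its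
    restriction to the first axis, a one-variable power series integrated termwise. *)
Lemma cauchy_axis (rho : R) (f : Cn -> C) (s : C) : 1 < rho -> sliceholo rho f -> cmod s < 1 ->
  cint sigma S (fun x : BCn R n => f x * szego (s *: delta_mx 0 0) x) = f (s *: delta_mx 0 0).
Proof.
move=> rho1 hf s1; have ve : vnorm (s *: (delta_mx 0 0 : Cn)) < 1 by rewrite vnormZ vnorm_delta mulr1.
have rho0 : 0 < rho by rewrite (lt_trans _ rho1).
set psi := szego (s *: delta_mx 0 0); pose B := (1 - vnorm (s *: (delta_mx 0 0 : Cn))) ^- n.
have mpsi : cmeas S (psi : BCn R n -> C) by exact: cmeas_szego.
have hB x : S x -> cmod (psi x) <= B by move=> /csphere_le1; exact: szego_bound.
have s1' : sigma S = 1%E by case: hs.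
rewrite (@cint_axis _ _ _ hs rho f psi B) //; last first.
  by move=> z x _; rewrite /psi /szego !cdotZl !cdot_delta offaxisE mul1r.
pose phi (z : C) := f (z *: delta_mx 0 0).
have vz (z : C) : vnorm (z *: (delta_mx 0 0 : Cn)) = cmod z by rewrite vnormZ vnorm_delta mulr1.
have dphi z : cmod z < rho -> cdiff phi z.
  move=> zr; have := (proj2 hf) 0 (delta_mx 0 0) z; rewrite add0r vz => /(_ zr).
  by apply: (cdiff_near ltr01) => h _; rewrite add0r.
have [c hc] := expands_exists rho0 dphi.
pose r := (1 + rho) / 2.
have r1 : 1 < r by rewrite ltr_pdivlMr //; lra.
have rr : r < rho by rewrite ltr_pdivrMr //; lra.
have r0 : 0 < r by rewrite (lt_trans _ r1).
have [M hM] : exists M, forall z : Cn, vnorm z <= r -> cmod (f z) <= M.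
  by apply: vball_bounded => z hz; apply: (proj1 hf); rewrite (le_lt_trans hz).
have hphi z : cmod z <= r -> cmod (phi z) <= M by move=> zr; apply: hM; rewrite vz.
have [_ h] := hc r M r0 rr hphi; clearbody r.
have M0 : 0 <= M by apply: le_trans (hM 0 _); rewrite ?cmod_ge0 // vnorm0 ltW.
pose K := M * (r / (r - 1)).
have tail z N : cmod z <= 1 -> cmod (phi z - \sum_(k < N) c k * z ^+ k) <= K * r^-1 ^+ N.
  move=> z1; apply: (le_trans (h z N (le_lt_trans z1 r1))).
  rewrite /K -mulrA [X in _ <= X]mulrAC -[X in _ <= X]mulrA ler_wpM2l // ler_pM //.
  - by rewrite exprn_ge0 // divr_ge0 ?cmod_ge0 ?(ltW r0).
  - by rewrite divr_ge0 ?(ltW r0) // subr_ge0 (le_trans z1) ?ltW.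
  - by rewrite lerXn2r ?nnegrE ?divr_ge0 ?invr_ge0 ?cmod_ge0 ?(ltW r0) // -[X in _ <= X]mul1r ler_wpM2r // invr_ge0 ltW.
  - rewrite ler_wpM2l ?(ltW r0) // lef_pV2 ?posrE ?subr_gt0 ?(le_lt_trans z1) //.
    by rewrite lerD2l lerN2.
have q1 : r^-1 < 1 by rewrite invf_lt1.
have iX k : cintegrable sigma S (fun x : BCn R n => c k * ((x : Cn) 0 0 ^+ k * psi x)).
  apply: (cintegrableZ measurable_csphere).
  apply: (cintegrable_bounded measurable_csphere (M := 1 * B)) => //.
    apply: cmeasM => //; apply: vcont_cmeas => [|x _]; first exact: measurable_csphere.
    exact/vcontX/vcont_coord.
  move=> x Sx; rewrite cmodM ler_pM ?cmod_ge0 ?hB // cmodX exprn_ile1 ?cmod_ge0 //.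
  by rewrite (le_trans (cmod_coord _ _)) // csphere_le1.
have x1 (x : Cn) : S x -> cmod (x 0 0) <= 1 by move=> /csphere_le1; apply: le_trans; exact: cmod_coord.
have mf : cmeas S ((fun x : Cn => f (axis x) * psi x) : BCn R n -> C).
  apply: cmeasM => //; apply: vcont_cmeas => [|x Sx]; first exact: measurable_csphere.
  apply: (@vcont_affine _ _ (@axis R m) f 1) => [w|].
    by rewrite mul1r !axisE -scalerBl vz -coordB cmod_coord.
  by apply: (proj1 hf); rewrite axisE vz (le_lt_trans (x1 x Sx)).
have if_ : cintegrable sigma S (fun x : BCn R n => f (axis x) * psi x).
  apply: (cintegrable_bounded measurable_csphere (M := M * B)) => // x Sx.
  rewrite cmodM ler_pM ?cmod_ge0 ?hB // axisE; apply: hphi.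
  by rewrite (le_trans (x1 x Sx)) // ltW.
apply: (@eq_of_geometric _ _ _ (K * B + K) r^-1 0) => // [|N _]; first by rewrite invr_ge0 ltW.
have E : cint sigma S (fun x : BCn R n => \sum_(k < N) c k * ((x : Cn) 0 0 ^+ k * psi x)) =
    \sum_(k < N) c k * s ^+ k.
  rewrite (cint_sum measurable_csphere _ (fun k : 'I_N => iX k)); apply: eq_bigr => k _.
  rewrite (cintZ measurable_csphere) ?cint_szego_pow //.
  apply: (cintegrable_bounded measurable_csphere (M := 1 * B)) => //.
    apply: cmeasM => //; apply: vcont_cmeas => [|x _]; first exact: measurable_csphere.
    exact/vcontX/vcont_coord.
  by move=> x Sx; rewrite cmodM ler_pM ?cmod_ge0 ?hB // cmodX exprn_ile1 ?cmod_ge0 ?x1.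
apply: (le_trans (ler_cmod_dist _ (\sum_(k < N) c k * s ^+ k) _)).
rewrite mulrDl; apply: lerD; last by rewrite cmodBC; apply: tail; rewrite ltW.
rewrite -E -(cintB measurable_csphere) //; last first.
  exact: (cintegrable_sum measurable_csphere _ (fun k : 'I_N => iX k)).
have := @cmod_cint_bounded _ _ _ sigma S measurable_csphere (fun x : BCn R n =>
  f (axis x) * psi x - \sum_(k < N) c k * ((x : Cn) 0 0 ^+ k * psi x)) (K * B * r^-1 ^+ N) fin.
rewrite s1' mulr1; apply.
  apply: cmeasB => //; apply: cintegrable_meas.
  exact: (cintegrable_sum measurable_csphere _ (fun k : 'I_N => iX k)).
move=> x Sx; have -> : \sum_(k < N) c k * ((x : Cn) 0 0 ^+ k * psi x) =
    (\sum_(k < N) c k * (x : Cn) 0 0 ^+ k) * psi x.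
  by rewrite mulr_suml; apply: eq_bigr => k _; rewrite mulrA.
rewrite -mulrBl cmodM mulrAC ler_pM ?cmod_ge0 ?hB // axisE.
by apply: tail; exact: x1.
Qed.

(** Stated for functions holomorphic beyond the sphere; Hardy functions enter through their dilates,
    with [rho = 1 / r]. *)
Theorem cauchy_formula_sphere (rho : R) (f : Cn -> C) (w : Cn) :
  1 < rho -> sliceholo rho f -> vnorm w < 1 ->
  cint sigma S (fun x : BCn R n => f x * szego w x) = f w.
Proof.
move=> rho1 hf w1; have [U hU hw] := polar_decomposition w.
rewrite -(cint_rot hs hU (f := fun x : Cn => f x * szego w x)); last first.
  apply: cmeasM; last exact: cmeas_szego.
  apply: vcont_cmeas => [|x Sx]; first exact: measurable_csphere.
  by apply: (proj1 hf); rewrite (le_lt_trans (csphere_le1 Sx)).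
have := cauchy_axis rho1 (sliceholo_rot hU hf) (s := ofReal (vnorm w)).
rewrite cmod_ofReal ger0_norm ?vnorm_ge0 // -scalemxAl -hw => /(_ w1) <-.
apply: eq_cint => x _; congr (_ * _).
by rewrite /szego {1}hw !cdotZl cdot_unitary.
Qed.

End Moments.

(** * Orthogonal series *)

Lemma bounded_sum_tail (R : realType) (a : nat -> R) (A : R) : (forall k, 0 <= a k) ->
  (forall N, \sum_(k < N) a k <= A) ->
  forall e : R, 0 < e -> exists N, forall M, (N <= M)%N ->
    \sum_(k < M) a k - \sum_(k < N) a k <= e.
Proof.
move=> a0 hA e e0; pose E : set R := [set x | exists N, x = \sum_(k < N) a k].
have hE : has_sup E.
  split; first by exists 0; exists 0%N; rewrite big_ord0.
  by exists A => _ [N ->].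
have [_ [N ->] hN] := sup_adherent e0 hE.
exists N => M _; have : \sum_(k < M) a k <= sup E.
  by apply: ub_le_sup; [case: hE|exists M].
lra.
Qed.

Section OrthogonalSeries.
Context {R : realType} {X : Type}.
Variable H : hilbert R X.
Local Notation C := (Cplx R).
Local Notation P := (hcar H).
Local Notation ip := (hip H).
Local Notation q := (hnorm2 H).
Variable F : nat -> X -> C.
Hypothesis hF : forall k, P (F k).
Hypothesis orth : forall k l, k <> l -> ip (F k) (F l) = 0.
Implicit Types (t s : nat -> C) (g : X -> C).

Lemma hip_self g : P g -> ip g g = ofReal (q g).
Proof.
move=> hg; apply: cplxP => //=.
have := congr1 (@complex.Im R) (hip_conj hg hg); rewrite cIm_conj; lra.
Qed.

Definition osum t N : X -> C := fun x => \sum_(k < N) t k * F k x.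

Lemma osum0 t : osum t 0 = (fun=> 0).
Proof. by apply/funext => x; rewrite /osum big_ord0. Qed.

Lemma osumS t N : osum t N.+1 = (fun x => t N * F N x + osum t N x).
Proof. by apply/funext => x; rewrite /osum big_ord_recr /= addrC. Qed.

Lemma hcar_osum t N : P (osum t N).
Proof.
elim: N => [|N IH]; first by rewrite osum0; exact: hcar0.
by rewrite osumS; exact: hcar_lin.
Qed.

Lemma hip_osum t N g : P g -> ip (osum t N) g = \sum_(k < N) t k * ip (F k) g.
Proof.
move=> hg; elim: N => [|N IH]; first by rewrite osum0 hip0l // big_ord0.
by rewrite osumS (hip_lin (t N) (hF N) (hcar_osum t N) hg) IH big_ord_recr /= addrC.
Qed.

Lemma hip_osumF t N j : (j < N)%N -> ip (osum t N) (F j) = t j * ofReal (q (F j)).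
Proof.
move=> jN; rewrite hip_osum // (bigD1 (Ordinal jN)) //= big1 ?addr0 ?hip_self // => k kj.
by rewrite orth ?mulr0 // => e; move/eqP: kj; apply; exact: val_inj.
Qed.

Lemma hnorm2_osum t N : q (osum t N) = \sum_(k < N) cmod (t k) ^+ 2 * q (F k).
Proof.
rewrite [LHS]/hnorm2 (hip_osum t N (hcar_osum t N)) cRe_sum; apply: eq_bigr => k _.
rewrite (hip_conj (hcar_osum t N) (hF k)) hip_osumF // cconjM conj_ofReal mulrA mul_conj.
by rewrite -ofRealM.
Qed.

Lemma osumB t s N : (fun x => osum t N x - osum s N x) = osum (fun k => t k - s k) N.
Proof. by apply/funext => x; rewrite /osum -sumrB; apply: eq_bigr => k _; rewrite mulrBl. Qed.

Lemma osum_widen t N M : (N <= M)%N -> osum t N = osum (fun k => if (k < N)%N then t k else 0) M.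
Proof.
move=> NM; apply/funext => x; rewrite /osum (big_ord_widen _ (fun k => t k * F k x) NM).
by rewrite big_mkcond; apply: eq_bigr => k _; case: ifP => // _; rewrite mul0r.
Qed.

Lemma hnorm2_osumB t N M : (N <= M)%N ->
  q (fun x => osum t M x - osum t N x) =
  \sum_(k < M) cmod (t k) ^+ 2 * q (F k) - \sum_(k < N) cmod (t k) ^+ 2 * q (F k).
Proof.
move=> NM; rewrite (osum_widen t NM) osumB hnorm2_osum.
rewrite (big_ord_widen _ (fun k => cmod (t k) ^+ 2 * q (F k)) NM) [X in _ - X]big_mkcond -sumrB.
apply: eq_bigr => k _; case: ifP => _; first by rewrite !subrr cmod0 expr0n mul0r.
by rewrite !subr0.
Qed.

Lemma ortho_pythagoras g t N : P g ->
  (forall k, (k < N)%N -> ip g (F k) = t k * ofReal (q (F k))) ->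
  q (fun x => g x - osum t N x) = q g - \sum_(k < N) cmod (t k) ^+ 2 * q (F k).
Proof.
move=> hg h; rewrite (hnorm2B hg (hcar_osum t N)) hnorm2_osum.
have -> : complex.Re (ip g (osum t N)) = \sum_(k < N) cmod (t k) ^+ 2 * q (F k).
  rewrite (hip_conj (hcar_osum t N) hg) cRe_conj (hip_osum t N hg) cRe_sum; apply: eq_bigr => k _.
  rewrite (hip_conj hg (hF k)) h ?ltn_ord // cconjM conj_ofReal mulrA mul_conj.
  by rewrite -ofRealM.
ring.
Qed.

Lemma hnorm2_ge0 g : P g -> 0 <= q g.
Proof. exact: hip_ge0. Qed.

Lemma ortho_cvg (A : R) : (forall N, \sum_(k < N) q (F k) <= A) ->
  exists g, [/\ P g, hcvg H (osum (fun=> 1)) g & forall k, ip g (F k) = ofReal (q (F k))].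
Proof.
move=> hA; pose u := osum (fun=> 1).
have E N M : (N <= M)%N -> q (fun x => u M x - u N x) =
    \sum_(k < M) q (F k) - \sum_(k < N) q (F k).
  by move=> NM; rewrite hnorm2_osumB //; congr (_ - _); apply: eq_bigr => k _; rewrite cmod1 expr1n mul1r.
have sym f g : P f -> P g -> q (fun x => f x - g x) = q (fun x => g x - f x).
  by move=> hf hg; rewrite !hnorm2B // (hip_conj hf hg) cRe_conj addrAC addrC addrA [q g + q f]addrC.
have mono N M : (N <= M)%N -> \sum_(k < N) q (F k) <= \sum_(k < M) q (F k).
  by move=> NM; rewrite -subr_ge0 -E //; apply/hnorm2_ge0/hcarB; exact: hcar_osum.
have [l hl cl] : exists2 l, P l & hcvg H u l.
  apply: hcomplete => [k|e e0]; first exact: hcar_osum.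
  have [N hN] := bounded_sum_tail (fun k => hnorm2_ge0 (hF k)) hA e0.
  exists N => i j Ni Nj; case: (leqP j i) => [ji|/ltnW ij].
    rewrite -/(q _) (E j i ji); have := hN i Ni; have := mono N j Nj; lra.
  rewrite -/(q _) (sym _ _ (hcar_osum _ i) (hcar_osum _ j)) (E i j ij); have := hN j Nj; have := mono N i Ni; lra.
exists l; split => // k; apply: (hip_lim (fun N => hcar_osum (fun=> 1) N) hl (hF k) cl) => e e0.
by exists k.+1 => N kN; rewrite (hip_osumF (fun=> 1) kN) mul1r subrr cmod0 ltW.
Qed.

End OrthogonalSeries.

(** * Square-integrable functions as a Hilbert space *)

Section L2Hilbert.
Context {R : realType} {d : measure_display} {T : measurableType d}.
Local Notation C := (Cplx R).
Variables (mu : {measure set T -> \bar R}) (D : set T).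
Hypothesis mD : measurable D.

Lemma sqip_complete (u : nat -> T -> C) : (forall k, sqint mu D (u k)) ->
  (forall e : R, 0 < e -> exists N, forall m n, (N <= m)%N -> (N <= n)%N ->
     complex.Re (sqip mu D (fun x => u m x - u n x) (fun x => u m x - u n x)) <= e) ->
  exists2 l, sqint mu D l & forall e : R, 0 < e -> exists N, forall n, (N <= n)%N ->
     complex.Re (sqip mu D (fun x => u n x - l x) (fun x => u n x - l x)) <= e.
Proof.
move=> hu hC; have [e e0|g hg h] := sqint_complete mD hu.
  have [N hN] := hC e e0; exists N => i j Ni Nj.
  by rewrite -EFin_sqip ?lee_fin ?hN //; apply: sqintB.
exists g => // e e0; have [N hN] := h e e0; exists N => k Nk.
by rewrite -lee_fin EFin_sqip ?hN //; apply: sqintB.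
Qed.

Definition L2_hilbert : hilbert R T :=
  @Hilbert R T (sqint mu D) (sqip mu D) (sqint0 mu mD) (sqint_lin mD) (sqipl mD) (sqipC mD)
    (fun f _ => sqip_ge0 mu D f) sqip_complete.

End L2Hilbert.

(** * Homogeneous expansion and boundary values *)

Section HilbertInequalities.
Context {R : realType} {X : Type}.
Variable H : hilbert R X.
Local Notation C := (Cplx R).
Local Notation P := (hcar H).
Local Notation ip := (hip H).
Local Notation q := (hnorm2 H).
Implicit Types (f g h : X -> C).

Lemma hnorm2_lin_le (a : C) f g : P f -> P g ->
  q (fun x => a * f x + g x) <= 2 * (cmod a ^+ 2 * q f + q g).
Proof.
move=> hf hg; have := hnorm2_ge0 (hcar_lin (- a) hf hg).
by rewrite !hnorm2_lin // cmodN mulNr cReN; lra.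
Qed.

Lemma hnorm2_triangle f g h : P f -> P g -> P h ->
  q (fun x => f x - h x) <= 2 * (q (fun x => f x - g x) + q (fun x => h x - g x)).
Proof.
move=> hf hg hh.
have -> : (fun x => f x - h x) = (fun x => -1 * (h x - g x) + (f x - g x)).
  by apply/funext => x; ring.
apply: (le_trans (hnorm2_lin_le (-1) (hcarB hh hg) (hcarB hf hg))).
by rewrite cmodN cmod1 expr1n mul1r addrC.
Qed.

(** Vectors at null distance are indistinguishable to the form; this stands in for equality of
    classes. *)
Lemma hip_null f g h : P f -> P g -> P h -> q (fun x => f x - g x) = 0 -> ip f h = ip g h.
Proof.
move=> hf hg hh h0; apply/eqP; rewrite -subr_eq0 -hipBl // -cmod_eq0 -sqrf_eq0 eq_le sqr_ge0 andbT.
by apply: (le_trans (hcauchy_schwarz (hcarB hf hg) hh)); rewrite h0 mul0r.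
Qed.

Lemma hnorm2_null f g : P f -> P g -> q (fun x => f x - g x) = 0 -> q f = q g.
Proof.
move=> hf hg h0; rewrite /hnorm2 (hip_null hf hg hf h0) (hip_conj hf hg) cRe_conj.
by rewrite (hip_null hf hg hg h0).
Qed.

End HilbertInequalities.

Lemma one_sub_exp_le (R : realType) (r : R) k : 0 <= r -> r <= 1 -> 1 - r ^+ k <= k%:R * (1 - r).
Proof.
move=> r0 r1; elim: k => [|k IH]; first by rewrite expr0 subrr mul0r.
have : 0 <= r ^+ k <= 1 by rewrite exprn_ge0 // exprn_ile1.
rewrite exprS -natr1; nra.
Qed.

Section HardyCoefficients.
Context {R : realType} {m : nat}.
Local Notation n := m.+1.
Local Notation C := (Cplx R).
Local Notation Cn := 'rV[Cplx R]_n.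
Local Notation S := (csphere : set (BCn R n)).
Variable sigma : {measure set (BCn R n) -> \bar R}.
Hypothesis hs : normalized_rotation_invariant sigma.
Implicit Types (f g : Cn -> C) (r : R).

Definition L2s : hilbert R (BCn R n) := L2_hilbert sigma measurable_csphere.
Local Notation q := (hnorm2 L2s).
Local Notation ip := (hip L2s).

Let fin : (sigma S < +oo)%E. Proof. exact: sigma_finite_total hs. Qed.

Definition dil r f : BCn R n -> C := fun x => f (ofReal r *: (x : Cn)).

Lemma dilation_in_ball r (x : Cn) : 0 < r -> r < 1 -> S x -> vnorm (ofReal r *: x) < 1.
Proof.
by move=> r0 r1 /csphere_vnorm x1; rewrite vnormZ x1 mulr1 cmod_ofReal gtr0_norm.
Qed.

Lemma sqint_dil r f : 0 < r -> r < 1 -> sliceholo 1 f -> sqint sigma S (dil r f).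
Proof.
move=> r0 r1 [f1 _].
have [M hM] : exists M, forall z : Cn, vnorm z <= r -> cmod (f z) <= M.
  by apply: vball_bounded => z hz; apply: f1; rewrite (le_lt_trans hz).
apply: (sqint_bounded measurable_csphere (M := M)) => //; last first.
  move=> x Sx; apply: hM; move/csphere_vnorm: Sx => x1.
  by rewrite vnormZ x1 mulr1 cmod_ofReal gtr0_norm.
apply: (@vcont_cmeas _ _ _ (fun x : Cn => f (ofReal r *: x))) => [|x Sx]; first exact: measurable_csphere.
apply: (@vcont_affine _ _ (fun x : Cn => ofReal r *: x) f r) => [w|].
  by rewrite -scalerBr vnormZ cmod_ofReal gtr0_norm.
by apply: f1; exact: dilation_in_ball.
Qed.

Lemma hnorm2_bounded (f : BCn R n -> C) (M : R) : sqint sigma S f ->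
  (forall x, S x -> cmod (f x) <= M) -> q f <= M ^+ 2.
Proof.
move=> hf hM; rewrite -lee_fin /hnorm2 (EFin_sqip measurable_csphere hf).
have s1 : sigma S = 1%E by case: hs.
have mS := @measurable_csphere R n.
apply: (@le_trans _ _ (\int[sigma]_(x in S) (M ^+ 2)%:E)%E).
  apply: ge0_le_integral => //.
  - by move=> x _; rewrite lee_fin sqr_ge0.
  - exact: (esqr_meas (sqint_cmeas hf)).
  - move=> x Sx; rewrite lee_fin lerXn2r ?nnegrE ?cmod_ge0 ?hM //.
    by rewrite (le_trans (cmod_ge0 _) (hM x Sx)).
rewrite integral_cst ?s1 ?mule1 //; exact: mS.
Qed.

(** [F k] is the homogeneous part of degree [k] restricted to the sphere, read off as Taylor
    coefficient [k] of [z |-> f (z x)]. A scalar rotation by [z] multiplies it by [z^k], whence the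
    orthogonality; the remainder on each dilate is uniform on the sphere. *)
Lemma hardy_coef f : sliceholo 1 f -> exists F : nat -> BCn R n -> C,
  [/\ forall k, sqint sigma S (F k),
      forall k l, k <> l -> ip (F k) (F l) = 0
    & forall r, 0 < r -> r < 1 -> exists K p : R, [/\ 0 <= p, p < 1 &
        forall N (x : BCn R n), S x -> cmod (dil r f x - osum F (fun k => ofReal r ^+ k) N x) <= K * p ^+ N]].
Proof.
move=> [f1 f2].
have vz (z : C) (x : BCn R n) : S x -> vnorm (z *: (x : Cn)) = cmod z.
  by move=> /csphere_vnorm x1; rewrite vnormZ x1 mulr1.
have [F [mF hF]] : exists F : nat -> BCn R n -> C, (forall k, cmeas S (F k)) /\
    forall x, S x -> expands (fun z => f (z *: (x : Cn))) (F^~ x) 1.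
  apply: (@slice_coef _ _ (BCn R n) S (fun z (x : BCn R n) => f (z *: (x : Cn)))) => //.
  - move=> x Sx z z1; have := f2 0 (x : Cn) z; rewrite add0r vz // => /(_ z1).
    by apply: (cdiff_near ltr01) => h _; rewrite add0r.
  - move=> z z1; apply: (@vcont_cmeas _ _ _ (fun x : Cn => f (z *: x))) => [|x Sx]; first exact: measurable_csphere.
    apply: (@vcont_affine _ _ (fun x : Cn => z *: x) f (cmod z)) => [w|].
      by rewrite -scalerBr vnormZ.
    by apply: f1; rewrite vz.
  - move=> r r1; have [M hM] : exists M, forall z : Cn, vnorm z <= r -> cmod (f z) <= M.
      by apply: vball_bounded => z hz; apply: f1; rewrite (le_lt_trans hz).
    by exists M => x z Sx zr; apply: hM; rewrite vz.
have bM r : r < 1 -> exists M, forall x z, S x -> cmod z <= r -> cmod (f (z *: (x : Cn))) <= M.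
  move=> r1; have [M hM] : exists M, forall z : Cn, vnorm z <= r -> cmod (f z) <= M.
    by apply: vball_bounded => z hz; apply: f1; rewrite (le_lt_trans hz).
  by exists M => x z Sx zr; apply: hM; rewrite vz.
have h0 : 0 < (2^-1 : R) by rewrite invr_gt0.
have h1 : (2^-1 : R) < 1 by rewrite invf_lt1 // ltr1n.
have [M0 hM0] := bM _ h1.
have bF k x : S x -> cmod (F k x) <= M0 / 2^-1 ^+ k.
  move=> Sx; have [h _] := hF x Sx _ M0 h0 h1 (fun z => hM0 x z Sx).
  by rewrite ler_pdivlMr ?exprn_gt0.
have sF k : sqint sigma S (F k).
  by apply: (sqint_bounded measurable_csphere (M := M0 / 2^-1 ^+ k)) => // x Sx; exact: bF.
exists F; split => // [k l kl|r r0 r1].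
  have [z z1 hz] := @exists_unimodular_diff R k l kl.
  apply: (@cint_eigen _ _ _ hs z%:M (fun x : Cn => F k x * (F l x)^*) (z ^+ k * (z ^+ l)^*)).
  - exact: unitary_scalar.
  - exact: (sqint_mul measurable_csphere).
  - have rotF j (x : BCn R n) : S x -> F j (z *: (x : Cn)) = z ^+ j * F j x.
      move=> Sx; have Sx' : S (z *: (x : Cn)) by apply/csphere_vnorm; rewrite vz.
      apply: (@expands_uniq _ (fun w => f (w *: (z *: (x : Cn)))) (fun j => F j (z *: (x : Cn))) (fun j => z ^+ j * F j x) 1 _ M0 h0 h1).
      + by move=> w wr; exact: hM0.
      + exact: hF.
      + move=> r' M' r0' rr' hM'.
        have hx w : cmod w <= r' -> cmod (f (w *: (x : Cn))) <= M'.
          move=> wr; have := hM' (w * z^-1); rewrite scalerA cmodM cmodV z1 invr1 mulr1 mulfVK.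
            exact.
          by rewrite -cmod_gt0 z1.
        have [h2 h3] := hF x Sx r' M' r0' rr' hx; split => [i|w N wr].
          by rewrite cmodM cmodX z1 expr1n mul1r.
        have zw : cmod (w * z) = cmod w by rewrite cmodM z1 mulr1.
        have := h3 (w * z) N; rewrite zw scalerA => /(_ wr).
        by under eq_bigr => i _ do rewrite exprMn mulrA mulrAC [F i x * _]mulrC.
    by move=> x Sx; rewrite mul_mx_scalar !rotF // !(cconjM, cconjX); ring.
  - by rewrite hz -subr_eq0 -opprD oppr_eq0 -[1 + 1]/(2%:R) pnatr_eq0.
pose t := (1 + r) / 2.
have t1 : t < 1 by rewrite ltr_pdivrMr //; lra.
have rt : r < t by rewrite ltr_pdivlMr //; lra.
clearbody t; have t0 : 0 < t by rewrite (lt_trans r0).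
have [M hM] := bM t t1.
have cr : cmod (ofReal r : C) = r by rewrite cmod_ofReal gtr0_norm.
exists (M * (t / (t - r))), (r / t); split; first by rewrite divr_ge0 // ltW.
  by rewrite ltr_pdivrMr // mul1r.
move=> N x Sx; have [_ h] := hF x Sx t M t0 t1 (fun z => hM x z Sx).
have := h (ofReal r) N; rewrite cr => /(_ rt); rewrite mulrAC.
by rewrite /dil /osum; under [X in _ -> cmod (_ - X) <= _]eq_bigr do rewrite mulrC.
Qed.

End HardyCoefficients.

Lemma hnorm2BC (R : realType) (X : Type) (H : hilbert R X) (f g : X -> Cplx R) :
  hcar H f -> hcar H g -> hnorm2 H (fun x => f x - g x) = hnorm2 H (fun x => g x - f x).
Proof.
by move=> hf hg; rewrite !hnorm2B // (hip_conj hf hg) cRe_conj [hnorm2 H g + _]addrC.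
Qed.

Section BoundaryValues.
Context {R : realType} {m : nat}.
Local Notation n := m.+1.
Local Notation C := (Cplx R).
Local Notation Cn := 'rV[Cplx R]_n.
Local Notation S := (csphere : set (BCn R n)).
Variable sigma : {measure set (BCn R n) -> \bar R}.
Hypothesis hs : normalized_rotation_invariant sigma.
Implicit Types (f g : Cn -> C) (r : R).
Local Notation L2s := (L2s sigma).
Local Notation q := (hnorm2 L2s).
Local Notation ip := (hip L2s).

Section Series.
Variables (f : Cn -> C) (F : nat -> BCn R n -> C).
Hypothesis hf : sliceholo 1 f.
Hypothesis sF : forall k, sqint sigma S (F k).
Hypothesis oF : forall k l, k <> l -> ip (F k) (F l) = 0.
Hypothesis geo : forall r, 0 < r -> r < 1 -> exists K p : R, [/\ 0 <= p, p < 1 &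
  forall N (x : BCn R n), S x -> cmod (dil r f x - osum F (fun k => ofReal r ^+ k) N x) <= K * p ^+ N].

Lemma sqip_dil_coef r k : 0 < r -> r < 1 ->
  ip (dil r f) (F k) = ofReal r ^+ k * ofReal (q (F k)).
Proof.
move=> r0 r1; have [K [p [p0 p1 hK]]] := geo r0 r1.
have sFk : hcar L2s (F k) := sF k.
have sd : hcar L2s (dil r f) by exact: sqint_dil.
have so N : hcar L2s (osum F (fun k => ofReal r ^+ k) N) by exact: hcar_osum.
apply: (@eq_of_geometric _ _ _ (K * Num.sqrt (q (F k))) p k.+1) => // N kN.
rewrite -(hip_osumF (H := L2s) sF oF (fun k => ofReal r ^+ k) kN) -hipBl //.
have K0 : 0 <= K * p ^+ N.
  have x1 : S (delta_mx 0 0 : Cn) by apply/csphere_vnorm; rewrite vnorm_delta.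
  by apply: le_trans (hK N _ x1); exact: cmod_ge0.
apply: ler_of_sqr; rewrite ?cmod_ge0 //.
  by rewrite mulrAC mulr_ge0 ?sqrtr_ge0.
apply: (le_trans (hcauchy_schwarz (hcarB sd (so N)) sFk)).
rewrite mulrAC exprMn sqr_sqrtr ?hnorm2_ge0 // ler_wpM2r ?hnorm2_ge0 //.
by apply: (hnorm2_bounded hs) => [|x Sx]; [exact: (hcarB (H := L2s) sd (so N))|exact: hK].
Qed.

Lemma hnorm2_dil_osum r N : 0 < r -> r < 1 ->
  q (fun x => dil r f x - osum F (fun k => ofReal r ^+ k) N x) =
  q (dil r f) - \sum_(k < N) r ^+ k ^+ 2 * q (F k).
Proof.
move=> r0 r1; rewrite (ortho_pythagoras (H := L2s) sF oF); first last.
- by move=> k _; exact: sqip_dil_coef.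
- exact: sqint_dil.
by congr (_ - _); apply: eq_bigr => k _; rewrite cmodX cmod_ofReal gtr0_norm.
Qed.

(** Bessel's inequality for the dilate of radius [r] bounds the sum with weights [r^(2k)]; for a
    fixed number of terms the weights tend to 1 with [r]. *)
Lemma hardy_sum_le (M : R) : (forall r, 0 < r -> r < 1 -> q (dil r f) <= M) ->
  forall N, \sum_(k < N) q (F k) <= M.
Proof.
move=> hM N; set s := \sum_(k < N) _.
have s0 : 0 <= s by apply: sumr_ge0 => k _; apply: hnorm2_ge0; exact: sF.
have step r : 0 < r -> r < 1 -> s <= M + (2 * N)%:R * (1 - r) * s.
  move=> r0 r1; have := hnorm2_ge0 (hcarB (sqint_dil hs r0 r1 hf : hcar L2s _) (hcar_osum (H := L2s) sF (fun k => ofReal r ^+ k) N)).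
  rewrite hnorm2_dil_osum // => h.
  have : s - \sum_(k < N) r ^+ k ^+ 2 * q (F k) <= (2 * N)%:R * (1 - r) * s.
    rewrite /s -sumrB mulr_sumr; apply: ler_sum => k _.
    have qk : 0 <= q (F k) by apply: hnorm2_ge0; exact: sF.
    rewrite -[X in X - _]mul1r -mulrBl ler_wpM2r // -exprM.
    apply: (le_trans (one_sub_exp_le _ (ltW r0) (ltW r1))).
    rewrite ler_wpM2r ?subr_ge0 ?(ltW r1) // ler_nat mulnC leq_pmul2l //; exact: ltnW.
  by have := hM r r0 r1; lra.
rewrite leNgt; apply/negP => Ms.
(* With [r = 1 - y]: the first bound keeps [r] positive, the second makes the loss [2 N y s] at most
   half of [s - M]. *)
pose y := Num.min 2^-1 ((s - M) / (2 * ((2 * N)%:R * s + 1))).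
have N0 : 0 <= (2 * N)%:R * s by rewrite mulr_ge0.
have d0 : 0 < 2 * ((2 * N)%:R * s + 1) by rewrite mulr_gt0 // ltr_wpDl.
have y0 : 0 < y by rewrite lt_min invr_gt0 ltr0n /= divr_gt0 ?subr_gt0.
have y1 : y <= 2^-1 by rewrite ge_min lexx.
have y2 : y * (2 * ((2 * N)%:R * s + 1)) <= s - M by rewrite -ler_pdivlMr // ge_min lexx orbT.
clearbody y; have := step (1 - y); rewrite subKr => h.
have r0 : 0 < 1 - y by lra.
have r1 : 1 - y < 1 by lra.
have := h r0 r1; move: y2 Ms N0 y0; nra.
Qed.

Variable A : R.
Hypothesis hA : forall r, 0 < r -> r < 1 -> q (dil r f) <= A.

(** The weights [r^(2k)] are at most 1, so the tail of every dilate is dominated by the tail of the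
    unweighted sum, uniformly in [r]. *)
Lemma hnorm2_dil_tail (N : nat) (e : R) r : 0 < r -> r < 1 ->
  (forall M, (N <= M)%N -> \sum_(k < M) q (F k) - \sum_(k < N) q (F k) <= e) ->
  q (fun x => dil r f x - osum F (fun k => ofReal r ^+ k) N x) <= e.
Proof.
move=> r0 r1 he; have [K [p [p0 p1 hK]]] := geo r0 r1.
have sd : hcar L2s (dil r f) by exact: sqint_dil.
have so M : hcar L2s (osum F (fun k => ofReal r ^+ k) M) by exact: hcar_osum.
apply/ler_addgt0Pr => x x0.
have K0 : 0 <= K ^+ 2 by exact: sqr_ge0.
have p2 : `|p ^+ 2| < 1 by rewrite ger0_norm ?sqr_ge0 // expr_lt1.
have [N' hN'] := geometric_small (K ^+ 2) p2 x0; pose M := maxn N N'.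
have NM : (N <= M)%N by exact: leq_maxl.
have : q (fun x => dil r f x - osum F (fun k => ofReal r ^+ k) M x) <= x.
  have := hN' M (leq_maxr _ _); rewrite exprAC -exprMn ger0_norm ?sqr_ge0 // => /ltW; apply: le_trans.
  by apply: (hnorm2_bounded hs) => [|y Sy]; [exact: (hcarB (H := L2s) sd (so M))|exact: hK].
rewrite !hnorm2_dil_osum //.
have : \sum_(k < M) r ^+ k ^+ 2 * q (F k) - \sum_(k < N) r ^+ k ^+ 2 * q (F k) <=
    \sum_(k < M) q (F k) - \sum_(k < N) q (F k).
  rewrite (big_ord_widen _ (fun k => r ^+ k ^+ 2 * q (F k)) NM) (big_ord_widen _ (fun k => q (F k)) NM).
  rewrite [X in _ - X]big_mkcond [X in _ <= _ - X]big_mkcond -!sumrB; apply: ler_sum => k _.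
  have qk : 0 <= q (F k) by apply: hnorm2_ge0; exact: sF.
  case: ifP => _; first by rewrite !subrr.
  rewrite !subr0 ler_piMl // expr_le1 // ?exprn_ge0 ?exprn_ile1 // ltW //.
by have := he M NM; lra.
Qed.

(** [g] is the L^2 sum of the homogeneous parts. The last two clauses say that its squared norm is
    the supremum over the dilates, so bounds pass freely between a Hardy function and its boundary
    value. *)
Lemma hardy_limit : exists g : BCn R n -> C, [/\ sqint sigma S g,
  forall e : R, 0 < e -> exists2 dl : R, 0 < dl & forall r, 0 < r -> r < 1 -> 1 - dl < r ->
    q (fun x => dil r f x - g x) <= e,
  forall r, 0 < r -> r < 1 -> q (dil r f) <= q g
  & forall M, (forall r, 0 < r -> r < 1 -> q (dil r f) <= M) -> q g <= M].
Proof.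
have sA := hardy_sum_le hA.
have [g [sg cg ig]] := ortho_cvg (H := L2s) sF oF sA.
have pg N : q (fun x => g x - osum F (fun=> 1) N x) = q g - \sum_(k < N) q (F k).
  rewrite (@ortho_pythagoras _ _ L2s F sF oF g (fun=> 1) N sg) => [|k _]; last by rewrite ig mul1r.
  by congr (_ - _); apply: eq_bigr => k _; rewrite cmod1 expr1n mul1r.
have so t N : hcar L2s (osum F t N) by exact: hcar_osum.
have a0 k : 0 <= q (F k) by apply: hnorm2_ge0; exact: sF.
have sum_g N : \sum_(k < N) q (F k) <= q g.
  by rewrite -subr_ge0 -pg; apply: hnorm2_ge0; exact: hcarB.
have sym N : q (fun x => osum F (fun=> 1) N x - g x) = q (fun x => g x - osum F (fun=> 1) N x).
  exact: (@hnorm2BC _ _ L2s).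
have A0 : 0 <= A by apply: le_trans (sA 0%N); rewrite big_ord0.
exists g; split => // [e e0|r r0 r1|M hM].
(* Path: the dilate, its partial sum, the partial sum at radius 1, then [g]. Each step costs
   [e / 16], and the two uses of [hnorm2_triangle] double, giving [10 e / 16] in all. *)
- have e8 : 0 < e / 16 by rewrite divr_gt0.
  have [N1 h1] := bounded_sum_tail a0 sA e8.
  have [N2 h2] := cg (e / 16) e8; pose N := maxn N1 N2.
  have tail M : (N <= M)%N -> \sum_(k < M) q (F k) - \sum_(k < N) q (F k) <= e / 16.
    move=> NM; have N1N : (N1 <= N)%N by exact: leq_maxl.
    have := h1 M (leq_trans N1N NM).
    have : \sum_(k < N1) q (F k) <= \sum_(k < N) q (F k).
      rewrite (big_ord_widen _ (fun k => q (F k)) N1N) big_mkcond; apply: ler_sum => k _.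
      by case: ifP.
    lra.
  have hN := h2 N (leq_maxr _ _).
  have y0 : 0 < Num.min 1 (e / (16 * (N%:R ^+ 2 * A + 1))).
    have z0 : 0 <= N%:R ^+ 2 * A by rewrite mulr_ge0 ?sqr_ge0.
    by rewrite lt_min ltr01 divr_gt0 // mulr_gt0 // ltr_wpDl.
  exists (Num.min 1 (e / (16 * (N%:R ^+ 2 * A + 1)))) => // r r0 r1.
  rewrite ltrBlDr -ltrBlDl lt_min => /andP[_]; set y := 1 - r.
  have z0 : 0 <= N%:R ^+ 2 * A by rewrite mulr_ge0 ?sqr_ge0.
  rewrite ltr_pdivlMr ?mulr_gt0 ?ltr_wpDl // => hy.
  have sd : hcar L2s (dil r f) by exact: sqint_dil.
  have t1 := hnorm2_dil_tail r0 r1 tail.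
  have t2 : q (fun x => osum F (fun=> 1) N x - osum F (fun k => ofReal r ^+ k) N x) <= e / 16.
    rewrite osumB (hnorm2_osum (H := L2s) sF oF).
    apply: (@le_trans _ _ (\sum_(k < N) (N%:R * y) ^+ 2 * q (F k))).
      apply: ler_sum => k _; rewrite ler_wpM2r // -[1]ofReal1 -ofRealX -ofRealB cmod_ofReal.
      have rk : 0 <= 1 - r ^+ k by rewrite subr_ge0 exprn_ile1 // ltW.
      have hk := one_sub_exp_le k (ltW r0) (ltW r1).
      rewrite ger0_norm // lerXn2r ?nnegrE //; first by rewrite mulr_ge0 // /y; lra.
      apply: (le_trans hk); rewrite ler_wpM2r //; first by rewrite /y; lra.
      by rewrite ler_nat ltnW.
    rewrite -mulr_sumr exprMn; apply: (@le_trans _ _ (N%:R ^+ 2 * y ^+ 2 * A)).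
      by rewrite ler_wpM2l ?sA // mulr_ge0 ?sqr_ge0.
    have yy : y ^+ 2 <= y by rewrite expr2 ler_piMr //; rewrite /y; lra.
    have yp : 0 < y by rewrite /y; lra.
    move: hy z0 yy yp; move: (N%:R ^+ 2 : R) y => B y; nra.
  apply: (le_trans (hnorm2_triangle (g := osum F (fun k => ofReal r ^+ k) N) sd (so _ _) sg)).
  have t3 : q (fun x => g x - osum F (fun k => ofReal r ^+ k) N x) <=
      2 * (e / 16 + e / 16).
    apply: (le_trans (hnorm2_triangle (g := osum F (fun=> 1) N) sg (so _ _) (so _ _))).
    move: hN (t2); rewrite -/(q _) sym => hN t2'.
    have : q (fun x => osum F (fun k => ofReal r ^+ k) N x - osum F (fun=> 1) N x) <= e / 16.
      by rewrite (@hnorm2BC _ _ L2s).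
    lra.
  lra.
- apply: (@le_trans _ _ (q g)) => //.
  apply/ler_addgt0Pr => x x0; have [N hN] := bounded_sum_tail a0 sA x0.
  have := hnorm2_dil_tail r0 r1 hN; rewrite hnorm2_dil_osum //.
  have : \sum_(k < N) r ^+ k ^+ 2 * q (F k) <= \sum_(k < N) q (F k).
    apply: ler_sum => k _; rewrite ler_piMl // expr_le1 // ?exprn_ge0 ?exprn_ile1 // ltW //.
  by have := sum_g N; lra.
- apply/ler_addgt0Pr => x x0; have [N hN] := cg x x0.
  have := hN N (leqnn N); rewrite -/(q _) sym pg.
  by have := hardy_sum_le hM N; lra.
Qed.

End Series.
End BoundaryValues.

(** * The Hardy space as a Hilbert space *)

Section HardySpace.
Context {R : realType} {m : nat}.
Local Notation n := m.+1.
Local Notation C := (Cplx R).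
Local Notation Cn := 'rV[Cplx R]_n.
Local Notation S := (csphere : set (BCn R n)).
Variable sigma : {measure set (BCn R n) -> \bar R}.
Hypothesis hs : normalized_rotation_invariant sigma.
Implicit Types (f g : Cn -> C) (r : R).
Local Notation L2s := (L2s sigma).
Local Notation q := (hnorm2 L2s).
Local Notation ip := (hip L2s).
Local Notation bv := (boundary_value sigma).

Lemma integral_dil r f : 0 < r -> r < 1 -> sliceholo 1 f ->
  (\int[sigma]_(x in S) (cmod (f (ofReal r *: (x : Cn))) ^+ 2)%:E = (q (dil r f))%:E)%E.
Proof.
by move=> r0 r1 hf; rewrite /hnorm2 (EFin_sqip measurable_csphere (sqint_dil hs r0 r1 hf)).
Qed.

Lemma Hardy2P f : Hardy2 sigma f <-> holomorphic f /\
  exists M, forall r, 0 < r -> r < 1 -> q (dil r f) <= M.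
Proof.
split=> [[hf hM]|[hf [M hM]]]; split => //; have sf := holomorphic_sliceholo hf.
  set A := ereal_sup _ in hM; have hA r : 0 < r -> r < 1 -> ((q (dil r f))%:E <= A)%E.
    move=> r0 r1; apply: ereal_sup_ubound; exists r; first by rewrite /= r0 r1.
    exact: integral_dil.
  exists (fine A) => r r0 r1; have fA : A \is a fin_num.
    by rewrite fin_real // hM andbT; apply: lt_le_trans (hA r r0 r1); rewrite ltNyr.
  by rewrite -lee_fin (fineK fA) hA.
apply: (@le_lt_trans _ _ M%:E); last by rewrite ltry.
apply: ub_ereal_sup => _ [r /andP[r0 r1] <-].
by rewrite integral_dil // lee_fin hM.
Qed.

Definition bvlim f (g : BCn R n -> C) := sqint sigma S g /\
  forall e : R, 0 < e -> exists2 dl : R, 0 < dl & forall r, 0 < r -> r < 1 -> 1 - dl < r ->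
    q (fun x => dil r f x - g x) <= e.

Lemma bvP f g : sliceholo 1 f -> is_boundary_value sigma f g <-> bvlim f (g : BCn R n -> C).
Proof.
move=> hf.
have E (g' : BCn R n -> C) r : sqint sigma S g' -> 0 < r -> r < 1 ->
    (\int[sigma]_(x in S) (cmod (f (ofReal r *: (x : Cn)) - g' x) ^+ 2)%:E =
     (q (fun x => dil r f x - g' x))%:E)%E.
  move=> sg r0 r1; rewrite /hnorm2 (EFin_sqip measurable_csphere) //.
  exact: (sqintB measurable_csphere (sqint_dil hs r0 r1 hf) sg).
split=> [[sg cg]|[sg cg]]; split => //.
  move=> e e0; have /fine_cvgP[_ /cvgrPdist_le/(_ e e0)] := cg.
  move=> /nbhs_ballP[dl /= d0 h]; exists dl => // r r0 r1 rd.
  have := h r; rewrite /ball /= => /(_ _ r1).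
  rewrite ger0_norm ?subr_ge0 ?(ltW r1) // => h'.
  have : `|0 - fine (q (fun x => dil r f x - g x))%:E| <= e.
    rewrite -E //; apply: h'; lra.
  by rewrite /= sub0r normrN; apply: le_trans; exact: ler_norm.
have near01 : \forall r \near (1 : R)^'-, 0 < r /\ r < 1.
  near=> r; split; near: r; [exact: nbhs_left_gt|exact: nbhs_left_lt].
apply/fine_cvgP; split.
  near=> r; have [r0 r1] : 0 < r /\ r < 1 by near: r.
  by rewrite E.
apply/cvgrPdist_le => e e0; have [dl d0 h] := cg e e0.
near=> r; have [r0 r1] : 0 < r /\ r < 1 by near: r.
rewrite /= E //= sub0r normrN ger0_norm.
  by apply: h => //; near: r; apply: nbhs_left_gt; rewrite ltrBlDr ltrDl.
apply: hnorm2_ge0; exact: (sqintB measurable_csphere (sqint_dil hs r0 r1 hf) sg).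
Unshelve. all: by end_near.
Qed.

Lemma bvlim_uniq f (g g' : BCn R n -> C) : sliceholo 1 f -> bvlim f g -> bvlim f g' ->
  q (fun x => g x - g' x) = 0.
Proof.
move=> hf [sg cg] [sg' cg']; apply/eqP; rewrite eq_le hnorm2_ge0 ?andbT; last first.
  exact: (hcarB (H := L2s) sg sg').
apply/ler_addgt0Pr => e e0; rewrite add0r; have e4 : 0 < e / 4 by rewrite divr_gt0.
have [d1 d10 h1] := cg _ e4; have [d2 d20 h2] := cg' _ e4.
pose y := Num.min 2^-1 (Num.min (d1 / 2) (d2 / 2)).
have y0 : 0 < y by rewrite !lt_min invr_gt0 ltr0n !divr_gt0.
have y2 : y <= 2^-1 by rewrite ge_min lexx.
have y3 : y <= d1 / 2 by rewrite !ge_min lexx ?orbT.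
have y4 : y <= d2 / 2 by rewrite !ge_min lexx ?orbT.
clearbody y; have r0 : 0 < 1 - y by lra.
have r1 : 1 - y < 1 by lra.
have {}h1 : q (fun x => dil (1 - y) f x - g x) <= e / 4 by apply: h1 => //; lra.
have {}h2 : q (fun x => dil (1 - y) f x - g' x) <= e / 4 by apply: h2 => //; lra.
have sd : hcar L2s (dil (1 - y) f) by exact: sqint_dil.
rewrite (@hnorm2BC _ _ L2s) // in h1; rewrite (@hnorm2BC _ _ L2s) // in h2.
have := @hnorm2_triangle _ _ L2s _ _ _ sg sd sg'; lra.
Qed.

Lemma bvlim_lin (a : C) f g (f' g' : BCn R n -> C) : sliceholo 1 f -> sliceholo 1 g ->
  bvlim f f' -> bvlim g g' ->
  bvlim (fun z => a * f z + g z) (fun x => a * f' x + g' x).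
Proof.
move=> hf hg [sf cf] [sg cg]; split; first exact: (sqint_lin measurable_csphere).
move=> e e0; pose B := 4 * (cmod a ^+ 2 + 1).
have B0 : 0 < B by rewrite mulr_gt0 // ltr_wpDl // sqr_ge0.
have eB : 0 < e / B by rewrite divr_gt0.
have [d1 d10 h1] := cf _ eB; have [d2 d20 h2] := cg _ eB.
exists (Num.min d1 d2) => [|r r0 r1 rd]; first by rewrite lt_min d10.
have rd1 : 1 - d1 < r by apply: le_lt_trans rd; rewrite lerD2l lerN2 ge_min lexx.
have rd2 : 1 - d2 < r by apply: le_lt_trans rd; rewrite lerD2l lerN2 ge_min lexx orbT.
have {}h1 := h1 r r0 r1 rd1; have {}h2 := h2 r r0 r1 rd2.
have -> : (fun x => dil r (fun z => a * f z + g z) x - (a * f' x + g' x)) =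
    (fun x => a * (dil r f x - f' x) + (dil r g x - g' x)).
  by apply/funext => x; rewrite /dil; ring.
have s1 : hcar L2s (fun x => dil r f x - f' x).
  exact: (sqintB measurable_csphere (sqint_dil hs r0 r1 hf) sf).
have s2 : hcar L2s (fun x => dil r g x - g' x).
  exact: (sqintB measurable_csphere (sqint_dil hs r0 r1 hg) sg).
apply: (le_trans (hnorm2_lin_le a s1 s2)).
have a2 : 0 <= cmod a ^+ 2 by exact: sqr_ge0.
have := hnorm2_ge0 s1; have := hnorm2_ge0 s2.
move: h1 h2; rewrite !ler_pdivlMr // /B.
move: (cmod a ^+ 2) (q _) (q _) a2 => c u v c0; nra.
Qed.

Lemma Hardy2_holo f : Hardy2 sigma f -> sliceholo 1 f.
Proof. by case=> /holomorphic_sliceholo. Qed.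

Lemma hardy_exists f : Hardy2 sigma f -> exists g, [/\ bvlim f g,
  forall r, 0 < r -> r < 1 -> q (dil r f) <= q g
  & forall M, (forall r, 0 < r -> r < 1 -> q (dil r f) <= M) -> q g <= M].
Proof.
move=> /Hardy2P[hf [M hM]]; have sf := holomorphic_sliceholo hf.
have [F [sF oF geo]] := hardy_coef hs sf.
have [g [sg cg h1 h2]] := hardy_limit hs sf sF oF geo hM.
by exists g; split.
Qed.

(** [boundary_value] is a choice with default 0; existence, from the homogeneous series, makes the
    chosen function a genuine limit. *)
Lemma bv_spec f : Hardy2 sigma f -> bvlim f (bv f).
Proof.
move=> hf; have [g [hg _ _]] := hardy_exists hf.
have sf := Hardy2_holo hf; apply/(bvP _ sf).
by apply: (@xgetPex _ (fun=> 0) (is_boundary_value sigma f)); exists g; apply/(bvP _ sf).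
Qed.

Lemma sqint_bv f : Hardy2 sigma f -> sqint sigma S (bv f : BCn R n -> C).
Proof. by move=> /bv_spec[]. Qed.

Lemma hnorm2_bvE f g : Hardy2 sigma f -> bvlim f g -> q (bv f : BCn R n -> C) = q g.
Proof.
move=> hf hg; apply: hnorm2_null (bvlim_uniq (Hardy2_holo hf) (bv_spec hf) hg).
  exact: sqint_bv.
by case: hg.
Qed.

Lemma hnorm2_dil_le f r : Hardy2 sigma f -> 0 < r -> r < 1 ->
  q (dil r f) <= q (bv f : BCn R n -> C).
Proof.
move=> hf r0 r1; have [g [hg h _]] := hardy_exists hf.
by rewrite (hnorm2_bvE hf hg) h.
Qed.

Lemma hnorm2_bv_le f M : Hardy2 sigma f ->
  (forall r, 0 < r -> r < 1 -> q (dil r f) <= M) -> q (bv f : BCn R n -> C) <= M.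
Proof.
move=> hf hM; have [g [hg _ h]] := hardy_exists hf.
by rewrite (hnorm2_bvE hf hg) h.
Qed.

Lemma Hardy2_lin (a : C) f g : Hardy2 sigma f -> Hardy2 sigma g ->
  Hardy2 sigma (fun z => a * f z + g z).
Proof.
move=> hf hg; apply/Hardy2P; split.
  move=> z hz; have df := proj1 hf z hz; have dg := proj1 hg z hz.
  apply: (@differentiableD _ _ _ (fun z => a * f z) g) => //.
  exact: (@differentiableZ _ _ _ f a).
exists (2 * (cmod a ^+ 2 * q (bv f : BCn R n -> C) + q (bv g : BCn R n -> C))) => r r0 r1.
have s1 : hcar L2s (dil r f) by exact: sqint_dil (Hardy2_holo hf).
have s2 : hcar L2s (dil r g) by exact: sqint_dil (Hardy2_holo hg).
apply: (le_trans (hnorm2_lin_le a s1 s2)); rewrite ler_wpM2l //.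
by apply: lerD; rewrite ?ler_wpM2l ?sqr_ge0 ?hnorm2_dil_le.
Qed.

Lemma Hardy20 : Hardy2 sigma (fun=> 0).
Proof.
apply/Hardy2P; split; first by move=> z _; exact: differentiable_cst.
exists 0 => r _ _; have := hip0l (hcar0 L2s); rewrite /hnorm2 /dil => ->.
by rewrite lexx.
Qed.

(** The function chosen for [a f + g] matches the combination of the chosen functions only up to
    null distance, which the inner product does not see. *)
Lemma H2inner_lin (a : C) f g h : Hardy2 sigma f -> Hardy2 sigma g -> Hardy2 sigma h ->
  H2inner sigma (fun z => a * f z + g z) h = a * H2inner sigma f h + H2inner sigma g h.
Proof.
move=> hf hg hh; have hfg := Hardy2_lin a hf hg.
have n0 := bvlim_uniq (Hardy2_holo hfg) (bv_spec hfg)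
  (bvlim_lin a (Hardy2_holo hf) (Hardy2_holo hg) (bv_spec hf) (bv_spec hg)).
have s1 := sqint_bv hf; have s2 := sqint_bv hg; have s3 := sqint_bv hh; have s4 := sqint_bv hfg.
have s5 := sqint_lin measurable_csphere a s1 s2.
transitivity (ip (fun x => a * bv f x + bv g x) (bv h)).
  exact: (@hip_null _ _ L2s _ _ _ s4 s5 s3 n0).
exact: (@hip_lin _ _ L2s a _ _ _ s1 s2 s3).
Qed.

Lemma H2inner_conj f g : Hardy2 sigma f -> Hardy2 sigma g ->
  H2inner sigma g f = (H2inner sigma f g)^*.
Proof. by move=> /sqint_bv hf /sqint_bv hg; exact: (@hip_conj _ _ L2s _ _ hf hg). Qed.

Lemma H2inner_ge0 f : Hardy2 sigma f -> 0 <= complex.Re (H2inner sigma f f).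
Proof. by move=> /sqint_bv hf; exact: (@hip_ge0 _ _ L2s _ hf). Qed.

(** Only dilates with [0 < r < 1] enter the definition near 1, so [f] and [g] have the same set of
    boundary values; the choice then returns the same function everywhere. *)
Lemma bv_ball_eq f g : ball_eq f g -> bv f = bv g.
Proof.
have E (f1 f2 h : Cn -> C) : ball_eq f1 f2 -> is_boundary_value sigma f1 h -> is_boundary_value sigma f2 h.
  move=> e [sh ch]; split => //; apply: cvg_trans ch.
  apply: near_eq_cvg; near=> r; apply: eq_integral => x /[!inE] Sx.
  have [r0 r1] : 0 < r /\ r < 1.
    by split; near: r; [exact: nbhs_left_gt|exact: nbhs_left_lt].
  by rewrite e //; apply/cball_vnorm; exact: dilation_in_ball.
move=> fg; rewrite /boundary_value; congr xget; apply/seteqP; split => h; apply: E => //.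
by move=> z hz; rewrite fg.
Unshelve. all: by end_near.
Qed.

Lemma H2inner_ball_eql f f' g : ball_eq f f' -> H2inner sigma f g = H2inner sigma f' g.
Proof. by move=> /bv_ball_eq e; rewrite /H2inner e. Qed.

Lemma szego_dil r (x w : Cn) : szego (ofReal r *: x) w = (szego (ofReal r *: w) x)^*.
Proof. by rewrite szego_conj /szego cdotZl cdotZr conj_ofReal. Qed.

Lemma holomorphic_szego (w : Cn) : vnorm w < 1 -> holomorphic (fun z => szego z w).
Proof. by move=> hw z /cball_vnorm hz; apply: szego_differentiable => //; rewrite ltW. Qed.

Lemma sqint_szego_conj (w : Cn) : vnorm w < 1 -> sqint sigma S (fun x : BCn R n => szego x w).
Proof.
move=> hw; apply: (sqint_bounded measurable_csphere (M := (1 - vnorm w) ^- n)).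
- exact: sigma_finite_total hs.
- rewrite (_ : (fun x : BCn R n => szego x w) = (fun x => (szego w x)^*)).
    by apply: cmeas_conj; exact: cmeas_szego.
  by apply/funext => x; rewrite szego_conj.
- by move=> x Sx; rewrite -szego_conj cmod_conj szego_bound // csphere_le1.
Qed.

Lemma Hardy2_szego (w : Cn) : vnorm w < 1 -> Hardy2 sigma (fun z => szego z w).
Proof.
move=> hw; apply/Hardy2P; split; first exact: holomorphic_szego.
exists (((1 - vnorm w) ^- n) ^+ 2) => r r0 r1.
have w0 : 0 < 1 - vnorm w by rewrite subr_gt0.
apply: (hnorm2_bounded hs) => [|x Sx].
  exact/(sqint_dil hs r0 r1)/holomorphic_sliceholo/holomorphic_szego.
rewrite /dil szego_dil cmod_conj; have rw : vnorm (ofReal r *: w) <= vnorm w.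
  by rewrite vnormZ cmod_ofReal gtr0_norm // ler_piMl ?vnorm_ge0 // ltW.
apply: (le_trans (szego_bound (le_lt_trans rw hw) (csphere_le1 Sx))).
have w1 : 0 < 1 - vnorm (ofReal r *: w) by rewrite subr_gt0 (le_lt_trans rw).
rewrite lef_pV2 ?posrE ?exprn_gt0 // lerXn2r ?nnegrE ?(ltW w0) ?(ltW w1) //.
by rewrite lerD2l lerN2.
Qed.

(** [szego_dil] moves the dilation from [x] to the pole [w]; the first-order expansion at [w] then
    bounds the difference by [K * (1 - r)], uniformly on the sphere. *)
Lemma bvlim_szego (w : Cn) : vnorm w < 1 -> bvlim (fun z => szego z w) (fun x : BCn R n => szego x w).
Proof.
move=> hw; split; first exact: sqint_szego_conj.
have [M [_ _ [B [dl [B0 d0 _ hB]]]]] := szego_uexp hw.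
pose K := B + n%:R * B.
have K0 : 0 <= K by rewrite addr_ge0 // mulr_ge0.
move=> e e0; pose y := Num.min dl (Num.min 1 (e / (K ^+ 2 + 1))).
have K2 : 0 < K ^+ 2 + 1 by rewrite ltr_wpDl // sqr_ge0.
have y0 : 0 < y by rewrite !lt_min d0 ltr01 divr_gt0.
exists y => // r r0 r1; rewrite ltrBlDr -ltrBlDl !lt_min => /and3P[].
set x := 1 - r => xd x1; rewrite ltr_pdivlMr // => xe.
have x0 : 0 < x by rewrite subr_gt0.
apply: (@le_trans _ _ ((K * x) ^+ 2)); last first.
  have x2 : x ^+ 2 <= x by rewrite expr2 ler_piMr // ltW.
  rewrite exprMn; have := sqr_ge0 K; nra.
apply: (hnorm2_bounded hs) => [|xi Sx].
  apply: (hcarB (H := L2s)); last exact: sqint_szego_conj.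
  exact/(sqint_dil hs r0 r1)/holomorphic_sliceholo/holomorphic_szego.
rewrite /dil szego_dil -[X in cmod (_ - X)]szego_conj -cconjB cmod_conj.
pose h : Cn := ofReal (- x) *: w.
have vh : vnorm h <= x.
  by rewrite vnormZ cmod_ofReal normrN gtr0_norm // ler_piMr ?(ltW x0) // ltW.
have -> : ofReal r *: w = w + h.
  by rewrite /h -[X in X + _](scale1r w) -scalerDl -[1]ofReal1 -ofRealD /x opprB addrC subrK.
have [_ bM /(_ h (le_lt_trans vh xd)) h1] := hB xi (csphere_le1 Sx).
have h2 := sum_coord_bound h bM.
have -> : szego (w + h) xi - szego w xi =
    (szego (w + h) xi - szego w xi - \sum_j h 0 j * M j xi) + \sum_j h 0 j * M j xi.
  by rewrite subrK.
apply: (le_trans (ler_cmodD _ _)); have v0 := vnorm_ge0 h.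
apply: (le_trans (lerD h1 h2)).
have nB : 0 <= n%:R * B by rewrite mulr_ge0.
rewrite /K mulrDl; apply: lerD; last by rewrite ler_wpM2l.
by rewrite ler_wpM2l //; clear -v0 vh x1; nra.
Qed.

(** The Cauchy formula for the dilate gives [f (r w)]; as [r] tends to 1, the dilates converge to
    the boundary value in mean square and [f (r w)] tends to [f w]. *)
Lemma reproducing f (w : Cn) : Hardy2 sigma f -> vnorm w < 1 ->
  ip (bv f) (fun x : BCn R n => szego x w) = f w.
Proof.
move=> hf hw; have sf := Hardy2_holo hf; have [sb cb] := bv_spec hf.
have sk := sqint_szego_conj hw.
apply/eqP; rewrite -subr_eq0; apply/eqP; apply: cmod_small_eq0 => e e0.
have e2 : 0 < e / 2 by rewrite divr_gt0.
have [d1 d10 h1] := (proj1 sf) w hw (e / 2) e2.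
pose Q := q (fun x : BCn R n => szego x w).
have Q0 : 0 <= Q by exact: (@hnorm2_ge0 _ _ L2s _ sk).
have e3 : 0 < (e / 2) ^+ 2 / (Q + 1) by rewrite divr_gt0 ?exprn_gt0 // ltr_wpDl.
have [d2 d20 h2] := cb _ e3.
pose y := Num.min 2^-1 (Num.min (d1 / 2) (d2 / 2)).
have y0 : 0 < y by rewrite !lt_min invr_gt0 ltr0n !divr_gt0.
have y2 : y <= 2^-1 by rewrite ge_min lexx.
have y3 : y <= d1 / 2 by rewrite !ge_min lexx ?orbT.
have y4 : y <= d2 / 2 by rewrite !ge_min lexx ?orbT.
clearbody y; pose r := 1 - y; have r0 : 0 < r by rewrite /r; lra.
have r1 : r < 1 by rewrite /r; lra.
have sd := sqint_dil hs r0 r1 sf.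
have E : ip (dil r f) (fun x : BCn R n => szego x w) = f (ofReal r *: w).
  have rho1 : 1 < 1 / r by rewrite ltr_pdivlMr // mul1r.
  rewrite -(cauchy_formula_sphere hs rho1 (sliceholo_scale r0 sf) hw).
  by apply: eq_cint => x _; rewrite szego_conj.
have h3 : cmod (f (ofReal r *: w) - f w) <= e / 2.
  apply: h1; rewrite -{2}[w]scale1r -scalerBl -[1]ofReal1 -ofRealB vnormZ cmod_ofReal /r.
  rewrite addrAC subrr sub0r normrN gtr0_norm //.
  have := vnorm_ge0 w; nra.
have h4 : cmod (ip (bv f) (fun x : BCn R n => szego x w) - f (ofReal r *: w)) <= e / 2.
  rewrite -E -(hipBl (H := L2s) sb sd sk); apply: ler_of_sqr; rewrite ?cmod_ge0 ?(ltW e2) //.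
  apply: (le_trans (hcauchy_schwarz (H := L2s) (hcarB (H := L2s) sb sd) sk)).
  rewrite (@hnorm2BC _ _ L2s _ _ sb sd).
  have rd : 1 - d2 < r by rewrite /r; lra.
  have Q1 : 0 < Q + 1 by rewrite ltr_wpDl.
  have := h2 r r0 r1 rd; rewrite ler_pdivlMr // -/Q.
  have := @hnorm2_ge0 _ _ L2s _ (hcarB (H := L2s) sd sb).
  by clear; move: (q (fun x => dil r f x - bv f x)) => z; nra.
apply: (le_trans (ler_cmod_dist _ (f (ofReal r *: w)) _)); lra.
Qed.

Lemma H2inner_szego f (w : Cn) : Hardy2 sigma f -> vnorm w < 1 ->
  H2inner sigma f (fun z => szego z w) = f w.
Proof.
move=> hf hw; rewrite -(reproducing hf hw).
have hk := Hardy2_szego hw; have sk := sqint_szego_conj hw; have sb := sqint_bv hf.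
have n0 := bvlim_uniq (Hardy2_holo hk) (bv_spec hk) (bvlim_szego hw).
transitivity (ip (bv f) (bv (fun z => szego z w))) => //.
rewrite (@hip_conj _ _ L2s _ _ (sqint_bv hk) sb) (@hip_conj _ _ L2s _ _ sk sb); congr (_^*).
exact: (@hip_null _ _ L2s _ _ _ (sqint_bv hk) sk sb n0).
Qed.

Lemma Hardy2_sub f g : Hardy2 sigma f -> Hardy2 sigma g -> Hardy2 sigma (fun z => f z - g z).
Proof.
move=> hf hg; rewrite (_ : (fun z => _) = (fun z => -1 * g z + f z)); first exact: Hardy2_lin.
by apply/funext => z; rewrite mulN1r addrC.
Qed.

Lemma hnorm2_bvB f g : Hardy2 sigma f -> Hardy2 sigma g ->
  q (bv (fun z => f z - g z) : BCn R n -> C) = q (fun x => bv f x - bv g x).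
Proof.
move=> hf hg; apply: hnorm2_bvE; first exact: Hardy2_sub.
have := bvlim_lin (-1) (Hardy2_holo hg) (Hardy2_holo hf) (bv_spec hg) (bv_spec hf).
by congr bvlim; apply/funext => z; rewrite mulN1r addrC.
Qed.

(** The limit is the Cauchy integral [F] of the L^2 limit [g] of the boundary values; [reproducing]
    gives pointwise convergence on the ball. Fatou's lemma on each dilate then controls [u j - F],
    without comparing the boundary value of [F] with [g]. *)
Lemma Hardy2_complete (u : nat -> Cn -> C) : (forall k, Hardy2 sigma (u k)) ->
  (forall e : R, 0 < e -> exists N, forall i j, (N <= i)%N -> (N <= j)%N ->
     complex.Re (H2inner sigma (fun x => u i x - u j x) (fun x => u i x - u j x)) <= e) ->
  exists2 l, Hardy2 sigma l & forall e : R, 0 < e -> exists N, forall j, (N <= j)%N ->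
     complex.Re (H2inner sigma (fun x => u j x - l x) (fun x => u j x - l x)) <= e.
Proof.
move=> hu hC; have mS := @measurable_csphere R n.
have sb k : sqint sigma S (bv (u k) : BCn R n -> C) by exact: sqint_bv.
have [g sg cg] : exists2 g, sqint sigma S g & hcvg L2s (fun k => bv (u k) : BCn R n -> C) g.
  apply: (sqip_complete mS sb) => e e0; have [N hN] := hC e e0.
  by exists N => i j Ni Nj; have := hN i j Ni Nj; rewrite -/(q _) hnorm2_bvB.
pose F (z : Cn) : C := cint sigma S (fun x : BCn R n => g x * szego z x).
have cF z : vnorm z < 1 -> forall e : R, 0 < e -> exists N, forall k, (N <= k)%N ->
    cmod (u k z - F z) <= e.
  move=> hz e e0; have sk := sqint_szego_conj hz.
  pose Q := q (fun x : BCn R n => szego x z).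
  have Q0 : 0 <= Q by exact: (@hnorm2_ge0 _ _ L2s _ sk).
  have e3 : 0 < e ^+ 2 / (Q + 1) by rewrite divr_gt0 ?exprn_gt0 // ltr_wpDl.
  have [N hN] := cg _ e3; exists N => k Nk.
  have -> : F z = ip g (fun x : BCn R n => szego x z).
    by apply: eq_cint => x _; rewrite szego_conj.
  rewrite -(reproducing (hu k) hz) -(hipBl (H := L2s) (sb k) sg sk).
  apply: ler_of_sqr; rewrite ?cmod_ge0 ?(ltW e0) //.
  apply: (le_trans (hcauchy_schwarz (H := L2s) (hcarB (H := L2s) (sb k) sg) sk)).
  have Q1 : 0 < Q + 1 by rewrite ltr_wpDl.
  have := hN k Nk; rewrite ler_pdivlMr // -/Q.
  have := @hnorm2_ge0 _ _ L2s _ (hcarB (H := L2s) (sb k) sg).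
  by clear; rewrite -/(q _); move: (q (fun x => bv (u k) x - g x)) => y; nra.
have hF : holomorphic F.
  move=> z /cball_vnorm hz; apply: cauchy_integral_differentiable => //.
  have s1 : sqint sigma S (fun=> 1 : C).
    apply: (sqint_bounded mS (M := 1)); first exact: sigma_finite_total hs.
      exact: cmeas_cst.
    by move=> x _; rewrite cmod1.
  have := sqint_mul mS sg s1; congr cintegrable; apply/funext => x.
  by rewrite cconj1 mulr1.
have key e : 0 < e -> exists N, forall j, (N <= j)%N -> forall r, 0 < r -> r < 1 ->
    q (dil r (fun z => u j z - F z)) <= e.
  move=> e0; have [N hN] := hC e e0; exists N => j Nj r r0 r1.
  have hd : sliceholo 1 (fun z => u j z - F z).
    apply: holomorphic_sliceholo => z hz.
    exact: differentiableB ((proj1 (hu j)) z hz) (hF z hz).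
  rewrite -lee_fin /hnorm2 (EFin_sqip mS (sqint_dil hs r0 r1 hd)).
  have hij k : Hardy2 sigma (fun z => u j z - u (N + k)%N z) by exact: Hardy2_sub.
  apply: (fatou_sqint mS (F := fun k => dil r (fun z => u j z - u (N + k)%N z))).
  - by move=> k; apply: sqint_cmeas; exact/(sqint_dil hs r0 r1)/Hardy2_holo.
  - move=> x Sx d d0; have [N' hN'] := cF _ (dilation_in_ball r0 r1 Sx) d d0.
    exists N' => k Nk; rewrite /dil opprB addrC addrA subrK cmodBC; apply: hN'.
    by rewrite (leq_trans Nk) // leq_addl.
  - move=> k; have sd := sqint_dil hs r0 r1 (Hardy2_holo (hij k)).
    rewrite -(EFin_sqip mS sd) lee_fin.
    apply: (le_trans (hnorm2_dil_le (hij k) r0 r1)).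
    by apply: (hN j (N + k)%N); rewrite // leq_addr.
have hjF e : 0 < e -> exists N, forall j, (N <= j)%N -> Hardy2 sigma (fun z => u j z - F z) /\
    q (bv (fun z => u j z - F z) : BCn R n -> C) <= e.
  move=> e0; have [N hN] := key e e0; exists N => j Nj.
  have h : Hardy2 sigma (fun z => u j z - F z).
    apply/Hardy2P; split; last by exists e; exact: hN.
    by move=> z hz; exact: differentiableB ((proj1 (hu j)) z hz) (hF z hz).
  by split => //; apply: hnorm2_bv_le => //; exact: hN.
exists F => [|e e0]; last by have [N hN] := hjF e e0; exists N => j Nj; exact: (proj2 (hN j Nj)).
(* [F = u N - (u N - F)] is a difference of Hardy functions. *)
have [N /(_ N (leqnn N))[h _]] := hjF 1 ltr01.
have := Hardy2_sub (hu N) h; congr (Hardy2 sigma).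
by apply/funext => z; rewrite opprB addrC subrK.
Qed.

Definition Hardy_hilbert : hilbert R Cn :=
  @Hilbert R Cn (Hardy2 sigma) (H2inner sigma) Hardy20 Hardy2_lin H2inner_lin H2inner_conj
    H2inner_ge0 Hardy2_complete.

End HardySpace.

(** * Cauchy kernels and polynomials in L^2 *)

Section PolynomialDensity.
Context {R : realType} {m : nat}.
Local Notation n := m.+1.
Local Notation C := (Cplx R).
Local Notation Cn := 'rV[Cplx R]_n.
Local Notation S := (csphere : set (BCn R n)).
Variable mu : {measure set (BCn R n) -> \bar R}.
Hypothesis fin : (mu S < +oo)%E.
Local Notation mS := (@measurable_csphere R n).

Lemma bounded_mul_cintegrable (f g : BCn R n -> C) (M : R) : cintegrable mu S f -> cmeas S g ->
  (forall x, S x -> cmod (g x) <= M) -> cintegrable mu S (fun x => g x * f x).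
Proof.
move=> fi mg hM; apply: (le_cintegrable mS (h := fun x => M * cmod (f x))).
- by apply: cmeasM => //; exact: (cintegrable_meas fi).
- by apply: (integrable_realZl mS); exact: (cintegrable_cmod mS fi).
- by move=> x Sx; rewrite cmodM ler_wpM2r ?cmod_ge0 ?hM.
Qed.

Lemma cmod_cint_mul_le (f g : BCn R n -> C) (M : R) : cintegrable mu S f -> cmeas S g ->
  (forall x, S x -> cmod (g x) <= M) ->
  cmod (cint mu S (fun x => g x * f x)) <= M * \int[mu]_(x in S) cmod (f x).
Proof.
move=> fi mg hM; have gi := bounded_mul_cintegrable fi mg hM.
apply: (le_trans (cmod_cint_le mS gi)).
rewrite -(RintegralZl M mS (cintegrable_cmod mS fi)).
apply: (le_Rintegral mS).
- exact: (cintegrable_cmod mS gi).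
- by apply: (integrable_realZl mS); exact: (cintegrable_cmod mS fi).
- by move=> x Sx; rewrite cmodM ler_wpM2r ?cmod_ge0 ?hM.
Qed.

Lemma vcont_cmeas_bounded (g : Cn -> C) : (forall x, vcont g x) ->
  cmeas S (g : BCn R n -> C) /\ exists M, forall x, S x -> cmod (g x) <= M.
Proof.
move=> cg; split; first exact: (vcont_cmeas mS (fun x _ => cg x)).
have [M hM] := @vball_bounded _ _ g 1 (fun z _ => cg z).
by exists M => x /csphere_le1; exact: hM.
Qed.

Lemma vcont_mul_cintegrable (f : BCn R n -> C) (g : Cn -> C) : cintegrable mu S f ->
  (forall x, vcont g x) -> cintegrable mu S (fun x : BCn R n => g x * f x).
Proof.
by move=> fi cg; have [mg [M hM]] := vcont_cmeas_bounded cg; exact: bounded_mul_cintegrable hM.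
Qed.

(** * Functions annihilated by the Cauchy kernels *)

Section Annihilator.
Variable f : BCn R n -> C.
Hypothesis fi : cintegrable mu S f.
Hypothesis f0 : forall z : Cn, vnorm z < 1 -> cint mu S (fun x : BCn R n => szego z x * f x) = 0.

(** At [z = s v] the hypothesis makes the partial sums of a power series in [s] of order [|s|^N];
    [coef_zero] kills the coefficients, and the binomial factor is nonzero. *)
Lemma annihilate_pow k (v : Cn) : cint mu S (fun x : BCn R n => cdot v x ^+ k * f x) = 0.
Proof.
pose K := vnorm v + 1; have K0 : 0 < K by rewrite ltr_wpDl ?vnorm_ge0.
have h0 : 0 < (2^-1 : R) by rewrite invr_gt0.
have h1 : (2^-1 : R) < 1 by rewrite invf_lt1 // ltr1n.
have [A A0 hA] := kernel_series m (ltW h0) h1 h0 h1.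
pose I := \int[mu]_(x in S) cmod (f x).
have I0 : 0 <= I by apply: Rintegral_ge0 => x _; exact: cmod_ge0.
pose e k := 'C(m + k, k)%:R * cint mu S (fun x : BCn R n => cdot v x ^+ k * f x).
have ci k' : cintegrable mu S (fun x : BCn R n => cdot v x ^+ k' * f x).
  by apply: (vcont_mul_cintegrable fi (g := fun x => cdot v x ^+ k')) => x; exact/vcontX/vcont_cdotr.
suff e0 : forall k, e k = 0.
  by have /eqP := e0 k; rewrite mulf_eq0 pnatr_eq0 -leqn0 leqNgt bin_gt0 leq_addl /= => /eqP.
have t0 : 0 < 2^-1 / K by rewrite divr_gt0.
apply: (@coef_zero _ e (A * I) (2^-1 / K) (2^-1 / K)) => // [|N s]; first by rewrite mulr_ge0.
rewrite ltr_pdivlMr // => hs.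
have vs : cmod s * vnorm v <= cmod s * K by rewrite ler_wpM2l ?cmod_ge0 // lerDl.
have sv : vnorm (s *: v) < 1 by rewrite vnormZ (le_lt_trans vs) // (lt_trans hs).
have -> : \sum_(j < N) e j * s ^+ j =
    cint mu S (fun x : BCn R n => (ksum m N (s * cdot v x) - szego (s *: v) x) * f x).
  have i1 j : cintegrable mu S (fun x : BCn R n => 'C(m + j, j)%:R * s ^+ j * (cdot v x ^+ j * f x)).
    exact: (cintegrableZ mS).
  have E : (fun x : BCn R n => (ksum m N (s * cdot v x) - szego (s *: v) x) * f x) =
      (fun x : BCn R n => \sum_(j < N) 'C(m + j, j)%:R * s ^+ j * (cdot v x ^+ j * f x) - szego (s *: v) x * f x).
    apply/funext => x; rewrite mulrBl; congr (_ - _); rewrite /ksum mulr_suml.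
    by apply: eq_bigr => j _; rewrite exprMn !mulrA.
  rewrite E (cintB mS); first last.
  - apply: (bounded_mul_cintegrable fi (M := (1 - vnorm (s *: v)) ^- n)); first exact: cmeas_szego.
    by move=> x /csphere_le1; exact: szego_bound.
  - exact: (cintegrable_sum mS _ (fun j : 'I_N => i1 j)).
  rewrite f0 // subr0 (cint_sum mS _ (fun j : 'I_N => i1 j)); apply: eq_bigr => j _.
  by rewrite (cintZ mS) // /e mulrAC.
rewrite mulrAC; apply: cmod_cint_mul_le => //.
  apply: cmeasB; last exact: cmeas_szego.
  apply: (@cmeas_sum _ _ _ S 'I_N _ (fun j (x : BCn R n) => 'C(m + j, j)%:R * (s * cdot v x) ^+ j)) => j.
  apply: cmeasZ; apply: cmeasX; apply: cmeasZ.
  exact: (@vcont_cmeas _ _ S (fun x => cdot v x) mS (fun x _ => vcont_cdotr v x)).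
move=> x Sx; have sx : cmod (s * cdot v x) <= cmod s * K.
  rewrite cmodM ler_wpM2l ?cmod_ge0 // (le_trans (cauchy_schwarz_cdot _ _)) //.
  by rewrite (proj1 (csphere_vnorm x) Sx) mulr1 lerDl.
rewrite cmodBC /szego cdotZl; apply: (le_trans (hA N _ (le_trans sx (ltW hs)))).
rewrite ler_wpM2l // lerXn2r ?nnegrE ?divr_ge0 ?cmod_ge0 ?(ltW h0) ?(ltW K0) //.
by rewrite invf_div [X in _ <= X]mulrA ler_wpM2r ?invr_ge0 ?(ltW h0).
Qed.

(** The factor [cdot v x ^+ k] is carried along for every [k] and [v] to make the property stable
    under multiplication by a conjugate coordinate; all conjugate monomials follow by induction. *)
Definition annihilated (H : Cn -> C) := (forall x, vcont H x) /\
  forall k v, cint mu S (fun x : BCn R n => cdot v x ^+ k * (H x * f x)) = 0.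

Lemma annihilated1 : annihilated (fun=> 1).
Proof.
split => [x|k v]; first exact: vcont_cst.
by rewrite -[RHS](annihilate_pow k v); apply: eq_cint => x _; rewrite mul1r.
Qed.

(** The linear coefficient in [t] of the vanishing integrals with [cdot (v + t e_j) x ^+ k.+1]. *)
Lemma annihilated_coord H j : annihilated H -> annihilated (fun x => (x 0 j)^* * H x).
Proof.
have cj x : vcont (fun x : Cn => (x 0 j)^*) x by exact/vcont_conj/vcont_coord.
move=> [cH hH]; split => [x|k v]; first by apply: vcontM.
have k1 : k.+1%:R != 0 :> C by rewrite pnatr_eq0.
apply: (mulfI k1); rewrite mulr0.
rewrite (@eq_cint _ _ _ mu S _ (fun x : BCn R n => cdot v x ^+ k * ((x : Cn) 0 j)^* * (H x * f x))); last first.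
  by move=> x _; rewrite !mulrA.
rewrite (@cint_pow_coef1 _ _ mu (fun x => cdot v x) (fun x : Cn => (x 0 j)^*) (fun x => H x * f x) k 0) ?coef0 //.
- by move=> x; exact: vcont_cdotr.
- move=> g cg; have := vcont_mul_cintegrable fi (g := fun x => g x * H x).
  have cgH x : vcont (fun x => g x * H x) x by apply: vcontM.
  by move=> /(_ cgH); congr cintegrable; apply/funext => x; rewrite mulrA.
move=> t; rewrite horner0 -[RHS](hH k.+1 (v + t *: delta_mx 0 j)); apply: eq_cint => x _.
by rewrite cdotDl cdotZl cdot_delta.
Qed.

Lemma annihilated_monomial (a : 'I_n -> nat) (s : seq 'I_n) :
  annihilated (fun x => \prod_(i <- s) (x 0 i)^* ^+ a i).
Proof.
elim: s => [|i s IH].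
  by have := annihilated1; congr annihilated; apply/funext => x; rewrite big_nil.
have h k : annihilated (fun x => (x 0 i)^* ^+ k * \prod_(i <- s) (x 0 i)^* ^+ a i).
  elim: k => [|k IHk]; first by have := IH; congr annihilated; apply/funext => x; rewrite expr0 mul1r.
  by have := annihilated_coord i IHk; congr annihilated; apply/funext => x; rewrite exprS mulrA.
by have := h (a i); congr annihilated; apply/funext => x; rewrite big_cons.
Qed.

Lemma annihilate_poly (p : mpoly.mpoly n C) :
  cint mu S (fun x : BCn R n => f x * (polyfun p x)^*) = 0.
Proof.
have ci (k : mpoly.multinom n) : cintegrable mu S (fun x : BCn R n =>
    (mpoly.mcoeff k p)^* * ((\prod_i ((x : Cn) 0 i)^* ^+ mpoly.fun_of_multinom k i) * f x)).
  apply: (cintegrableZ mS); apply: (vcont_mul_cintegrable fi (g := fun x : Cn => \prod_i (x 0 i)^* ^+ mpoly.fun_of_multinom k i)).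
  by case: (annihilated_monomial (mpoly.fun_of_multinom k) (index_enum 'I_n)).
rewrite (@eq_cint _ _ _ mu S _ (fun x : BCn R n => \sum_(k <- mpoly.msupp p)
    (mpoly.mcoeff k p)^* * ((\prod_i ((x : Cn) 0 i)^* ^+ mpoly.fun_of_multinom k i) * f x))); last first.
  move=> x _; rewrite /polyfun mpoly.mevalE cconj_sum mulr_sumr; apply: eq_bigr => k _.
  rewrite cconjM mulrC -mulrA; congr (_ * (_ * _)).
  by rewrite rmorph_prod; apply: eq_bigr => i _; exact: cconjX.
rewrite (cint_sum mS _ ci) big1 // => k _; rewrite (cintZ mS).
  (* Exponent 0 removes the auxiliary power and leaves the monomial alone. *)
  have [_ /(_ 0%N 0)] := annihilated_monomial (mpoly.fun_of_multinom k) (index_enum 'I_n).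
  by under eq_cint => x _ do rewrite expr0 mul1r; move=> ->; rewrite mulr0.
apply: (vcont_mul_cintegrable fi (g := fun x : Cn => \prod_i (x 0 i)^* ^+ mpoly.fun_of_multinom k i)).
by case: (annihilated_monomial (mpoly.fun_of_multinom k) (index_enum 'I_n)).
Qed.

End Annihilator.

Definition is_poly (g : Cn -> C) := exists p : mpoly.mpoly n C, forall x, g x = polyfun p x.

Lemma is_poly_cst (c : C) : is_poly (fun=> c).
Proof. by exists (mpoly.mpolyC n c) => x; rewrite /polyfun mpoly.mevalC. Qed.

Lemma is_polyD g h : is_poly g -> is_poly h -> is_poly (fun x => g x + h x).
Proof. by move=> [p hp] [p' hp']; eexists => x; rewrite hp hp'; exact: esym (mpoly.mevalD _ p p'). Qed.

Lemma is_polyM g h : is_poly g -> is_poly h -> is_poly (fun x => g x * h x).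
Proof. by move=> [p hp] [p' hp']; eexists => x; rewrite hp hp'; exact: esym (mpoly.mevalM _ p p'). Qed.

Lemma is_poly_coord j : is_poly (fun x => x 0 j).
Proof. by exists (mpoly.mpolyX C (mpoly.mnm1 j)) => x; rewrite /polyfun mpoly.mevalXU. Qed.

Lemma is_poly_sum (I : Type) (s : seq I) (F : I -> Cn -> C) : (forall i, is_poly (F i)) ->
  is_poly (fun x => \sum_(i <- s) F i x).
Proof.
move=> hF; elim: s => [|i s IH].
  by have := is_poly_cst 0; congr is_poly; apply/funext => x; rewrite big_nil.
by have := is_polyD (hF i) IH; congr is_poly; apply/funext => x; rewrite big_cons.
Qed.

Lemma is_polyX g k : is_poly g -> is_poly (fun x => g x ^+ k).
Proof.
move=> hg; elim: k => [|k IH]; first by have := is_poly_cst 1.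
by have := is_polyM hg IH; congr is_poly; apply/funext => x; rewrite exprS.
Qed.

Lemma vcont_polyfun (p : mpoly.mpoly n C) x : vcont (polyfun p) x.
Proof.
have -> : polyfun p = (fun x => \sum_(k <- mpoly.msupp p)
    mpoly.mcoeff k p * \prod_i x 0 i ^+ mpoly.fun_of_multinom k i).
  by apply/funext => y; rewrite /polyfun mpoly.mevalE.
elim: (mpoly.msupp p) => [|k s IH].
  by have := vcont_cst (0 : C) x; congr vcont; apply/funext => y; rewrite big_nil.
rewrite (_ : (fun x => _) = (fun x : Cn => mpoly.mcoeff k p * \prod_i x 0 i ^+ mpoly.fun_of_multinom k i +
  \sum_(k <- s) mpoly.mcoeff k p * \prod_i x 0 i ^+ mpoly.fun_of_multinom k i)); last first.
  by apply/funext => y; rewrite big_cons.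
apply: vcontD IH; apply: vcontM; first exact: vcont_cst.
elim: (index_enum 'I_n) => [|i r IHr].
  by have := vcont_cst (1 : C) x; congr vcont; apply/funext => y; rewrite big_nil.
rewrite (_ : (fun x => _) = (fun x : Cn => x 0 i ^+ mpoly.fun_of_multinom k i *
  \prod_(i <- r) x 0 i ^+ mpoly.fun_of_multinom k i)); last by apply/funext => y; rewrite big_cons.
by apply: vcontM IHr; exact/vcontX/vcont_coord.
Qed.

Lemma sqint_vcont (g : Cn -> C) : (forall x, vcont g x) -> sqint mu S (g : BCn R n -> C).
Proof.
move=> cg; have [mg [M hM]] := vcont_cmeas_bounded cg.
exact: (sqint_bounded mS fin mg hM).
Qed.

Lemma sqint_szego_mu (z : Cn) : vnorm z < 1 -> sqint mu S (fun x : BCn R n => szego x z).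
Proof.
move=> hz; apply: (sqint_bounded mS (M := (1 - vnorm z) ^- n)) => //.
  rewrite (_ : (fun x : BCn R n => szego x z) = (fun x => (szego z x)^*)).
    by apply: cmeas_conj; exact: cmeas_szego.
  by apply/funext => x; rewrite szego_conj.
by move=> x Sx; rewrite -szego_conj cmod_conj szego_bound // csphere_le1.
Qed.

(** The partial sums [ksum m N (cdot x z)] are polynomials in [x] converging uniformly on the
    sphere, and the measure is finite. *)
Lemma szego_in_H2 (z : Cn) : vnorm z < 1 -> H2_of_measure mu (fun x => szego x z).
Proof.
move=> hz; split; first exact: sqint_szego_mu.
move=> e e0; pose t := (1 + vnorm z) / 2.
have z0 := vnorm_ge0 z.
have t0 : 0 < t by rewrite divr_gt0 // ltr_wpDr.
have t1 : t < 1 by rewrite ltr_pdivrMr //; lra.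
have zt : vnorm z / t < 1 by rewrite ltr_pdivrMr // mul1r ltr_pdivlMr //; lra.
clearbody t; have [A A0 hA] := kernel_series m z0 hz t0 t1.
pose V := fine (mu S); have V0 : 0 <= V by exact: fine_ge0.
have q1 : `|vnorm z / t| < 1 by rewrite ger0_norm // divr_ge0 // ltW.
have e1 : 0 < e / (V + 1) by rewrite divr_gt0 // ltr_wpDl.
have [N hN] := geometric_small A q1 e1.
have [p hp] : is_poly (fun x => ksum m N (cdot x z)).
  apply: (@is_poly_sum 'I_N) => k; apply: is_polyM; first exact: is_poly_cst.
  apply: is_polyX; rewrite (_ : (fun x => _) = (fun x : Cn => \sum_j x 0 j * (z 0 j)^*)).
    by apply: is_poly_sum => j; apply: is_polyM; [exact: is_poly_coord|exact: is_poly_cst].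
  by apply/funext => x; rewrite cdot_sum.
exists p; pose g (x : BCn R n) := szego x z - polyfun p x.
have sg : sqint mu S g by apply: (sqintB mS); [exact: sqint_szego_mu|exact/sqint_vcont/vcont_polyfun].
have hg x : S x -> cmod (g x) <= A * (vnorm z / t) ^+ N.
  move=> Sx; have xz : cmod (cdot x z) <= vnorm z.
    by rewrite (le_trans (cauchy_schwarz_cdot _ _)) // (proj1 (csphere_vnorm x) Sx) mul1r.
  rewrite /g -hp; apply: (le_trans (hA N _ xz)).
  rewrite ler_wpM2l // lerXn2r ?nnegrE ?divr_ge0 ?cmod_ge0 ?(ltW t0) //.
  by rewrite ler_wpM2r // invr_ge0 ltW.
have := hN N (leqnn N); set B := A * _ in hg *; rewrite ltr_norml => /andP[_ hB].
have B0 : 0 <= B by rewrite mulr_ge0 // exprn_ge0 // divr_ge0 // ltW.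
have h : complex.Re (sqip mu S g g) <= B ^+ 2 * V.
  apply: (le_trans (Re_le_cmod _)).
  apply: (cmod_cint_bounded mS fin).
    exact: (cintegrable_meas (sqint_mul mS sg sg)).
  by move=> x Sx; rewrite cmodM cmod_conj expr2 ler_pM ?cmod_ge0 ?hg.
rewrite -[X in _ < X](gtr0_norm e0) -sqrtr_sqr /L2norm ltr_sqrt ?exprn_gt0 //.
apply: (le_lt_trans h); move: hB; rewrite ltr_pdivlMr ?ltr_wpDl // => hB.
clearbody B V; apply: (@le_lt_trans _ _ ((B * (V + 1)) ^+ 2)).
  by clear -V0; rewrite exprMn ler_wpM2l ?sqr_ge0 //; nra.
by rewrite ltrXn2r // mulr_ge0 // addr_ge0.
Qed.

(** One direction is [szego_in_H2]. For the other, [annihilate_poly] gives orthogonality to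
    polynomials, and Cauchy-Schwarz extends it to their closure. *)
Lemma L2ortho_H2P (f : Cn -> C) : L2 mu f ->
  (forall z, vnorm z < 1 -> cint mu S (fun x : BCn R n => f x * szego z x) = 0) <->
  L2ortho mu (H2_of_measure mu) f.
Proof.
move=> sf; split=> [f0|[_ f0] z hz]; last first.
  have := f0 _ (szego_in_H2 hz); rewrite /L2inner => <-.
  by apply: eq_cint => x _; rewrite szego_conj.
split => // g [sg hg].
have s1 : sqint mu S (fun=> 1 : C) by apply: sqint_vcont => x; exact: vcont_cst.
have fi : cintegrable mu S (f : BCn R n -> C).
  by have := sqint_mul mS sf s1; congr cintegrable; apply/funext => x; rewrite cconj1 mulr1.
have f0' z : vnorm z < 1 -> cint mu S (fun x : BCn R n => szego z x * f x) = 0.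
  by move=> /f0 <-; apply: eq_cint => x _; rewrite mulrC.
pose H := L2_hilbert mu mS.
have Q0 : 0 <= hnorm2 H f by exact: (@hnorm2_ge0 _ _ H _ sf).
apply: cmod_small_eq0 => e e0; pose d := e / (hnorm2 H f + 1).
have Q1 : 0 < hnorm2 H f + 1 by rewrite ltr_wpDl.
have d0 : 0 < d by rewrite divr_gt0.
have [p hp] := hg d d0; have sp := sqint_vcont (vcont_polyfun p).
have sd : sqint mu S (fun x : BCn R n => g x - polyfun p x) by exact: (sqintB mS).
have -> : L2inner mu f g = hip H f (fun x => g x - polyfun p x).
  rewrite (@hip_conj _ _ H _ _ sd sf) (@hipBl _ _ H _ _ _ sg sp sf) cconjB.
  rewrite -(@hip_conj _ _ H _ _ sg sf) -(@hip_conj _ _ H _ _ sp sf).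
  by rewrite [X in _ - X](annihilate_poly fi f0' p) subr0.
apply: ler_of_sqr; rewrite ?cmod_ge0 ?(ltW e0) //.
apply: (le_trans (@hcauchy_schwarz _ _ H _ _ sf sd)).
have h2 : hnorm2 H (fun x => g x - polyfun p x) <= d ^+ 2.
  rewrite -[X in X <= _]sqr_sqrtr; last exact: (@hnorm2_ge0 _ _ H _ sd).
  rewrite lerXn2r ?nnegrE ?sqrtr_ge0 ?(ltW d0) //; exact: ltW.
have dE : e = d * (hnorm2 H f + 1) by rewrite /d divfK // gt_eqF.
rewrite dE; apply: (@le_trans _ _ (hnorm2 H f * d ^+ 2)); first by rewrite ler_wpM2l.
move: (hnorm2 H f) Q0 => Q Q0; clearbody d; clear -Q0.
rewrite exprMn mulrC ler_wpM2l ?sqr_ge0 //; nra.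
Qed.

End PolynomialDensity.

(** * The operator V_b *)

Lemma szegoE (R : realType) (m : nat) (z x : 'rV[Cplx R]_m.+1) :
  szego z x = (1 - dotmx z x) ^- m.+1.
Proof. by rewrite /szego cdotE. Qed.

Lemma cauchy_kernelE (R : realType) (m : nat) (z x : 'rV[Cplx R]_m.+1) :
  cauchy_kernel z x = szego z x.
Proof. by rewrite szegoE. Qed.

Section DeBrangesRovnyak.
Context {R : realType} {m : nat}.
Local Notation n := m.+1.
Local Notation C := (Cplx R).
Local Notation Cn := 'rV[Cplx R]_n.
Local Notation S := (csphere : set (BCn R n)).
Local Notation mS := (@measurable_csphere R n).
Variables (sigma mu : {measure set (BCn R n) -> \bar R}) (b : Cn -> C).
Variables (Tbar A : (Cn -> C) -> (Cn -> C)).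
Hypothesis hs : normalized_rotation_invariant sigma.
Hypothesis hb : forall z, vnorm z < 1 -> differentiable b z.
Hypothesis b1 : forall z, vnorm z < 1 -> cmod (b z) <= 1.
Hypothesis bnc : exists z w, [/\ vnorm z < 1, vnorm w < 1 & b z != b w].
Hypothesis clark : is_Clark_measure b mu.
Hypothesis hT : is_adjoint sigma (mulop b) Tbar.
Hypothesis hA : is_positive_sqrt sigma (defect b Tbar) A.
Local Notation H2 := (Hardy_hilbert hs).
Local Notation H1 := (L2_hilbert mu mS).
Local Notation ker := (fun w z : Cn => szego z w).

Let bneq z : vnorm z < 1 -> 1 - b z != 0.
Proof. by move=> hz; rewrite subr_eq0 eq_sym; exact: (clark_neq1 hb bnc clark hz). Qed.

Let bneq_conj z : vnorm z < 1 -> 1 - (b z)^* != 0.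
Proof. by move=> hz; have := bneq hz; rewrite -conjC_eq0 cconjB cconj1. Qed.

(** The bound on [b] puts [b K_z] in the Hardy space, so that [adjoint_ker] can evaluate
    [<b K_z, K_w>] at [w] by the reproducing property. *)
Lemma Hardy2_mul_ker w : vnorm w < 1 -> Hardy2 sigma (mulop b (ker w)).
Proof.
move=> hw; have hd : holomorphic (mulop b (ker w)).
  move=> z hz; have /cball_vnorm z1 := hz.
  apply: differentiableM; first exact: hb.
  exact: (holomorphic_szego hw).
apply/(Hardy2P hs); split => //; exists ((1 * (1 - vnorm w) ^- n) ^+ 2) => r r0 r1.
apply: (hnorm2_bounded hs) => [|x Sx].
  exact/(sqint_dil hs r0 r1)/holomorphic_sliceholo.
have rx := dilation_in_ball r0 r1 Sx.
rewrite /dil /mulop cmodM ler_pM ?cmod_ge0 ?b1 //.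
by rewrite -szego_conj cmod_conj szego_bound // ltW.
Qed.

Lemma adjoint_ker z w : vnorm z < 1 -> vnorm w < 1 -> Tbar (ker w) z = (b w)^* * szego z w.
Proof.
move=> hz hw; have [[hT1 _ _ _] adj] := hT.
have hk := Hardy2_szego hs hw; have hk' := Hardy2_szego hs hz.
rewrite -(H2inner_szego hs (hT1 _ hk) hz) (H2inner_conj hs hk' (hT1 _ hk)) -adj //.
by rewrite (H2inner_szego hs (Hardy2_mul_ker hz) hw) /mulop cconjM szego_conj.
Qed.

Let Ah f : Hardy2 sigma f -> Hardy2 sigma (A f).
Proof. by case: hA => [[h _ _ _] _ _]; exact: h. Qed.

Let A_lin (a : C) f g : Hardy2 sigma f -> Hardy2 sigma g ->
  ball_eq (A (fun z => a * f z + g z)) (fun z => a * A f z + A g z).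
Proof. by case: hA => [[_ _ h _] _ _]; exact: h. Qed.

(** Positivity makes [<A h, h>] real for every [h]; applied to [h = a f + g] with [a = 1] and
    [a = i], this yields the imaginary and real parts of the identity. *)
Lemma sqrt_selfadjoint f g : Hardy2 sigma f -> Hardy2 sigma g ->
  H2inner sigma (A f) g = H2inner sigma f (A g).
Proof.
move=> hf hg; case: hA => _ pos _.
have real h : Hardy2 sigma h -> complex.Im (H2inner sigma (A h) h) = 0.
  by move=> /pos /ge0_cplx ->.
have expand (a : C) : complex.Im (a * H2inner sigma (A f) g + a^* * H2inner sigma (A g) f) = 0.
  have hfg := Hardy2_lin hs a hf hg.
  have := real _ hfg; rewrite (H2inner_ball_eql sigma _ (A_lin a hf hg)).
  rewrite (H2inner_lin hs a (Ah hf) (Ah hg) hfg).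
  have lr h : Hardy2 sigma h -> H2inner sigma h (fun z => a * f z + g z) =
      a^* * H2inner sigma h f + H2inner sigma h g.
    by move=> hh; exact: (@hip_linr _ _ H2 a f g _ hf hg hh).
  rewrite !lr; [|exact: Ah|exact: Ah].
  move: (real f hf) (real g hg).
  move: (H2inner sigma (A f) f) (H2inner sigma (A f) g) (H2inner sigma (A g) f) (H2inner sigma (A g) g).
  move=> x y x' y' x0 y0; rewrite mulrDr mulrA mul_conj !cImD cImZ x0 mulr0 add0r y0 addr0.
  by [].
have := expand 1; have := expand (Complex 0 1).
rewrite (H2inner_conj hs (Ah hg) hf).
move: (H2inner sigma (A f) g) (H2inner sigma (A g) f) => x y.
rewrite cconj1 !mul1r [(Complex 0 1)^*]conjE /= !(cImD, cImM) /= => h2 h1.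
apply: cplxP; rewrite ?cRe_conj ?cIm_conj; lra.
Qed.

Lemma sqrt_eval u z : Hardy2 sigma u -> vnorm z < 1 ->
  A u z = H2inner sigma u (A (ker z)).
Proof.
move=> hu hz; rewrite -(H2inner_szego hs (Ah hu) hz).
by apply: sqrt_selfadjoint => //; exact: Hardy2_szego.
Qed.

Lemma sqrt_gram v w : vnorm v < 1 -> vnorm w < 1 ->
  H2inner sigma (A (ker v)) (A (ker w)) = szego w v * (1 - b w * (b v)^*).
Proof.
move=> hv hw; have kv := Hardy2_szego hs hv.
rewrite -(sqrt_eval (Ah kv) hw); case: hA => _ _ -> //; last exact/cball_vnorm.
by rewrite /defect /mulop adjoint_ker //; ring.
Qed.

(** A subtype of points of the ball: [gram_transfer] asks that its families lie in the space for
    every index. *)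
Let W := {w : Cn | vnorm w < 1}.

Definition clark_family (w : W) : BCn R n -> C := fun x => szego x (sval w).

Definition sqrt_family (w : W) : Cn -> C :=
  fun z => (1 - (b (sval w))^*)^-1 * A (ker (sval w)) z.

Lemma clark_familyP w : hcar H1 (clark_family w).
Proof. exact: (sqint_szego_mu (clark_finite clark) (svalP w)). Qed.

Lemma Hardy2_scale (a : C) f : Hardy2 sigma f -> Hardy2 sigma (fun z => a * f z).
Proof.
move=> hf; have := Hardy2_lin hs a hf (Hardy20 hs).
by congr (Hardy2 sigma); apply/funext => z; rewrite addr0.
Qed.

Lemma H2inner_scale_r (a : C) f g : Hardy2 sigma f -> Hardy2 sigma g ->
  H2inner sigma f (fun z => a * g z) = a^* * H2inner sigma f g.
Proof.
move=> hf hg; have := @hip_linr _ _ H2 a g _ _ hg (Hardy20 hs) hf.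
rewrite (@hip_conj _ _ H2 _ _ (Hardy20 hs) hf) (@hip0l _ _ H2 _ hf) cconj0 addr0 => <-.
by congr (H2inner _ _ _); apply/funext => z; rewrite addr0.
Qed.

Lemma H2inner_scale_l (a : C) f g : Hardy2 sigma f -> Hardy2 sigma g ->
  H2inner sigma (fun z => a * f z) g = a * H2inner sigma f g.
Proof.
move=> hf hg; rewrite (H2inner_conj hs hg (Hardy2_scale a hf)) H2inner_scale_r //.
by rewrite cconjM cconjK -(H2inner_conj hs hg hf).
Qed.

Lemma sqrt_familyP w : hcar H2 (sqrt_family w).
Proof. exact/Hardy2_scale/Ah/Hardy2_szego/(svalP w). Qed.

Lemma family_gram v w :
  hip H1 (clark_family v) (clark_family w) = hip H2 (sqrt_family v) (sqrt_family w).
Proof.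
have hv := svalP v; have hw := svalP w.
have av := Ah (Hardy2_szego hs hv); have aw := Ah (Hardy2_szego hs hw).
rewrite [RHS](H2inner_scale_l _ av (sqrt_familyP w)) (H2inner_scale_r _ av aw) sqrt_gram //.
have -> : hip H1 (clark_family v) (clark_family w) = szego_gram mu (sval w) (sval v).
  by apply: eq_cint => x _; rewrite /clark_family !szego_conj mulrC.
have := clark_gram hb bnc clark hw hv; have bv := bneq_conj hv; have bw := bneq hw.
rewrite cconjV cconjB cconj1 cconjK => h.
apply: (mulIf (mulf_neq0 bw bv)); rewrite h.
move: bv bw; move: (szego _ _ * _) (1 - b (sval w)) (1 - (b (sval v))^*) => x p r r0 p0.
by field; rewrite p0 r0.
Qed.

Lemma Vb_eval f z (hz : vnorm z < 1) :
  Vb b mu f z = (1 - b z) * hip H1 (f : BCn R n -> C) (clark_family (exist _ z hz)).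
Proof.
rewrite /Vb; congr (_ * _); apply: (@eq_cint _ _ _ mu S) => x _.
by rewrite /clark_family szego_conj -szegoE.
Qed.

Lemma sqrt_family_eval u z (hz : vnorm z < 1) : Hardy2 sigma u ->
  A u z = (1 - b z) * hip H2 u (sqrt_family (exist _ z hz)).
Proof.
move=> hu; have az := Ah (Hardy2_szego hs hz).
rewrite [hip _ _ _](H2inner_scale_r _ hu az) /= (sqrt_eval hu hz).
by rewrite cconjV cconjB cconj1 cconjK mulrA divff ?mul1r // bneq.
Qed.

(** [f1] is the projection of [f] on the closed span of the kernels and [u] its copy in the Hardy
    space. Both operators are [1 - b z] times an inner product with a family; as that factor is
    nonzero, their kernels are the orthogonal complements of the two families. *)
Lemma Vb_transfer f : L2 mu f -> exists (f1 : Cn -> C) (u : Cn -> C),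
  [/\ L2 mu f1, Hardy2 sigma u, ball_eq (Vb b mu f) (A u) /\ ball_eq (Vb b mu f) (Vb b mu f1),
      hnorm2 H1 (f1 : BCn R n -> C) = hnorm2 H2 u
    & (forall h, L2 mu h -> ball_eq (Vb b mu h) (fun=> 0) -> hip H1 (f1 : BCn R n -> C) h = 0) /\
      (forall h, Hardy2 sigma h -> ball_eq (A h) (fun=> 0) -> H2inner sigma u h = 0)].
Proof.
move=> hf; have [f1 [u [[h1 hu] e1 e2 e3 [p1 p2]]]] :=
  gram_transfer clark_familyP sqrt_familyP family_gram (hf : hcar H1 _).
exists f1, u; split => //; split.
- move=> z /cball_vnorm hz; rewrite (Vb_eval f hz) (sqrt_family_eval hz hu).
  by rewrite e2.
- by move=> z /cball_vnorm hz; rewrite (Vb_eval f hz) (Vb_eval f1 hz) e1.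
- move=> h hh h0; apply: p1 => // -[z hz].
  have := h0 z (proj2 (cball_vnorm z) hz); rewrite (Vb_eval h hz) => /eqP.
  by rewrite mulf_eq0 (negbTE (bneq hz)) => /eqP.
- move=> h hh h0; apply: p2 => // -[z hz].
  have := h0 z (proj2 (cball_vnorm z) hz); rewrite (sqrt_family_eval hz hh) => /eqP.
  by rewrite mulf_eq0 (negbTE (bneq hz)) => /eqP.
Qed.

Lemma Vb_linear (a : C) f g : L2 mu f -> L2 mu g ->
  ball_eq (Vb b mu (fun x => a * f x + g x)) (fun z => a * Vb b mu f z + Vb b mu g z).
Proof.
move=> hf hg z /cball_vnorm hz; rewrite (Vb_eval _ hz) (Vb_eval f hz) (Vb_eval g hz).
rewrite (@hip_lin _ _ H1 a f g _ hf hg (clark_familyP _)); ring.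
Qed.

(** [gram_transfer] with the two families exchanged. *)
Lemma Vb_onto g : range_space sigma A g -> exists2 f, L2 mu f & ball_eq (Vb b mu f) g.
Proof.
move=> [u hu gu].
have [u1 [f [[h1 hf] e1 e2 _ _]]] :=
  gram_transfer sqrt_familyP clark_familyP (fun v w => esym (family_gram v w)) (hu : hcar H2 _).
exists f => // z hz; have /cball_vnorm z1 := hz.
by rewrite gu // (Vb_eval f z1) e2 -(sqrt_family_eval z1 hu).
Qed.

Lemma H2normE f : H2norm sigma f = Num.sqrt (hnorm2 H2 f).
Proof. by []. Qed.

Lemma L2normE f : L2norm mu f = Num.sqrt (hnorm2 H1 (f : BCn R n -> C)).
Proof. by []. Qed.

(** Two preimages of [f] orthogonal to the kernel of [A] differ by an element of that kernel
    orthogonal to itself, so the value chosen by [range_norm] is determined. *)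
Lemma range_normE f u : Hardy2 sigma u -> ball_eq f (A u) ->
  (forall h, Hardy2 sigma h -> ball_eq (A h) (fun=> 0) -> H2inner sigma u h = 0) ->
  range_norm sigma A f = H2norm sigma u.
Proof.
move=> hu fu ou; rewrite /range_norm; apply: xget_unique; first by exists u.
move=> _ [v [hv ov fv ->]].
have hd : Hardy2 sigma (fun z => v z - u z) by exact: Hardy2_sub.
have d0 : ball_eq (A (fun z => v z - u z)) (fun=> 0).
  move=> z hz; have -> : (fun z => v z - u z) = (fun z => -1 * u z + v z).
    by apply/funext => x; ring.
  by rewrite A_lin // mulN1r -fu // -fv // addNr.
have q0 : hnorm2 H2 (fun z => v z - u z) = 0.
  rewrite /hnorm2 (@hipBl _ _ H2 _ _ _ hv hu hd).
  by rewrite [X in X - _](ov _ hd d0) [X in _ - X](ou _ hd d0) subrr.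
by rewrite !H2normE (@hnorm2_null _ _ H2 _ _ hv hu q0).
Qed.

Lemma Vb_isometry f : L2ortho mu (L2ker mu (Vb b mu)) f ->
  range_norm sigma A (Vb b mu f) = L2norm mu f.
Proof.
move=> [hf of_]; have [f1 [u [h1 hu [e1 e2] e3 [p1 p2]]]] := Vb_transfer hf.
have hd : L2 mu (fun x => f x - f1 x) by exact: (sqintB mS hf h1).
have d0 : ball_eq (Vb b mu (fun x => f x - f1 x)) (fun=> 0).
  move=> z hz; have -> : (fun x => f x - f1 x) = (fun x => -1 * f1 x + f x).
    by apply/funext => x; ring.
  by rewrite Vb_linear // mulN1r e2 // addNr.
(* [f - f1] lies in the kernel of [Vb], while [f] and [f1] are both orthogonal to it. *)
have q0 : hnorm2 H1 (fun x => f x - f1 x) = 0.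
  rewrite /hnorm2 (@hipBl _ _ H1 _ _ _ hf h1 hd).
  by rewrite [X in X - _](of_ _ (conj hd d0)) [X in _ - X](p1 _ hd d0) subrr.
by rewrite (range_normE hu e1 p2) H2normE L2normE -e3 (@hnorm2_null _ _ H1 _ _ hf h1 q0).
Qed.

Lemma Vb_range f : L2 mu f -> range_space sigma A (Vb b mu f).
Proof. by move=> /Vb_transfer[f1 [u [_ hu [e _] _ _]]]; exists u. Qed.

Lemma Vb_ker : L2ker mu (Vb b mu) = L2ortho mu (H2_of_measure mu).
Proof.
have E f z : vnorm z < 1 -> Vb b mu f z = (1 - b z) * cint mu S (fun x : BCn R n => f x * szego z x).
  move=> hz; transitivity ((1 - b z) * cint mu S (fun x : BCn R n => f x / (1 - dotmx z x) ^+ n)).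
    by reflexivity.
  suff -> : cint mu S (fun x : BCn R n => f x / (1 - dotmx z x) ^+ n) =
      cint mu S (fun x : BCn R n => f x * szego z x) by [].
  by apply: eq_cint => x _; rewrite -szegoE.
apply/seteqP; split => f.
  move=> [hf f0]; apply/(L2ortho_H2P (clark_finite clark) hf) => z hz.
  have := f0 z (proj2 (cball_vnorm z) hz); rewrite E // => /eqP.
  by rewrite mulf_eq0 (negbTE (bneq hz)) => /eqP.
move=> hf; have h2 := proj1 hf; split => // z /cball_vnorm hz; rewrite E //.
by have /(L2ortho_H2P (clark_finite clark) h2) -> := hf; rewrite ?mulr0.
Qed.

Lemma Vb_kernel w : cball w -> ball_eq (Vb b mu (fun xi => cauchy_kernel xi w))
  (fun z => deBranges_kernel b z w / (1 - (b w)^*)).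
Proof.
move=> /cball_vnorm hw z /cball_vnorm hz.
have -> : Vb b mu (fun xi => cauchy_kernel xi w) z = (1 - b z) * szego_gram mu z w.
  transitivity ((1 - b z) * cint mu S (fun x : BCn R n => cauchy_kernel (x : Cn) w / (1 - dotmx z x) ^+ n)).
    by reflexivity.
  suff -> : cint mu S (fun x : BCn R n => cauchy_kernel (x : Cn) w / (1 - dotmx z x) ^+ n) =
      szego_gram mu z w by [].
  by apply: eq_cint => x _; rewrite cauchy_kernelE szego_conj -szegoE mulrC.
have bw := bneq_conj hw; apply: (mulIf bw); rewrite divfK //.
have := clark_gram hb bnc clark hz hw; rewrite /deBranges_kernel -cdotE => h.
by rewrite [RHS]mulrC -h; ring.
Qed.

End DeBrangesRovnyak.

Theorem theorem2p1 (R : realType) (n : nat)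
    (sigma mu : {measure set (BCn R n) -> \bar R})
    (b : 'rV[Cplx R]_n -> Cplx R)
    (Tbar S : ('rV[Cplx R]_n -> Cplx R) -> ('rV[Cplx R]_n -> Cplx R)) :
  (1 <= n)%N ->
  normalized_rotation_invariant sigma ->
  Hinfty b ->
  (Hinfty_norm b <= 1)%E ->
  (exists z w, [/\ cball z, cball w & b z != b w]) ->
  is_Clark_measure b mu ->
  is_adjoint sigma (mulop b) Tbar ->
  is_positive_sqrt sigma (defect b Tbar) S ->
  [/\ partial_isometry mu (range_space sigma S) (range_norm sigma S) (Vb b mu),
      forall g, range_space sigma S g ->
        exists2 f, L2 mu f & ball_eq (Vb b mu f) g,
      L2ker mu (Vb b mu) = L2ortho mu (H2_of_measure mu)
    & forall w, cball w ->
        ball_eq (Vb b mu (fun xi => cauchy_kernel xi w))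
                (fun z => deBranges_kernel b z w / (1 - (b w)^*))].
Proof.
case: n sigma mu b Tbar S => [//|m] sigma mu b Tbar S _ hs [hol _] bnorm bnc clark hT hS.
have hb z : vnorm z < 1 -> differentiable b z by move=> /cball_vnorm; exact: hol.
have b1 z : vnorm z < 1 -> cmod (b z) <= 1.
  move=> /cball_vnorm hz; rewrite -lee_fin; apply: le_trans bnorm.
  by apply: ereal_sup_ubound; exists z.
have bnc' : exists z w, [/\ vnorm z < 1, vnorm w < 1 & b z != b w].
  by have [z [w [hz hw bzw]]] := bnc; exists z, w; split => //; exact/cball_vnorm.
split.
- split.
  + exact: (Vb_range hs hb b1 bnc' clark hT hS).
  + exact: (Vb_linear clark).
  + exact: (Vb_isometry hs hb b1 bnc' clark hT hS).
- exact: (Vb_onto hs hb b1 bnc' clark hT hS).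
- exact: (Vb_ker hb bnc' clark).
- exact: (Vb_kernel hb bnc' clark).
Qed.
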